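(* Let $\alpha=\{0,1\}$ and $\beta=\{1,0,0\}$. The restricted renormalization operator $\mathcal{R}_{\alpha,\beta}$ acting on the space of Lorenz maps with critical exponent $\rho=2$ has a hyperbolic fixed point.
   Context: **Lorenz maps.** Let $I=[l,r]$ with $l<0<r$. A Lorenz map on $I$ is a monotone increasing continuous function $F:I\setminus\{0\}\to I$ with $F(0^-)=r$ and $F(0^+)=l$, where $F(0^-)=\lim_{x\uparrow 0}F(x)$ and $F(0^+)=\lim_{x\downarrow 0}F(x)$. Moreover it is required that $F(x)=\varphi(|x|^\rho)$ for $x\in(l,0)$ and $F(x)=\psi(|x|^\rho)$ for $x\in(0,r)$, where $\varphi$ and $\psi$ are analytic on complex neighbourhoods of $[0,|l|^\rho]$ and $[0,r^\rho]$ respectively and are symmetric, i.e. $\varphi(\bar z)=\overline{\varphi(z)}$ and likewise for $\psi$. The constant $\rho>1$ is the critical exponent. **Renormalization.** A Lorenz map $F$ on $I=[l,r]$ is renormalizable if there is a maximal interval $U\subsetneq I$ containing $0$ such that the first-return map $\tilde F$ of $F$ to $U$ is a Lorenz map on $U$. Then $\mathcal{R}F=h^{-1}\circ\tilde F\circ h$, where $h$ is the increasing linear map with $h(0)=0$ taking $l$ to the left endpoint of $U$ (so $\mathcal{R}F$ is a Lorenz map on $h^{-1}(U)$, whose left endpoint is $l$ and whose right endpoint may differ from $r$). **Type.** A branch of $F^n$ is a maximal open interval $B$ on which $F^n$ is monotone; its word is $\omega(B)=\{\sigma_0,\dots,\sigma_{n-1}\}$ with $\sigma_j=0$ if $F^j(B)\subset(l,0)$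 and $\sigma_j=1$ if $F^j(B)\subset(0,r)$. If $F$ is renormalizable with return interval $U$, put $L=U\cap(l,0)$ and $R=U\cap(0,r)$. There are unique integers $a,b\ge2$ with $\tilde F|_L=F^a$ and $\tilde F|_R=F^b$; $L$ lies in a branch $A$ of $F^a$ and $R$ in a branch $B$ of $F^b$. The pair $(\omega(A),\omega(B))$ is the type of the renormalization. $\mathcal{R}_{\alpha,\beta}$ is the restriction of $\mathcal{R}$ to Lorenz maps having renormalization of type $(\alpha,\beta)$. **Functional setting ($\rho=2$).** Let $X$ be the real Banach space of analytic functions $f(z)=\sum_{k\ge0}a_kz^k$ on the open unit disk with $a_k\in\mathbb{R}$ and $\|f\|=\sum|a_k|<\infty$, and let $Y=X\times X$ with $\|(f,g)\|=\|f\|+\|g\|$. Fix $s=2.2$, $t=0.5$. A Lorenz map on an interval $[-1,r]$ with critical exponent $2$ is represented by $(f,g)\in Y$ via $\varphi(z)=f((z-1)/s)$ for $|z-1|<s$ and $\psi(z)=-1+z\,g(z/t)$ for $|z|<t$. In these coordinates $\mathcal{R}_{\alpha,\beta}$, for $\alpha=\{0,1\}$, $\beta=\{1,0,0\}$, is the operator $T(f,g)=(\hat f,\hat g)$ where $$\lambda=-f\big([f(0)^2-1]/s\big),\qquad u(w)=f\big(\lambda^2[w+\tfrac1s]-\tfrac1s\big)^2,\qquad \hat f(w)=\lambda^{-1}\big\{-1+u(w)\,g\big(u(w)/t\big)\big\},$$ $$v(w)=\lambda^2 t w\, g(\lambda^2 w),\qquad \hat g(w)=\frac{1}{tw}\Big\{1+\lambda^{-1}f\Big(\tfrac1s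 f\big(v(w)[v(w)-2]/s\big)^2-\tfrac1s\Big)\Big\}$$ (the singularity of $\hat g$ at $w=0$ is removable). $T$ is considered on pairs for which $\lambda\neq0$ and all compositions are well defined (for $w$ in the closed unit disk all arguments of $f$ and $g$ lie in the open unit disk). A fixed point is hyperbolic if the derivative of the operator there (a compact linear operator on $Y$) has no spectrum on the unit circle. *)

(* Defs.v *)
From Stdlib Require Export Reals List Arith.
From Stdlib Require Import Lra Lia.
From Stdlib Require Export ClassicalEpsilon FunctionalExtensionality ProofIrrelevance.
From Coquelicot Require Export Coquelicot.
Export ListNotations.
Open Scope R_scope.

(** * Lorenz maps *)

Definition analytic_at (phi : C -> C) (z0 : C) : Prop :=
  exists (a : nat -> C) (eps : posreal),
    forall z : C, Cmod (z - z0)%C < eps ->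
      @is_pseries C_AbsRing C_NormedModule a (z - z0)%C (phi z).

Definition symmetric_analytic_near (phi : C -> C) (c : R) : Prop :=
  exists D : C -> Prop,
    open D /\
    (forall x : R, 0 <= x <= c -> D (RtoC x)) /\
    (forall z : C, D z ->
       analytic_at phi z /\ D (Cconj z) /\ phi (Cconj z) = Cconj (phi z)).

Definition punctured (l r x : R) : Prop := l <= x <= r /\ x <> 0.

(** A Lorenz map is a total function [F : R -> R] of which only the values on
    [[l,r] \ {0}] are meaningful.  As [F(0-) = r > l = F(0+)], "increasing"
    refers to each of the two sides of [0] separately. *)
Record lorenz_with (rho l r : R) (phi psi : C -> C) (F : R -> R) : Prop := {
  lorenz_interval : l < 0 < r;
  lorenz_exponent : 1 < rho;
  lorenz_maps_to : forall x, punctured l r x -> l <= F x <= r;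
  lorenz_continuous : continuous_on (punctured l r) F;
  lorenz_increasing_left : forall x y, l <= x -> x < y -> y < 0 -> F x < F y;
  lorenz_increasing_right : forall x y, 0 < x -> x < y -> y <= r -> F x < F y;
  lorenz_left_limit : filterlim F (at_left 0) (locally r);
  lorenz_right_limit : filterlim F (at_right 0) (locally l);
  lorenz_phi_analytic : symmetric_analytic_near phi (Rpower (Rabs l) rho);
  lorenz_psi_analytic : symmetric_analytic_near psi (Rpower r rho);
  lorenz_left_branch :
    forall x, l < x < 0 -> RtoC (F x) = phi (RtoC (Rpower (Rabs x) rho));
  lorenz_right_branch :
    forall x, 0 < x < r -> RtoC (F x) = psi (RtoC (Rpower (Rabs x) rho))
}.

Definition is_lorenz (rho l r : R) (F : R -> R) : Prop :=
  exists phi psi : C -> C, lorenz_with rho l r phi psi F.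

(** * Renormalization *)

Definition iterate (n : nat) (F : R -> R) (x : R) : R := Nat.iter n F x.

(** Since [p < 0 < q], an orbit that has not yet returned to [[p,q]] has not
    met [0], so only meaningful values of [F] are used. *)
Definition first_return_map (F : R -> R) (p q : R) (G : R -> R) : Prop :=
  forall x, punctured p q x ->
    exists n : nat, (1 <= n)%nat /\
      p <= iterate n F x <= q /\
      (forall j : nat, (1 <= j < n)%nat -> ~ (p <= iterate j F x <= q)) /\
      G x = iterate n F x.

Definition lorenz_return_interval (rho l r : R) (F : R -> R) (p q : R) : Prop :=
  l <= p /\ p < 0 /\ 0 < q /\ q <= r /\ ~ (p = l /\ q = r) /\
  exists G : R -> R, first_return_map F p q G /\ is_lorenz rho p q G.

Definition renormalization_interval
    (rho l r : R) (F : R -> R) (p q : R) : Prop :=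
  lorenz_return_interval rho l r F p q /\
  forall p' q' : R,
    lorenz_return_interval rho l r F p' q' ->
    p' <= p -> q <= q' -> p' = p /\ q' = q.

Definition monotone_piece (l r : R) (F : R -> R) (n : nat) (c d : R) : Prop :=
  l <= c /\ c < d /\ d <= r /\
  (forall x (j : nat), c < x < d -> (j < n)%nat -> iterate j F x <> 0) /\
  (forall x y, c < x -> x < y -> y < d -> iterate n F x < iterate n F y).

(** The branch is the open interval [(c,d)]. *)
Definition branch (l r : R) (F : R -> R) (n : nat) (c d : R) : Prop :=
  monotone_piece l r F n c d /\
  forall c' d' : R,
    monotone_piece l r F n c' d' -> c' <= c -> d <= d' -> c' = c /\ d' = d.

Definition branch_word (l r : R) (F : R -> R) (n : nat) (c d : R)
    (w : list nat) : Prop :=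
  length w = n /\
  forall j : nat, (j < n)%nat ->
    (nth j w 0%nat = 0%nat /\
       forall x, c < x < d -> l < iterate j F x < 0) \/
    (nth j w 0%nat = 1%nat /\
       forall x, c < x < d -> 0 < iterate j F x < r).

Definition renormalization_type (l r : R) (F : R -> R) (p q : R)
    (G : R -> R) (alpha beta : list nat) : Prop :=
  exists (a b : nat) (cA dA cB dB : R),
    (2 <= a)%nat /\ (2 <= b)%nat /\
    (forall x, p <= x <= q -> l < x < 0 ->
       G x = iterate a F x /\ cA < x < dA) /\
    (forall x, p <= x <= q -> 0 < x < r ->
       G x = iterate b F x /\ cB < x < dB) /\
    branch l r F a cA dA /\ branch_word l r F a cA dA alpha /\
    branch l r F b cB dB /\ branch_word l r F b cB dB beta.

(** [F] on [[l,r]] has a renormalization of type [(alpha, beta)], equal to [F']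
    on [[l,r']].  Here [h x = (p / l) * x]. *)
Definition renormalizes_to (rho : R) (alpha beta : list nat)
    (l r : R) (F : R -> R) (r' : R) (F' : R -> R) : Prop :=
  is_lorenz rho l r F /\
  exists (p q : R) (G : R -> R),
    renormalization_interval rho l r F p q /\
    first_return_map F p q G /\
    renormalization_type l r F p q G alpha beta /\
    (p / l) * r' = q /\
    forall x, punctured l r' x -> F' x = G ((p / l) * x) / (p / l).

(** * The Banach spaces X and Y *)

Record X : Type := mkX {
  coef :> nat -> R;
  coef_summable : ex_series (fun k => Rabs (coef k))
}.

Lemma X_ext (x y : X) : (forall k, x k = y k) -> x = y.
Proof.
  destruct x as [a Ha], y as [b Hb]; simpl; intros H.
  assert (a = b) by (apply functional_extensionality; exact H). subst b.
  f_equal; apply proof_irrelevance.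
Qed.

Lemma X_plus_summable (x y : X) : ex_series (fun k => Rabs (x k + y k)).
Proof.
  apply @ex_series_le with (b := fun k => Rabs (x k) + Rabs (y k)).
  - intros n. unfold norm; simpl. unfold abs; simpl.
    rewrite Rabs_Rabsolu. apply Rabs_triang.
  - apply @ex_series_plus; apply coef_summable.
Qed.

Lemma X_scal_summable (c : R) (x : X) : ex_series (fun k => Rabs (c * x k)).
Proof.
  apply ex_series_ext with (fun k => scal (Rabs c) (Rabs (x k))).
  - intros n. rewrite Rabs_mult. reflexivity.
  - apply @ex_series_scal. apply coef_summable.
Qed.

Lemma X_zero_summable : ex_series (fun _ : nat => Rabs 0).
Proof.
  exists 0. apply is_series_ext with (fun _ => scal 0 0).
  - intros _. rewrite Rabs_R0. unfold scal; simpl. unfold mult; simpl. ring.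
  - apply filterlim_ext with (fun _ => 0).
    + intros n. induction n as [|n IH].
      * rewrite sum_O. unfold scal; simpl. unfold mult; simpl. ring.
      * rewrite sum_Sn, <- IH. unfold scal, plus; simpl. unfold mult; simpl. ring.
    + apply filterlim_const.
Qed.

Definition X_plus (x y : X) : X := mkX _ (X_plus_summable x y).
Definition X_scal (c : R) (x : X) : X := mkX _ (X_scal_summable c x).
Definition X_opp (x : X) : X := X_scal (-1) x.
Definition X_zero : X := mkX _ X_zero_summable.

Definition X_norm (x : X) : R := Series (fun k => Rabs (x k)).

Definition X_AbelianMonoid_mixin : AbelianMonoid.mixin_of X.
Proof.
  apply (AbelianMonoid.Mixin X X_plus X_zero); intros;
    apply X_ext; intros k; simpl; ring.
Defined.

Definition X_AbelianMonoid := AbelianMonoid.Pack X X_AbelianMonoid_mixin X.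

Definition X_AbelianGroup_mixin : AbelianGroup.mixin_of X_AbelianMonoid.
Proof.
  apply (AbelianGroup.Mixin X_AbelianMonoid X_opp); intros;
    apply X_ext; intros k; simpl; ring.
Defined.

Definition X_AbelianGroup :=
  AbelianGroup.Pack X
    (AbelianGroup.Class X X_AbelianMonoid_mixin X_AbelianGroup_mixin) X.

Definition X_ModuleSpace_mixin :
  ModuleSpace.mixin_of R_Ring X_AbelianGroup.
Proof.
  apply (ModuleSpace.Mixin R_Ring X_AbelianGroup X_scal); intros;
    apply X_ext; intros k; simpl; unfold mult, plus, one; simpl; ring.
Defined.

Definition X_ModuleSpace : ModuleSpace R_Ring :=
  ModuleSpace.Pack R_Ring X
    (ModuleSpace.Class R_Ring X (AbelianGroup.class X_AbelianGroup)
       X_ModuleSpace_mixin) X.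

Lemma X_norm_triangle (x y : X) : X_norm (X_plus x y) <= X_norm x + X_norm y.
Proof.
  unfold X_norm.
  rewrite <- Series_plus by apply coef_summable.
  apply Series_le.
  - intros n; simpl. split; [apply Rabs_pos | apply Rabs_triang].
  - apply @ex_series_plus; apply coef_summable.
Qed.

Lemma X_norm_scal (c : R) (x : X) : X_norm (X_scal c x) = Rabs c * X_norm x.
Proof.
  unfold X_norm. rewrite <- Series_scal_l.
  apply Series_ext; intros n; simpl. apply Rabs_mult.
Qed.

Lemma coef_le_norm (x : X) (n : nat) : Rabs (x n) <= X_norm x.
Proof.
  unfold X_norm.
  rewrite (Series_incr_n (fun k => Rabs (x k)) (S n)) by
    (try lia; apply coef_summable).
  simpl pred.
  assert (Hs : forall m, 0 <= sum_f_R0 (fun k => Rabs (x k)) m).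
  { intros m; apply cond_pos_sum; intros; apply Rabs_pos. }
  assert (H1 : Rabs (x n) <= sum_f_R0 (fun k => Rabs (x k)) n).
  { destruct n as [|n]; simpl; [lra|]. specialize (Hs n). lra. }
  assert (H2 : 0 <= Series (fun k => Rabs (x (S n + k)%nat))).
  { apply Rle_trans with (Series (fun k => 0 * Rabs (x (S n + k)%nat))).
    - rewrite Series_scal_l. lra.
    - apply Series_le.
      + intros k. generalize (Rabs_pos (x (S n + k)%nat)). lra.
      + apply (ex_series_incr_n (fun k => Rabs (x k)) (S n)), coef_summable. }
  lra.
Qed.

Lemma X_norm_pos (x : X) : 0 <= X_norm x.
Proof.
  apply Rle_trans with (Rabs (x 0%nat)); [apply Rabs_pos | apply coef_le_norm].
Qed.

Lemma X_norm_eq0 (x : X) : X_norm x = 0 -> x = X_zero.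
Proof.
  intros H; apply X_ext; intros k; simpl.
  generalize (coef_le_norm x k) (Rabs_pos (x k)); rewrite H; intros H1 H2.
  destruct (Req_dec (x k) 0) as [E|E]; [exact E|].
  apply Rabs_pos_lt in E; lra.
Qed.

(** [Y = X * X] as an [R]-module, with the norm [||f|| + ||g||]
    (Coquelicot's product norm is Euclidean instead). *)
Definition Y_ModuleSpace : ModuleSpace R_Ring :=
  prod_ModuleSpace R_Ring X_ModuleSpace X_ModuleSpace.

Definition Y_norm (p : Y_ModuleSpace) : R := X_norm (fst p) + X_norm (snd p).

Lemma Y_norm_triangle (p q : Y_ModuleSpace) :
  Y_norm (plus p q) <= Y_norm p + Y_norm q.
Proof.
  unfold Y_norm.
  generalize (X_norm_triangle (fst p) (fst q)) (X_norm_triangle (snd p) (snd q)).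
  simpl. unfold plus; simpl. unfold plus; simpl. lra.
Qed.

Lemma Y_norm_scal (c : R) (p : Y_ModuleSpace) :
  Y_norm (scal c p) = Rabs c * Y_norm p.
Proof.
  unfold Y_norm.
  generalize (X_norm_scal c (fst p)) (X_norm_scal c (snd p)).
  unfold scal; simpl. unfold scal; simpl. intros -> ->. ring.
Qed.

Lemma Y_norm_zero : Y_norm zero = 0.
Proof.
  assert (H := Y_norm_scal 0 zero). rewrite scal_zero_r in H.
  rewrite Rabs_R0, Rmult_0_l in H. exact H.
Qed.

Definition Y_ball (p : Y_ModuleSpace) (eps : R) (q : Y_ModuleSpace) : Prop :=
  Y_norm (minus q p) < eps.

Definition Y_UniformSpace_mixin : UniformSpace.mixin_of Y_ModuleSpace.
Proof.
  apply (UniformSpace.Mixin Y_ModuleSpace zero Y_ball); unfold Y_ball.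
  - intros p e. rewrite minus_eq_zero.
    eapply Rle_lt_trans; [apply Req_le; exact Y_norm_zero | apply cond_pos].
  - intros p q e H. rewrite <- opp_minus, <- scal_opp_one, Y_norm_scal.
    unfold opp, one; simpl. rewrite Rabs_Ropp, Rabs_R1, Rmult_1_l. exact H.
  - intros p q w e1 e2 H1 H2.
    assert (E : minus w p = plus (minus q p) (minus w q)).
    { rewrite (plus_comm (minus q p)). apply minus_trans. }
    rewrite E.
    eapply Rle_lt_trans; [exact (Y_norm_triangle _ _)|].
    apply Rplus_lt_compat; assumption.
Defined.

Definition Y_NormedModuleAux : NormedModuleAux R_AbsRing :=
  NormedModuleAux.Pack R_AbsRing Y_ModuleSpace
    (NormedModuleAux.Class R_AbsRing Y_ModuleSpace
       (ModuleSpace.class _ Y_ModuleSpace) Y_UniformSpace_mixin) Y_ModuleSpace.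

Definition Y_NormedModule_mixin :
  NormedModule.mixin_of R_AbsRing Y_NormedModuleAux.
Proof.
  apply (NormedModule.Mixin R_AbsRing Y_NormedModuleAux Y_norm 1).
  - exact Y_norm_triangle.
  - intros c p. apply Req_le. exact (Y_norm_scal c p).
  - intros p q eps H. exact H.
  - intros p q eps H. rewrite Rmult_1_l. exact H.
  - intros [f g] H. unfold Y_norm in H; simpl in H.
    assert (Hf := X_norm_pos f). assert (Hg := X_norm_pos g).
    rewrite (X_norm_eq0 f), (X_norm_eq0 g) by lra. reflexivity.
Defined.

Definition Y : NormedModule R_AbsRing :=
  NormedModule.Pack R_AbsRing Y_NormedModuleAux
    (NormedModule.Class R_AbsRing Y_NormedModuleAux
       (NormedModuleAux.class _ Y_NormedModuleAux) Y_NormedModule_mixin)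
    Y_NormedModuleAux.

(** The value of [f] at [z], meaningful when [Cmod z <= 1]. *)
Definition evalX (f : X) (z : C) : C :=
  (Series (fun k => f k * Re (z ^ k)%C), Series (fun k => f k * Im (z ^ k)%C)).

(** * The operator in coordinates *)

Definition s : R := 22 / 10.
Definition t : R := 5 / 10.

Section Operator.
Open Scope C_scope.

Definition phi_of (p : Y) (z : C) : C := evalX (fst p) ((z - 1) / s).
Definition psi_of (p : Y) (z : C) : C := - (1) + z * evalX (snd p) (z / t).

Variable p : Y.
Let f : C -> C := evalX (fst p).
Let g : C -> C := evalX (snd p).

Definition op_lambda : C := - f ((f 0 ^ 2 - 1) / s).

Definition op_u_arg (w : C) : C := op_lambda ^ 2 * (w + 1 / s) - 1 / s.
Definition op_u (w : C) : C := f (op_u_arg w) ^ 2.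
Definition op_f (w : C) : C := (- (1) + op_u w * g (op_u w / t)) / op_lambda.

Definition op_v (w : C) : C := op_lambda ^ 2 * t * w * g (op_lambda ^ 2 * w).
Definition op_v_arg (w : C) : C := op_v w * (op_v w - 2) / s.
Definition op_g_arg (w : C) : C := 1 / s * f (op_v_arg w) ^ 2 - 1 / s.
Definition op_g (w : C) : C := / (t * w) * (1 + f (op_g_arg w) / op_lambda).

Definition T_domain : Prop :=
  op_lambda <> 0 /\
  Cmod ((f 0 ^ 2 - 1) / s) < 1 /\
  forall w : C, Cmod w <= 1 ->
    Cmod (op_u_arg w) < 1 /\ Cmod (op_u w / t) < 1 /\
    Cmod (op_lambda ^ 2 * w) < 1 /\ Cmod (op_v_arg w) < 1 /\
    Cmod (op_g_arg w) < 1.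

(** The value of [evalX (snd p') 0], where [op_g] has its removable
    singularity, is determined by the values nearby. *)
Definition T_spec (p' : Y) : Prop :=
  forall w : C, Cmod w < 1 ->
    evalX (fst p') w = op_f w /\
    (w <> 0 -> evalX (snd p') w = op_g w).

End Operator.

(** Outside [T_domain] the value is irrelevant. *)
Definition T (p : Y) : Y := epsilon (inhabits (zero : Y)) (T_spec p).

(** [r^2 < t] puts [[0, r^2]] inside the disk on which [psi_of p] is defined. *)
Definition represents (p : Y) (r : R) (F : R -> R) : Prop :=
  r ^ 2 < t /\ lorenz_with 2 (-1) r (phi_of p) (psi_of p) F.

(** * Hyperbolicity *)

Definition compact_operator (V : NormedModule R_AbsRing) (A : V -> V) : Prop :=
  is_linear A /\
  forall x : nat -> V, (forall n, norm (x n) <= 1) ->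
    exists (sigma : nat -> nat) (y : V),
      (forall n, (sigma n < sigma (S n))%nat) /\
      filterlim (fun n => A (x (sigma n))) eventually (locally y).

(** [A - z] on the complexification of [V], where [(x, y)] stands for
    [x + i y]. *)
Definition complexified_minus (V : NormedModule R_AbsRing) (A : V -> V) (z : C)
    (xy : V * V) : V * V :=
  let (x, y) := xy in
  (plus (minus (A x) (scal (Re z) x)) (scal (Im z) y),
   minus (minus (A y) (scal (Im z) x)) (scal (Re z) y)).

Definition in_spectrum (V : NormedModule R_AbsRing) (A : V -> V) (z : C) : Prop :=
  ~ exists B : prod_NormedModule _ V V -> prod_NormedModule _ V V,
      is_linear B /\
      (forall xy, B (complexified_minus V A z xy) = xy) /\
      (forall xy, complexified_minus V A z (B xy) = xy).

Definition hyperbolic_fixed_point (V : NormedModule R_AbsRing)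
    (Phi : V -> V) (p : V) : Prop :=
  Phi p = p /\
  exists A : V -> V,
    filterdiff Phi (locally p) A /\
    compact_operator V A /\
    forall z : C, Cmod z = 1 -> ~ in_spectrum V A z.

Definition alpha : list nat := [0; 1]%nat.
Definition beta : list nat := [1; 0; 0]%nat.

(* Main.v *)
(** In the l1 norm, polynomials with dyadic coefficients approximate the elements of [X], so an
    explicit approximate fixed point and its image under [T] can be enclosed by integer ball
    arithmetic.  In coordinates spanned by approximate eigenvectors the derivative of [T] differs,
    on a small ball, from a diagonal operator with entries 23.375, 12.125 and zeros by an operator
    of norm at most [21/32 < 1 / sqrt 2].  Hence Newton's map with this diagonal derivative is a
    contraction, which gives the fixed point, and a Neumann series around the diagonal resolvent
    shows that no spectrum lies on the unit circle.

    At the fixed point the branches [FL], [FR] of the Lorenz map satisfy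
    [FR (FL (lam y)) = lam FL y] and [FL (FL (FR (lam y))) = lam FR y]: the first return to
    [[-lam, lam r]] is [F] rescaled by [lam], once a few inequalities for the orbits of the
    endpoints have been checked.  A larger return interval would have an endpoint with a preimage
    under [F] at which the first return map already takes an extreme value. *)

Require Import Defs.
From Stdlib Require Import Reals List.
From Coquelicot Require Import Coquelicot.
From Stdlib Require Import Lra Lia Psatz ZArith.
Import ListNotations.
Open Scope R_scope.

(** [T] is a choice from a specification and offers nothing to differentiate, so it is replaced by a
    straight-line program over the Banach algebra [X]. One induction over instructions gives each
    register a derivative with quadratic remainder, smallness of that derivative on high degrees
    (hence compactness) and an enclosure; the enclosures supply the bounds, norm below 1 and
    constant term away from 0, that the analytic rules require. The infinitely many columns of the
    derivative need finitely many runs, because a tangent known only to vanish below degree [K]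
    stands for all columns beyond [K]. The threshold 1 / sqrt 2 comes from complexification: with
    the sum norm on pairs, the resolvent of the diagonal on the unit circle has norm at most sqrt 2.
    The eigenvalue 0.540 lies below 21/32 and is left among the zeros, though its eigenvector serves
    as a coordinate. The derivative is controlled within 2^-24 of the centre and the fixed point is
    found within 2^-25; the margin is the neighbourhood in which [T] is differentiable there. *)

Lemma nonneg_series_bound (a : nat -> R) (M : R) :
  (forall k, 0 <= a k) -> (forall n, sum_f_R0 a n <= M) ->
  ex_series a /\ Series a <= M.
Proof.
  intros Ha HM.
  assert (Hincr : forall n, sum_n a n <= sum_n a (S n)).
  { intros n; rewrite sum_Sn; unfold plus; simpl.
    specialize (Ha (S n)); lra. }
  assert (HM' : forall n, sum_n a n <= M) by (intros n; rewrite sum_n_Reals; apply HM).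
  assert (Hex : ex_series a) by exact (ex_finite_lim_seq_incr _ _ Hincr HM').
  split; [exact Hex|].
  apply (is_lim_seq_le (sum_n a) (fun _ => M) (Series a) M HM').
  - exact (Series_correct _ Hex).
  - apply is_lim_seq_const.
Qed.

Lemma partial_sum_le_series (a : nat -> R) (n : nat) :
  (forall k, 0 <= a k) -> ex_series a -> sum_f_R0 a n <= Series a.
Proof.
  intros Ha Hex. rewrite <- sum_n_Reals.
  apply (is_lim_seq_incr_compare (sum_n a) (Series a)).
  - exact (Series_correct _ Hex).
  - intros k; rewrite sum_Sn; unfold plus; simpl. specialize (Ha (S k)); lra.
Qed.

Lemma ex_series_dominated (a b : nat -> R) :
  (forall k, Rabs (a k) <= b k) -> ex_series b -> ex_series a.
Proof.
  intros H Hb. exact (@ex_series_le R_AbsRing R_CompleteNormedModule a b H Hb).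
Qed.

Lemma sum_shift (a : nat -> R) (n : nat) :
  sum_f_R0 a (S n) = a 0%nat + sum_f_R0 (fun k => a (S k)) n.
Proof. rewrite decomp_sum by lia. reflexivity. Qed.

Lemma series_shift (a : nat -> R) :
  ex_series a -> Series a = a 0%nat + Series (fun k => a (S k)).
Proof. intros H. apply Series_incr_1, H. Qed.

(** * The Banach algebra X *)

(** Total on all sequences, with value zero off the summable ones, so that operations can be defined
    coefficientwise before their summability is known. *)
Definition X_of (a : nat -> R) : X :=
  match excluded_middle_informative (ex_series (fun k => Rabs (a k))) with
  | left H => mkX a H
  | right _ => X_zero
  end.

Lemma X_of_coef (a : nat -> R) (k : nat) :
  ex_series (fun k => Rabs (a k)) -> X_of a k = a k.
Proof.
  intros H; unfold X_of.
  destruct (excluded_middle_informative _) as [H'|n]; [reflexivity|contradiction].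
Qed.

Lemma X_norm_le_partial (x : X) (M : R) :
  (forall n, sum_f_R0 (fun k => Rabs (x k)) n <= M) -> X_norm x <= M.
Proof.
  intros H. apply nonneg_series_bound; [intros k; apply Rabs_pos | exact H].
Qed.

Lemma partial_le_X_norm (x : X) (n : nat) :
  sum_f_R0 (fun k => Rabs (x k)) n <= X_norm x.
Proof. apply partial_sum_le_series; [intros; apply Rabs_pos | apply coef_summable]. Qed.

(** Bounded partial sums give summability and the norm bound at once; products, shifts, infinite
    sums and diagonal operators all enter [X] this way. *)
Lemma X_of_norm (a : nat -> R) (M : R) :
  (forall n, sum_f_R0 (fun k => Rabs (a k)) n <= M) ->
  (forall k, X_of a k = a k) /\ X_norm (X_of a) <= M.
Proof.
  intros H.
  destruct (nonneg_series_bound (fun k => Rabs (a k)) M) as [Hex _];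
    [intros; apply Rabs_pos | exact H |].
  split; [intros; apply X_of_coef, Hex|].
  apply X_norm_le_partial. intros n.
  rewrite (sum_eq _ (fun k => Rabs (a k))); [apply H|].
  intros; now rewrite X_of_coef.
Qed.

(** Coefficient of a product, read off from [(a0 + z a') b]. The recursion shifts [a], so inductions
    on [n] must quantify over [a]. *)
Fixpoint cauchy (a b : nat -> R) (n : nat) : R :=
  match n with
  | O => a O * b O
  | S m => a O * b (S m) + cauchy (fun k => a (S k)) b m
  end.

(** Using the full norm of [b], not a partial sum, is what lets the induction close when the first
    coefficient of [a] is split off. *)
Lemma cauchy_partial (b : X) (n : nat) : forall a : nat -> R,
  sum_f_R0 (fun k => Rabs (cauchy a b k)) n <=
  sum_f_R0 (fun k => Rabs (a k)) n * X_norm b.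
Proof.
  induction n as [|n IH]; intros a.
  - simpl. rewrite Rabs_mult. apply Rmult_le_compat_l; [apply Rabs_pos|apply coef_le_norm].
  - rewrite (sum_shift (fun k => Rabs (a k))).
    apply Rle_trans with
      (Rabs (a 0%nat) * sum_f_R0 (fun k => Rabs (b k)) (S n) +
       sum_f_R0 (fun k => Rabs (cauchy (fun k => a (S k)) b k)) n).
    + rewrite !sum_shift. simpl cauchy at 1.
      rewrite Rabs_mult, Rmult_plus_distr_l, Rplus_assoc. apply Rplus_le_compat_l.
      rewrite scal_sum, <- sum_plus. apply sum_Rle. intros k _. simpl.
      eapply Rle_trans; [apply Rabs_triang|]. rewrite Rabs_mult. lra.
    + rewrite Rmult_plus_distr_r. apply Rplus_le_compat; [|apply IH].
      apply Rmult_le_compat_l; [apply Rabs_pos | apply partial_le_X_norm].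
Qed.

Definition X_mul (f g : X) : X := X_of (cauchy f g).

Lemma X_mul_spec (f g : X) :
  (forall k, X_mul f g k = cauchy f g k) /\ X_norm (X_mul f g) <= X_norm f * X_norm g.
Proof.
  apply X_of_norm. intros n. eapply Rle_trans; [apply cauchy_partial|].
  apply Rmult_le_compat_r; [apply X_norm_pos | apply partial_le_X_norm].
Qed.

Lemma X_mul_coef (f g : X) (k : nat) : X_mul f g k = cauchy f g k.
Proof. apply X_mul_spec. Qed.

Lemma X_norm_mul (f g : X) : X_norm (X_mul f g) <= X_norm f * X_norm g.
Proof. apply X_mul_spec. Qed.

Lemma cauchy_ext (a a' b b' : nat -> R) (n : nat) :
  (forall k, a k = a' k) -> (forall k, b k = b' k) -> cauchy a b n = cauchy a' b' n.
Proof.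
  revert a a'. induction n as [|n IH]; intros a a' Ha Hb; simpl.
  - now rewrite Ha, Hb.
  - rewrite Ha, Hb, (IH _ (fun k => a' (S k))); auto.
Qed.

Lemma cauchy_plus_l (a a' b : nat -> R) (n : nat) :
  cauchy (fun k => a k + a' k) b n = cauchy a b n + cauchy a' b n.
Proof.
  revert a a'. induction n as [|n IH]; intros a a'; simpl; [ring|].
  rewrite (IH (fun k => a (S k)) (fun k => a' (S k))). ring.
Qed.

Lemma cauchy_scal_l (c : R) (a b : nat -> R) (n : nat) :
  cauchy (fun k => c * a k) b n = c * cauchy a b n.
Proof.
  revert a. induction n as [|n IH]; intros a; simpl; [ring|].
  rewrite (IH (fun k => a (S k))). ring.
Qed.

(** The mirror image of the defining recursion; together they give commutativity. *)
Lemma cauchy_succ_r (a b : nat -> R) (n : nat) :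
  cauchy a b (S n) = a (S n) * b O + cauchy a (fun k => b (S k)) n.
Proof.
  revert a. induction n as [|n IH]; intros a; [simpl; ring|].
  change (cauchy a b (S (S n)))
    with (a O * b (S (S n)) + cauchy (fun k => a (S k)) b (S n)).
  rewrite IH. simpl. ring.
Qed.

Lemma cauchy_comm (n : nat) : forall a b : nat -> R, cauchy a b n = cauchy b a n.
Proof.
  induction n as [|n IH]; intros a b; [simpl; ring|].
  rewrite cauchy_succ_r, IH. simpl. ring.
Qed.

Lemma cauchy_assoc (n : nat) : forall a b c : nat -> R,
  cauchy (cauchy a b) c n = cauchy a (cauchy b c) n.
Proof.
  induction n as [|n IH]; intros a b c; [simpl; ring|].
  simpl. rewrite <- IH.
  change (fun k => a O * b (S k) + cauchy (fun i => a (S i)) b k)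
    with (fun k => (fun k => a O * b (S k)) k + cauchy (fun i => a (S i)) b k).
  rewrite cauchy_plus_l, (cauchy_scal_l (a O) (fun k => b (S k))). ring.
Qed.

Definition X_const (c : R) : X := X_of (fun k => match k with O => c | _ => 0 end).
Definition X_one : X := X_const 1.
Definition X_tail (f : X) : X := X_of (fun k => f (S k)).
Definition X_shift (f : X) : X := X_of (fun k => match k with O => 0 | S j => f j end).
Definition X_var : X := X_shift X_one.
Definition X_minus (f g : X) : X := X_plus f (X_opp g).

Lemma X_const_spec (c : R) :
  (forall k, X_const c k = match k with O => c | _ => 0 end) /\ X_norm (X_const c) <= Rabs c.
Proof.
  apply X_of_norm. induction n as [|n IH]; simpl; [lra|]. rewrite Rabs_R0. lra.
Qed.

Lemma X_const_coef (c : R) k : X_const c k = match k with O => c | _ => 0 end.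
Proof. apply X_const_spec. Qed.

Lemma X_norm_const (c : R) : X_norm (X_const c) = Rabs c.
Proof.
  apply Rle_antisym; [apply X_const_spec|].
  eapply Rle_trans; [|apply (coef_le_norm _ 0)]. rewrite X_const_coef. lra.
Qed.

Lemma X_tail_spec (f : X) :
  (forall k, X_tail f k = f (S k)) /\ X_norm (X_tail f) <= X_norm f.
Proof.
  apply X_of_norm. intros n. eapply Rle_trans; [|apply (partial_le_X_norm f (S n))].
  rewrite sum_shift. generalize (Rabs_pos (f 0%nat)); lra.
Qed.

Lemma X_tail_coef (f : X) k : X_tail f k = f (S k).
Proof. apply X_tail_spec. Qed.

Lemma X_norm_tail (f : X) : X_norm (X_tail f) <= X_norm f.
Proof. apply X_tail_spec. Qed.

Lemma X_shift_spec (f : X) :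
  (forall k, X_shift f k = match k with O => 0 | S j => f j end) /\
  X_norm (X_shift f) <= X_norm f.
Proof.
  apply X_of_norm. intros [|n].
  - simpl. rewrite Rabs_R0. apply X_norm_pos.
  - rewrite sum_shift, Rabs_R0, Rplus_0_l. apply partial_le_X_norm.
Qed.

Lemma X_shift_coef (f : X) k : X_shift f k = match k with O => 0 | S j => f j end.
Proof. apply X_shift_spec. Qed.

Lemma X_var_coef k : X_var k = match k with 1%nat => 1 | _ => 0 end.
Proof.
  unfold X_var, X_one. rewrite X_shift_coef. destruct k as [|[|k]];
    rewrite ?X_const_coef; reflexivity.
Qed.

Lemma X_norm_var : X_norm X_var <= 1.
Proof.
  unfold X_var. eapply Rle_trans; [apply X_shift_spec|].
  unfold X_one. rewrite X_norm_const, Rabs_R1. lra.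
Qed.

Lemma X_shift_mul (f : X) : X_mul X_var f = X_shift f.
Proof.
  apply X_ext. intros k. rewrite X_mul_coef, X_shift_coef.
  destruct k as [|k]; simpl; rewrite !X_var_coef; [ring|].
  rewrite Rmult_0_l, Rplus_0_l.
  rewrite (cauchy_ext _ (X_const 1) f f); auto.
  2:{ intros j; rewrite X_var_coef, X_const_coef; destruct j; reflexivity. }
  destruct k as [|k]; simpl; rewrite X_const_coef; [ring|].
  rewrite (cauchy_ext _ (fun j => 0 * 0) f f); auto.
  2:{ intros j; rewrite X_const_coef; ring. }
  rewrite cauchy_scal_l. ring.
Qed.

Lemma X_const_mul (c : R) (f : X) : X_mul (X_const c) f = X_scal c f.
Proof.
  apply X_ext. intros k. rewrite X_mul_coef. simpl.
  destruct k as [|k]; simpl; rewrite X_const_coef; [ring|].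
  rewrite (cauchy_ext _ (fun j => 0 * 0) f f); auto.
  2:{ intros j; rewrite X_const_coef; ring. }
  rewrite cauchy_scal_l. ring.
Qed.

Lemma X_ring_theory :
  ring_theory X_zero X_one X_plus X_mul X_minus X_opp (@eq X).
Proof.
  constructor; intros; apply X_ext; intros k;
    try (simpl; ring).
  - unfold X_one. rewrite X_const_mul. simpl. ring.
  - rewrite !X_mul_coef. apply cauchy_comm.
  - rewrite !X_mul_coef.
    rewrite (cauchy_ext x x (X_mul y z) (cauchy y z));
      auto using X_mul_coef.
    rewrite (cauchy_ext (X_mul x y) (cauchy x y) z z);
      auto using X_mul_coef.
    symmetry; apply cauchy_assoc.
  - simpl. rewrite !X_mul_coef. apply cauchy_plus_l.
Qed.

Add Ring X_ring : X_ring_theory.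

Lemma X_scal_mul (c : R) (f : X) : X_scal c f = X_mul (X_const c) f.
Proof. symmetry; apply X_const_mul. Qed.

Lemma X_const_plus (a b : R) : X_const (a + b) = X_plus (X_const a) (X_const b).
Proof.
  apply X_ext; intros [|k]; simpl; rewrite !X_const_coef; ring.
Qed.

Lemma X_const_times (a b : R) : X_const (a * b) = X_mul (X_const a) (X_const b).
Proof.
  rewrite X_const_mul. apply X_ext; intros [|k]; simpl; rewrite !X_const_coef; ring.
Qed.

Lemma X_const_opp (a : R) : X_const (- a) = X_opp (X_const a).
Proof. apply X_ext; intros [|k]; simpl; rewrite !X_const_coef; ring. Qed.

Lemma X_const_0 : X_const 0 = X_zero.
Proof. apply X_ext; intros [|k]; rewrite X_const_coef; reflexivity. Qed.

Lemma X_norm_zero : X_norm X_zero = 0.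
Proof. rewrite <- X_const_0, X_norm_const. apply Rabs_R0. Qed.

Lemma X_norm_one : X_norm X_one = 1.
Proof. unfold X_one. rewrite X_norm_const. apply Rabs_R1. Qed.

Lemma X_norm_opp (x : X) : X_norm (X_opp x) = X_norm x.
Proof. unfold X_opp. rewrite X_norm_scal, Rabs_left; lra. Qed.

Lemma X_norm_minus (x y : X) : X_norm (X_minus x y) <= X_norm x + X_norm y.
Proof. rewrite <- (X_norm_opp y). apply X_norm_triangle. Qed.

Lemma X_norm_le_minus (x y : X) : X_norm x <= X_norm y + X_norm (X_minus x y).
Proof.
  replace x with (X_plus y (X_minus x y)) at 1 by ring. apply X_norm_triangle.
Qed.

Lemma X_minus_eq0 (x y : X) : X_norm (X_minus x y) = 0 -> x = y.
Proof.
  intros H. apply X_norm_eq0 in H.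
  replace x with (X_plus (X_minus x y) y) by ring. rewrite H. ring.
Qed.

Fixpoint X_pow (q : X) (k : nat) : X :=
  match k with O => X_one | S j => X_mul q (X_pow q j) end.

Lemma X_norm_pow (q : X) (k : nat) : X_norm (X_pow q k) <= X_norm q ^ k.
Proof.
  induction k as [|k IH]; simpl; [rewrite X_norm_one; lra|].
  eapply Rle_trans; [apply X_norm_mul|].
  apply Rmult_le_compat_l; [apply X_norm_pos|exact IH].
Qed.

(** * Norm-convergent series in [X] *)

Definition X_sum (x : nat -> X) : X := X_of (fun n => Series (fun k => x k n)).

Lemma X_coef_ex (x : nat -> X) (n : nat) :
  ex_series (fun k => X_norm (x k)) -> ex_series (fun k => x k n).
Proof. apply ex_series_dominated. intros k; apply coef_le_norm. Qed.

Lemma X_coef_ex_abs (x : nat -> X) (n : nat) :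
  ex_series (fun k => X_norm (x k)) -> ex_series (fun k => Rabs (x k n)).
Proof.
  apply ex_series_dominated. intros k; rewrite Rabs_Rabsolu; apply coef_le_norm.
Qed.

(** A finite sum over coefficients commutes with the series over [k], and each finite sum is at most
    a norm. *)
Lemma X_sum_partial (x : nat -> X) (n : nat) :
  ex_series (fun k => X_norm (x k)) ->
  sum_f_R0 (fun i => Rabs (Series (fun k => x k i))) n <=
  Series (fun k => X_norm (x k)).
Proof.
  intros H.
  apply Rle_trans with (sum_f_R0 (fun i => Series (fun k => Rabs (x k i))) n).
  { apply sum_Rle. intros i _. apply Series_Rabs, X_coef_ex_abs, H. }
  apply Rle_trans with (Series (fun k => sum_f_R0 (fun i => Rabs (x k i)) n)).
  - right. induction n as [|n IH]; simpl; [reflexivity|].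
    rewrite IH, <- Series_plus; [reflexivity| |].
    + revert H; apply ex_series_dominated. intros k.
      rewrite Rabs_pos_eq; [apply partial_le_X_norm|].
      apply cond_pos_sum; intros; apply Rabs_pos.
    + apply X_coef_ex_abs, H.
  - apply Series_le; [|exact H]. intros k; split; [|apply partial_le_X_norm].
    apply cond_pos_sum; intros; apply Rabs_pos.
Qed.

Lemma X_sum_spec (x : nat -> X) :
  ex_series (fun k => X_norm (x k)) ->
  (forall n, X_sum x n = Series (fun k => x k n)) /\
  X_norm (X_sum x) <= Series (fun k => X_norm (x k)).
Proof.
  intros H. apply X_of_norm. intros n. apply X_sum_partial, H.
Qed.

Lemma X_sum_coef (x : nat -> X) n :
  ex_series (fun k => X_norm (x k)) -> X_sum x n = Series (fun k => x k n).
Proof. intros H; apply X_sum_spec, H. Qed.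

Lemma X_norm_sum (x : nat -> X) :
  ex_series (fun k => X_norm (x k)) -> X_norm (X_sum x) <= Series (fun k => X_norm (x k)).
Proof. intros H; apply X_sum_spec, H. Qed.

Lemma X_sum_shift (x : nat -> X) :
  ex_series (fun k => X_norm (x k)) ->
  X_sum x = X_plus (x O) (X_sum (fun k => x (S k))).
Proof.
  intros H. assert (H' := proj1 (ex_series_incr_1 (fun k => X_norm (x k))) H).
  apply X_ext. intros n. simpl. rewrite !X_sum_coef by assumption.
  apply series_shift, X_coef_ex, H.
Qed.

Lemma X_sum_plus (x y : nat -> X) :
  ex_series (fun k => X_norm (x k)) -> ex_series (fun k => X_norm (y k)) ->
  X_plus (X_sum x) (X_sum y) = X_sum (fun k => X_plus (x k) (y k)).
Proof.
  intros Hx Hy.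
  assert (Hxy : ex_series (fun k => X_norm (X_plus (x k) (y k)))).
  { apply ex_series_dominated with (fun k => X_norm (x k) + X_norm (y k)).
    - intros k. rewrite Rabs_pos_eq by apply X_norm_pos. apply X_norm_triangle.
    - apply @ex_series_plus; assumption. }
  apply X_ext. intros n. simpl. rewrite !X_sum_coef by assumption. simpl.
  symmetry. apply Series_plus; apply X_coef_ex; assumption.
Qed.

Lemma X_sum_ext (x y : nat -> X) : (forall k, x k = y k) -> X_sum x = X_sum y.
Proof. intros H. f_equal. apply functional_extensionality, H. Qed.

Lemma X_sum_mul (a : X) (x : nat -> X) :
  ex_series (fun k => X_norm (x k)) ->
  X_mul a (X_sum x) = X_sum (fun k => X_mul a (x k)) /\
  ex_series (fun k => X_norm (X_mul a (x k))).
Proof.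
  intros Hx.
  assert (Hax : ex_series (fun k => X_norm (X_mul a (x k)))).
  { apply ex_series_dominated with (fun k => X_norm a * X_norm (x k)).
    - intros k. rewrite Rabs_pos_eq by apply X_norm_pos. apply X_norm_mul.
    - apply @ex_series_scal. exact Hx. }
  split; [|exact Hax].
  apply X_ext. intros n. rewrite X_mul_coef, X_sum_coef by exact Hax.
  rewrite (cauchy_ext a a _ (fun n => Series (fun k => x k n)));
    [|reflexivity|intros; apply X_sum_coef, Hx].
  rewrite (Series_ext _ (fun k => cauchy a (x k) n))
    by (intros; apply X_mul_coef).
  (* The induction on [n] shifts [a], so the claim is proved for arbitrary sequences; each
     coefficient of the product is a finite combination of series. *)
  generalize (a : nat -> R); clear Hax a.
  assert (H : forall a : nat -> R,
    ex_series (fun k => cauchy a (x k) n) /\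
    cauchy a (fun n => Series (fun k => x k n)) n = Series (fun k => cauchy a (x k) n)).
  { induction n as [|n IH]; intros a; simpl.
    - split; [apply @ex_series_scal, X_coef_ex, Hx|]. now rewrite Series_scal_l.
    - destruct (IH (fun k => a (S k))) as [E1 E2]. split.
      + apply @ex_series_plus; [apply @ex_series_scal, X_coef_ex, Hx | exact E1].
      + rewrite E2, Series_plus; [now rewrite Series_scal_l | | exact E1].
        apply @ex_series_scal, X_coef_ex, Hx. }
  intros a; apply H.
Qed.

(** * Composition in X *)

(** The common estimate for composition, its derivative, its Lipschitz bound and its Taylor
    remainder: only the factor [M], uniform in [k], differs. *)
Lemma X_dominated (f : X) (x : nat -> X) (M : R) :
  (forall k, X_norm (x k) <= Rabs (f k) * M) ->
  ex_series (fun k => X_norm (x k)) /\ X_norm (X_sum x) <= X_norm f * M.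
Proof.
  intros H.
  assert (Hex : ex_series (fun k => Rabs (f k) * M)).
  { apply ex_series_ext with (fun k => scal M (Rabs (f k))).
    - intros k. unfold scal; simpl; unfold mult; simpl; ring.
    - apply @ex_series_scal, coef_summable. }
  assert (Hx : ex_series (fun k => X_norm (x k))).
  { revert Hex; apply ex_series_dominated. intros k.
    rewrite Rabs_pos_eq by apply X_norm_pos. apply H. }
  split; [exact Hx|].
  eapply Rle_trans; [apply X_norm_sum, Hx|].
  unfold X_norm. rewrite <- Series_scal_r. apply Series_le; [|exact Hex].
  intros k; split; [apply X_norm_pos|apply H].
Qed.

Lemma X_sum_minus (x y : nat -> X) :
  ex_series (fun k => X_norm (x k)) -> ex_series (fun k => X_norm (y k)) ->
  X_minus (X_sum x) (X_sum y) = X_sum (fun k => X_minus (x k) (y k)).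
Proof.
  intros Hx Hy. destruct (X_sum_mul (X_const (-1)) y Hy) as [E Hy'].
  replace (X_minus (X_sum x) (X_sum y))
    with (X_plus (X_sum x) (X_mul (X_const (-1)) (X_sum y))).
  - rewrite E, X_sum_plus by assumption. apply X_sum_ext. intros k.
    rewrite X_const_mul. reflexivity.
  - rewrite X_const_mul. reflexivity.
Qed.

Lemma pow_le_1 (a : R) (k : nat) : 0 <= a <= 1 -> a ^ k <= 1.
Proof.
  intros H. induction k as [|k IH]; simpl; [lra|].
  assert (0 <= a ^ k) by (apply pow_le; lra). nra.
Qed.

Lemma X_norm_pow_le_1 (q : X) (k : nat) : X_norm q <= 1 -> X_norm (X_pow q k) <= 1.
Proof.
  intros H. eapply Rle_trans; [apply X_norm_pow|].
  apply pow_le_1. split; [apply X_norm_pos|exact H].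
Qed.

Lemma X_pow_add (q : X) (j k : nat) : X_pow q (j + k) = X_mul (X_pow q j) (X_pow q k).
Proof. induction j as [|j IH]; simpl; [ring|]. rewrite IH. ring. Qed.

Lemma X_norm_pow_mono (q : X) (j k : nat) :
  X_norm q <= 1 -> (j <= k)%nat -> X_norm (X_pow q k) <= X_norm (X_pow q j).
Proof.
  intros H Hk. replace k with (j + (k - j))%nat by lia. rewrite X_pow_add.
  eapply Rle_trans; [apply X_norm_mul|].
  generalize (X_norm_pow_le_1 q (k - j) H) (X_norm_pos (X_pow q j)). nra.
Qed.

(** Each of the [k] copies of [th^(k-1)] is at most one of the terms [1, th, ..., th^(k-1)] of a
    geometric sum. *)
Lemma derivative_factor_bound (th : R) (k : nat) :
  0 <= th < 1 -> INR k * th ^ pred k <= / (1 - th).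
Proof.
  intros H. assert (Hp : 0 < / (1 - th)) by (apply Rinv_0_lt_compat; lra).
  assert (He : th * / (1 - th) + 1 = / (1 - th)) by (field; lra).
  destruct k as [|k]; [simpl; lra|]. simpl pred.
  induction k as [|k IH]; [simpl; nra|].
  rewrite S_INR, Rmult_plus_distr_r, Rmult_1_l.
  assert (th ^ S k <= 1) by (apply pow_le_1; lra).
  replace (INR (S k) * th ^ S k) with (th * (INR (S k) * th ^ k)) by (simpl pow; ring).
  nra.
Qed.

Definition X_comp (f q : X) : X := X_sum (fun k => X_mul (X_const (f k)) (X_pow q k)).

(** The derivative of [f] at [q]; it is summable only for [X_norm q < 1]. *)
Definition X_dcomp (f q : X) : X :=
  X_sum (fun k => X_mul (X_const (INR k * f k)) (X_pow q (pred k))).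

Lemma comp_terms (f q : X) : X_norm q <= 1 -> forall k,
  X_norm (X_mul (X_const (f k)) (X_pow q k)) <= Rabs (f k) * 1.
Proof.
  intros H k. eapply Rle_trans; [apply X_norm_mul|]. rewrite X_norm_const.
  apply Rmult_le_compat_l; [apply Rabs_pos|]. apply X_norm_pow_le_1, H.
Qed.

Lemma comp_ex (f q : X) : X_norm q <= 1 ->
  ex_series (fun k => X_norm (X_mul (X_const (f k)) (X_pow q k))).
Proof. intros H. apply (X_dominated f _ 1), comp_terms, H. Qed.

Lemma X_norm_comp (f q : X) : X_norm q <= 1 -> X_norm (X_comp f q) <= X_norm f.
Proof.
  intros H. rewrite <- (Rmult_1_r (X_norm f)). apply X_dominated, comp_terms, H.
Qed.

Lemma comp_plus (f g q : X) : X_norm q <= 1 ->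
  X_comp (X_plus f g) q = X_plus (X_comp f q) (X_comp g q).
Proof.
  intros H. unfold X_comp. rewrite X_sum_plus by (apply comp_ex, H).
  apply X_sum_ext. intros k. simpl. rewrite X_const_plus. ring.
Qed.

Lemma comp_scal (c : R) (f q : X) : X_norm q <= 1 ->
  X_comp (X_scal c f) q = X_scal c (X_comp f q).
Proof.
  intros H. unfold X_comp. rewrite (X_scal_mul c (X_sum _)).
  rewrite (proj1 (X_sum_mul (X_const c) _ (comp_ex f q H))).
  apply X_sum_ext. intros k. simpl. rewrite X_const_times. ring.
Qed.

Lemma comp_zero (q : X) : X_norm q <= 1 -> X_comp X_zero q = X_zero.
Proof.
  intros H. replace X_zero with (X_scal 0 X_zero) at 1.
  - rewrite comp_scal by exact H. rewrite X_scal_mul, X_const_0. ring.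
  - rewrite X_scal_mul, X_const_0. ring.
Qed.

Lemma comp_minus (f g q : X) : X_norm q <= 1 ->
  X_comp (X_minus f g) q = X_minus (X_comp f q) (X_comp g q).
Proof.
  intros H. unfold X_minus, X_opp. rewrite comp_plus, comp_scal; auto.
Qed.

(** The source of compactness: composing with a [q] of norm below 1 damps everything in degrees
    [>= K] by [q^K]. *)
Lemma comp_tail_small (K : nat) (f q : X) : X_norm q <= 1 ->
  (forall k, (k < K)%nat -> f k = 0) ->
  X_norm (X_comp f q) <= X_norm f * X_norm (X_pow q K).
Proof.
  intros H HK. apply X_dominated. intros k.
  eapply Rle_trans; [apply X_norm_mul|]. rewrite X_norm_const.
  destruct (Nat.lt_ge_cases k K) as [Hk|Hk].
  - rewrite (HK k Hk), Rabs_R0. lra.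
  - apply Rmult_le_compat_l; [apply Rabs_pos|]. now apply X_norm_pow_mono.
Qed.

Lemma dcomp_terms (f q : X) (th : R) : X_norm q <= th < 1 -> forall k,
  X_norm (X_mul (X_const (INR k * f k)) (X_pow q (pred k))) <= Rabs (f k) * / (1 - th).
Proof.
  intros H k. assert (H0 := X_norm_pos q).
  eapply Rle_trans; [apply X_norm_mul|].
  rewrite X_norm_const, Rabs_mult, (Rabs_pos_eq (INR k)) by apply pos_INR.
  rewrite (Rmult_comm (INR k)), Rmult_assoc.
  apply Rmult_le_compat_l; [apply Rabs_pos|].
  eapply Rle_trans; [|apply (derivative_factor_bound th k); lra].
  apply Rmult_le_compat_l; [apply pos_INR|].
  eapply Rle_trans; [apply X_norm_pow|]. apply pow_incr; lra.
Qed.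

Lemma dcomp_ex (f q : X) : X_norm q < 1 ->
  ex_series (fun k => X_norm (X_mul (X_const (INR k * f k)) (X_pow q (pred k)))).
Proof.
  intros H. apply (X_dominated f _ (/ (1 - X_norm q))), dcomp_terms; lra.
Qed.

Lemma X_norm_dcomp (f q : X) (th : R) : X_norm q <= th < 1 ->
  X_norm (X_dcomp f q) <= X_norm f * / (1 - th).
Proof. intros H. apply X_dominated, dcomp_terms, H. Qed.

Lemma dcomp_minus (f g q : X) : X_norm q < 1 ->
  X_dcomp (X_minus f g) q = X_minus (X_dcomp f q) (X_dcomp g q).
Proof.
  intros H. unfold X_dcomp. rewrite X_sum_minus by (apply dcomp_ex, H).
  apply X_sum_ext. intros k.
  replace (INR k * X_minus f g k) with (INR k * f k + - (INR k * g k)) by (simpl; ring).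
  rewrite X_const_plus, X_const_opp. ring.
Qed.

(** From [q'^(k+1) - q^(k+1) = q' (q'^k - q^k) + (q' - q) q^k]; the constant [1 / (1 - th)] is the
    fixed point of [c -> th c + 1], so the bound does not grow with [k]. *)
Lemma pow_difference_bound (q q' : X) (th : R) (k : nat) :
  X_norm q <= th < 1 -> X_norm q' <= th ->
  X_norm (X_minus (X_pow q' k) (X_pow q k)) <= X_norm (X_minus q' q) * / (1 - th).
Proof.
  intros H H'. assert (H0 := X_norm_pos q).
  set (d := X_norm (X_minus q' q)). assert (Hd : 0 <= d) by apply X_norm_pos.
  assert (Hp : 0 < / (1 - th)) by (apply Rinv_0_lt_compat; lra).
  assert (He : th * / (1 - th) + 1 = / (1 - th)) by (field; lra).
  induction k as [|k IH].
  - simpl. replace (X_minus X_one X_one) with X_zero by ring.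
    rewrite X_norm_zero. nra.
  - simpl. replace (X_minus _ _)
      with (X_plus (X_mul q' (X_minus (X_pow q' k) (X_pow q k)))
                   (X_mul (X_minus q' q) (X_pow q k))) by ring.
    eapply Rle_trans; [apply X_norm_triangle|].
    assert (A := X_norm_mul q' (X_minus (X_pow q' k) (X_pow q k))).
    assert (B := X_norm_mul (X_minus q' q) (X_pow q k)). fold d in B.
    assert (C := X_norm_pow_le_1 q k). 
    assert (D := X_norm_pos (X_minus (X_pow q' k) (X_pow q k))).
    assert (E := X_norm_pos q').
    rewrite <- He. nra.
Qed.

Definition pow_remainder (q q' : X) (k : nat) : X :=
  X_minus (X_minus (X_pow q' k) (X_pow q k))
    (X_mul (X_mul (X_const (INR k)) (X_pow q (pred k))) (X_minus q' q)).

(** The remainders satisfy [R_(k+1) = q' R_k + k q^(k-1) h^2], and [k q^(k-1)] is bounded by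
    [1 / (1 - th)]; again the bound is stable under the recursion. *)
Lemma pow_remainder_bound (q q' : X) (th : R) (k : nat) :
  X_norm q <= th < 1 -> X_norm q' <= th ->
  X_norm (pow_remainder q q' k) <= X_norm (X_minus q' q) ^ 2 * / (1 - th) ^ 2.
Proof.
  intros H H'. assert (H0 := X_norm_pos q).
  set (h := X_minus q' q). set (d := X_norm h).
  assert (Hd : 0 <= d) by apply X_norm_pos.
  set (i := / (1 - th)).
  assert (Hp : 0 < i) by (apply Rinv_0_lt_compat; lra).
  assert (He : th * i + 1 = i) by (unfold i; field; lra).
  replace (/ (1 - th) ^ 2) with (i ^ 2) by (unfold i; field; lra).
  induction k as [|k IH].
  - unfold pow_remainder. simpl.
    replace (X_minus _ _) with X_zero by (rewrite X_const_0; ring).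
    rewrite X_norm_zero. nra.
  - assert (Hrec : pow_remainder q q' (S k) =
      X_plus (X_mul q' (pow_remainder q q' k))
        (X_mul (X_mul (X_const (INR k)) (X_pow q (pred k))) (X_mul h h))).
    { unfold pow_remainder, h. rewrite S_INR, X_const_plus. simpl pred. simpl X_pow.
      fold X_one. destruct k as [|k]; simpl X_pow; simpl pred.
      - simpl INR. rewrite X_const_0. ring.
      - ring. }
    rewrite Hrec. eapply Rle_trans; [apply X_norm_triangle|].
    assert (A := X_norm_mul q' (pow_remainder q q' k)).
    assert (B : X_norm (X_mul (X_mul (X_const (INR k)) (X_pow q (pred k))) (X_mul h h))
                <= i * d ^ 2).
    { eapply Rle_trans; [apply X_norm_mul|].
      apply Rmult_le_compat; try apply X_norm_pos.
      - eapply Rle_trans; [apply X_norm_mul|].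
        rewrite X_norm_const, Rabs_pos_eq by apply pos_INR.
        eapply Rle_trans; [|apply (derivative_factor_bound th k); lra].
        apply Rmult_le_compat_l; [apply pos_INR|].
        eapply Rle_trans; [apply X_norm_pow|]. apply pow_incr; lra.
      - eapply Rle_trans; [apply X_norm_mul|]. fold d. lra. }
    assert (D := X_norm_pos (pow_remainder q q' k)).
    assert (E := X_norm_pos q').
    assert (F : X_norm (X_mul q' (pow_remainder q q' k)) <= th * (d ^ 2 * i ^ 2)).
    { eapply Rle_trans; [exact A|]. apply Rmult_le_compat; auto. }
    replace (d ^ 2 * i ^ 2) with (th * (d ^ 2 * i ^ 2) + i * d ^ 2).
    + lra.
    + transitivity (d ^ 2 * i * (th * i + 1)); [ring|]. rewrite He. ring.
Qed.

Lemma comp_lipschitz (f q q' : X) (th : R) :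
  X_norm q <= th < 1 -> X_norm q' <= th ->
  X_norm (X_minus (X_comp f q') (X_comp f q)) <=
  X_norm f * (X_norm (X_minus q' q) * / (1 - th)).
Proof.
  intros H H'. unfold X_comp. rewrite X_sum_minus by (apply comp_ex; lra).
  apply X_dominated. intros k.
  replace (X_minus _ _)
    with (X_mul (X_const (f k)) (X_minus (X_pow q' k) (X_pow q k))) by ring.
  eapply Rle_trans; [apply X_norm_mul|]. rewrite X_norm_const.
  apply Rmult_le_compat_l; [apply Rabs_pos|]. now apply pow_difference_bound.
Qed.

Lemma comp_taylor (f q q' : X) (th : R) :
  X_norm q <= th < 1 -> X_norm q' <= th ->
  X_norm (X_minus (X_minus (X_comp f q') (X_comp f q)) (X_mul (X_dcomp f q) (X_minus q' q)))
  <= X_norm f * (X_norm (X_minus q' q) ^ 2 * / (1 - th) ^ 2).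
Proof.
  intros H H'. set (h := X_minus q' q).
  assert (E1 := comp_ex f q ltac:(lra)). assert (E2 := comp_ex f q' ltac:(lra)).
  destruct (X_sum_mul h _ (dcomp_ex f q ltac:(lra))) as [E E3].
  replace (X_mul (X_dcomp f q) h) with (X_mul h (X_dcomp f q)) by ring.
  unfold X_dcomp, X_comp. rewrite E. rewrite X_sum_minus by assumption.
  rewrite X_sum_minus; [| |exact E3].
  - apply X_dominated. intros k.
    replace (X_minus _ _) with (X_mul (X_const (f k)) (pow_remainder q q' k)).
    + eapply Rle_trans; [apply X_norm_mul|]. rewrite X_norm_const.
      apply Rmult_le_compat_l; [apply Rabs_pos|]. now apply pow_remainder_bound.
    + unfold pow_remainder, h. rewrite X_const_times. ring.
  - apply ex_series_dominated with
      (fun k => X_norm (X_mul (X_const (f k)) (X_pow q' k)) +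
                X_norm (X_mul (X_const (f k)) (X_pow q k))).
    + intros k. rewrite Rabs_pos_eq by apply X_norm_pos. apply X_norm_minus.
    + apply @ex_series_plus; assumption.
Qed.

(** * Density of polynomials *)

Fixpoint X_tails (n : nat) (x : X) : X :=
  match n with O => x | S m => X_tails m (X_tail x) end.

Fixpoint X_head (n : nat) (x : X) : X :=
  match n with
  | O => X_zero
  | S m => X_plus (X_const (x O)) (X_mul X_var (X_head m (X_tail x)))
  end.

Lemma X_split (x : X) : x = X_plus (X_const (x O)) (X_mul X_var (X_tail x)).
Proof.
  rewrite X_shift_mul. apply X_ext. intros [|k]; simpl;
    rewrite X_const_coef, X_shift_coef, ?X_tail_coef; ring.
Qed.

Lemma X_norm_split (x : X) : X_norm x = Rabs (x O) + X_norm (X_tail x).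
Proof.
  unfold X_norm. rewrite series_shift by apply coef_summable.
  f_equal. apply Series_ext. intros k. now rewrite X_tail_coef.
Qed.

Lemma X_head_tails (n : nat) : forall x,
  x = X_plus (X_head n x) (X_mul (X_pow X_var n) (X_tails n x)).
Proof.
  induction n as [|n IH]; intros x; simpl; [ring|].
  transitivity (X_plus (X_const (x O)) (X_mul X_var (X_tail x))); [apply X_split|].
  rewrite (IH (X_tail x)) at 1. ring.
Qed.

Lemma X_norm_tails (n : nat) : forall x,
  X_norm x = sum_f_R0 (fun k => Rabs (x k)) n + X_norm (X_tails (S n) x).
Proof.
  induction n as [|n IH]; intros x.
  - apply X_norm_split.
  - rewrite sum_shift, X_norm_split, (IH (X_tail x)).
    rewrite (sum_eq _ (fun k => Rabs (x (S k)))); [simpl; ring|].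
    intros; now rewrite X_tail_coef.
Qed.

Lemma X_tails_small (x : X) (eps : R) :
  0 < eps -> exists N, forall n, (N <= n)%nat -> X_norm (X_tails n x) < eps.
Proof.
  intros He.
  assert (H := Series_correct _ (coef_summable x)).
  change (is_lim_seq (sum_n (fun k => Rabs (x k))) (Series (fun k => Rabs (x k)))) in H.
  apply is_lim_seq_spec in H. destruct (H (mkposreal eps He)) as [N HN].
  exists (S N). intros [|n] Hn; [lia|].
  specialize (HN n ltac:(lia)). simpl in HN. rewrite sum_n_Reals in HN.
  change (Series (fun k => Rabs (x k))) with (X_norm x) in HN.
  assert (T := X_norm_tails n x).
  rewrite Rabs_left1 in HN; [lra|].
  generalize (partial_le_X_norm x n); lra.
Qed.

(** Subadditivity suffices, so that [phi] may be the norm of a linear map into R, C or [Y];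
    homogeneity enters only through the values on monomials. *)
Definition X_sublinear (phi : X -> R) : Prop :=
  (forall x y, phi (X_plus x y) <= phi x + phi y) /\
  exists C, forall x, phi x <= C * X_norm x.

(** The unit ball of l1 is the closed convex hull of the signed monomials, so a bound on monomials
    holds everywhere with the same constant. *)
Lemma X_sublinear_bound (phi : X -> R) (kap : R) :
  X_sublinear phi ->
  (forall c k, phi (X_scal c (X_pow X_var k)) <= Rabs c * kap) ->
  forall x, phi x <= kap * X_norm x.
Proof.
  intros [Hs [C HC]] Hk x.
  assert (Hkap : 0 <= kap \/ kap < 0) by lra.
  assert (HC' : 0 <= Rmax C 0) by apply Rmax_r.
  assert (HM : forall x, phi x <= Rmax C 0 * X_norm x).
  { intros y. eapply Rle_trans; [apply HC|].
    apply Rmult_le_compat_r; [apply X_norm_pos|apply Rmax_l]. }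
  (* The power [X_var^j] is carried along because every step of [X_head] pulls out one factor
     [X_var]. *)
  assert (Hn : forall n x j, phi (X_mul (X_pow X_var j) (X_head (S n) x)) <=
            kap * sum_f_R0 (fun k => Rabs (x k)) n).
  { clear x. induction n as [|n IH]; intros x j.
    - simpl X_head. replace (X_mul (X_pow X_var j) _)
        with (X_scal (x O) (X_pow X_var j)).
      + simpl sum_f_R0. rewrite Rmult_comm. apply Hk.
      + rewrite X_scal_mul. ring.
    - change (X_head (S (S n)) x)
        with (X_plus (X_const (x O)) (X_mul X_var (X_head (S n) (X_tail x)))).
      replace (X_mul (X_pow X_var j) _) with
        (X_plus (X_scal (x O) (X_pow X_var j))
                (X_mul (X_pow X_var (S j)) (X_head (S n) (X_tail x)))).
      + eapply Rle_trans; [apply Hs|]. rewrite sum_shift, Rmult_plus_distr_l.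
        apply Rplus_le_compat; [rewrite Rmult_comm; apply Hk|].
        eapply Rle_trans; [apply IH|]. right. f_equal. apply sum_eq.
        intros; apply f_equal, X_tail_coef.
      + rewrite X_scal_mul. change (X_pow X_var (S j)) with (X_mul X_var (X_pow X_var j)).
        ring. }
  apply Rnot_lt_le. intros Hlt.
  set (gap := phi x - kap * X_norm x).
  assert (Hgap : 0 < gap) by (unfold gap; lra).
  (* The tail enters once with the crude constant and once inside [kap * X_norm x]; a tail below
     [gap / B] therefore cannot account for the gap. *)
  set (B := Rmax C 0 + Rabs kap + 1). assert (HB : 0 < B).
  { unfold B. generalize (Rabs_pos kap); lra. }
  destruct (X_tails_small x (gap / B)) as [N HN]; [apply Rdiv_lt_0_compat; assumption|].
  specialize (HN (S N) ltac:(lia)).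
  assert (H1 : phi x <= kap * sum_f_R0 (fun k => Rabs (x k)) N +
                Rmax C 0 * X_norm (X_tails (S N) x)).
  { rewrite (X_head_tails (S N) x) at 1. eapply Rle_trans; [apply Hs|].
    apply Rplus_le_compat.
    - replace (X_head (S N) x) with (X_mul (X_pow X_var 0) (X_head (S N) x))
        by (simpl X_pow; ring). apply Hn.
    - eapply Rle_trans; [apply HM|]. apply Rmult_le_compat_l; [exact HC'|].
      eapply Rle_trans; [apply X_norm_mul|].
      generalize (X_norm_pow_le_1 X_var (S N) X_norm_var)
                 (X_norm_pos (X_tails (S N) x)). nra. }
  assert (T := X_norm_tails N x).
  assert (P := X_norm_pos (X_tails (S N) x)).
  assert (Q : X_norm (X_tails (S N) x) * B < gap).
  { apply (Rmult_lt_compat_r B) in HN; [|exact HB].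
    unfold Rdiv in HN. rewrite Rmult_assoc, Rinv_l, Rmult_1_r in HN; lra. }
  unfold gap, B in Q. rewrite T in Q.
  generalize (Rle_abs kap) (Rabs_maj2 kap). intros.
  nra.
Qed.

(** The preceding bound with constant 0, applied to [|L1 - L2|]. *)
Lemma X_bounded_linear_eq (L1 L2 : X -> R) (C : R) :
  (forall x y, L1 (X_plus x y) = L1 x + L1 y) ->
  (forall x y, L2 (X_plus x y) = L2 x + L2 y) ->
  (forall c x, L1 (X_scal c x) = c * L1 x) ->
  (forall c x, L2 (X_scal c x) = c * L2 x) ->
  (forall x, Rabs (L1 x) <= C * X_norm x) ->
  (forall x, Rabs (L2 x) <= C * X_norm x) ->
  (forall k, L1 (X_pow X_var k) = L2 (X_pow X_var k)) ->
  forall x, L1 x = L2 x.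
Proof.
  intros A1 A2 S1 S2 B1 B2 H x.
  assert (Hle : Rabs (L1 x - L2 x) <= 0 * X_norm x).
  { apply (X_sublinear_bound (fun x => Rabs (L1 x - L2 x)) 0).
    - split.
      + intros u v. rewrite A1, A2.
        replace (_ - _) with ((L1 u - L2 u) + (L1 v - L2 v)) by ring.
        apply Rabs_triang.
      + exists (C + C). intros u. generalize (B1 u) (B2 u). unfold Rminus.
        generalize (Rabs_triang (L1 u) (- L2 u)). rewrite Rabs_Ropp. lra.
    - intros c k. rewrite S1, S2, H.
      replace (_ - _) with 0 by ring. rewrite Rabs_R0. lra. }
  rewrite Rmult_0_l in Hle. generalize (Rabs_pos (L1 x - L2 x)). intros.
  apply Rminus_diag_uniq. destruct (Req_dec (L1 x - L2 x) 0) as [E|E]; [exact E|].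
  apply Rabs_pos_lt in E. lra.
Qed.

(** * Evaluation *)

Lemma Cmod_pow_le_1 (z : C) (k : nat) : Cmod z <= 1 -> Cmod (z ^ k)%C <= 1.
Proof.
  intros H. rewrite Cmod_pow. apply pow_le_1. split; [apply Cmod_ge_0|exact H].
Qed.

Lemma Rabs_Re_le (z : C) : Rabs (Re z) <= Cmod z.
Proof. apply Rle_trans with (2 := Rmax_Cmod z). apply Rmax_l. Qed.

Lemma Rabs_Im_le (z : C) : Rabs (Im z) <= Cmod z.
Proof. apply Rle_trans with (2 := Rmax_Cmod z). apply Rmax_r. Qed.

Lemma weighted_ex (f : X) (u : nat -> R) :
  (forall k, Rabs (u k) <= 1) -> ex_series (fun k => Rabs (f k * u k)).
Proof.
  intros H. apply ex_series_dominated with (2 := coef_summable f).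
  intros k. rewrite Rabs_Rabsolu, Rabs_mult.
  generalize (H k) (Rabs_pos (f k)) (Rabs_pos (u k)). nra.
Qed.

Lemma weighted_bound (f : X) (u : nat -> R) :
  (forall k, Rabs (u k) <= 1) -> Rabs (Series (fun k => f k * u k)) <= X_norm f.
Proof.
  intros H. eapply Rle_trans; [apply Series_Rabs, weighted_ex, H|].
  apply Series_le; [|apply coef_summable]. intros k. split; [apply Rabs_pos|].
  rewrite Rabs_mult. generalize (H k) (Rabs_pos (f k)) (Rabs_pos (u k)). nra.
Qed.

Section Eval.
Variable z : C.
Hypothesis Hz : Cmod z <= 1.

Lemma Re_pow_le k : Rabs (Re (z ^ k)%C) <= 1.
Proof. eapply Rle_trans; [apply Rabs_Re_le|]. now apply Cmod_pow_le_1. Qed.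

Lemma Im_pow_le k : Rabs (Im (z ^ k)%C) <= 1.
Proof. eapply Rle_trans; [apply Rabs_Im_le|]. now apply Cmod_pow_le_1. Qed.

Lemma eval_ex_Re (f : X) : ex_series (fun k => f k * Re (z ^ k)%C).
Proof. apply ex_series_Rabs, weighted_ex, Re_pow_le. Qed.

Lemma eval_ex_Im (f : X) : ex_series (fun k => f k * Im (z ^ k)%C).
Proof. apply ex_series_Rabs, weighted_ex, Im_pow_le. Qed.

Lemma evalX_plus (f g : X) : evalX (X_plus f g) z = (evalX f z + evalX g z)%C.
Proof.
  unfold evalX, Cplus; simpl. f_equal; rewrite <- Series_plus;
    auto using eval_ex_Re, eval_ex_Im;
    apply Series_ext; intros k; ring.
Qed.

Lemma evalX_scal (c : R) (f : X) : evalX (X_scal c f) z = (RtoC c * evalX f z)%C.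
Proof.
  unfold evalX, Cmult, RtoC; simpl.
  rewrite !Rmult_0_l, Rminus_0_r, Rplus_0_r, <- !Series_scal_l.
  f_equal; apply Series_ext; intros k; ring.
Qed.

Lemma evalX_opp (f : X) : evalX (X_opp f) z = (- evalX f z)%C.
Proof. unfold X_opp. rewrite evalX_scal.
  change (-1) with (- (1)). rewrite RtoC_opp. ring. Qed.

Lemma evalX_minus (f g : X) : evalX (X_minus f g) z = (evalX f z - evalX g z)%C.
Proof. unfold X_minus. rewrite evalX_plus, evalX_opp. ring. Qed.

Lemma Re_evalX_bound (f : X) : Rabs (Re (evalX f z)) <= X_norm f.
Proof. apply weighted_bound, Re_pow_le. Qed.

Lemma Im_evalX_bound (f : X) : Rabs (Im (evalX f z)) <= X_norm f.
Proof. apply weighted_bound, Im_pow_le. Qed.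

Lemma evalX_const (c : R) : evalX (X_const c) z = RtoC c.
Proof.
  assert (H : forall u : nat -> R, (forall k, Rabs (u k) <= 1) ->
             Series (fun k => X_const c k * u k) = c * u O).
  { intros u Hu. rewrite series_shift by (apply ex_series_Rabs, weighted_ex, Hu).
    rewrite X_const_coef, (Series_ext _ (fun _ => 0 * 0)).
    - rewrite Series_scal_l. ring.
    - intros k. rewrite X_const_coef. ring. }
  unfold evalX. rewrite !H by (apply Re_pow_le || apply Im_pow_le).
  unfold RtoC. simpl. f_equal; ring.
Qed.

Lemma evalX_shift (f : X) : evalX (X_shift f) z = (z * evalX f z)%C.
Proof.
  unfold evalX at 1.
  rewrite (series_shift _ (eval_ex_Re _)), (series_shift _ (eval_ex_Im _)).
  rewrite !X_shift_coef, !Rmult_0_l, !Rplus_0_l.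
  rewrite (Series_ext _ (fun k => Re z * (f k * Re (z ^ k)%C) - Im z * (f k * Im (z ^ k)%C))).
  2:{ intros k. rewrite X_shift_coef. rewrite Cpow_S. unfold Re, Im. simpl. ring. }
  rewrite (Series_ext (fun k => X_shift f (S k) * Im (z ^ S k)%C)
     (fun k => Re z * (f k * Im (z ^ k)%C) + Im z * (f k * Re (z ^ k)%C))).
  2:{ intros k. rewrite X_shift_coef, Cpow_S. unfold Re, Im. simpl. ring. }
  rewrite Series_minus, Series_plus, !Series_scal_l;
    try (apply @ex_series_scal; auto using eval_ex_Re, eval_ex_Im).
  unfold evalX, Cmult; simpl. reflexivity.
Qed.

Lemma evalX_pow_var_mul (k : nat) (g : X) :
  evalX (X_mul (X_pow X_var k) g) z = (z ^ k * evalX g z)%C.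
Proof.
  induction k as [|k IH].
  - simpl X_pow. replace (X_mul X_one g) with g by ring. simpl. ring.
  - simpl X_pow. replace (X_mul _ g) with (X_mul X_var (X_mul (X_pow X_var k) g)) by ring.
    rewrite X_shift_mul, evalX_shift, IH. simpl. ring.
Qed.

Lemma evalX_one : evalX X_one z = RtoC 1.
Proof. apply evalX_const. Qed.

Lemma evalX_var : evalX X_var z = z.
Proof. unfold X_var. rewrite evalX_shift, evalX_one. ring. Qed.

Lemma evalX_pow_var (k : nat) : evalX (X_pow X_var k) z = (z ^ k)%C.
Proof.
  replace (X_pow X_var k) with (X_mul (X_pow X_var k) X_one) by ring.
  rewrite evalX_pow_var_mul, evalX_one. ring.
Qed.

Lemma C_ext (a b : C) : Re a = Re b -> Im a = Im b -> a = b.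
Proof. destruct a, b; simpl; congruence. Qed.

(** Reduces identities between evaluations to monomials; real and imaginary parts are treated as two
    real functionals. *)
Lemma X_to_C_eq (L1 L2 : X -> C) (M : R) :
  (forall x y, L1 (X_plus x y) = L1 x + L1 y)%C ->
  (forall x y, L2 (X_plus x y) = L2 x + L2 y)%C ->
  (forall c x, L1 (X_scal c x) = RtoC c * L1 x)%C ->
  (forall c x, L2 (X_scal c x) = RtoC c * L2 x)%C ->
  (forall x, Rabs (Re (L1 x)) <= M * X_norm x /\ Rabs (Im (L1 x)) <= M * X_norm x) ->
  (forall x, Rabs (Re (L2 x)) <= M * X_norm x /\ Rabs (Im (L2 x)) <= M * X_norm x) ->
  (forall k, L1 (X_pow X_var k) = L2 (X_pow X_var k)) ->
  forall x, L1 x = L2 x.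
Proof.
  intros A1 A2 S1 S2 B1 B2 H x. apply C_ext.
  - apply (X_bounded_linear_eq (fun x => Re (L1 x)) (fun x => Re (L2 x)) M).
    + intros; now rewrite A1.
    + intros; now rewrite A2.
    + intros; rewrite S1; unfold Re, Im; simpl; ring.
    + intros; rewrite S2; unfold Re, Im; simpl; ring.
    + intros; apply B1.
    + intros; apply B2.
    + intros; now rewrite H.
  - apply (X_bounded_linear_eq (fun x => Im (L1 x)) (fun x => Im (L2 x)) M).
    + intros; now rewrite A1.
    + intros; now rewrite A2.
    + intros; rewrite S1; unfold Re, Im; simpl; ring.
    + intros; rewrite S2; unfold Re, Im; simpl; ring.
    + intros; apply B1.
    + intros; apply B2.
    + intros; now rewrite H.
Qed.

(** Both sides are bounded and linear in [f] for fixed [g], and for monomials [f] the claim is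
    repeated shifting. The factor 2 bounds the two products in each part of a complex product. *)
Lemma evalX_mul (f g : X) : evalX (X_mul f g) z = (evalX f z * evalX g z)%C.
Proof.
  apply (X_to_C_eq (fun f => evalX (X_mul f g) z)
           (fun f => evalX f z * evalX g z)%C (2 * X_norm g)).
  - intros x y. rewrite <- evalX_plus. f_equal. ring.
  - intros x y. rewrite evalX_plus. ring.
  - intros c x. rewrite <- evalX_scal, !X_scal_mul. f_equal. ring.
  - intros c x. rewrite evalX_scal. ring.
  - intros x. assert (N := X_norm_mul x g).
    assert (0 <= X_norm g * X_norm x) by (apply Rmult_le_pos; apply X_norm_pos).
    split; [eapply Rle_trans; [apply Re_evalX_bound|] |
            eapply Rle_trans; [apply Im_evalX_bound|]]; lra.
  - intros x.
    assert (Hb : forall a b c d A B, Rabs a <= A -> Rabs b <= B -> Rabs c <= A -> Rabs d <= B ->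
      Rabs (a * b + c * d) <= 2 * B * A).
    { intros a b c d A B Ha Hb Hc Hd.
      eapply Rle_trans; [apply Rabs_triang|]. rewrite !Rabs_mult.
      assert (Rabs a * Rabs b <= A * B) by (apply Rmult_le_compat; auto using Rabs_pos).
      assert (Rabs c * Rabs d <= A * B) by (apply Rmult_le_compat; auto using Rabs_pos).
      lra. }
    split; simpl.
    + unfold Rminus. rewrite Ropp_mult_distr_r. apply Hb; rewrite ?Rabs_Ropp;
        (apply (Re_evalX_bound x) || apply (Im_evalX_bound x) ||
         apply (Re_evalX_bound g) || apply (Im_evalX_bound g)).
    + apply Hb;
        (apply (Re_evalX_bound x) || apply (Im_evalX_bound x) ||
         apply (Re_evalX_bound g) || apply (Im_evalX_bound g)).
  - intros k. now rewrite evalX_pow_var_mul, evalX_pow_var.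
Qed.

Lemma evalX_pow (q : X) (k : nat) : evalX (X_pow q k) z = (evalX q z ^ k)%C.
Proof.
  induction k as [|k IH]; simpl; [apply evalX_one|]. now rewrite evalX_mul, IH.
Qed.

(** Bounding the parts separately would lose a factor sqrt 2; testing on monomials recovers the
    constant 1. *)
Lemma Cmod_evalX (f : X) : Cmod (evalX f z) <= X_norm f.
Proof.
  rewrite <- (Rmult_1_l (X_norm f)).
  apply (X_sublinear_bound (fun f => Cmod (evalX f z)) 1).
  - split.
    + intros x y. rewrite evalX_plus. apply Cmod_triangle.
    + exists (sqrt 2). intros x. eapply Rle_trans; [apply Cmod_2Rmax|].
      apply Rmult_le_compat_l; [apply sqrt_pos|].
      apply Rmax_lub; [apply Re_evalX_bound|apply Im_evalX_bound].
  - intros c k. rewrite evalX_scal, Cmod_mult, Cmod_R, evalX_pow_var.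
    apply Rmult_le_compat_l; [apply Rabs_pos|]. now apply Cmod_pow_le_1.
Qed.

End Eval.

(** * Composition agrees with composition of functions *)

Lemma comp_shift (f q : X) : X_norm q <= 1 -> X_comp (X_shift f) q = X_mul q (X_comp f q).
Proof.
  intros H. unfold X_comp. rewrite X_sum_shift by (apply (comp_ex (X_shift f)), H).
  rewrite (proj1 (X_sum_mul q _ (comp_ex f q H))).
  rewrite X_shift_coef, X_const_0.
  transitivity (X_sum (fun k => X_mul (X_const (X_shift f (S k))) (X_pow q (S k)))); [ring|].
  apply X_sum_ext. intros k. rewrite X_shift_coef. simpl. ring.
Qed.

Lemma comp_const (c : R) (q : X) : X_norm q <= 1 -> X_comp (X_const c) q = X_const c.
Proof.
  intros H. unfold X_comp. rewrite X_sum_shift by (apply (comp_ex (X_const c)), H).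
  rewrite X_const_coef. simpl X_pow.
  rewrite (X_sum_ext _ (fun _ => X_mul (X_const 0) X_zero)).
  2:{ intros k. rewrite X_const_coef, X_const_0. ring. }
  assert (E : ex_series (fun _ : nat => X_norm X_zero)).
  { apply ex_series_ext with (fun _ => Rabs 0); [|apply X_zero_summable].
    intros _. now rewrite X_norm_zero, Rabs_R0. }
  rewrite <- (proj1 (X_sum_mul (X_const 0) (fun _ => X_zero) E)), X_const_0. ring.
Qed.

Lemma comp_pow_var (q : X) (k : nat) : X_norm q <= 1 -> X_comp (X_pow X_var k) q = X_pow q k.
Proof.
  intros H. induction k as [|k IH]; simpl.
  - apply comp_const, H.
  - rewrite X_shift_mul, comp_shift, IH; auto.
Qed.

Lemma evalX_comp (f q : X) (z : C) : Cmod z <= 1 -> X_norm q <= 1 ->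
  evalX (X_comp f q) z = evalX f (evalX q z).
Proof.
  intros Hz Hq.
  assert (Hqz : Cmod (evalX q z) <= 1) by (eapply Rle_trans; [now apply Cmod_evalX|exact Hq]).
  apply (X_to_C_eq (fun f => evalX (X_comp f q) z) (fun f => evalX f (evalX q z)) 1).
  - intros x y. rewrite comp_plus, evalX_plus; auto.
  - intros x y. apply evalX_plus; auto.
  - intros c x. rewrite comp_scal, evalX_scal; auto.
  - intros c x. apply evalX_scal; auto.
  - intros x. rewrite Rmult_1_l. assert (N := X_norm_comp x q Hq).
    split; eapply Rle_trans; eauto using Re_evalX_bound, Im_evalX_bound.
  - intros x. rewrite Rmult_1_l. auto using Re_evalX_bound, Im_evalX_bound.
  - intros k. rewrite comp_pow_var, evalX_pow, evalX_pow_var; auto.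
Qed.

Lemma evalX_split (f : X) (z : C) : Cmod z <= 1 ->
  evalX f z = (RtoC (f O) + z * evalX (X_tail f) z)%C.
Proof.
  intros H. rewrite (X_split f) at 1.
  now rewrite evalX_plus, evalX_mul, evalX_const, evalX_var.
Qed.

Lemma evalX_0 (f : X) : evalX f 0 = RtoC (f O).
Proof. rewrite evalX_split by (rewrite Cmod_0; lra). ring. Qed.

Lemma Cmod_RtoC_pos (x : R) : 0 <= x -> Cmod (RtoC x) = x.
Proof. intros H. rewrite Cmod_R. now apply Rabs_pos_eq. Qed.

(** Identity theorem: the constant coefficient is read off near 0, then a factor [x] is divided out
    and the argument repeats. The point 0 is excluded because [T_spec] says nothing about the second
    component there. *)
Lemma evalX_inj (f g : X) :
  (forall x : R, 0 < x < 1 -> evalX f (RtoC x) = evalX g (RtoC x)) -> f = g.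
Proof.
  intros H.
  assert (Hz : forall d : X, (forall x, 0 < x < 1 -> evalX d (RtoC x) = 0) -> d O = 0).
  { intros d Hd. destruct (Req_dec (d O) 0) as [E|E]; [exact E|exfalso].
    apply Rabs_pos_lt in E.
    (* So small that [x * X_norm d < |d O|], which contradicts [d O = - x * tail(x)]. *)
    set (x := Rmin (1 / 2) (Rabs (d O) / (2 * (X_norm d + 1)))).
    assert (Hn := X_norm_pos d).
    assert (Hp : 0 < Rabs (d O) / (2 * (X_norm d + 1)))
      by (apply Rdiv_lt_0_compat; lra).
    assert (Hx : 0 < x <= 1 / 2).
    { unfold x. split; [apply Rmin_glb_lt; lra|apply Rmin_l]. }
    specialize (Hd x ltac:(lra)).
    rewrite evalX_split in Hd by (rewrite Cmod_RtoC_pos; lra).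
    assert (Hc : Cmod (RtoC (d O)) <= x * X_norm d).
    { replace (RtoC (d O)) with (- (RtoC x * evalX (X_tail d) (RtoC x)))%C.
      - rewrite Cmod_opp, Cmod_mult, Cmod_RtoC_pos by lra.
        apply Rmult_le_compat_l; [lra|].
        eapply Rle_trans; [apply Cmod_evalX; rewrite Cmod_RtoC_pos; lra|apply X_norm_tail].
      - rewrite <- (Cplus_0_l (- _)%C), <- Hd. ring. }
    rewrite Cmod_R in Hc.
    assert (Hx2 : x * (2 * (X_norm d + 1)) <= Rabs (d O)).
    { apply Rle_trans with (Rabs (d O) / (2 * (X_norm d + 1)) * (2 * (X_norm d + 1))).
      - apply Rmult_le_compat_r; [lra|apply Rmin_r].
      - right. field. lra. }
    nra. }
  apply X_minus_eq0.
  assert (Hd : forall x, 0 < x < 1 -> evalX (X_minus f g) (RtoC x) = 0).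
  { intros x Hx. rewrite evalX_minus, (H x Hx) by (rewrite Cmod_RtoC_pos; lra). ring. }
  assert (Ht : forall n (d : X), (forall x, 0 < x < 1 -> evalX d (RtoC x) = 0) -> d n = 0).
  { induction n as [|n IH]; intros d H0; [now apply Hz|].
    rewrite <- X_tail_coef. apply IH. intros x Hx.
    assert (H1 := H0 x Hx).
    rewrite evalX_split, (Hz d H0) in H1 by (rewrite Cmod_RtoC_pos; lra).
    assert (H2 : (RtoC x * evalX (X_tail d) (RtoC x) = 0)%C).
    { rewrite <- H1. rewrite Cplus_0_l. reflexivity. }
    destruct (Ceq_dec (evalX (X_tail d) (RtoC x)) 0) as [E|E]; [exact E|exfalso].
    revert H2. apply Cmult_neq_0; [|exact E].
    intros E2. apply RtoC_inj in E2. lra. }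
  replace (X_minus f g) with X_zero; [apply X_norm_zero|].
  apply X_ext. intros k. symmetry. apply Ht, Hd.
Qed.

(** * Straight-line programs over X and their derivatives *)

(** Operands are registers; [ICmp true] and [ICmp false] compose the two
    components of the argument with a register. *)
Inductive instr : Type :=
| ICst (n : Z) (d : positive)
| IVar
| IAdd (i j : nat)
| ISub (i j : nat)
| IMul (i j : nat)
| IInv (i : nat)
| ICmp (b : bool) (i : nat).

(** Indexing the components by a boolean lets one proof serve both. *)
Definition pr (b : bool) (p : Y) : X := if b then fst p else snd p.

(** A function [Y -> X] together with its derivative. *)
Definition dfun : Type := ((Y -> X) * (Y -> Y -> X))%type.

Definition dfun_zero : dfun := (fun _ => X_zero, fun _ _ => X_zero).

Definition reg (env : list dfun) (i : nat) : dfun := nth i env dfun_zero.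

(** [IInv] inverts the constant coefficient only: it is applied to constants. *)
Definition step (env : list dfun) (o : instr) : dfun :=
  match o with
  | ICst n d => (fun _ => X_const (IZR n / IZR (Zpos d)), fun _ _ => X_zero)
  | IVar => (fun _ => X_var, fun _ _ => X_zero)
  | IAdd i j =>
      let (v, dv) := reg env i in let (w, dw) := reg env j in
      (fun p => X_plus (v p) (w p), fun p h => X_plus (dv p h) (dw p h))
  | ISub i j =>
      let (v, dv) := reg env i in let (w, dw) := reg env j in
      (fun p => X_minus (v p) (w p), fun p h => X_minus (dv p h) (dw p h))
  | IMul i j =>
      let (v, dv) := reg env i in let (w, dw) := reg env j in
      (fun p => X_mul (v p) (w p),
       fun p h => X_plus (X_mul (dv p h) (w p)) (X_mul (v p) (dw p h)))
  | IInv i =>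
      let (v, dv) := reg env i in
      (fun p => X_const (/ (v p O)),
       fun p h => X_const (- (dv p h O * (/ (v p O) * / (v p O)))))
  | ICmp b i =>
      let (v, dv) := reg env i in
      (fun p => X_comp (pr b p) (v p),
       fun p h => X_plus (X_comp (pr b h) (v p)) (X_mul (X_dcomp (pr b p) (v p)) (dv p h)))
  end.

(** Results are appended, so in a run from the empty environment register [i] is the result of
    instruction [i]. *)
Fixpoint run (prog : list instr) (env : list dfun) : list dfun :=
  match prog with
  | nil => env
  | o :: prog => run prog (env ++ step env o :: nil)
  end.

Lemma pr_plus b (p q : Y) : pr b (plus p q) = X_plus (pr b p) (pr b q).
Proof. destruct b; reflexivity. Qed.

Lemma pr_minus b (p q : Y) : pr b (minus p q) = X_minus (pr b p) (pr b q).
Proof. destruct b; reflexivity. Qed.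

Lemma pr_scal b (c : R) (p : Y) : pr b (scal c p) = X_scal c (pr b p).
Proof. destruct b; reflexivity. Qed.

Lemma pr_norm b (p : Y) : X_norm (pr b p) <= Y_norm p.
Proof.
  unfold Y_norm. generalize (X_norm_pos (fst p)) (X_norm_pos (snd p)).
  destruct b; simpl; lra.
Qed.

Lemma Y_norm_pos (p : Y) : 0 <= Y_norm p.
Proof. generalize (X_norm_pos (pr true p)) (pr_norm true p). lra. Qed.

Definition low_zero (K : nat) (h : Y) : Prop :=
  forall b k, (k < K)%nat -> pr b h k = 0.

Lemma low_zero_mono (K L : nat) (h : Y) : (K <= L)%nat -> low_zero L h -> low_zero K h.
Proof. intros HK H b k Hk. apply H. lia. Qed.

Section Smooth.
Local Arguments pow : simpl never.
Variable B : Y -> Prop.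
Variable MB : R.
Hypothesis HMB : forall p b, B p -> X_norm (pr b p) <= MB.

(** One constant, uniform on [B], for value, derivative, increment and quadratic remainder: in this
    form the property is stable under all instructions, and the remainder is what the mean value
    inequality consumes. *)
Definition smooth_bound (M : R) (f : dfun) : Prop :=
  0 <= M /\
  forall p, B p -> X_norm (fst f p) <= M /\
    (forall h, X_norm (snd f p h) <= M * Y_norm h) /\
    (forall p', B p' ->
       X_norm (X_minus (fst f p') (fst f p)) <= M * Y_norm (minus p' p) /\
       X_norm (X_minus (X_minus (fst f p') (fst f p)) (snd f p (minus p' p)))
         <= M * Y_norm (minus p' p) ^ 2).

(** The last field says that the derivative is small on perturbations of high degree; it is carried
    through the program to make the derivative of [T] compact. *)
Record smooth (f : dfun) : Prop := {
  smooth_plus : forall p h k, B p -> snd f p (plus h k) = X_plus (snd f p h) (snd f p k);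
  smooth_scal : forall p c h, B p -> snd f p (scal c h) = X_scal c (snd f p h);
  smooth_quadratic : exists M, smooth_bound M f;
  smooth_tail : forall p eps, B p -> 0 < eps ->
    exists K, forall h, low_zero K h -> X_norm (snd f p h) <= eps * Y_norm h
}.

Lemma smooth_constant (c : X) : smooth (fun _ => c, fun _ _ => X_zero).
Proof.
  constructor; cbn [fst snd].
  - intros. ring.
  - intros. rewrite X_scal_mul. ring.
  - exists (X_norm c). split; [apply X_norm_pos|]. intros p _. cbn [fst snd]. split; [lra|].
    assert (H : forall h, 0 <= X_norm c * Y_norm h).
    { intros. apply Rmult_le_pos; [apply X_norm_pos|apply Y_norm_pos]. }
    split; [intros h; rewrite X_norm_zero; apply H|]. intros p' _.
    replace (X_minus (X_minus c c) X_zero) with X_zero by ring.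
    replace (X_minus c c) with X_zero by ring. rewrite X_norm_zero. split; [apply H|].
    apply Rmult_le_pos; [apply X_norm_pos|]. apply pow_le, Y_norm_pos.
  - intros p eps _ He. exists O. intros h _. rewrite X_norm_zero.
    apply Rmult_le_pos; [lra|apply Y_norm_pos].
Qed.

Lemma smooth_zero : smooth dfun_zero.
Proof. apply smooth_constant. Qed.

Lemma smooth_add (v w : Y -> X) (dv dw : Y -> Y -> X) :
  smooth (v, dv) -> smooth (w, dw) ->
  smooth (fun p => X_plus (v p) (w p), fun p h => X_plus (dv p h) (dw p h)).
Proof.
  intros [P1 S1 [M1 [N1 Q1]] T1] [P2 S2 [M2 [N2 Q2]] T2]. cbn [fst snd] in *.
  constructor; cbn [fst snd].
  - intros. rewrite P1, P2 by assumption. ring.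
  - intros. rewrite S1, S2 by assumption. rewrite !X_scal_mul. ring.
  - exists (M1 + M2). split; [lra|]. intros p Hp. cbn [fst snd].
    destruct (Q1 p Hp) as (A1 & B1 & C1), (Q2 p Hp) as (A2 & B2 & C2).
    split; [|split].
    + eapply Rle_trans; [apply X_norm_triangle|]. lra.
    + intros h. eapply Rle_trans; [apply X_norm_triangle|].
      specialize (B1 h). specialize (B2 h). lra.
    + intros p' Hp'. destruct (C1 p' Hp') as [D1 E1], (C2 p' Hp') as [D2 E2]. split.
      * replace (X_minus _ _) with (X_plus (X_minus (v p') (v p)) (X_minus (w p') (w p))) by ring.
        eapply Rle_trans; [apply X_norm_triangle|]. lra.
      * replace (X_minus _ _)
          with (X_plus (X_minus (X_minus (v p') (v p)) (dv p (minus p' p)))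
                       (X_minus (X_minus (w p') (w p)) (dw p (minus p' p)))) by ring.
        eapply Rle_trans; [apply X_norm_triangle|]. lra.
  - intros p eps Hp He.
    destruct (T1 p (eps / 2) Hp ltac:(lra)) as [K1 H1].
    destruct (T2 p (eps / 2) Hp ltac:(lra)) as [K2 H2].
    exists (max K1 K2). intros h Hh. eapply Rle_trans; [apply X_norm_triangle|].
    specialize (H1 h (low_zero_mono _ _ _ (Nat.le_max_l _ _) Hh)).
    specialize (H2 h (low_zero_mono _ _ _ (Nat.le_max_r _ _) Hh)). lra.
Qed.

Lemma smooth_mul (v w : Y -> X) (dv dw : Y -> Y -> X) :
  smooth (v, dv) -> smooth (w, dw) ->
  smooth (fun p => X_mul (v p) (w p),
          fun p h => X_plus (X_mul (dv p h) (w p)) (X_mul (v p) (dw p h))).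
Proof.
  intros [P1 S1 [M1 [N1 Q1]] T1] [P2 S2 [M2 [N2 Q2]] T2]. cbn [fst snd] in *.
  assert (N12 : 0 <= M1 * M2) by (apply Rmult_le_pos; assumption).
  assert (Hm : forall x y a b, X_norm x <= a -> X_norm y <= b -> X_norm (X_mul x y) <= a * b).
  { intros x y a b Ha Hb. eapply Rle_trans; [apply X_norm_mul|].
    apply Rmult_le_compat; auto using X_norm_pos. }
  constructor; cbn [fst snd].
  - intros. rewrite P1, P2 by assumption. ring.
  - intros. rewrite S1, S2 by assumption. rewrite !X_scal_mul. ring.
  (* The remainder of a product has three parts: the remainder of either factor times the other, and
     the product of the increments. *)
  - exists (3 * (M1 * M2)). split; [lra|]. intros p Hp. cbn [fst snd].
    destruct (Q1 p Hp) as (A1 & B1 & C1), (Q2 p Hp) as (A2 & B2 & C2).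
    split; [|split].
    + generalize (Hm _ _ _ _ A1 A2). lra.
    + intros h. eapply Rle_trans; [apply X_norm_triangle|].
      assert (H1 := Hm _ _ _ _ (B1 h) A2). assert (H2 := Hm _ _ _ _ A1 (B2 h)).
      assert (0 <= M1 * M2 * Y_norm h) by (apply Rmult_le_pos; [lra|apply Y_norm_pos]).
      nra.
    + intros p' Hp'. destruct (C1 p' Hp') as [D1 E1], (C2 p' Hp') as [D2 E2].
      destruct (Q2 p' Hp') as (A2' & _).
      set (n := Y_norm (minus p' p)) in *. assert (Hn : 0 <= n) by apply Y_norm_pos. split.
      * replace (X_minus _ _) with
          (X_plus (X_mul (X_minus (v p') (v p)) (w p')) (X_mul (v p) (X_minus (w p') (w p)))) by ring.
        eapply Rle_trans; [apply X_norm_triangle|].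
        assert (H1 := Hm _ _ _ _ D1 A2'). assert (H2 := Hm _ _ _ _ A1 D2).
        assert (0 <= M1 * M2 * n) by (apply Rmult_le_pos; lra). nra.
      * replace (X_minus _ _)
          with (X_plus (X_plus
             (X_mul (X_minus (X_minus (v p') (v p)) (dv p (minus p' p))) (w p))
             (X_mul (v p) (X_minus (X_minus (w p') (w p)) (dw p (minus p' p)))))
             (X_mul (X_minus (v p') (v p)) (X_minus (w p') (w p)))) by ring.
        eapply Rle_trans; [apply X_norm_triangle|].
        eapply Rle_trans; [apply Rplus_le_compat_r, X_norm_triangle|].
        assert (H1 := Hm _ _ _ _ E1 A2). assert (H2 := Hm _ _ _ _ A1 E2).
        assert (H3 := Hm _ _ _ _ D1 D2). nra.
  - intros p eps Hp He. destruct (Q1 p Hp) as (A1 & _), (Q2 p Hp) as (A2 & _).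
    destruct (T1 p (eps / (2 * (M2 + 1))) Hp) as [K1 H1];
      [apply Rdiv_lt_0_compat; lra|].
    destruct (T2 p (eps / (2 * (M1 + 1))) Hp) as [K2 H2];
      [apply Rdiv_lt_0_compat; lra|].
    exists (max K1 K2). intros h Hh. eapply Rle_trans; [apply X_norm_triangle|].
    specialize (H1 h (low_zero_mono _ _ _ (Nat.le_max_l _ _) Hh)).
    specialize (H2 h (low_zero_mono _ _ _ (Nat.le_max_r _ _) Hh)).
    assert (U1 := Hm _ (w p) _ (M2 + 1) H1 ltac:(lra)).
    assert (U2 := Hm (v p) _ (M1 + 1) _ ltac:(lra) H2).
    replace (eps * Y_norm h) with
      (eps / (2 * (M2 + 1)) * Y_norm h * (M2 + 1) + (M1 + 1) * (eps / (2 * (M1 + 1)) * Y_norm h))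
      by (field; lra). lra.
Qed.

(** Addition of the product with the constant -1; the two pairs of functions are identified
    extensionally. *)
Lemma smooth_sub (v w : Y -> X) (dv dw : Y -> Y -> X) :
  smooth (v, dv) -> smooth (w, dw) ->
  smooth (fun p => X_minus (v p) (w p), fun p h => X_minus (dv p h) (dw p h)).
Proof.
  intros Hv Hw.
  assert (H := smooth_add _ _ _ _ Hv
     (smooth_mul _ _ _ _ (smooth_constant (X_const (-1))) Hw)).
  assert (E : forall x y, X_plus x (X_mul (X_const (-1)) y) = X_minus x y).
  { intros x y. rewrite X_const_mul. reflexivity. }
  assert (E' : forall x y z, X_plus x (X_plus (X_mul X_zero z) (X_mul (X_const (-1)) y)) = X_minus x y).
  { intros x y z. rewrite <- E. ring. }
  match type of H with smooth ?a => match goal with |- smooth ?b =>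
    assert (Q : a = b); [|rewrite <- Q; exact H] end end.
  f_equal; apply functional_extensionality; intros p; [now rewrite E|].
  apply functional_extensionality; intros h. now rewrite E'.
Qed.

(** Outer and inner function vary together with [p]. A uniform [th < 1] keeps the inner function
    inside a smaller ball, where the derivative costs at most [1 / (1 - th)]. *)
Lemma smooth_comp (b : bool) (v : Y -> X) (dv : Y -> Y -> X) (th : R) :
  th < 1 -> (forall p, B p -> X_norm (v p) <= th) -> smooth (v, dv) ->
  smooth (fun p => X_comp (pr b p) (v p),
          fun p h => X_plus (X_comp (pr b h) (v p)) (X_mul (X_dcomp (pr b p) (v p)) (dv p h))).
Proof.
  intros Hth Hv [P1 S1 [M [N1 Q1]] T1]. cbn [fst snd] in *.
  set (i := / (1 - th)).
  assert (Hi : 0 < i) by (apply Rinv_0_lt_compat; lra).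
  constructor; cbn [fst snd].
  - intros p h k Hp. rewrite P1, pr_plus, comp_plus by (auto; specialize (Hv p Hp); lra). ring.
  - intros p c h Hp. rewrite S1, pr_scal, comp_scal by (auto; specialize (Hv p Hp); lra).
    rewrite !X_scal_mul. ring.
  (* In order: the value, the variation of the outer function, the chain rule term, the mixed term
     and the Taylor remainder. *)
  - exists (Rabs MB + 1 + Rabs MB * i * M + M * i + Rabs MB * (M ^ 2 * i ^ 2)).
    assert (Z1 := Rabs_pos MB).
    assert (Z2 : 0 <= Rabs MB * i * M)
      by (apply Rmult_le_pos; [apply Rmult_le_pos; lra|assumption]).
    assert (Z3 : 0 <= M * i) by (apply Rmult_le_pos; lra).
    assert (Z4 : 0 <= Rabs MB * (M ^ 2 * i ^ 2))
      by (apply Rmult_le_pos; [lra|apply Rmult_le_pos; apply pow2_ge_0]).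
    split; [lra|]. intros p Hp. cbn [fst snd].
    destruct (Q1 p Hp) as (A & D & C).
    assert (Hq := Hv p Hp). set (q := v p) in *.
    assert (HF : X_norm (pr b p) <= Rabs MB)
      by (eapply Rle_trans; [apply HMB, Hp|apply Rle_abs]).
    assert (Hd : X_norm (X_dcomp (pr b p) q) <= Rabs MB * i).
    { eapply Rle_trans; [apply (X_norm_dcomp _ _ th); lra|].
      apply Rmult_le_compat_r; [left; exact Hi|exact HF]. }
    split; [|split].
    + eapply Rle_trans; [apply X_norm_comp; lra|]. lra.
    + intros h. assert (Hn := Y_norm_pos h).
      eapply Rle_trans; [apply X_norm_triangle|].
      assert (U1 : X_norm (X_comp (pr b h) q) <= Y_norm h).
      { eapply Rle_trans; [apply X_norm_comp; lra|apply pr_norm]. }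
      assert (U2 : X_norm (X_mul (X_dcomp (pr b p) q) (dv p h)) <= Rabs MB * i * (M * Y_norm h)).
      { eapply Rle_trans; [apply X_norm_mul|].
        apply Rmult_le_compat; auto using X_norm_pos. }
      assert (0 <= (Rabs MB + M * i + Rabs MB * (M ^ 2 * i ^ 2)) * Y_norm h)
        by (apply Rmult_le_pos; lra).
      lra.
    + intros p' Hp'. destruct (C p' Hp') as [E1 E2].
      assert (Hq' := Hv p' Hp'). set (q' := v p') in *.
      set (n := Y_norm (minus p' p)) in *. assert (Hn : 0 <= n) by apply Y_norm_pos.
      set (df := X_minus (pr b p') (pr b p)).
      assert (Hdf : X_norm df <= n).
      { unfold df. rewrite <- pr_minus. apply pr_norm. }
      assert (Hk := X_norm_pos (X_minus q' q)).
      assert (L1 : X_norm (X_minus (X_comp (pr b p) q') (X_comp (pr b p) q)) <= Rabs MB * (M * n * i)).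
      { eapply Rle_trans; [apply (comp_lipschitz _ _ _ th); lra|].
        apply Rmult_le_compat; auto using X_norm_pos; [|].
        - apply Rmult_le_pos; [exact Hk|left; exact Hi].
        - apply Rmult_le_compat_r; [left; exact Hi|exact E1]. }
      split.
      * replace (X_minus (X_comp (pr b p') q') (X_comp (pr b p) q))
          with (X_plus (X_comp df q') (X_minus (X_comp (pr b p) q') (X_comp (pr b p) q))).
        2:{ unfold df. rewrite comp_minus by lra. ring. }
        eapply Rle_trans; [apply X_norm_triangle|].
        assert (U1 : X_norm (X_comp df q') <= n).
        { eapply Rle_trans; [apply X_norm_comp; lra|exact Hdf]. }
        assert (0 <= (Rabs MB + M * i + Rabs MB * (M ^ 2 * i ^ 2)) * n)
          by (apply Rmult_le_pos; lra).
        lra.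
      * rewrite pr_minus. fold df.
        (* Change of the outer increment between [q] and [q'], Taylor remainder of the fixed outer
           function, and its derivative applied to the remainder of [v]. *)
        replace (X_minus _ _) with
          (X_plus (X_plus (X_minus (X_comp df q') (X_comp df q))
             (X_minus (X_minus (X_comp (pr b p) q') (X_comp (pr b p) q))
                 (X_mul (X_dcomp (pr b p) q) (X_minus q' q))))
             (X_mul (X_dcomp (pr b p) q) (X_minus (X_minus q' q) (dv p (minus p' p))))).
        2:{ unfold df. rewrite !comp_minus by lra. ring. }
        eapply Rle_trans; [apply X_norm_triangle|].
        eapply Rle_trans; [apply Rplus_le_compat_r, X_norm_triangle|].
        assert (U1 : X_norm (X_minus (X_comp df q') (X_comp df q)) <= n * (M * n * i)).
        { eapply Rle_trans; [apply (comp_lipschitz _ _ _ th); lra|].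
          apply Rmult_le_compat; auto using X_norm_pos; [|].
          - apply Rmult_le_pos; [exact Hk|left; exact Hi].
          - apply Rmult_le_compat_r; [left; exact Hi|exact E1]. }
        assert (U2 : X_norm (X_minus (X_minus (X_comp (pr b p) q') (X_comp (pr b p) q))
                 (X_mul (X_dcomp (pr b p) q) (X_minus q' q))) <= Rabs MB * ((M * n) ^ 2 * i ^ 2)).
        { eapply Rle_trans; [apply (comp_taylor _ _ _ th); lra|].
          replace (/ (1 - th) ^ 2) with (i ^ 2) by (unfold i; field; lra).
          apply Rmult_le_compat; auto using X_norm_pos; [|].
          - apply Rmult_le_pos; apply pow2_ge_0.
          - apply Rmult_le_compat_r; [apply pow2_ge_0|]. apply pow_incr. lra. }
        assert (U3 : X_norm (X_mul (X_dcomp (pr b p) q)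
              (X_minus (X_minus q' q) (dv p (minus p' p)))) <= Rabs MB * i * (M * n ^ 2)).
        { eapply Rle_trans; [apply X_norm_mul|].
          apply Rmult_le_compat; auto using X_norm_pos. }
        assert (0 <= (Rabs MB + 1) * n ^ 2)
          by (apply Rmult_le_pos; [lra|apply pow2_ge_0]).
        replace (Rabs MB * ((M * n) ^ 2 * i ^ 2))
          with (Rabs MB * (M ^ 2 * i ^ 2) * n ^ 2) in U2 by ring.
        lra.
  - intros p eps Hp He. assert (Hq := Hv p Hp). set (q := v p) in *.
    assert (Hq0 := X_norm_pos q).
    set (D := X_norm (X_dcomp (pr b p) q)). assert (HD : 0 <= D) by apply X_norm_pos.
    destruct (T1 p (eps / (2 * (D + 1))) Hp) as [K1 H1]; [apply Rdiv_lt_0_compat; lra|].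
    (* Two sources of smallness: the tail property of [v], and the decay of [q^K] for the directly
       composed perturbation. *)
    destruct (pow_lt_1_zero (X_norm q)) with (y := eps / 2) as [K2 H2];
      [rewrite Rabs_pos_eq; lra|lra|].
    exists (max K1 K2). intros h Hh. assert (Hn := Y_norm_pos h).
    eapply Rle_trans; [apply X_norm_triangle|].
    specialize (H1 h (low_zero_mono _ _ _ (Nat.le_max_l _ _) Hh)).
    assert (U1 : X_norm (X_comp (pr b h) q) <= Y_norm h * (eps / 2)).
    { eapply Rle_trans; [apply (comp_tail_small K2); [lra|]|].
      - intros k Hk. apply Hh. lia.
      - apply Rmult_le_compat; auto using X_norm_pos, pr_norm.
        eapply Rle_trans; [apply X_norm_pow|]. left.
        eapply Rle_lt_trans; [apply Rle_abs|]. apply H2. lia. }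
    assert (U2 : X_norm (X_mul (X_dcomp (pr b p) q) (dv p h)) <=
              (D + 1) * (eps / (2 * (D + 1)) * Y_norm h)).
    { eapply Rle_trans; [apply X_norm_mul|].
      apply Rmult_le_compat; auto using X_norm_pos. fold D. lra. }
    replace ((D + 1) * (eps / (2 * (D + 1)) * Y_norm h)) with (Y_norm h * (eps / 2)) in U2
      by (field; lra).
    lra.
Qed.

Lemma smooth_inv (v : Y -> X) (dv : Y -> Y -> X) (m : R) :
  0 < m -> (forall p, B p -> m <= Rabs (v p O)) -> smooth (v, dv) ->
  smooth (fun p => X_const (/ v p O),
          fun p h => X_const (- (dv p h O * (/ v p O * / v p O)))).
Proof.
  intros Hm Hv [P1 S1 [M [N1 Q1]] T1]. cbn [fst snd] in *.
  set (i := / m). assert (Hi : 0 < i) by (apply Rinv_0_lt_compat, Hm).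
  assert (Hnz : forall p, B p -> v p O <> 0).
  { intros p Hp E. specialize (Hv p Hp). rewrite E, Rabs_R0 in Hv. lra. }
  assert (Hinv : forall p, B p -> Rabs (/ v p O) <= i).
  { intros p Hp. rewrite Rabs_inv. apply Rinv_le_contravar; auto. }
  assert (Hmul : forall x y a b, Rabs x <= a -> Rabs y <= b -> Rabs (x * y) <= a * b).
  { intros. rewrite Rabs_mult. apply Rmult_le_compat; auto using Rabs_pos. }
  constructor; cbn [fst snd].
  - intros p h k Hp. rewrite P1 by exact Hp. cbn [X_plus X_scal coef]. rewrite <- X_const_plus. f_equal. ring.
  - intros p c h Hp. rewrite S1 by exact Hp. cbn [X_plus X_scal coef]. rewrite X_scal_mul, <- X_const_times.
    f_equal. ring.
  - assert (Z : 0 <= M * (i * i)) by (apply Rmult_le_pos; [|apply Rmult_le_pos]; lra).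
    assert (Z' : 0 <= M * M * (i * i * i)).
    { apply Rmult_le_pos; apply Rmult_le_pos; try lra. apply Rmult_le_pos; lra. }
    exists (i + M * (i * i) + M * M * (i * i * i)).
    split; [lra|]. intros p Hp. cbn [fst snd]. destruct (Q1 p Hp) as (A & D & C).
    assert (I := Hinv p Hp). assert (I2 := Hmul _ _ _ _ I I).
    split; [|split].
    + rewrite X_norm_const. lra.
    + intros h. rewrite X_norm_const, Rabs_Ropp.
      assert (U := Hmul _ _ _ _ (Rle_trans _ _ _ (coef_le_norm (dv p h) 0) (D h)) I2).
      assert (0 <= (i + M * M * (i * i * i)) * Y_norm h)
        by (apply Rmult_le_pos; [lra|apply Y_norm_pos]).
      lra.
    + intros p' Hp'. destruct (C p' Hp') as [E1 E2].
      assert (I' := Hinv p' Hp').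
      assert (F1 := Rle_trans _ _ _ (coef_le_norm _ 0) E1).
      assert (F2 := Rle_trans _ _ _ (coef_le_norm _ 0) E2).
      set (n := Y_norm (minus p' p)) in *. assert (Hn : 0 <= n) by apply Y_norm_pos.
      assert (x1 := Hnz p Hp). assert (x2 := Hnz p' Hp').
      cbn [X_minus X_plus X_opp X_scal coef] in F1, F2. set (x := v p O) in *. set (x' := v p' O) in *.
      set (y := dv p (minus p' p) O) in *. split.
      * unfold X_minus. rewrite <- X_const_opp, <- X_const_plus, X_norm_const.
        replace (/ x' + - / x) with (- ((x' + -1 * x) * (/ x * / x'))) by (field; auto).
        rewrite Rabs_Ropp.
        assert (U := Hmul _ _ _ _ F1 (Hmul _ _ _ _ I I')).
        assert (0 <= (i + M * M * (i * i * i)) * n) by (apply Rmult_le_pos; lra). lra.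
      * unfold X_minus. rewrite <- !X_const_opp, <- !X_const_plus, X_norm_const.
        (* With increment [d = x' - x] and linear part [y], the remainder of the inverse is
           [d^2 / (x^2 x') - (d - y) / x^2]. *)
        replace (/ x' + - / x + - - (y * (/ x * / x)))
          with ((x' + -1 * x) * (x' + -1 * x) * (/ x * / x * / x')
                + - ((x' + -1 * x + -1 * y) * (/ x * / x))) by (field; auto).
        eapply Rle_trans; [apply Rabs_triang|]. rewrite Rabs_Ropp.
        assert (U := Hmul _ _ _ _ F2 I2).
        assert (W := Hmul _ _ _ _ (Hmul _ _ _ _ F1 F1) (Hmul _ _ _ _ I2 I')).
        assert (0 <= i * n ^ 2) by (apply Rmult_le_pos; [lra|apply pow2_ge_0]).
        lra.
  - intros p eps Hp He. destruct (T1 p (eps / (i * i)) Hp) as [K H].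
    { apply Rdiv_lt_0_compat; [lra|]. apply Rmult_lt_0_compat; lra. }
    exists K. intros h Hh. specialize (H h Hh).
    rewrite X_norm_const, Rabs_Ropp.
    assert (I := Hinv p Hp). assert (I2 := Hmul _ _ _ _ I I).
    assert (U := Hmul _ _ _ _ (Rle_trans _ _ _ (coef_le_norm (dv p h) 0) H) I2).
    replace (eps / (i * i) * Y_norm h * (i * i)) with (eps * Y_norm h) in U by (field; lra).
    exact U.
Qed.

End Smooth.

(** * Ball arithmetic *)

Lemma dcomp_shift (f q : X) : X_norm q < 1 ->
  X_dcomp (X_shift f) q = X_plus (X_comp f q) (X_mul q (X_dcomp f q)).
Proof.
  intros H.
  assert (E1 := comp_ex f q ltac:(lra)).
  destruct (X_sum_mul q _ (dcomp_ex f q H)) as [E E2].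
  unfold X_dcomp at 1. rewrite X_sum_shift by (apply (dcomp_ex (X_shift f)), H).
  unfold X_comp, X_dcomp. rewrite E, X_sum_plus by assumption.
  rewrite X_shift_coef, Rmult_0_r, X_const_0.
  match goal with |- X_plus ?a ?b = ?c => transitivity b; [ring|] end.
  apply X_sum_ext. intros [|k]; cbn [pred X_pow]; rewrite X_shift_coef.
  - simpl INR. rewrite Rmult_0_l, X_const_0, Rmult_1_l. ring.
  - rewrite (S_INR (S k)), Rmult_plus_distr_r, X_const_plus, Rmult_1_l. ring.
Qed.

Lemma dcomp_const (c : R) (q : X) : X_norm q < 1 -> X_dcomp (X_const c) q = X_zero.
Proof.
  intros H. unfold X_dcomp. rewrite (X_sum_ext _ (fun _ => X_zero)).
  - apply X_ext. intros n. rewrite X_sum_coef.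
    + simpl. rewrite (Series_ext _ (fun _ => 0 * 0)) by (intros; ring).
      rewrite Series_scal_l. ring.
    + apply ex_series_ext with (fun _ => Rabs 0); [|apply X_zero_summable].
      intros _. now rewrite X_norm_zero, Rabs_R0.
  - intros [|k]; rewrite X_const_coef; simpl INR;
      rewrite ?Rmult_0_l, ?Rmult_0_r, X_const_0; ring.
Qed.

Lemma dcomp_plus (f g q : X) : X_norm q < 1 ->
  X_dcomp (X_plus f g) q = X_plus (X_dcomp f q) (X_dcomp g q).
Proof.
  intros H. unfold X_dcomp. rewrite X_sum_plus by (apply dcomp_ex, H).
  apply X_sum_ext. intros k. simpl X_plus at 1.
  change (X_plus f g k) with (f k + g k).
  rewrite Rmult_plus_distr_l, X_const_plus. ring.
Qed.

(** * Integer polynomials in units of [u] *)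

Fixpoint polu (u : R) (P : list Z) : X :=
  match P with
  | nil => X_zero
  | a :: P => X_plus (X_const (IZR a * u)) (X_mul X_var (polu u P))
  end.

Fixpoint l1 (P : list Z) : Z :=
  match P with nil => 0 | a :: P => Z.abs a + l1 P end%Z.

Fixpoint padd (P Q : list Z) : list Z :=
  match P, Q with
  | nil, _ => Q
  | _, nil => P
  | a :: P', b :: Q' => (a + b)%Z :: padd P' Q'
  end.

Fixpoint conv (P Q : list Z) : list Z :=
  match P with
  | nil => nil
  | a :: P' => padd (map (Z.mul a) Q) (0%Z :: conv P' Q)
  end.

(** Leibniz rule for [a + z P], which needs no degree counter and matches [dcomp_shift]. *)
Fixpoint pderiv (P : list Z) : list Z :=
  match P with
  | nil => nil
  | a :: P' => padd P' (0%Z :: pderiv P')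
  end.

Lemma polu_padd u (P : list Z) : forall Q,
  polu u (padd P Q) = X_plus (polu u P) (polu u Q).
Proof.
  induction P as [|a P IH]; intros [|b Q]; simpl; try ring.
  rewrite IH, plus_IZR, Rmult_plus_distr_r, X_const_plus. ring.
Qed.

Lemma polu_scale u v c (P : list Z) :
  polu (u * v) (map (Z.mul c) P) = X_mul (X_const (IZR c * u)) (polu v P).
Proof.
  induction P as [|a P IH]; simpl; [ring|].
  rewrite IH, mult_IZR.
  replace (IZR c * IZR a * (u * v)) with ((IZR c * u) * (IZR a * v)) by ring.
  rewrite X_const_times. ring.
Qed.

Lemma polu_conv u v (P Q : list Z) :
  polu (u * v) (conv P Q) = X_mul (polu u P) (polu v Q).
Proof.
  induction P as [|a P IH]; simpl; [ring|].
  rewrite polu_padd, polu_scale. simpl. rewrite IH, Rmult_0_l, X_const_0. ring.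
Qed.

Lemma polu_opp u (P : list Z) : polu u (map Z.opp P) = X_opp (polu u P).
Proof.
  induction P as [|a P IH]; simpl; [ring|].
  rewrite IH, opp_IZR, <- Ropp_mult_distr_l, X_const_opp. ring.
Qed.

Lemma polu_app u (P Q : list Z) :
  polu u (P ++ Q) = X_plus (polu u P) (X_mul (X_pow X_var (length P)) (polu u Q)).
Proof. induction P as [|a P IH]; simpl; [ring|]. rewrite IH. ring. Qed.

Lemma X_norm_var_mul (x : X) : X_norm (X_mul X_var x) <= X_norm x.
Proof.
  eapply Rle_trans; [apply X_norm_mul|].
  generalize X_norm_var (X_norm_pos x) (X_norm_pos X_var). nra.
Qed.

Lemma X_norm_polu u (P : list Z) : 0 <= u -> X_norm (polu u P) <= IZR (l1 P) * u.
Proof.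
  intros Hu. induction P as [|a P IH]; simpl.
  - rewrite X_norm_zero. lra.
  - eapply Rle_trans; [apply X_norm_triangle|].
    rewrite X_norm_const, Rabs_mult, (Rabs_pos_eq u Hu), <- abs_IZR, plus_IZR.
    generalize (X_norm_var_mul (polu u P)). lra.
Qed.

Lemma polu_coef_0 u (P : list Z) : polu u P O = IZR (hd 0%Z P) * u.
Proof.
  destruct P as [|a P]; simpl; [ring|].
  rewrite X_const_coef, X_shift_mul, X_shift_coef. ring.
Qed.

Lemma comp_polu_cons u a (P : list Z) (q : X) : X_norm q <= 1 ->
  X_comp (polu u (a :: P)) q = X_plus (X_const (IZR a * u)) (X_mul q (X_comp (polu u P) q)).
Proof. intros H. simpl. now rewrite comp_plus, X_shift_mul, comp_const, comp_shift. Qed.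

Lemma dcomp_polu u (P : list Z) (q : X) : X_norm q < 1 ->
  X_dcomp (polu u P) q = X_comp (polu u (pderiv P)) q.
Proof.
  intros H. induction P as [|a P IH].
  - simpl. rewrite comp_zero by lra. rewrite <- X_const_0, dcomp_const by exact H.
    symmetry; apply X_const_0.
  - simpl pderiv. simpl polu at 1.
    rewrite dcomp_plus, dcomp_const, X_shift_mul, dcomp_shift, IH by assumption.
    rewrite polu_padd, comp_plus, comp_polu_cons by lra.
    rewrite Rmult_0_l, X_const_0. ring.
Qed.

Definition ball_t : Type := (list Z * Z)%type.

Definition enc (u : R) (b : ball_t) (x : X) : Prop :=
  X_norm (X_minus x (polu u (fst b))) <= IZR (snd b) * u.

Definition badd (a b : ball_t) : ball_t := (padd (fst a) (fst b), snd a + snd b)%Z.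
Definition bopp (a : ball_t) : ball_t := (map Z.opp (fst a), snd a).
Definition bsub (a b : ball_t) : ball_t := badd a (bopp b).
Definition tot (b : ball_t) : Z := (l1 (fst b) + snd b)%Z.

Lemma enc_badd u a b x y : enc u a x -> enc u b y -> enc u (badd a b) (X_plus x y).
Proof.
  unfold enc; simpl. intros Ha Hb. rewrite polu_padd, plus_IZR.
  replace (X_minus _ _)
    with (X_plus (X_minus x (polu u (fst a))) (X_minus y (polu u (fst b)))) by ring.
  eapply Rle_trans; [apply X_norm_triangle|]. lra.
Qed.

Lemma enc_bopp u a x : enc u a x -> enc u (bopp a) (X_opp x).
Proof.
  unfold enc; simpl. intros H. rewrite polu_opp.
  replace (X_minus _ _) with (X_opp (X_minus x (polu u (fst a)))) by ring.
  now rewrite X_norm_opp.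
Qed.

Lemma enc_bsub u a b x y : enc u a x -> enc u b y -> enc u (bsub a b) (X_minus x y).
Proof. intros Ha Hb. apply enc_badd; [exact Ha|]. now apply enc_bopp. Qed.

Lemma enc_tot u b x : 0 <= u -> enc u b x -> X_norm x <= IZR (tot b) * u.
Proof.
  unfold enc, tot. intros Hu H. rewrite plus_IZR.
  generalize (X_norm_le_minus x (polu u (fst b))) (X_norm_polu u (fst b) Hu). lra.
Qed.

Lemma enc_zero u : enc u (nil, 0%Z) X_zero.
Proof.
  unfold enc; simpl. replace (X_minus X_zero X_zero) with X_zero by ring.
  rewrite X_norm_zero. lra.
Qed.

Section Precision.
Variable prec : Z.
Variable K : nat.

Definition zone : Z := Z.shiftl 1 prec.

(** From the scale [u^2] back to the scale [u], keeping [K] coefficients. *)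
Definition rnd (P : list Z) (e : Z) : ball_t :=
  (map (fun a => Z.shiftr a prec) (firstn K P),
   Z.shiftr (e + l1 (skipn K P)) prec + 1 + Z.of_nat K)%Z.

Definition bmul (a b : ball_t) : ball_t :=
  rnd (conv (fst a) (fst b))
      (l1 (fst a) * snd b + l1 (fst b) * snd a + snd a * snd b)%Z.

Definition bcst (n : Z) (d : positive) : ball_t := ((n * zone / Zpos d)%Z :: nil, 1%Z).

(** [m] bounds [|x|] from below for every [x] in the ball; the radius is the residual [|1 - x y|]
    divided by [m], rounded up. *)
Definition binv (b : ball_t) : option ball_t :=
  let c := hd 0%Z (fst b) in
  let m := (Z.abs c - snd b)%Z in
  let y := (zone * zone / c)%Z in
  if Z.ltb 0 m
  then Some (y :: nil, (Z.abs (zone * zone - c * y) + snd b * Z.abs y) / m + 1)%Z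
  else None.

Fixpoint powers (n : nat) (q cur : ball_t) : list ball_t :=
  match n with
  | O => cur :: nil
  | S n => cur :: powers n q (bmul q cur)
  end.

(** Coefficients and powers both carry the unit [u], so the result is in units of [u^2]; it is
    rounded once, by the caller. *)
Fixpoint lincomb (cs : list Z) (pw : list ball_t) : list Z * Z :=
  match cs, pw with
  | c :: cs, b :: pw =>
      let (P, e) := lincomb cs pw in
      (padd (map (Z.mul c) (fst b)) P, Z.abs c * snd b + e)%Z
  | _, _ => (nil, 0%Z)
  end.

(** [tau] bounds a part of the composed function supported on degrees [>= K]. *)
Definition bcomp (F : ball_t) (pw : list ball_t) (tau : Z) : ball_t :=
  let (P, e) := lincomb (fst F) pw in
  let (P', e') := rnd P e in
  (P', e' + snd F +
       (if Z.eqb tau 0 then 0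
        else Z.shiftr (tau * tot (nth K pw (nil, 0))) prec + 1))%Z.

(** Differentiation is unbounded on [X]: the radius of [F] is amplified by [1 / (1 - |q|)]. *)
Definition bdcomp (F : ball_t) (pw : list ball_t) (q : ball_t) : ball_t :=
  let (P, e) := lincomb (pderiv (fst F)) pw in
  let (P', e') := rnd P e in
  (P', e' + (snd F * zone / (zone - tot q) + 1))%Z.

(** For a composition, the powers of the inner ball and the derivative of the outer one: computed
    once and shared by all tangent vectors. *)
Definition aux_t : Type := (list ball_t * ball_t)%type.

Definition breg (env : list ball_t) (i : nat) : ball_t := nth i env (nil, 0%Z).

Variables BF BG : ball_t.

Definition bsel (b : bool) : ball_t := if b then BF else BG.

(** Fails unless a composed ball lies in the open unit ball and an inverted constant is bounded away
    from 0; success thus proves the side conditions of the smoothness lemmas. *)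
Definition bstep (env : list ball_t) (o : instr) : option (ball_t * aux_t) :=
  let noaux := (nil, (nil, 0%Z)) in
  match o with
  | ICst n d => Some (bcst n d, noaux)
  | IVar => Some ((0%Z :: zone :: nil, 0%Z), noaux)
  | IAdd i j => Some (badd (breg env i) (breg env j), noaux)
  | ISub i j => Some (bsub (breg env i) (breg env j), noaux)
  | IMul i j => Some (bmul (breg env i) (breg env j), noaux)
  | IInv i => option_map (fun b => (b, noaux)) (binv (breg env i))
  | ICmp b i =>
      let q := breg env i in
      if Z.ltb (tot q) zone then
        let pw := powers K q (zone :: nil, 0%Z) in
        Some (bcomp (bsel b) pw 0, (pw, bdcomp (bsel b) pw q))
      else None
  end.

Fixpoint annotate (prog : list instr) (env : list ball_t) :
    option (list (instr * (ball_t * aux_t))) :=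
  match prog with
  | nil => Some nil
  | o :: prog =>
      match bstep env o with
      | Some r => option_map (cons (o, r)) (annotate prog (env ++ fst r :: nil))
      | None => None
      end
  end.

(** Forward differentiation on balls. The integer in [DF] and [DG] allows an arbitrary part of the
    direction in degrees [>= K]. *)
Definition tstep (DF DG : ball_t * Z) (env denv : list ball_t)
    (o : instr) (r : ball_t * aux_t) : ball_t :=
  match o with
  | ICst _ _ | IVar => (nil, 0%Z)
  | IAdd i j => badd (breg denv i) (breg denv j)
  | ISub i j => bsub (breg denv i) (breg denv j)
  | IMul i j => badd (bmul (breg denv i) (breg env j)) (bmul (breg env i) (breg denv j))
  | IInv i =>
      let h := breg denv i in
      (* Only the constant coefficient of the tangent enters, as [IInv] ignores the others. *)
      bopp (bmul (firstn 1 (fst h), snd h) (bmul (fst r) (fst r)))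
  | ICmp b i =>
      let D := if b then DF else DG in
      badd (bcomp (fst D) (fst (snd r)) (snd D)) (bmul (snd (snd r)) (breg denv i))
  end.

Fixpoint trun (DF DG : ball_t * Z) (ann : list (instr * (ball_t * aux_t)))
    (env denv : list ball_t) : list ball_t :=
  match ann with
  | nil => denv
  | (o, r) :: ann =>
      trun DF DG ann (env ++ fst r :: nil) (denv ++ tstep DF DG env denv o r :: nil)
  end.

Hypothesis Hprec : (0 <= prec)%Z.

Definition ulp : R := / IZR zone.

Lemma one_pos : (0 < zone)%Z.
Proof. unfold zone. rewrite Z.shiftl_1_l. apply Z.pow_pos_nonneg; lia. Qed.

Lemma IZR_one_pos : 0 < IZR zone.
Proof. apply IZR_lt, one_pos. Qed.

Lemma ulp_pos : 0 < ulp.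
Proof. apply Rinv_0_lt_compat, IZR_one_pos. Qed.

Lemma one_ulp : IZR zone * ulp = 1.
Proof. unfold ulp. apply Rinv_r. generalize IZR_one_pos; lra. Qed.

Lemma shiftr_bounds (v : R) (a : Z) : 0 <= v ->
  IZR (Z.shiftr a prec) * v <= IZR a * (v * ulp) <= (IZR (Z.shiftr a prec) + 1) * v.
Proof.
  intros Hv.
  rewrite Z.shiftr_div_pow2 by exact Hprec. rewrite <- Z.shiftl_1_l. fold zone.
  assert (Ho := one_pos).
  assert (H1 : (zone * (a / zone) <= a)%Z) by (apply Z.mul_div_le; lia).
  assert (H2 : (a < zone * (a / zone + 1))%Z).
  { replace (a / zone + 1)%Z with (Z.succ (a / zone)) by lia. apply Z.mul_succ_div_gt; lia. }
  apply IZR_le in H1. apply IZR_lt in H2. rewrite mult_IZR in H1, H2. rewrite plus_IZR in H2.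
  assert (U := ulp_pos). assert (E := one_ulp).
  set (d := IZR (a / zone)) in *.
  replace (d * v) with (IZR zone * d * (v * ulp)) by (rewrite <- (Rmult_1_l (d * v)), <- E; ring).
  replace ((d + 1) * v) with (IZR zone * (d + 1) * (v * ulp))
    by (rewrite <- (Rmult_1_l ((d + 1) * v)), <- E; ring).
  assert (0 <= v * ulp) by (apply Rmult_le_pos; lra).
  split; apply Rmult_le_compat_r; lra.
Qed.

(** Rounding down loses at most one unit per coefficient. *)
Lemma polu_shiftr (v : R) (P : list Z) : 0 <= v ->
  X_norm (X_minus (polu (v * ulp) P) (polu v (map (fun a => Z.shiftr a prec) P)))
  <= INR (length P) * v.
Proof.
  intros Hv. induction P as [|a P IH].
  - simpl. replace (X_minus X_zero X_zero) with X_zero by ring. rewrite X_norm_zero. lra.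
  - cbn [polu map length]. rewrite S_INR.
    replace (X_minus _ _) with
      (X_plus (X_const (IZR a * (v * ulp) + - (IZR (Z.shiftr a prec) * v)))
        (X_mul X_var (X_minus (polu (v * ulp) P)
                       (polu v (map (fun a => Z.shiftr a prec) P)))))
      by (rewrite X_const_plus, X_const_opp; ring).
    eapply Rle_trans; [apply X_norm_triangle|]. rewrite X_norm_const.
    eapply Rle_trans; [apply Rplus_le_compat_l, X_norm_var_mul|].
    assert (H := shiftr_bounds v a Hv). rewrite Rabs_pos_eq by lra. lra.
Qed.

Lemma enc_rnd (P : list Z) (e : Z) (x : X) :
  X_norm (X_minus x (polu (ulp * ulp) P)) <= IZR e * (ulp * ulp) ->
  enc ulp (rnd P e) x.
Proof.
  intros H. unfold enc, rnd. cbn [fst snd].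
  assert (U := ulp_pos).
  assert (U2 : 0 <= ulp * ulp) by nra.
  assert (H1 := polu_shiftr ulp (firstn K P) ltac:(lra)).
  assert (H2 := shiftr_bounds ulp (e + l1 (skipn K P)) ltac:(lra)).
  rewrite !plus_IZR in *. rewrite <- INR_IZR_INZ.
  (* The coefficients kept are rounded; those dropped are charged to the radius by their l1 norm. *)
  assert (HP : polu (ulp * ulp) P = X_plus (polu (ulp * ulp) (firstn K P))
     (X_mul (X_pow X_var (length (firstn K P))) (polu (ulp * ulp) (skipn K P)))).
  { rewrite <- polu_app, firstn_skipn. reflexivity. }
  set (A := polu (ulp * ulp) (firstn K P)) in *.
  set (T := X_mul (X_pow X_var (length (firstn K P))) (polu (ulp * ulp) (skipn K P))) in *.
  assert (HT : X_norm T <= IZR (l1 (skipn K P)) * (ulp * ulp)).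
  { unfold T. eapply Rle_trans; [apply X_norm_mul|].
    assert (N1 := X_norm_pow_le_1 X_var (length (firstn K P)) X_norm_var).
    assert (N2 := X_norm_polu (ulp * ulp) (skipn K P) U2).
    generalize (X_norm_pos (polu (ulp * ulp) (skipn K P)))
               (X_norm_pos (X_pow X_var (length (firstn K P)))). nra. }
  match goal with |- X_norm (X_minus x ?S) <= _ => set (S0 := S) in * end.
  replace (X_minus x S0) with
    (X_plus (X_plus (X_minus x (X_plus A T)) T) (X_minus A S0)) by ring.
  eapply Rle_trans; [apply X_norm_triangle|].
  eapply Rle_trans; [apply Rplus_le_compat_r, X_norm_triangle|].
  rewrite HP in H.
  assert (HL : INR (length (firstn K P)) <= INR K) by (apply le_INR, firstn_le_length).
  assert (INR (length (firstn K P)) * ulp <= INR K * ulp) by (apply Rmult_le_compat_r; lra).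
  lra.
Qed.

Lemma enc_bmul a b x y : enc ulp a x -> enc ulp b y -> enc ulp (bmul a b) (X_mul x y).
Proof.
  intros Ha Hb. apply enc_rnd. rewrite polu_conv, !plus_IZR, !mult_IZR.
  unfold enc in *. assert (U := ulp_pos).
  assert (N1 := X_norm_polu ulp (fst a) ltac:(lra)).
  assert (N2 := X_norm_polu ulp (fst b) ltac:(lra)).
  set (p := polu ulp (fst a)) in *. set (q := polu ulp (fst b)) in *.
  replace (X_minus (X_mul x y) (X_mul p q)) with
    (X_plus (X_plus (X_mul p (X_minus y q)) (X_mul q (X_minus x p)))
            (X_mul (X_minus x p) (X_minus y q))) by ring.
  eapply Rle_trans; [apply X_norm_triangle|].
  eapply Rle_trans; [apply Rplus_le_compat_r, X_norm_triangle|].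
  assert (Hm : forall v w s t, X_norm v <= s * ulp -> X_norm w <= t * ulp ->
             X_norm (X_mul v w) <= s * t * (ulp * ulp)).
  { intros v w c d Hc Hd. eapply Rle_trans; [apply X_norm_mul|].
    replace (c * d * (ulp * ulp)) with ((c * ulp) * (d * ulp)) by ring.
    apply Rmult_le_compat; auto using X_norm_pos. }
  rewrite !Rmult_plus_distr_r. repeat apply Rplus_le_compat; apply Hm; assumption.
Qed.

Lemma enc_bcst n d : enc ulp (bcst n d) (X_const (IZR n / IZR (Zpos d))).
Proof.
  unfold enc, bcst. cbn [fst snd polu].
  set (y := (n * zone / Zpos d)%Z).
  replace (X_minus _ _) with (X_const (IZR n / IZR (Zpos d) + - (IZR y * ulp)))
    by (rewrite X_const_plus, X_const_opp; ring).
  rewrite X_norm_const.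
  assert (H1 : (Zpos d * y <= n * zone)%Z) by (apply Z.mul_div_le; lia).
  assert (H2 : (n * zone < Zpos d * (y + 1))%Z).
  { replace (y + 1)%Z with (Z.succ y) by lia. apply Z.mul_succ_div_gt; lia. }
  apply IZR_le in H1. apply IZR_lt in H2. rewrite !mult_IZR in H1, H2. rewrite plus_IZR in H2.
  assert (Hd : 0 < IZR (Zpos d)) by (apply IZR_lt; lia).
  assert (U := ulp_pos). assert (E := one_ulp).
  set (D := IZR (Zpos d)) in *.
  assert (E1 : IZR n / D = IZR n * IZR zone * ulp / D).
  { rewrite Rmult_assoc, E. field. lra. }
  assert (L1 : IZR y * ulp <= IZR n / D).
  { rewrite E1. apply Rmult_le_reg_r with D; [exact Hd|].
    replace (IZR n * IZR zone * ulp / D * D) with (IZR n * IZR zone * ulp) by (field; lra).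
    nra. }
  assert (L2 : IZR n / D <= (IZR y + 1) * ulp).
  { rewrite E1. apply Rmult_le_reg_r with D; [exact Hd|].
    replace (IZR n * IZR zone * ulp / D * D) with (IZR n * IZR zone * ulp) by (field; lra).
    nra. }
  rewrite Rabs_pos_eq by lra. lra.
Qed.

Lemma enc_var : enc ulp (0%Z :: zone :: nil, 0%Z) X_var.
Proof.
  unfold enc. cbn [fst snd polu]. rewrite one_ulp, !Rmult_0_l, X_const_0. fold X_one.
  replace (X_minus _ _) with X_zero by ring. rewrite X_norm_zero. lra.
Qed.

Lemma enc_coef_0 u b x : enc u b x -> Rabs (x O - IZR (hd 0%Z (fst b)) * u) <= IZR (snd b) * u.
Proof.
  unfold enc. intros H.
  replace (x O - _) with (X_minus x (polu u (fst b)) O).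
  - eapply Rle_trans; [apply coef_le_norm|exact H].
  - rewrite <- polu_coef_0. simpl. ring.
Qed.

Lemma binv_pos b b' : binv b = Some b' ->
  0 < IZR (Z.abs (hd 0%Z (fst b)) - snd b) * ulp.
Proof.
  unfold binv. destruct (Z.ltb_spec 0 (Z.abs (hd 0%Z (fst b)) - snd b)) as [Hm|];
    [|discriminate].
  intros _. apply Rmult_lt_0_compat; [apply IZR_lt, Hm|apply ulp_pos].
Qed.

Lemma enc_binv b b' x : binv b = Some b' -> enc ulp b x ->
  IZR (Z.abs (hd 0%Z (fst b)) - snd b) * ulp <= Rabs (x O) /\
  enc ulp b' (X_const (/ x O)).
Proof.
  unfold binv. intros Hb H. apply enc_coef_0 in H.
  set (c := hd 0%Z (fst b)) in *. set (e := snd b) in *.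
  destruct (Z.ltb_spec 0 (Z.abs c - e)) as [Hm|]; [|discriminate].
  injection Hb as <-. set (m := (Z.abs c - e)%Z) in *.
  assert (U := ulp_pos). assert (E := one_ulp).
  assert (Hm' : 0 < IZR m) by (apply IZR_lt, Hm).
  assert (Hx : IZR m * ulp <= Rabs (x O)).
  { unfold m. rewrite minus_IZR, abs_IZR.
    assert (T : Rabs (IZR c * ulp) <= Rabs (x O) + Rabs (x O - IZR c * ulp)).
    { replace (IZR c * ulp) with (x O + - (x O - IZR c * ulp)) at 1 by ring.
      eapply Rle_trans; [apply Rabs_triang|]. rewrite Rabs_Ropp. lra. }
    rewrite Rabs_mult, (Rabs_pos_eq ulp) in T by lra. lra. }
  assert (Hmu : 0 < IZR m * ulp) by nra.
  split; [assumption|].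
  unfold enc. cbn [fst snd polu].
  set (y := (zone * zone / c)%Z).
  replace (X_minus _ _) with (X_const (/ x O + - (IZR y * ulp)))
    by (rewrite X_const_plus, X_const_opp; ring).
  rewrite X_norm_const.
  assert (Hx0 : x O <> 0) by (intros E0; rewrite E0, Rabs_R0 in Hx; lra).
  set (N := (Z.abs (zone * zone - c * y) + e * Z.abs y)%Z).
  (* The error is [1 / x - y = (1 - x y) / x]; the residual splits into that of the centre [c] and
     the uncertainty of [x] times [y]. *)
  assert (HN : Rabs (1 - x O * (IZR y * ulp)) <= IZR N * (ulp * ulp)).
  { replace (1 - x O * (IZR y * ulp)) with
      (IZR (zone * zone - c * y) * (ulp * ulp) + - ((x O - IZR c * ulp) * (IZR y * ulp))).
    - eapply Rle_trans; [apply Rabs_triang|].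
      rewrite Rabs_Ropp, !Rabs_mult, (Rabs_pos_eq ulp) by lra.
      unfold N. rewrite plus_IZR, (mult_IZR e), !abs_IZR.
      assert (Rabs (x O - IZR c * ulp) * (Rabs (IZR y) * ulp) <=
              IZR e * ulp * (Rabs (IZR y) * ulp)).
      { apply Rmult_le_compat_r; [|exact H].
        apply Rmult_le_pos; [apply Rabs_pos|lra]. }
      lra.
    - rewrite minus_IZR, !mult_IZR.
      replace 1 with ((IZR zone * ulp) * (IZR zone * ulp)) by (rewrite E; ring). ring. }
  replace (/ x O + - (IZR y * ulp)) with ((1 - x O * (IZR y * ulp)) * / x O) by (field; exact Hx0).
  rewrite Rabs_mult, Rabs_inv.
  assert (HN0 : 0 <= IZR N * (ulp * ulp)) by (eapply Rle_trans; [apply Rabs_pos|exact HN]).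
  apply Rle_trans with (IZR N * (ulp * ulp) * / (IZR m * ulp)).
  { apply Rmult_le_compat; auto using Rabs_pos.
    - left. apply Rinv_0_lt_compat. now apply Rabs_pos_lt.
    - apply Rinv_le_contravar; assumption. }
  replace (IZR N * (ulp * ulp) * / (IZR m * ulp)) with (IZR N / IZR m * ulp) by (field; lra).
  apply Rmult_le_compat_r; [lra|].
  assert (HZ : (N < m * (N / m + 1))%Z).
  { replace (N / m + 1)%Z with (Z.succ (N / m)) by lia. apply Z.mul_succ_div_gt; lia. }
  apply IZR_lt in HZ. rewrite mult_IZR in HZ.
  apply Rmult_le_reg_r with (IZR m); [exact Hm'|].
  unfold Rdiv. rewrite Rmult_assoc, Rinv_l, Rmult_1_r by lra. lra.
Qed.

Lemma enc_one : enc ulp (zone :: nil, 0%Z) X_one.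
Proof.
  unfold enc. cbn [fst snd polu]. rewrite one_ulp, Rmult_0_l. fold X_one.
  replace (X_minus _ _) with X_zero by ring. rewrite X_norm_zero. lra.
Qed.

Definition enc_powers (pw : list ball_t) (x : X) (k : nat) : Prop :=
  forall i, (i < length pw)%nat -> enc ulp (nth i pw (nil, 0%Z)) (X_pow x (k + i)).

Lemma powers_length n q : forall cur, length (powers n q cur) = S n.
Proof. induction n as [|n IH]; intros cur; simpl; [reflexivity|]. now rewrite IH. Qed.

Lemma enc_powers_spec n q x : enc ulp q x -> forall cur k,
  enc ulp cur (X_pow x k) -> enc_powers (powers n q cur) x k.
Proof.
  intros Hq. induction n as [|n IH]; intros cur k Hc i Hi; simpl in Hi.
  - replace i with O by lia. now rewrite Nat.add_0_r.
  - destruct i as [|i]; simpl nth; [now rewrite Nat.add_0_r|].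
    rewrite Nat.add_succ_r, <- Nat.add_succ_l. apply IH; [|lia].
    simpl. now apply enc_bmul.
Qed.

(** The offset [x^k] is forced by the recursion, which drops the first coefficient together with the
    first power. *)
Lemma enc_lincomb cs x : X_norm x <= 1 -> forall pw k,
  (length cs <= length pw)%nat -> enc_powers pw x k ->
  X_norm (X_minus (X_mul (X_pow x k) (X_comp (polu ulp cs) x))
            (polu (ulp * ulp) (fst (lincomb cs pw))))
  <= IZR (snd (lincomb cs pw)) * (ulp * ulp).
Proof.
  intros Hx. assert (U := ulp_pos).
  induction cs as [|c cs IH]; intros pw k Hl Hpw.
  - simpl. rewrite comp_zero by exact Hx.
    replace (X_minus _ _) with X_zero by ring. rewrite X_norm_zero. lra.
  - destruct pw as [|b pw]; [simpl in Hl; lia|]. simpl in Hl.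
    assert (Hb : enc ulp b (X_pow x k)).
    { rewrite <- (Nat.add_0_r k). apply (Hpw O). simpl. lia. }
    specialize (IH pw (S k) ltac:(lia)).
    assert (Hpw' : enc_powers pw x (S k)).
    { intros i Hi. rewrite Nat.add_succ_l, <- Nat.add_succ_r. apply (Hpw (S i)). simpl. lia. }
    specialize (IH Hpw'). cbn [lincomb].
    destruct (lincomb cs pw) as [P e]. cbn [fst snd] in *.
    rewrite comp_polu_cons by exact Hx. rewrite polu_padd, polu_scale.
    cbn [X_pow] in IH. set (Q := X_comp (polu ulp cs) x) in *.
    replace (X_minus _ _) with
      (X_plus (X_mul (X_const (IZR c * ulp)) (X_minus (X_pow x k) (polu ulp (fst b))))
        (X_minus (X_mul (X_mul x (X_pow x k)) Q) (polu (ulp * ulp) P))) by ring.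
    eapply Rle_trans; [apply X_norm_triangle|].
    rewrite plus_IZR, mult_IZR, abs_IZR, Rmult_plus_distr_r.
    apply Rplus_le_compat; [|exact IH].
    eapply Rle_trans; [apply X_norm_mul|].
    rewrite X_norm_const, Rabs_mult, (Rabs_pos_eq ulp) by lra.
    unfold enc in Hb.
    replace (Rabs (IZR c) * IZR (snd b) * (ulp * ulp))
      with (Rabs (IZR c) * ulp * (IZR (snd b) * ulp)) by ring.
    apply Rmult_le_compat_l; [|exact Hb].
    apply Rmult_le_pos; [apply Rabs_pos|lra].
Qed.

(** A function in the ball [fst D], up to a part of norm at most [snd D]
    supported on degrees [>= K]. *)
Definition enc_tail (D : ball_t * Z) (h : X) : Prop :=
  exists h1 h2, h = X_plus h1 h2 /\ enc ulp (fst D) h1 /\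
    (forall k, (k < K)%nat -> h2 k = 0) /\ X_norm h2 <= IZR (snd D) * ulp.

Lemma enc_no_tail b h : enc ulp b h -> enc_tail (b, 0%Z) h.
Proof.
  intros H. exists h, X_zero. split; [ring|]. split; [exact H|].
  split; [reflexivity|]. rewrite X_norm_zero. simpl. lra.
Qed.

Lemma enc_bcomp (F : ball_t) (tau : Z) pw (f x : X) :
  (length (fst F) <= K)%nat -> length pw = S K -> X_norm x <= 1 ->
  enc_powers pw x 0 -> enc_tail (F, tau) f ->
  enc ulp (bcomp F pw tau) (X_comp f x).
Proof.
  intros HF Hpw Hx Hp (f1 & f2 & -> & H1 & H2 & H3). cbn [fst snd] in *.
  assert (U := ulp_pos).
  assert (HL := enc_lincomb (fst F) x Hx pw O ltac:(lia) Hp).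
  unfold bcomp. destruct (lincomb (fst F) pw) as [P e]. cbn [fst snd] in HL.
  apply enc_rnd in HL. destruct (rnd P e) as [P' e'].
  unfold enc in *. cbn [fst snd] in *.
  rewrite comp_plus by exact Hx. cbn [X_pow] in HL.
  set (g := polu ulp (fst F)) in *.
  (* Three errors: evaluation of the centre, the ball around the outer centre (composition does not
     increase norms), and the part of high degree. *)
  replace (X_minus _ _) with
    (X_plus (X_plus (X_minus (X_mul X_one (X_comp g x)) (polu ulp P'))
              (X_comp (X_minus f1 g) x)) (X_comp f2 x))
    by (rewrite comp_minus by exact Hx; ring).
  eapply Rle_trans; [apply X_norm_triangle|].
  eapply Rle_trans; [apply Rplus_le_compat_r, X_norm_triangle|].
  assert (C1 := X_norm_comp (X_minus f1 g) x Hx).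
  rewrite !plus_IZR.
  assert (C2 : X_norm (X_comp f2 x) <= IZR
    (if Z.eqb tau 0 then 0 else Z.shiftr (tau * tot (nth K pw (nil, 0%Z))) prec + 1)%Z * ulp).
  { destruct (Z.eqb_spec tau 0) as [->|_].
    - eapply Rle_trans; [apply X_norm_comp, Hx|]. lra.
    - rewrite plus_IZR.
      eapply Rle_trans; [apply (comp_tail_small K); assumption|].
      eapply Rle_trans; [|apply shiftr_bounds; lra].
      rewrite mult_IZR.
      replace (_ * _ * (ulp * ulp)) with
        (IZR tau * ulp * (IZR (tot (nth K pw (nil, 0%Z))) * ulp)) by ring.
      apply Rmult_le_compat; auto using X_norm_pos.
      apply enc_tot; [lra|]. apply (Hp K). lia. }
  lra.
Qed.

Lemma pderiv_length (P : list Z) : (length (pderiv P) <= length P)%nat.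
Proof.
  assert (L : forall P Q, length (padd P Q) = max (length P) (length Q)).
  { induction P0 as [|a P0 IH]; intros [|b Q]; simpl; auto. }
  induction P as [|a P IH]; simpl; [lia|]. rewrite L. simpl. lia.
Qed.

Lemma enc_bdcomp (F : ball_t) pw q (f x : X) :
  (length (fst F) <= K)%nat -> length pw = S K -> (tot q < zone)%Z -> enc ulp q x ->
  enc_powers pw x 0 -> enc ulp F f ->
  enc ulp (bdcomp F pw q) (X_dcomp f x).
Proof.
  intros HF Hpw Hq Hx Hp H. assert (U := ulp_pos). assert (E := one_ulp).
  apply enc_tot in Hx; [|lra].
  assert (Hq' : IZR (tot q) * ulp < 1).
  { rewrite <- E. apply Rmult_lt_compat_r; [lra|]. apply IZR_lt, Hq. }
  assert (Hx1 : X_norm x <= 1) by lra.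
  assert (HL := enc_lincomb (pderiv (fst F)) x Hx1 pw O
                  ltac:(generalize (pderiv_length (fst F)); lia) Hp).
  unfold bdcomp. destruct (lincomb (pderiv (fst F)) pw) as [P e]. cbn [fst snd] in HL.
  apply enc_rnd in HL. destruct (rnd P e) as [P' e'].
  unfold enc in *. cbn [fst snd] in *. cbn [X_pow] in HL.
  rewrite <- dcomp_polu in HL by lra.
  set (g := polu ulp (fst F)) in *.
  replace (X_minus _ _) with
    (X_plus (X_minus (X_mul X_one (X_dcomp g x)) (polu ulp P')) (X_dcomp (X_minus f g) x))
    by (rewrite dcomp_minus by lra; ring).
  eapply Rle_trans; [apply X_norm_triangle|].
  rewrite !plus_IZR, Rmult_plus_distr_r. apply Rplus_le_compat; [exact HL|].
  eapply Rle_trans; [apply (X_norm_dcomp _ _ (IZR (tot q) * ulp)); lra|].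
  set (m := (zone - tot q)%Z).
  assert (Hm : (0 < m)%Z) by (unfold m; lia).
  assert (Hm' : 0 < IZR m) by (apply IZR_lt, Hm).
  assert (Em : 1 - IZR (tot q) * ulp = IZR m * ulp).
  { unfold m. rewrite minus_IZR. lra. }
  rewrite Em.
  apply Rle_trans with (IZR (snd F) * ulp * / (IZR m * ulp)).
  { apply Rmult_le_compat_r; [|exact H]. left. apply Rinv_0_lt_compat. nra. }
  set (N := (snd F * zone)%Z).
  replace (IZR (snd F) * ulp * / (IZR m * ulp)) with (IZR N / IZR m * ulp).
  2:{ unfold N. rewrite mult_IZR. transitivity (IZR (snd F) * (IZR zone * ulp) / IZR m).
      - field; lra. - rewrite E. field. lra. }
  apply Rmult_le_compat_r; [lra|].
  assert (HZ : (N < m * (N / m + 1))%Z).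
  { replace (N / m + 1)%Z with (Z.succ (N / m)) by lia. apply Z.mul_succ_div_gt; lia. }
  apply IZR_lt in HZ. rewrite mult_IZR in HZ. rewrite plus_IZR in HZ.
  apply Rmult_le_reg_r with (IZR m); [exact Hm'|].
  unfold Rdiv. rewrite Rmult_assoc, Rinv_l, Rmult_1_r by lra. lra.
Qed.

(** ** Soundness of the program runs *)

Variable B : Y -> Prop.
Hypothesis HB : forall p b, B p -> enc ulp (bsel b) (pr b p).
Hypothesis HlenF : forall b, (length (fst (bsel b)) <= K)%nat.

(** Smoothness and enclosure must go through the induction together: the enclosure of an operand
    proves the hypotheses under which composition and inversion are smooth. *)
Definition value_ok (f : dfun) (b : ball_t) : Prop :=
  smooth B f /\ forall p, B p -> enc ulp b (fst f p).

Lemma value_ok_reg env benv i : Forall2 value_ok env benv ->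
  value_ok (reg env i) (breg benv i).
Proof.
  intros H. revert i. unfold reg, breg. induction H as [|f b env benv Hf H IH]; intros [|i];
    simpl; auto; (split; [apply smooth_zero|intros; apply enc_zero]).
Qed.

Lemma data_bound p b : B p -> X_norm (pr b p) <= Rmax (IZR (tot BF) * ulp) (IZR (tot BG) * ulp).
Proof.
  intros Hp. assert (H := HB p b Hp). assert (U := ulp_pos).
  apply enc_tot in H; [|lra].
  eapply Rle_trans; [exact H|]. destruct b; [apply Rmax_l|apply Rmax_r].
Qed.

Lemma bstep_sound env benv o r : Forall2 value_ok env benv -> bstep benv o = Some r ->
  value_ok (step env o) (fst r).
Proof.
  intros H Hr. assert (U := ulp_pos). assert (Hreg := fun i => value_ok_reg _ _ i H).
  destruct o as [n d| |i j|i j|i j|i|b i]; simpl in Hr; simpl step.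
  - injection Hr as <-. split; [apply smooth_constant|]. intros; apply enc_bcst.
  - injection Hr as <-. split; [apply smooth_constant|]. intros; apply enc_var.
  - injection Hr as <-. destruct (Hreg i) as [S1 V1], (Hreg j) as [S2 V2].
    destruct (reg env i), (reg env j). split; [apply smooth_add; assumption|].
    intros p Hp. apply enc_badd; auto.
  - injection Hr as <-. destruct (Hreg i) as [S1 V1], (Hreg j) as [S2 V2].
    destruct (reg env i), (reg env j). split; [apply smooth_sub; assumption|].
    intros p Hp. apply enc_bsub; auto.
  - injection Hr as <-. destruct (Hreg i) as [S1 V1], (Hreg j) as [S2 V2].
    destruct (reg env i), (reg env j). split; [apply smooth_mul; assumption|].
    intros p Hp. apply enc_bmul; auto.
  - destruct (Hreg i) as [S1 V1].
    destruct (binv (breg benv i)) as [b|] eqn:E; [|discriminate]. injection Hr as <-.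
    destruct (reg env i) as [v dv]. cbn [fst snd] in *.
    assert (Hv := fun p Hp => enc_binv _ _ _ E (V1 p Hp)).
    split; [|intros p Hp; apply Hv, Hp].
    eapply smooth_inv; [exact (binv_pos _ _ E)| |exact S1]. intros p Hp. apply Hv, Hp.
  - destruct (Hreg i) as [S1 V1].
    destruct (Z.ltb_spec (tot (breg benv i)) zone) as [Hq|]; [|discriminate].
    injection Hr as <-. destruct (reg env i) as [v dv]. cbn [fst snd] in *.
    assert (Hq' : IZR (tot (breg benv i)) * ulp < 1).
    { rewrite <- one_ulp. apply Rmult_lt_compat_r; [lra|]. apply IZR_lt, Hq. }
    assert (Hn : forall p, B p -> X_norm (v p) <= IZR (tot (breg benv i)) * ulp).
    { intros p Hp. apply enc_tot; [lra|]. auto. }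
    split.
    + eapply smooth_comp; eauto. intros p c Hp. apply data_bound, Hp.
    + intros p Hp. apply enc_bcomp; auto.
      * apply powers_length.
      * specialize (Hn p Hp). lra.
      * apply enc_powers_spec; [auto|]. apply enc_one.
      * apply enc_no_tail. auto.
Qed.

Lemma annotate_sound prog : forall env benv ann,
  Forall2 value_ok env benv -> annotate prog benv = Some ann ->
  Forall2 value_ok (run prog env) (benv ++ map (fun x => fst (snd x)) ann).
Proof.
  induction prog as [|o prog IH]; intros env benv ann H Ha; simpl in *.
  - injection Ha as <-. now rewrite app_nil_r.
  - destruct (bstep benv o) as [r|] eqn:Er; [|discriminate].
    destruct (annotate prog (benv ++ fst r :: nil)) as [ann'|] eqn:Ea; [|discriminate].
    injection Ha as <-. simpl.
    replace (benv ++ fst r :: map (fun x => fst (snd x)) ann')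
      with ((benv ++ fst r :: nil) ++ map (fun x => fst (snd x)) ann')
      by now rewrite <- app_assoc.
    apply IH; [|exact Ea]. apply Forall2_app; [exact H|]. constructor; [|constructor].
    eapply bstep_sound; eauto.
Qed.

Variables DF DG : ball_t * Z.
Variables p h : Y.
Hypothesis Hp : B p.
Hypothesis HD : forall b : bool, enc_tail (if b then DF else DG) (pr b h).
Hypothesis HlenD : forall b : bool, (length (fst (fst (if b then DF else DG))) <= K)%nat.

(** Base point [p] and direction [h] are fixed, but [p] is any point of [B]: a single run bounds the
    derivative on the whole set. *)
Definition tangent_ok (f : dfun) (d : ball_t) : Prop := enc ulp d (snd f p h).

Lemma tangent_ok_reg env denv i : Forall2 tangent_ok env denv ->
  tangent_ok (reg env i) (breg denv i).
Proof.
  intros H. revert i. unfold reg, breg. induction H as [|f b env benv Hf H IH]; intros [|i];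
    simpl; auto; apply enc_zero.
Qed.

Lemma enc_const_coef b x : enc ulp b x ->
  enc ulp (firstn 1 (fst b), snd b) (X_const (x O)).
Proof.
  intros H. apply enc_coef_0 in H. unfold enc. cbn [fst snd].
  replace (polu ulp (firstn 1 (fst b))) with (X_const (IZR (hd 0%Z (fst b)) * ulp)).
  - replace (X_minus _ _) with (X_const (x O - IZR (hd 0%Z (fst b)) * ulp)).
    + now rewrite X_norm_const.
    + unfold Rminus. rewrite X_const_plus, X_const_opp. ring.
  - destruct (fst b) as [|a P]; simpl; [rewrite Rmult_0_l; apply X_const_0|ring].
Qed.

Lemma tstep_sound env benv denv o r : Forall2 value_ok env benv ->
  Forall2 tangent_ok env denv -> bstep benv o = Some r ->
  tangent_ok (step env o) (tstep DF DG benv denv o r).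
Proof.
  intros H HT Hr. assert (U := ulp_pos). assert (Hreg := fun i => value_ok_reg _ _ i H).
  assert (Treg := fun i => tangent_ok_reg _ _ i HT). unfold tangent_ok in *.
  assert (Hstep := bstep_sound _ _ _ _ H Hr).
  destruct o as [n d| |i j|i j|i j|i|b i]; simpl in Hr; simpl step in *; simpl tstep.
  - apply enc_zero.
  - apply enc_zero.
  - specialize (Treg i) as T1. specialize (Treg j) as T2.
    destruct (reg env i), (reg env j). apply enc_badd; assumption.
  - specialize (Treg i) as T1. specialize (Treg j) as T2.
    destruct (reg env i), (reg env j). apply enc_bsub; assumption.
  - specialize (Treg i) as T1. specialize (Treg j) as T2.
    destruct (Hreg i) as [_ V1], (Hreg j) as [_ V2].
    destruct (reg env i), (reg env j). apply enc_badd; apply enc_bmul; auto.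
  - specialize (Treg i) as T1. destruct Hstep as [_ V].
    destruct (reg env i) as [v dv]. cbn [fst snd] in *.
    rewrite X_const_opp, !X_const_times.
    apply enc_bopp, enc_bmul; [now apply enc_const_coef|]. apply enc_bmul; auto.
  - specialize (Treg i) as T1. destruct (Hreg i) as [S1 V1].
    destruct (Z.ltb_spec (tot (breg benv i)) zone) as [Hq|]; [|discriminate].
    injection Hr as <-. destruct (reg env i) as [v dv]. cbn [fst snd] in *.
    assert (Hq' : IZR (tot (breg benv i)) * ulp < 1).
    { rewrite <- one_ulp. apply Rmult_lt_compat_r; [lra|]. apply IZR_lt, Hq. }
    assert (Hn : X_norm (v p) <= IZR (tot (breg benv i)) * ulp) by (apply enc_tot; auto; lra).
    assert (Hpw : enc_powers (powers K (breg benv i) (zone :: nil, 0%Z)) (v p) 0)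
      by (apply enc_powers_spec; [auto|apply enc_one]).
    apply enc_badd.
    + apply enc_bcomp; auto; [apply powers_length|lra|].
      specialize (HD b). destruct b; [destruct DF|destruct DG]; exact HD.
    + apply enc_bmul; [|exact T1]. apply enc_bdcomp; auto. apply powers_length.
Qed.

Lemma trun_sound prog : forall env benv denv ann,
  Forall2 value_ok env benv -> Forall2 tangent_ok env denv ->
  annotate prog benv = Some ann ->
  Forall2 tangent_ok (run prog env) (trun DF DG ann benv denv).
Proof.
  induction prog as [|o prog IH]; intros env benv denv ann H HT Ha; simpl in *.
  - injection Ha as <-. exact HT.
  - destruct (bstep benv o) as [r|] eqn:Er; [|discriminate].
    destruct (annotate prog (benv ++ fst r :: nil)) as [ann'|] eqn:Ea; [|discriminate].
    injection Ha as <-. simpl. apply IH; [| |exact Ea].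
    + apply Forall2_app; [exact H|]. constructor; [|constructor]. eapply bstep_sound; eauto.
    + apply Forall2_app; [exact HT|]. constructor; [|constructor]. eapply tstep_sound; eauto.
Qed.

End Precision.

(** * The renormalization operator as a program *)

(** Register 8 is [op_lambda], 13 [op_u_arg], 16 [op_u / t], 21 [op_f],
    26 [op_v], 30 [op_v_arg], 34 [op_g_arg] and 37 [t * w * op_g]; recall
    [1 / s = 5 / 11] and [1 / t = 2]. *)
Definition T_program : list instr :=
  [ ICst 0 1; ICmp true 0; ICst 5 11; ICst 1 1; IMul 1 1; ISub 4 3; IMul 5 2;
    ICmp true 6; ISub 0 7;
    IMul 8 8; IVar; IAdd 10 2; IMul 9 11; ISub 12 2;
    ICmp true 13; IMul 14 14; IAdd 15 15; ICmp false 16; IMul 15 17; ISub 18 3;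
    IInv 8; IMul 20 19;
    IMul 9 10; ICmp false 22; IMul 22 23; ICst 1 2; IMul 24 25;
    ICst 2 1; ISub 26 27; IMul 26 28; IMul 29 2;
    ICmp true 30; IMul 31 31; ISub 32 3; IMul 33 2;
    ICmp true 34; IMul 20 35; IAdd 36 3 ].

Definition val (p : Y) (i : nat) : X := fst (reg (run T_program nil) i) p.
Definition der (p h : Y) (i : nat) : X := snd (reg (run T_program nil) i) p h.

(** Register 37 vanishes at [w = 0], so [X_tail] divides it by [w], and 2 is [1 / t]: this removes
    the singularity of the second component. *)
Definition Tm (p : Y) : Y := (val p 21, X_scal 2 (X_tail (val p 37))).
Definition DTm (p h : Y) : Y := (der p h 21, X_scal 2 (X_tail (der p h 37))).

Definition T_defined (p : Y) : Prop :=
  (forall i, In i [0; 6; 13; 16; 22; 30; 34]%nat -> X_norm (val p i) < 1) /\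
  val p 8 O <> 0.

Lemma inv_s : (1 / RtoC s)%C = RtoC (5 / 11).
Proof.
  unfold s. rewrite <- RtoC_div by lra. f_equal. field.
Qed.

Lemma div_s (z : C) : (z / RtoC s)%C = (z * RtoC (5 / 11))%C.
Proof. rewrite <- inv_s. unfold Cdiv. ring. Qed.

Lemma div_t (z : C) : (z / RtoC t)%C = (z + z)%C.
Proof.
  unfold t, Cdiv. rewrite <- RtoC_inv by lra.
  replace (/ (5 / 10)) with (1 + 1) by field. rewrite RtoC_plus. ring.
Qed.

Lemma RtoC_1 : RtoC (IZR 1 / IZR (Zpos 1)) = RtoC 1.
Proof. f_equal. field. Qed.

(** * The program computes [T] *)

Section Semantics.
Variable p : Y.
Hypothesis Hd : T_defined p.

Section AtPoint.
Variable w : C.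
Hypothesis Hw : Cmod w <= 1.

Let f : C -> C := evalX (fst p).
Let g : C -> C := evalX (snd p).
Let ev (i : nat) : C := evalX (val p i) w.

Lemma ev_comp b i k : val p k = X_comp (pr b p) (val p i) ->
  In i [0; 6; 13; 16; 22; 30; 34]%nat -> ev k = evalX (pr b p) (ev i).
Proof.
  intros E Hi. unfold ev. rewrite E. apply evalX_comp; [exact Hw|].
  left. apply Hd, Hi.
Qed.

Lemma ev_F i k : val p k = X_comp (pr true p) (val p i) ->
  In i [0; 6; 13; 16; 22; 30; 34]%nat -> ev k = f (ev i).
Proof. exact (ev_comp true i k). Qed.

Lemma ev_G i k : val p k = X_comp (pr false p) (val p i) ->
  In i [0; 6; 13; 16; 22; 30; 34]%nat -> ev k = g (ev i).
Proof. exact (ev_comp false i k). Qed.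

Lemma ev_mul i j k : val p k = X_mul (val p i) (val p j) -> ev k = (ev i * ev j)%C.
Proof. intros E. unfold ev. rewrite E. now apply evalX_mul. Qed.

Lemma ev_add i j k : val p k = X_plus (val p i) (val p j) -> ev k = (ev i + ev j)%C.
Proof. intros E. unfold ev. rewrite E. now apply evalX_plus. Qed.

Lemma ev_sub i j k : val p k = X_minus (val p i) (val p j) -> ev k = (ev i - ev j)%C.
Proof. intros E. unfold ev. rewrite E. now apply evalX_minus. Qed.

Lemma ev_cst n d k : val p k = X_const (IZR n / IZR (Zpos d)) ->
  ev k = RtoC (IZR n / IZR (Zpos d)).
Proof. intros E. unfold ev. rewrite E. now apply evalX_const. Qed.

Lemma ev_3 : ev 3 = RtoC 1.
Proof. rewrite (ev_cst 1 1 3 eq_refl). apply RtoC_1. Qed.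

Lemma ev_2 : ev 2 = RtoC (5 / 11).
Proof. exact (ev_cst 5 11 2 eq_refl). Qed.

Lemma ev_6 : ev 6 = ((f 0 ^ 2 - 1) / s)%C.
Proof.
  rewrite (ev_mul 5 2 6 eq_refl), (ev_sub 4 3 5 eq_refl), (ev_mul 1 1 4 eq_refl).
  rewrite (ev_F 0 1 eq_refl) by (simpl; tauto).
  rewrite (ev_cst 0 1 0 eq_refl), ev_3, ev_2, div_s.
  replace (IZR 0 / IZR (Zpos 1)) with 0 by field. fold f. simpl Cpow. unfold f. simpl. ring.
Qed.

Lemma ev_8 : ev 8 = op_lambda p.
Proof.
  rewrite (ev_sub 0 7 8 eq_refl), (ev_F 6 7 eq_refl), ev_6 by (simpl; tauto).
  rewrite (ev_cst 0 1 0 eq_refl). replace (IZR 0 / IZR (Zpos 1)) with 0 by field.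
  unfold op_lambda, f.  ring.
Qed.

Lemma ev_9 : ev 9 = (op_lambda p ^ 2)%C.
Proof. rewrite (ev_mul 8 8 9 eq_refl), ev_8. simpl. ring. Qed.

Lemma ev_10 : ev 10 = w.
Proof. apply evalX_var, Hw. Qed.

Lemma ev_13 : ev 13 = op_u_arg p w.
Proof.
  rewrite (ev_sub 12 2 13 eq_refl), (ev_mul 9 11 12 eq_refl), (ev_add 10 2 11 eq_refl).
  rewrite ev_9, ev_10, ev_2. unfold op_u_arg. rewrite inv_s. ring.
Qed.

Lemma ev_15 : ev 15 = op_u p w.
Proof.
  rewrite (ev_mul 14 14 15 eq_refl), (ev_F 13 14 eq_refl), ev_13 by (simpl; tauto).
  unfold op_u, f. simpl. ring.
Qed.

Lemma ev_16 : ev 16 = (op_u p w / t)%C.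
Proof. rewrite (ev_add 15 15 16 eq_refl), ev_15, div_t. reflexivity. Qed.

Lemma ev_19 : ev 19 = (- (1) + op_u p w * g (op_u p w / t))%C.
Proof.
  rewrite (ev_sub 18 3 19 eq_refl), (ev_mul 15 17 18 eq_refl).
  rewrite (ev_G 16 17 eq_refl), ev_16, ev_15, ev_3 by (simpl; tauto).
  unfold g. ring.
Qed.

Lemma ev_22 : ev 22 = (op_lambda p ^ 2 * w)%C.
Proof. rewrite (ev_mul 9 10 22 eq_refl), ev_9, ev_10. reflexivity. Qed.

Lemma ev_26 : ev 26 = op_v p w.
Proof.
  rewrite (ev_mul 24 25 26 eq_refl), (ev_mul 22 23 24 eq_refl).
  rewrite (ev_G 22 23 eq_refl), ev_22, (ev_cst 1 2 25 eq_refl) by (simpl; tauto).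
  unfold op_v, g. replace (IZR 1 / IZR (Zpos 2)) with t by (unfold t; field).
  ring.
Qed.

Lemma ev_30 : ev 30 = op_v_arg p w.
Proof.
  rewrite (ev_mul 29 2 30 eq_refl), (ev_mul 26 28 29 eq_refl), (ev_sub 26 27 28 eq_refl).
  rewrite ev_26, ev_2, (ev_cst 2 1 27 eq_refl). unfold op_v_arg. rewrite div_s.
  replace (IZR 2 / IZR (Zpos 1)) with 2 by field. ring.
Qed.

Lemma ev_34 : ev 34 = op_g_arg p w.
Proof.
  rewrite (ev_mul 33 2 34 eq_refl), (ev_sub 32 3 33 eq_refl), (ev_mul 31 31 32 eq_refl).
  rewrite (ev_F 30 31 eq_refl), ev_30, ev_3, ev_2 by (simpl; tauto).
  unfold op_g_arg, f. rewrite inv_s. simpl. ring.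
Qed.

End AtPoint.

Lemma lambda_coef : op_lambda p = RtoC (val p 8 O).
Proof.
  rewrite <- (ev_8 0) by (rewrite Cmod_0; lra). apply evalX_0.
Qed.

Lemma lambda_nonzero : op_lambda p <> 0.
Proof.
  rewrite lambda_coef. intros E. apply RtoC_inj in E. now apply Hd.
Qed.

Lemma ev_20 (w : C) : Cmod w <= 1 -> evalX (val p 20) w = (/ op_lambda p)%C.
Proof.
  intros Hw. change (val p 20) with (X_const (/ val p 8 O)).
  rewrite evalX_const by exact Hw. rewrite lambda_coef. apply RtoC_inv, Hd.
Qed.

Lemma ev_21 (w : C) : Cmod w <= 1 -> evalX (val p 21) w = op_f p w.
Proof.
  intros Hw. rewrite (ev_mul w Hw 20 19 21 eq_refl), ev_19, ev_20 by exact Hw.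
  unfold op_f, Cdiv. ring.
Qed.

Lemma ev_37 (w : C) : Cmod w <= 1 ->
  evalX (val p 37) w = (1 + evalX (fst p) (op_g_arg p w) / op_lambda p)%C.
Proof.
  intros Hw. rewrite (ev_add w Hw 36 3 37 eq_refl), (ev_mul w Hw 20 35 36 eq_refl).
  rewrite (ev_F w Hw 34 35 eq_refl), ev_34, ev_3, ev_20 by (simpl; tauto || exact Hw).
  unfold Cdiv. ring.
Qed.

(** At [w = 0] the function [v] vanishes and the argument of the outer [f] becomes that in the
    definition of [lambda], so the quotient is -1. *)
Lemma val_37_0 : val p 37 O = 0.
Proof.
  apply RtoC_inj. rewrite <- evalX_0.
  assert (H0 : Cmod 0 <= 1) by (rewrite Cmod_0; lra).
  rewrite (ev_37 0 H0).
  assert (Hv : op_v p 0 = 0) by (unfold op_v; ring).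
  assert (Hg : op_g_arg p 0 = ((evalX (fst p) 0 ^ 2 - 1) / s)%C).
  { unfold op_g_arg, op_v_arg. rewrite Hv, inv_s, !div_s.
    replace (0 * (0 - 2) * RtoC (5 / 11))%C with (RtoC 0) by ring. ring. }
  rewrite Hg.
  replace (evalX (fst p) ((evalX (fst p) 0 ^ 2 - 1) / s)%C) with (- op_lambda p)%C
    by (unfold op_lambda; ring).
  field. apply lambda_nonzero.
Qed.

Lemma Tm_spec : T_spec p (Tm p).
Proof.
  intros w Hw. split.
  - apply ev_21. lra.
  - intros Hw0. unfold Tm. cbn [snd].
    rewrite evalX_scal by lra. unfold op_g. rewrite <- ev_37 by lra.
    rewrite (evalX_split (val p 37)) by lra. rewrite val_37_0.
    replace (RtoC 2) with (/ RtoC t)%C.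
    + field. split; [exact Hw0|]. unfold t. intros E. apply RtoC_inj in E. lra.
    + unfold t. rewrite <- RtoC_inv by lra. f_equal. field.
Qed.

(** [T p] satisfies [T_spec] because a solution exists, and the identity theorem makes the solution
    unique. *)
Lemma T_Tm : T p = Tm p.
Proof.
  assert (H : T_spec p (T p)).
  { unfold T. apply epsilon_spec. exists (Tm p). apply Tm_spec. }
  assert (H' := Tm_spec).
  assert (E : forall x, 0 < x < 1 -> Cmod (RtoC x) < 1).
  { intros x Hx. rewrite Cmod_RtoC_pos; lra. }
  assert (E0 : forall x, 0 < x < 1 -> RtoC x <> 0).
  { intros x Hx E1. apply RtoC_inj in E1. lra. }
  rewrite (surjective_pairing (T p)), (surjective_pairing (Tm p)). f_equal.
  - apply evalX_inj. intros x Hx.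
    rewrite (proj1 (H _ (E x Hx))), (proj1 (H' _ (E x Hx))). reflexivity.
  - apply evalX_inj. intros x Hx.
    rewrite (proj2 (H _ (E x Hx)) (E0 x Hx)), (proj2 (H' _ (E x Hx)) (E0 x Hx)). reflexivity.
Qed.

Lemma T_defined_domain : T_domain p.
Proof.
  assert (Hin : forall w i, Cmod w <= 1 -> In i [0; 6; 13; 16; 22; 30; 34]%nat ->
     Cmod (evalX (val p i) w) < 1).
  { intros w i Hw Hi. eapply Rle_lt_trans; [apply Cmod_evalX, Hw|]. apply Hd, Hi. }
  split; [exact lambda_nonzero|]. split.
  - rewrite <- (ev_6 0) by (rewrite Cmod_0; lra).
    apply Hin; [rewrite Cmod_0; lra|simpl; tauto].
  - intros w Hw. rewrite <- ev_13, <- ev_16, <- ev_22, <- ev_30, <- ev_34 by exact Hw.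
    repeat split; (apply Hin; [exact Hw|simpl; tauto]).
Qed.

End Semantics.

(** * Fixed points and hyperbolicity in the Banach space Y *)

Lemma Y_ext (x y : Y) : (forall b, pr b x = pr b y) -> x = y.
Proof.
  intros H. rewrite (surjective_pairing x), (surjective_pairing y).
  f_equal; [apply (H true)|apply (H false)].
Qed.

Lemma pr_zero b : pr b (zero : Y) = X_zero.
Proof. destruct b; reflexivity. Qed.

Lemma pr_opp b (x : Y) : pr b (opp x) = X_opp (pr b x).
Proof. destruct b; reflexivity. Qed.

Ltac Y_ring :=
  apply Y_ext; intros ?b;
  repeat rewrite ?pr_plus, ?pr_minus, ?pr_opp, ?pr_scal, ?pr_zero, ?X_scal_mul;
  ring.

Lemma Y_norm_pr (x : Y) : Y_norm x = X_norm (pr true x) + X_norm (pr false x).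
Proof. reflexivity. Qed.

Lemma Y_norm_plus (x y : Y) : Y_norm (plus x y) <= Y_norm x + Y_norm y.
Proof. apply Y_norm_triangle. Qed.

Lemma Y_norm_opp (x : Y) : Y_norm (opp x) = Y_norm x.
Proof. rewrite !Y_norm_pr, !pr_opp, !X_norm_opp. reflexivity. Qed.

Lemma Y_norm_minus (x y : Y) : Y_norm (minus x y) <= Y_norm x + Y_norm y.
Proof. rewrite <- (Y_norm_opp y). apply Y_norm_plus. Qed.

Lemma Y_norm_minus_sym (x y : Y) : Y_norm (minus x y) = Y_norm (minus y x).
Proof. rewrite <- Y_norm_opp. f_equal. Y_ring. Qed.

Lemma Y_minus_eq0 (x y : Y) : Y_norm (minus x y) = 0 -> x = y.
Proof.
  intros H. rewrite Y_norm_pr, !pr_minus in H.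
  generalize (X_norm_pos (X_minus (pr true x) (pr true y)))
             (X_norm_pos (X_minus (pr false x) (pr false y))); intros.
  apply Y_ext. intros [|]; apply X_minus_eq0; lra.
Qed.

Lemma Y_norm_scal' (c : R) (x : Y) : Y_norm (scal c x) = Rabs c * Y_norm x.
Proof. apply Y_norm_scal. Qed.

Lemma Y_norm_0 : Y_norm (zero : Y) = 0.
Proof. exact Y_norm_zero. Qed.

Definition mkY (f g : X) : Y := (f, g).

Lemma pr_mkY b f g : pr b (mkY f g) = if b then f else g.
Proof. destruct b; reflexivity. Qed.

(** ** Completeness and contractions *)

Lemma X_complete (u : nat -> X) (C kap : R) : 0 <= kap < 1 ->
  (forall n, X_norm (X_minus (u (S n)) (u n)) <= C * kap ^ n) ->
  exists l, forall n, X_norm (X_minus l (u n)) <= C * kap ^ n * / (1 - kap).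
Proof.
  intros Hk H.
  assert (HG : forall n, ex_series (fun k => C * kap ^ n * kap ^ k) /\
            Series (fun k => C * kap ^ n * kap ^ k) = C * kap ^ n * / (1 - kap)).
  { intros n. assert (G : is_series (fun k => kap ^ k) (/ (1 - kap))).
    { apply is_series_geom. rewrite Rabs_pos_eq; lra. }
    split.
    - apply @ex_series_scal. eexists; exact G.
    - rewrite Series_scal_l. f_equal. now apply is_series_unique. }
  assert (Hle : forall n k, Rabs (X_norm (X_minus (u (S (n + k))) (u (n + k)%nat)))
                 <= C * kap ^ n * kap ^ k).
  { intros n k. rewrite Rabs_pos_eq by apply X_norm_pos.
    rewrite Rmult_assoc, <- pow_add. apply H. }
  assert (Hex : forall n, ex_series (fun k => X_norm (X_minus (u (S (n + k))) (u (n + k)%nat)))).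
  { intros n. eapply ex_series_dominated; [apply (Hle n)|apply HG]. }
  (* The limit is the sum of the telescoping series; regrouped from index [n] on, its tail gives the
     error. *)
  exists (X_plus (u O) (X_sum (fun k => X_minus (u (S k)) (u k)))).
  intros n.
  assert (E : X_plus (u O) (X_sum (fun k => X_minus (u (S k)) (u k))) =
    X_plus (u n) (X_sum (fun k => X_minus (u (S (n + k))) (u (n + k)%nat)))).
  { induction n as [|n IH]; [reflexivity|]. rewrite IH.
    rewrite X_sum_shift by apply Hex. rewrite Nat.add_0_r.
    rewrite (X_sum_ext (fun k => X_minus (u (S (S n + k))) (u (S n + k)%nat))
               (fun k => X_minus (u (S (n + S k))) (u (n + S k)%nat))).
    - ring.
    - intros k. now rewrite Nat.add_succ_r. }
  rewrite E.
  replace (X_minus _ _) with (X_sum (fun k => X_minus (u (S (n + k))) (u (n + k)%nat))) by ring.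
  eapply Rle_trans; [apply X_norm_sum, Hex|].
  rewrite <- (proj2 (HG n)). apply Series_le; [|apply HG].
  intros k. split; [apply X_norm_pos|]. eapply Rle_trans; [apply Rle_abs|apply Hle].
Qed.

Lemma Y_complete (u : nat -> Y) (C kap : R) : 0 <= kap < 1 ->
  (forall n, Y_norm (minus (u (S n)) (u n)) <= C * kap ^ n) ->
  exists l : Y, forall n, Y_norm (minus l (u n)) <= 2 * C * kap ^ n * / (1 - kap).
Proof.
  intros Hk H.
  assert (Hb : forall b n, X_norm (X_minus (pr b (u (S n))) (pr b (u n))) <= C * kap ^ n).
  { intros b n. rewrite <- pr_minus. eapply Rle_trans; [apply pr_norm|apply H]. }
  destruct (X_complete (fun n => pr true (u n)) C kap Hk (Hb true)) as [l1 H1].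
  destruct (X_complete (fun n => pr false (u n)) C kap Hk (Hb false)) as [l2 H2].
  exists (mkY l1 l2). intros n. rewrite Y_norm_pr, !pr_minus, !pr_mkY.
  specialize (H1 n). specialize (H2 n). lra.
Qed.

Section Contraction.
Variable W : Type.
Variable d : W -> W -> R.
Variable P : W -> Prop.
Variables kap C0 : R.
Hypothesis Hkap : 0 <= kap < 1.
Hypothesis d_pos : forall x y, 0 <= d x y.
Hypothesis d_sym : forall x y, d x y = d y x.
Hypothesis d_tri : forall x y z, d x z <= d x y + d y z.
Hypothesis d_sep : forall x y, d x y = 0 -> x = y.
Hypothesis d_complete : forall (u : nat -> W) C,
  (forall n, d (u (S n)) (u n) <= C * kap ^ n) ->
  exists l, forall n, d l (u n) <= C0 * C * kap ^ n.
Hypothesis P_closed : forall l (u : nat -> W), (forall n, P (u n)) ->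
  (forall eps, 0 < eps -> exists n, d l (u n) < eps) -> P l.

(** Stated for an abstract distance because it serves both on [Y], for the fixed point, and on
    [Y * Y] with the sum norm, for the resolvent equation; only geometrically Cauchy sequences have
    to converge. *)
Lemma contraction_fixpoint (Phi : W -> W) (w0 : W) :
  P w0 -> (forall w, P w -> P (Phi w)) ->
  (forall w w', P w -> P w' -> d (Phi w) (Phi w') <= kap * d w w') ->
  exists w, P w /\ Phi w = w.
Proof.
  intros H0 HP Hc.
  set (u := fun n => Nat.iter n Phi w0).
  assert (Pu : forall n, P (u n)) by (induction n; simpl; auto).
  assert (Hu : forall n, d (u (S n)) (u n) <= d (u 1%nat) (u O) * kap ^ n).
  { induction n as [|n IH]; [simpl; lra|].
    change (u (S (S n))) with (Phi (u (S n))). change (u (S n)) with (Phi (u n)) at 2.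
    eapply Rle_trans; [apply Hc; apply Pu|]. simpl pow.
    assert (kap * d (u (S n)) (u n) <= kap * (d (u 1%nat) (u O) * kap ^ n))
      by (apply Rmult_le_compat_l; lra). lra. }
  destruct (d_complete u _ Hu) as [l Hl]. set (M := C0 * d (u 1%nat) (u O)) in *.
  assert (Hlim : forall eps, 0 < eps -> exists N, forall n, (N <= n)%nat -> d l (u n) < eps).
  { intros eps He.
    destruct (pow_lt_1_zero kap) with (y := eps / (Rabs M + 1)) as [N HN];
      [rewrite Rabs_pos_eq; lra|apply Rdiv_lt_0_compat; generalize (Rabs_pos M); lra|].
    exists N. intros n Hn. eapply Rle_lt_trans; [apply Hl|].
    specialize (HN n Hn). rewrite Rabs_pos_eq in HN by (apply pow_le; lra).
    assert (HM := Rabs_pos M).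
    apply Rle_lt_trans with ((Rabs M + 1) * kap ^ n).
    - apply Rmult_le_compat_r; [apply pow_le; lra|]. generalize (Rle_abs M); lra.
    - apply Rmult_lt_compat_l with (r := Rabs M + 1) in HN; [|lra].
      replace ((Rabs M + 1) * (eps / (Rabs M + 1))) with eps in HN by (field; lra). exact HN. }
  assert (Pl : P l).
  { apply (P_closed l u Pu). intros eps He. destruct (Hlim eps He) as [N HN].
    exists N. apply HN. lia. }
  exists l. split; [exact Pl|]. apply d_sep.
  destruct (Req_dec (d (Phi l) l) 0) as [E|E]; [exact E|exfalso].
  assert (Hp : 0 < d (Phi l) l) by (generalize (d_pos (Phi l) l); lra).
  destruct (Hlim (d (Phi l) l / 2)) as [N HN]; [lra|].
  assert (H1 := HN N ltac:(lia)). assert (H2 := HN (S N) ltac:(lia)).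
  change (u (S N)) with (Phi (u N)) in H2.
  assert (H3 := Hc l (u N) Pl (Pu N)). assert (H4 := d_tri (Phi l) (Phi (u N)) l).
  rewrite (d_sym (Phi (u N)) l) in H4. assert (0 <= d l (u N)) by apply d_pos.
  assert (kap * d l (u N) <= 1 * d l (u N)) by (apply Rmult_le_compat_r; lra). lra.
Qed.

End Contraction.

(** ** A mean value inequality *)

Lemma mean_value_inequality (H : Y -> Y) (dH : Y -> Y -> Y) (B : Y -> Prop) (M kap : R) :
  (forall x y c, B x -> B y -> 0 <= c <= 1 -> B (plus x (scal c (minus y x)))) ->
  (forall x y, B x -> B y ->
     Y_norm (minus (minus (H y) (H x)) (dH x (minus y x))) <= M * Y_norm (minus y x) ^ 2) ->
  (forall x h, B x -> Y_norm (dH x h) <= kap * Y_norm h) ->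
  forall x y, B x -> B y -> Y_norm (minus (H y) (H x)) <= kap * Y_norm (minus y x).
Proof.
  intros Hconv HM Hk x y Hx Hy. set (dd := minus y x). set (n := Y_norm dd).
  assert (Hn : 0 <= n) by apply Y_norm_pos.
  assert (Hstep : forall m : nat, (0 < m)%nat ->
    Y_norm (minus (H y) (H x)) <= kap * n + M * n ^ 2 / INR m).
  { intros m Hm. assert (Hm' : 0 < INR m) by (apply lt_0_INR, Hm).
    set (pt := fun i : nat => plus x (scal (INR i / INR m) dd)).
    assert (Bpt : forall i, (i <= m)%nat -> B (pt i)).
    { intros i Hi. apply Hconv; auto. apply le_INR in Hi.
      split; [apply Rmult_le_pos; [apply pos_INR|left; now apply Rinv_0_lt_compat]|].
      apply Rmult_le_reg_r with (INR m); [exact Hm'|].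
      unfold Rdiv. rewrite Rmult_assoc, Rinv_l; lra. }
    assert (Hd : forall i, minus (pt (S i)) (pt i) = scal (/ INR m) dd).
    { intros i. unfold pt. rewrite S_INR.
      replace ((INR i + 1) / INR m) with (INR i / INR m + / INR m) by (field; lra).
      apply Y_ext; intros b. rewrite ?pr_plus, ?pr_minus, ?pr_plus, ?pr_scal, ?X_scal_mul, X_const_plus.
      ring. }
    assert (Hi : forall i, (i <= m)%nat ->
      Y_norm (minus (H (pt i)) (H x)) <= INR i * (kap * (n / INR m) + M * (n / INR m) ^ 2)).
    { induction i as [|i IH]; intros Hi.
      - replace (pt O) with x.
        + replace (minus (H x) (H x)) with (zero : Y) by Y_ring.
          rewrite Y_norm_0. simpl. lra.
        + unfold pt. simpl INR. replace (0 / INR m) with 0 by (field; lra).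
          apply Y_ext; intros b. rewrite pr_plus, pr_scal, X_scal_mul, X_const_0. ring.
      - specialize (IH ltac:(lia)). rewrite S_INR, Rmult_plus_distr_r, Rmult_1_l.
        replace (minus (H (pt (S i))) (H x)) with
          (plus (minus (H (pt i)) (H x)) (minus (H (pt (S i))) (H (pt i)))) by Y_ring.
        eapply Rle_trans; [apply Y_norm_plus|]. apply Rplus_le_compat; [exact IH|].
        assert (B1 := Bpt i ltac:(lia)). assert (B2 := Bpt (S i) Hi).
        assert (Q := HM _ _ B1 B2). rewrite Hd in Q.
        assert (K := Hk (pt i) (scal (/ INR m) dd) B1).
        rewrite Y_norm_scal' in Q, K. fold n in Q, K.
        rewrite Rabs_pos_eq in Q, K by (left; now apply Rinv_0_lt_compat).
        replace (minus (H (pt (S i))) (H (pt i))) with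
          (plus (dH (pt i) (scal (/ INR m) dd))
             (minus (minus (H (pt (S i))) (H (pt i))) (dH (pt i) (scal (/ INR m) dd)))) by Y_ring.
        eapply Rle_trans; [apply Y_norm_plus|].
        replace (n / INR m) with (/ INR m * n) by (unfold Rdiv; ring). lra. }
    specialize (Hi m ltac:(lia)). replace (pt m) with y in Hi.
    - eapply Rle_trans; [exact Hi|]. right. field. lra.
    - unfold pt. replace (INR m / INR m) with 1 by (field; lra). unfold dd.
      apply Y_ext; intros b. rewrite pr_plus, pr_scal, pr_minus, X_scal_mul.
      fold X_one. ring. }
  apply Rnot_lt_le. intros Hlt.
  set (gap := Y_norm (minus (H y) (H x)) - kap * n) in *.
  assert (Hgap : 0 < gap) by (unfold gap; lra).
  destruct (archimed_cor1 (gap / (Rabs (M * n ^ 2) + 1))) as [m [Hm1 Hm2]].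
  { apply Rdiv_lt_0_compat; [exact Hgap|]. generalize (Rabs_pos (M * n ^ 2)); lra. }
  specialize (Hstep m Hm2).
  assert (Hm' : 0 < / INR m) by (apply Rinv_0_lt_compat, lt_0_INR, Hm2).
  assert (HZ := Rabs_pos (M * n ^ 2)). assert (HZ' := Rle_abs (M * n ^ 2)).
  set (Z := Rabs (M * n ^ 2)) in *.
  assert (M * n ^ 2 / INR m <= (Z + 1) * / INR m).
  { unfold Rdiv. apply Rmult_le_compat_r; lra. }
  assert ((Z + 1) * / INR m < gap).
  { apply Rmult_lt_compat_l with (r := Z + 1) in Hm1; [|lra].
    replace ((Z + 1) * (gap / (Z + 1))) with gap in Hm1 by (field; lra). exact Hm1. }
  unfold gap in *. lra.
Qed.

(** ** Bounding linear maps by their columns *)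

Definition basis (b : bool) (k : nat) : Y :=
  if b then mkY (X_pow X_var k) X_zero else mkY X_zero (X_pow X_var k).

(** In an l1 space the operator norm is the supremum of the column norms; separate constants for the
    two components keep the estimates of [Smat] sharper. *)
Lemma column_bound (L : Y -> Y) (kap : bool -> R) : is_linear L ->
  (forall b k, Y_norm (L (basis b k)) <= kap b) ->
  forall y, Y_norm (L y) <=
    kap true * X_norm (pr true y) + kap false * X_norm (pr false y).
Proof.
  intros HL Hk y. destruct (linear_norm L HL) as [M [HM HLM]].
  assert (Hb : forall (inj : X -> Y) (c0 : R),
    (forall x x', inj (X_plus x x') = plus (inj x) (inj x')) ->
    (forall c x, inj (X_scal c x) = scal c (inj x)) ->
    (forall x, Y_norm (inj x) = X_norm x) ->
    (forall k, Y_norm (L (inj (X_pow X_var k))) <= c0) ->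
    forall x, Y_norm (L (inj x)) <= c0 * X_norm x).
  { intros inj c0 Ip Is In Ik.
    apply (X_sublinear_bound (fun x => Y_norm (L (inj x))) c0).
    - split.
      + intros u v. rewrite Ip, (linear_plus L HL). apply Y_norm_plus.
      + exists M. intros x. eapply Rle_trans; [apply (HLM (inj x))|].
        change (norm (inj x)) with (Y_norm (inj x)). rewrite In. lra.
    - intros c k. rewrite Is, (linear_scal L HL), Y_norm_scal'.
      apply Rmult_le_compat_l; [apply Rabs_pos|apply Ik]. }
  assert (E1 := Hb (fun x => mkY x X_zero) (kap true)).
  assert (E2 := Hb (fun x => mkY X_zero x) (kap false)).
  replace y with (plus (mkY (pr true y) X_zero) (mkY X_zero (pr false y))) at 1.
  - rewrite (linear_plus L HL). eapply Rle_trans; [apply Y_norm_plus|].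
    apply Rplus_le_compat.
    + apply E1.
      * intros. apply Y_ext; intros b. rewrite pr_plus, !pr_mkY. destruct b; ring.
      * intros. apply Y_ext; intros b. rewrite pr_scal, !pr_mkY, !X_scal_mul. destruct b; ring.
      * intros. rewrite Y_norm_pr, !pr_mkY, X_norm_zero. ring.
      * intros k. apply (Hk true k).
    + apply E2.
      * intros. apply Y_ext; intros b. rewrite pr_plus, !pr_mkY. destruct b; ring.
      * intros. apply Y_ext; intros b. rewrite pr_scal, !pr_mkY, !X_scal_mul. destruct b; ring.
      * intros. rewrite Y_norm_pr, !pr_mkY, X_norm_zero. ring.
      * intros k. apply (Hk false k).
  - apply Y_ext; intros b. rewrite pr_plus, !pr_mkY. destruct b; ring.
Qed.

(** ** Diagonal operators *)

Definition X_had (m : nat -> R) (x : X) : X := X_of (fun k => m k * x k).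

Lemma X_had_spec (m : nat -> R) (M : R) (x : X) : (forall k, Rabs (m k) <= M) ->
  (forall k, X_had m x k = m k * x k) /\ X_norm (X_had m x) <= M * X_norm x.
Proof.
  intros Hm. apply X_of_norm. intros n.
  apply Rle_trans with (M * sum_f_R0 (fun k => Rabs (x k)) n).
  - rewrite scal_sum. apply sum_Rle. intros k _. rewrite Rabs_mult, Rmult_comm.
    apply Rmult_le_compat_l; [apply Rabs_pos|apply Hm].
  - apply Rmult_le_compat_l; [|apply partial_le_X_norm].
    eapply Rle_trans; [apply Rabs_pos|apply (Hm O)].
Qed.

Definition Y_had (m : bool -> nat -> R) (x : Y) : Y :=
  mkY (X_had (m true) (pr true x)) (X_had (m false) (pr false x)).

Lemma pr_had b m x : pr b (Y_had m x) = X_had (m b) (pr b x).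
Proof. unfold Y_had. rewrite pr_mkY. destruct b; reflexivity. Qed.

Lemma Y_coef_ext (x y : Y) : (forall b k, pr b x k = pr b y k) -> x = y.
Proof. intros H. apply Y_ext. intros b. apply X_ext. apply H. Qed.

Lemma pr_plus_coef b (x y : Y) k : pr b (plus x y) k = pr b x k + pr b y k.
Proof. now rewrite pr_plus. Qed.
Lemma pr_minus_coef b (x y : Y) k : pr b (minus x y) k = pr b x k - pr b y k.
Proof. rewrite pr_minus. simpl. ring. Qed.
Lemma pr_scal_coef b c (x : Y) k : pr b (scal c x) k = c * pr b x k.
Proof. now rewrite pr_scal. Qed.

Section Diagonal.
Variable m : bool -> nat -> R.
Variable M : R.
Hypothesis Hm : forall b k, Rabs (m b k) <= M.

Lemma Y_had_coef b x k : pr b (Y_had m x) k = m b k * pr b x k.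
Proof. rewrite pr_had. apply (X_had_spec _ M), Hm. Qed.

Lemma Y_norm_had x : Y_norm (Y_had m x) <= M * Y_norm x.
Proof.
  rewrite !Y_norm_pr, !pr_had.
  generalize (proj2 (X_had_spec (m true) M (pr true x) (Hm true)))
             (proj2 (X_had_spec (m false) M (pr false x) (Hm false))). lra.
Qed.

Lemma Y_had_linear : is_linear (Y_had m).
Proof.
  constructor.
  - intros x y. apply Y_coef_ext; intros b k.
    rewrite pr_plus_coef, !Y_had_coef, pr_plus_coef. ring.
  - intros c x. apply Y_coef_ext; intros b k.
    rewrite pr_scal_coef, !Y_had_coef, pr_scal_coef. ring.
  - exists (Rabs M + 1). split; [generalize (Rabs_pos M); lra|]. intros x.
    change (Y_norm (Y_had m x) <= (Rabs M + 1) * Y_norm x).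
    eapply Rle_trans; [apply Y_norm_had|]. apply Rmult_le_compat_r; [apply Y_norm_pos|].
    generalize (Rle_abs M); lra.
Qed.

End Diagonal.

Lemma linear_minus (L : Y -> Y) (x y : Y) : is_linear L -> L (minus x y) = minus (L x) (L y).
Proof. intros H. unfold minus. now rewrite (linear_plus L H), (linear_opp L y H). Qed.

Lemma Y_norm_tri (x y z : Y) :
  Y_norm (minus x z) <= Y_norm (minus x y) + Y_norm (minus y z).
Proof.
  replace (minus x z) with (plus (minus x y) (minus y z)) by Y_ring. apply Y_norm_plus.
Qed.

Lemma linear_bound (L : Y -> Y) : is_linear L ->
  exists M, 0 < M /\ forall x, Y_norm (L x) <= M * Y_norm x.
Proof. intros H. exact (linear_norm L H). Qed.

Record conjugation (S Q : Y -> Y) : Prop := {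
  conj_S : is_linear S;
  conj_Q : is_linear Q;
  conj_SQ : forall x, S (Q x) = x;
  conj_QS : forall x, Q (S x) = x
}.

(** * Operators close to a diagonal one *)

Section Newton.
Variables S Q : Y -> Y.
Hypothesis HSQ : conjugation S Q.
Variable m : bool -> nat -> R.
Variable Mm : R.
Hypothesis Hm : forall b k, Rabs (m b k) <= Mm.
(** Such entries have distance at least 1 from the point 1, as Newton's map requires, and from the
    whole unit circle, as the resolvent requires. *)
Hypothesis Hm2 : forall b k, m b k = 0 \/ 2 <= m b k.
Variable kap : R.

(** The Newton map for [T x = x] in the coordinates [S], with the derivative
    of [T] replaced by the diagonal operator [m]; its derivative is
    [- (m - 1)^{-1} (S DT Q - m)]. *)
Lemma newton_fixed_point (F : Y -> Y) (DF : Y -> Y -> Y) (B : Y -> Prop) (p0 : Y) (M r : R) :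
  0 <= kap < 1 -> 0 <= M -> 0 <= r ->
  (forall x : Y, Y_norm (minus x (S p0)) <= r -> B (Q x)) ->
  (forall p q, B p -> B q ->
     Y_norm (minus (minus (F q) (F p)) (DF p (minus q p))) <= M * Y_norm (minus q p) ^ 2) ->
  (forall p h, B p -> Y_norm (minus (S (DF p (Q h))) (Y_had m h)) <= kap * Y_norm h) ->
  Y_norm (S (minus (F p0) p0)) <= (1 - kap) * r ->
  exists p, B p /\ F p = p.
Proof.
  intros Hkap HM Hr HB HF HK H0. destruct HSQ as [LS LQ SQ QS].
  set (H := fun x : Y => minus (S (F (Q x))) (Y_had m x)).
  set (dH := fun x h : Y => minus (S (DF (Q x) (Q h))) (Y_had m h)).
  set (P := fun x : Y => Y_norm (minus x (S p0)) <= r).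
  destruct (linear_bound S LS) as [CS [CS0 HS]]. destruct (linear_bound Q LQ) as [CQ [CQ0 HQ]].
  assert (Hlip : forall x y : Y, P x -> P y ->
            Y_norm (minus (H y) (H x)) <= kap * Y_norm (minus y x)).
  { apply (mean_value_inequality H dH P (CS * (M * CQ ^ 2)) kap).
    - intros x y c Px Py Hc. unfold P in *.
      replace (minus (plus x (scal c (minus y x))) (S p0)) with
        (plus (scal (1 - c) (minus x (S p0))) (scal c (minus y (S p0)))).
      + eapply Rle_trans; [apply Y_norm_plus|]. rewrite !Y_norm_scal', !Rabs_pos_eq by lra.
        assert ((1 - c) * Y_norm (minus x (S p0)) <= (1 - c) * r)
          by (apply Rmult_le_compat_l; lra).
        assert (c * Y_norm (minus y (S p0)) <= c * r) by (apply Rmult_le_compat_l; lra). lra.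
      + apply Y_coef_ext; intros b k.
        rewrite !pr_plus_coef, !pr_minus_coef, !pr_plus_coef, !pr_scal_coef, !pr_minus_coef. ring.
    - intros x y Px Py. unfold H, dH.
      replace (minus (minus (minus (S (F (Q y))) (Y_had m y)) (minus (S (F (Q x))) (Y_had m x)))
                (minus (S (DF (Q x) (Q (minus y x)))) (Y_had m (minus y x))))
        with (S (minus (minus (F (Q y)) (F (Q x))) (DF (Q x) (minus (Q y) (Q x))))).
      + eapply Rle_trans; [apply HS|]. rewrite Rmult_assoc.
        apply Rmult_le_compat_l; [lra|].
        eapply Rle_trans; [apply HF; apply HB; assumption|]. rewrite Rmult_assoc.
        apply Rmult_le_compat_l; [exact HM|]. rewrite <- Rpow_mult_distr.
        apply pow_incr. split; [apply Y_norm_pos|]. rewrite <- linear_minus by exact LQ. apply HQ.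
      + rewrite !(linear_minus S), (linear_minus Q), (linear_minus (Y_had m))
          by (assumption || exact (Y_had_linear m Mm Hm)).
        rewrite <- (linear_minus Q) by assumption. Y_ring.
    - intros x h Px. apply HK, HB, Px. }
  (* All entries have modulus at most 1, so inverting [m - 1] does not enlarge the contraction
     constant. *)
  set (mi := fun b k => / (m b k - 1)).
  assert (Hmi : forall b k, Rabs (mi b k) <= 1).
  { intros b k. unfold mi. destruct (Hm2 b k) as [-> | H2].
    - replace (/ (0 - 1)) with (- (1)) by field. rewrite Rabs_Ropp, Rabs_R1. lra.
    - rewrite Rabs_inv, Rabs_pos_eq by lra. rewrite <- Rinv_1.
      apply Rinv_le_contravar; lra. }
  assert (Hm1 : forall b k, m b k - 1 <> 0).
  { intros b k. destruct (Hm2 b k); lra. }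
  (* [Phi x = x] reads [m x - S F Q x = (m - 1) x], that is [S F Q x = x]. *)
  set (Phi := fun x => opp (Y_had mi (H x))).
  assert (PhiL : forall x y : Y, P x -> P y ->
            Y_norm (minus (Phi y) (Phi x)) <= kap * Y_norm (minus y x)).
  { intros x y Px Py. unfold Phi.
    replace (minus (opp (Y_had mi (H y))) (opp (Y_had mi (H x))))
      with (opp (Y_had mi (minus (H y) (H x)))).
    - rewrite Y_norm_opp. eapply Rle_trans; [apply (Y_norm_had mi 1 Hmi)|].
      rewrite Rmult_1_l. now apply Hlip.
    - rewrite (linear_minus (Y_had mi)) by exact (Y_had_linear mi 1 Hmi). Y_ring. }
  assert (P0 : P (S p0)).
  { unfold P. replace (minus (S p0) (S p0)) with (zero : Y) by Y_ring. now rewrite Y_norm_0. }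
  assert (Phi0 : Y_norm (minus (Phi (S p0)) (S p0)) <= (1 - kap) * r).
  (* The first displacement is the residual at [p0], multiplied by entries of modulus at most 1. *)
  { replace (minus (Phi (S p0)) (S p0)) with (opp (Y_had mi (S (minus (F p0) p0)))).
    - rewrite Y_norm_opp. eapply Rle_trans; [apply (Y_norm_had mi 1 Hmi)|]. lra.
    - unfold Phi, H. rewrite QS. rewrite (linear_minus S) by exact LS.
      apply Y_coef_ext; intros b k.
      rewrite pr_opp, pr_minus_coef, pr_opp.
      change (- 1 * pr b (Y_had mi (minus (S (F p0)) (S p0))) k =
              - 1 * pr b (Y_had mi (minus (S (F p0)) (Y_had m (S p0)))) k - pr b (S p0) k).
      rewrite !(Y_had_coef mi 1 Hmi), !pr_minus_coef, (Y_had_coef m Mm Hm).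
      unfold mi. field. apply Hm1. }
  destruct (contraction_fixpoint Y (fun x y : Y => Y_norm (minus x y)) P kap (2 * / (1 - kap)))
    with (Phi := Phi) (w0 := S p0) as [x [Px Ex]].
  - exact Hkap.
  - intros; apply Y_norm_pos.
  - intros; apply Y_norm_minus_sym.
  - intros x y z. apply Y_norm_tri.
  - apply Y_minus_eq0.
  - intros u C Hu. destruct (Y_complete u C kap Hkap Hu) as [l Hl]. exists l. intros n.
    eapply Rle_trans; [apply Hl|]. right. ring.
  - intros l u Pu Hl. unfold P in *. cbv beta in *. apply Rnot_lt_le. intros Hlt.
    destruct (Hl (Y_norm (minus l (S p0)) - r)) as [n Hn]; [lra|]. specialize (Pu n).
    assert (N := Y_norm_tri l (u n) (S p0)). lra.
  - exact P0.
  - intros x Px. unfold P in *.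
    eapply Rle_trans; [apply (Y_norm_tri _ (Phi (S p0)))|].
    assert (L := PhiL _ _ P0 Px).
    assert (kap * Y_norm (minus x (S p0)) <= kap * r) by (apply Rmult_le_compat_l; lra). lra.
  - intros x y Px Py. now apply PhiL.
  - exists (Q x). split; [apply HB, Px|].
    assert (E : S (F (Q x)) = x).
    { apply Y_coef_ext; intros b k.
      assert (E1 : pr b (Phi x) k = pr b x k) by now rewrite Ex.
      unfold Phi in E1. rewrite pr_opp in E1.
      change (- 1 * pr b (Y_had mi (H x)) k = pr b x k) in E1.
      rewrite (Y_had_coef mi 1 Hmi) in E1. unfold H in E1.
      rewrite pr_minus_coef, (Y_had_coef m Mm Hm) in E1. unfold mi in E1.
      assert (Hn := Hm1 b k).
      apply (f_equal (Rmult (m b k - 1))) in E1.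
      replace ((m b k - 1) * (-1 * (/ (m b k - 1) * (pr b (S (F (Q x))) k - m b k * pr b x k))))
        with (m b k * pr b x k - pr b (S (F (Q x))) k) in E1 by (field; exact Hn).
      lra. }
    rewrite <- (QS (F (Q x))), E. reflexivity.
Qed.

(** ** No spectrum on the unit circle *)

Definition YY := prod_NormedModule R_AbsRing Y Y.

(** All estimates use the sum norm, in which entrywise bounds add up; the Euclidean product norm,
    equivalent to it, returns only for the continuity of the inverse. *)
Definition YY_norm (w : Y * Y) : R := Y_norm (fst w) + Y_norm (snd w).

Lemma YY_norm_norm (w : YY) : norm w <= YY_norm w /\ YY_norm w <= 2 * norm w.
Proof.
  assert (H1 := Y_norm_pos (fst w)). assert (H2 := Y_norm_pos (snd w)). unfold YY_norm.
  change (norm w) with (sqrt (Y_norm (fst w) ^ 2 + Y_norm (snd w) ^ 2)).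
  set (a := Y_norm (fst w)) in *. set (b := Y_norm (snd w)) in *. split.
  - apply Rle_trans with (sqrt ((a + b) ^ 2)).
    + apply sqrt_le_1_alt. nra.
    + rewrite sqrt_pow2; lra.
  - assert (Ha : a <= sqrt (a ^ 2 + b ^ 2)).
    { rewrite <- (sqrt_pow2 a) at 1 by lra. apply sqrt_le_1_alt. nra. }
    assert (Hb : b <= sqrt (a ^ 2 + b ^ 2)).
    { rewrite <- (sqrt_pow2 b) at 1 by lra. apply sqrt_le_1_alt. nra. }
    lra.
Qed.

Section Spectrum.
Variable A : Y -> Y.
Hypothesis LA : is_linear A.
Hypothesis HA : forall h, Y_norm (minus (S (A (Q h))) (Y_had m h)) <= kap * Y_norm h.
Hypothesis Hkap : 0 <= kap /\ kap * sqrt 2 < 1.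
Variable z : C.
Hypothesis Hz : Cmod z = 1.

Let a := Re z.
Let b := Im z.

Lemma circle_eq : a * a + b * b = 1.
Proof.
  unfold a, b. assert (H := Hz). unfold Cmod in H.
  assert (H' : sqrt (fst z ^ 2 + snd z ^ 2) ^ 2 = 1) by (rewrite H; ring).
  rewrite pow2_sqrt in H' by nra. unfold Re, Im. lra.
Qed.

(** Real part of [1 / (m - z)] with [z = a + i b]; [res_im] is the imaginary part. *)
Definition res_re (c : bool) (k : nat) : R :=
  (m c k - a) / ((m c k - a) * (m c k - a) + b * b).
Definition res_im (c : bool) (k : nat) : R :=
  b / ((m c k - a) * (m c k - a) + b * b).

(** The entry 0 has distance exactly 1 from [z]; an entry at least 2 exceeds the real part of [z] by
    at least 1. *)
Lemma resolvent_denominator c k : 1 <= (m c k - a) * (m c k - a) + b * b.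
Proof.
  assert (H := circle_eq). destruct (Hm2 c k) as [E|E].
  - rewrite E. lra.
  - assert (a <= 1) by nra. generalize (Rle_0_sqr b). unfold Rsqr. nra.
Qed.

(** Cauchy-Schwarz for the two parts of a number of modulus at most 1; this is where sqrt 2
    enters. *)
Lemma resolvent_l1 c k : Rabs (res_re c k) + Rabs (res_im c k) <= sqrt 2.
Proof.
  assert (H := resolvent_denominator c k). unfold res_re, res_im.
  set (x := m c k - a) in *. set (q := x * x + b * b) in *.
  unfold Rdiv. rewrite !Rabs_mult, Rabs_inv, (Rabs_pos_eq q) by lra.
  rewrite <- (sqrt_pow2 (Rabs x * / q + Rabs b * / q)).
  - apply sqrt_le_1_alt. rewrite <- Rmult_plus_distr_r, Rpow_mult_distr.
    assert (E : (Rabs x + Rabs b) ^ 2 <= 2 * q).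
    { unfold q. rewrite <- (Rsqr_def x), <- (Rsqr_def b), (Rsqr_abs x), (Rsqr_abs b).
      unfold Rsqr. generalize (Rle_0_sqr (Rabs x - Rabs b)). unfold Rsqr. nra. }
    apply Rmult_le_reg_r with (q ^ 2); [nra|].
    rewrite Rmult_assoc, <- Rpow_mult_distr, Rinv_l by lra.
    rewrite pow1, Rmult_1_r. nra.
  - apply Rplus_le_le_0_compat; apply Rmult_le_pos; auto using Rabs_pos;
      left; apply Rinv_0_lt_compat; lra.
Qed.

Lemma res_re_bound c k : Rabs (res_re c k) <= sqrt 2.
Proof. generalize (resolvent_l1 c k) (Rabs_pos (res_im c k)). lra. Qed.

Lemma res_im_bound c k : Rabs (res_im c k) <= sqrt 2.
Proof. generalize (resolvent_l1 c k) (Rabs_pos (res_re c k)). lra. Qed.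

(** The resolvent [(m - z)^{-1}] on the complexification. *)
Definition resolvent (w : Y * Y) : Y * Y :=
  (minus (Y_had res_re (fst w)) (Y_had res_im (snd w)),
   plus (Y_had res_re (snd w)) (Y_had res_im (fst w))).

Lemma X_norm_add_le (x y u v : X) (c : R) : 0 <= c ->
  (forall k, Rabs (x k) + Rabs (y k) <= c * (Rabs (u k) + Rabs (v k))) ->
  X_norm x + X_norm y <= c * (X_norm u + X_norm v).
Proof.
  intros Hc H. unfold X_norm.
  rewrite <- !Series_plus by apply coef_summable. rewrite <- Series_scal_l.
  apply Series_le.
  - intros k. split; [|apply H]. generalize (Rabs_pos (x k)) (Rabs_pos (y k)); lra.
  - apply @ex_series_scal, @ex_series_plus; apply coef_summable.
Qed.

Lemma resolvent_norm (w : Y * Y) : YY_norm (resolvent w) <= sqrt 2 * YY_norm w.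
Proof.
  unfold YY_norm, resolvent. cbn [fst snd]. rewrite !Y_norm_pr.
  assert (H : forall c, X_norm (pr c (minus (Y_had res_re (fst w)) (Y_had res_im (snd w)))) +
       X_norm (pr c (plus (Y_had res_re (snd w)) (Y_had res_im (fst w)))) <=
       sqrt 2 * (X_norm (pr c (fst w)) + X_norm (pr c (snd w)))).
  { intros c. apply X_norm_add_le; [apply sqrt_pos|]. intros k.
    rewrite pr_plus_coef, pr_minus_coef.
    rewrite !(Y_had_coef res_re _ res_re_bound), !(Y_had_coef res_im _ res_im_bound).
    assert (R1 := resolvent_l1 c k).
    set (x := pr c (fst w) k). set (y := pr c (snd w) k).
    set (al := res_re c k) in *. set (be := res_im c k) in *.
    assert (T1 : Rabs (al * x - be * y) <= Rabs al * Rabs x + Rabs be * Rabs y).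
    { unfold Rminus. eapply Rle_trans; [apply Rabs_triang|].
      rewrite Rabs_Ropp, !Rabs_mult. lra. }
    assert (T2 : Rabs (al * y + be * x) <= Rabs al * Rabs y + Rabs be * Rabs x).
    { eapply Rle_trans; [apply Rabs_triang|]. rewrite !Rabs_mult. lra. }
    assert (0 <= Rabs x + Rabs y) by (generalize (Rabs_pos x) (Rabs_pos y); lra).
    nra. }
  generalize (H true) (H false). lra.
Qed.

Lemma resolvent_unique (w c : Y * Y) :
  (w = resolvent c <->
   (minus (minus (Y_had m (fst w)) (scal a (fst w))) (fst c) = opp (scal b (snd w)) /\
    minus (minus (Y_had m (snd w)) (scal a (snd w))) (snd c) = scal b (fst w))).
Proof.
  assert (Hq : forall e k, (m e k - a) * (m e k - a) + b * b <> 0).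
  { intros e k. generalize (resolvent_denominator e k). lra. }
  assert (Po : forall e (x : Y) k, pr e (opp x) k = - pr e x k).
  { intros. rewrite pr_opp. simpl. ring. }
  split.
  - intros ->. unfold resolvent. cbn [fst snd]. split; apply Y_coef_ext; intros e k;
      rewrite ?Po, ?pr_minus_coef, ?(Y_had_coef m Mm Hm), ?pr_scal_coef, ?pr_minus_coef,
        ?pr_plus_coef, ?(Y_had_coef res_re _ res_re_bound), ?(Y_had_coef res_im _ res_im_bound);
      unfold res_re, res_im; field; apply Hq.
  - intros [E1 E2]. rewrite (surjective_pairing w). unfold resolvent.
    assert (F1 := fun e k => f_equal (fun x => pr e x k) E1).
    assert (F2 := fun e k => f_equal (fun x => pr e x k) E2). cbn beta in F1, F2.
    f_equal; apply Y_coef_ext; intros e k; specialize (F1 e k); specialize (F2 e k);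
      rewrite Po in F1; rewrite !pr_minus_coef, (Y_had_coef m Mm Hm), !pr_scal_coef in F1, F2;
      rewrite ?pr_minus_coef, ?pr_plus_coef, ?(Y_had_coef res_re _ res_re_bound),
        ?(Y_had_coef res_im _ res_im_bound);
      unfold res_re, res_im; set (x := m e k) in *;
      [replace (pr e (fst c) k) with ((x - a) * pr e (fst w) k + b * pr e (snd w) k) by lra;
       replace (pr e (snd c) k) with ((x - a) * pr e (snd w) k - b * pr e (fst w) k) by lra
      |replace (pr e (fst c) k) with ((x - a) * pr e (fst w) k + b * pr e (snd w) k) by lra;
       replace (pr e (snd c) k) with ((x - a) * pr e (snd w) k - b * pr e (fst w) k) by lra];
      field; apply Hq.
Qed.

Let E (h : Y) : Y := minus (S (A (Q h))) (Y_had m h).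
Let EE (w : Y * Y) : Y * Y := (E (fst w), E (snd w)).
Let SS (w : Y * Y) : Y * Y := (S (fst w), S (snd w)).
Let QQ (w : Y * Y) : Y * Y := (Q (fst w), Q (snd w)).
Let sub (w v : Y * Y) : Y * Y := (minus (fst w) (fst v), minus (snd w) (snd v)).

(** In the coordinates [S] the operator is [m + E], and [(m + E - z) w = c] is solved for the
    diagonal part. *)
Lemma spectral_equation (w c : Y * Y) :
  complexified_minus Y A z (QQ w) = QQ c <-> w = resolvent (sub c (EE w)).
Proof.
  destruct HSQ as [LS LQ SQ QS], w as [x y], c as [c1 c2].
  assert (HQQ : forall v v' : Y, Q v = Q v' <-> v = v').
  { intros v v'. split; [|now intros ->]. intros H. now rewrite <- (SQ v), <- (SQ v'), H. }
  rewrite resolvent_unique. unfold complexified_minus, QQ, sub, EE, E. cbn [fst snd].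
  fold a b.
  set (u := S (A (Q x))). set (v := S (A (Q y))).
  assert (F1 : plus (minus (A (Q x)) (scal a (Q x))) (scal b (Q y)) =
               Q (plus (minus u (scal a x)) (scal b y))).
  { rewrite (linear_plus Q LQ), (linear_minus Q _ _ LQ), !(linear_scal Q LQ).
    unfold u. now rewrite QS. }
  assert (F2 : minus (minus (A (Q y)) (scal b (Q x))) (scal a (Q y)) =
               Q (minus (minus v (scal b x)) (scal a y))).
  { rewrite !(linear_minus Q _ _ LQ), !(linear_scal Q LQ). unfold v. now rewrite QS. }
  rewrite F1, F2.
  split.
  - intros H. injection H as H1 H2. apply (proj1 (HQQ _ _)) in H1, H2. rewrite <- H1, <- H2.
    split; Y_ring.
  - intros [H1 H2].
    assert (G1 : c1 = plus (minus u (scal a x)) (scal b y)).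
    { transitivity (plus (minus u (scal a x))
         (opp (minus (minus (Y_had m x) (scal a x)) (minus (c1) (minus u (Y_had m x)))))).
      - Y_ring.
      - rewrite H1. Y_ring. }
    assert (G2 : c2 = minus (minus v (scal b x)) (scal a y)).
    { transitivity (minus (minus v (minus (minus (Y_had m y) (scal a y))
                     (minus (c2) (minus v (Y_had m y))))) (scal a y)).
      - Y_ring.
      - rewrite H2. reflexivity. }
    rewrite G1, G2. reflexivity.
Qed.

Lemma YY_norm_sub (w v : Y * Y) : YY_norm (sub w v) <= YY_norm w + YY_norm v.
Proof.
  unfold YY_norm, sub; cbn [fst snd].
  generalize (Y_norm_minus (fst w) (fst v)) (Y_norm_minus (snd w) (snd v)). lra.
Qed.

Lemma YY_norm_EE (w : Y * Y) : YY_norm (EE w) <= kap * YY_norm w.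
Proof. unfold YY_norm, EE, E; cbn [fst snd]. generalize (HA (fst w)) (HA (snd w)). lra. Qed.

Lemma YY_norm_pos (w : Y * Y) : 0 <= YY_norm w.
Proof. unfold YY_norm. generalize (Y_norm_pos (fst w)) (Y_norm_pos (snd w)). lra. Qed.

(** Absorb [E w] on the left, which is possible since [kap * sqrt 2 < 1]; this gives injectivity and
    continuity of the inverse. *)
Lemma spectral_bound (w c : Y * Y) : complexified_minus Y A z (QQ w) = QQ c ->
  YY_norm w <= sqrt 2 / (1 - kap * sqrt 2) * YY_norm c.
Proof.
  intros H. apply spectral_equation in H.
  assert (N : YY_norm w <= sqrt 2 * (YY_norm c + kap * YY_norm w)).
  { rewrite H at 1. eapply Rle_trans; [apply resolvent_norm|].
    apply Rmult_le_compat_l; [apply sqrt_pos|].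
    eapply Rle_trans; [apply YY_norm_sub|]. generalize (YY_norm_EE w). lra. }
  apply Rmult_le_reg_r with (1 - kap * sqrt 2); [lra|].
  replace (sqrt 2 / (1 - kap * sqrt 2) * YY_norm c * (1 - kap * sqrt 2))
    with (sqrt 2 * YY_norm c) by (field; lra).
  lra.
Qed.

Lemma linear_E : is_linear E.
Proof.
  destruct HSQ as [LS LQ SQ QS].
  assert (L1 : is_linear (fun h => S (A (Q h)))).
  { apply (is_linear_comp Q (fun h => S (A h))); [exact LQ|].
    apply (is_linear_comp A S); assumption. }
  assert (L2 := Y_had_linear m Mm Hm).
  constructor.
  - intros x y. unfold E. rewrite (linear_plus _ L1), (linear_plus _ L2). Y_ring.
  - intros c x. unfold E. rewrite (linear_scal _ L1), (linear_scal _ L2). Y_ring.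
  - exists (kap + 1). split; [lra|]. intros x.
    change (Y_norm (E x) <= (kap + 1) * Y_norm x).
    generalize (HA x) (Y_norm_pos x). unfold E. lra.
Qed.

Lemma resolvent_sub (w v : Y * Y) : resolvent (sub w v) = sub (resolvent w) (resolvent v).
Proof.
  unfold resolvent, sub. cbn [fst snd].
  rewrite !(linear_minus (Y_had res_re)), !(linear_minus (Y_had res_im))
    by (exact (Y_had_linear _ _ res_re_bound) || exact (Y_had_linear _ _ res_im_bound)).
  f_equal; Y_ring.
Qed.

(** The Neumann series in the form of a fixed point of [w -> resolvent (c - E w)]. *)
Lemma spectral_surjective (c : Y * Y) : exists w, complexified_minus Y A z (QQ w) = QQ c.
Proof.
  set (k2 := kap * sqrt 2). assert (Hk2 : 0 <= k2 < 1).
  { split; [apply Rmult_le_pos; [lra|apply sqrt_pos]|apply Hkap]. }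
  destruct (contraction_fixpoint (Y * Y) (fun x y => YY_norm (sub x y)) (fun _ => True) k2
              (4 * / (1 - k2))) with (Phi := fun w => resolvent (sub c (EE w)))
    (w0 := c) as [w [_ Hw]]; auto.
  - intros; apply YY_norm_pos.
  - intros x y. unfold YY_norm, sub; cbn [fst snd].
    now rewrite (Y_norm_minus_sym (fst x)), (Y_norm_minus_sym (snd x)).
  - intros x y v. unfold YY_norm, sub; cbn [fst snd].
    generalize (Y_norm_tri (fst x) (fst y) (fst v)) (Y_norm_tri (snd x) (snd y) (snd v)). lra.
  - intros x y. unfold YY_norm, sub; cbn [fst snd]. intros H.
    rewrite (surjective_pairing x), (surjective_pairing y).
    assert (H1 := Y_norm_pos (minus (fst x) (fst y))).
    assert (H2 := Y_norm_pos (minus (snd x) (snd y))).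
    f_equal; apply Y_minus_eq0; lra.
  - intros u C Hu. unfold YY_norm, sub in Hu; cbn [fst snd] in Hu.
    destruct (Y_complete (fun n => fst (u n)) C k2 Hk2) as [l1 Hl1].
    { intros n. generalize (Hu n) (Y_norm_pos (minus (snd (u (Datatypes.S n))) (snd (u n)))). lra. }
    destruct (Y_complete (fun n => snd (u n)) C k2 Hk2) as [l2 Hl2].
    { intros n. generalize (Hu n) (Y_norm_pos (minus (fst (u (Datatypes.S n))) (fst (u n)))). lra. }
    exists (l1, l2). intros n. unfold YY_norm, sub; cbn [fst snd].
    generalize (Hl1 n) (Hl2 n). lra.
  - intros x y _ _. rewrite <- resolvent_sub. 
    eapply Rle_trans; [apply resolvent_norm|].
    replace (sub (sub c (EE x)) (sub c (EE y))) with (EE (sub y x)).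
    + assert (YY_norm (sub y x) = YY_norm (sub x y)) as <-.
      { unfold YY_norm, sub; cbn [fst snd].
        now rewrite (Y_norm_minus_sym (fst x)), (Y_norm_minus_sym (snd x)). }
      unfold k2. rewrite (Rmult_comm kap), Rmult_assoc.
      apply Rmult_le_compat_l; [apply sqrt_pos|apply YY_norm_EE].
    + unfold EE, sub; cbn [fst snd].
      rewrite !(linear_minus E) by exact linear_E. f_equal; Y_ring.
  - exists w. apply spectral_equation. symmetry. exact Hw.
Qed.

Lemma not_in_spectrum : ~ in_spectrum Y A z.
Proof.
  intros Hspec. apply Hspec. clear Hspec. destruct HSQ as [LS LQ SQ QS].
  assert (QQSS : forall w, QQ (SS w) = w).
  { intros [x y]. unfold QQ, SS; cbn [fst snd]. now rewrite !QS. }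
  assert (Hsurj : forall c : Y * Y, exists w, complexified_minus Y A z w = c).
  { intros c. destruct (spectral_surjective (SS c)) as [w Hw].
    exists (QQ w). now rewrite Hw, QQSS. }
  (* The inverse is chosen pointwise; its linearity will follow from injectivity and its bound from
     [Hbelow]. *)
  set (Bi := fun c => proj1_sig (constructive_indefinite_description _ (Hsurj c))).
  assert (HBi : forall c, complexified_minus Y A z (Bi c) = c).
  { intros c. exact (proj2_sig (constructive_indefinite_description _ (Hsurj c))). }
  destruct (linear_bound S LS) as [CS [CS0 HS]]. destruct (linear_bound Q LQ) as [CQ [CQ0 HQ]].
  set (C1 := CQ * (sqrt 2 / (1 - kap * sqrt 2)) * CS).
  assert (Hr2 : 0 < sqrt 2 / (1 - kap * sqrt 2)).
  { apply Rdiv_lt_0_compat; [apply sqrt_lt_R0|]; lra. }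
  assert (Hbelow : forall w, YY_norm w <= C1 * YY_norm (complexified_minus Y A z w)).
  { intros w. set (c := complexified_minus Y A z w).
    assert (H : complexified_minus Y A z (QQ (SS w)) = QQ (SS c)) by now rewrite !QQSS.
    apply spectral_bound in H.
    assert (H1 : YY_norm w <= CQ * YY_norm (SS w)).
    { rewrite <- (QQSS w) at 1. unfold YY_norm, QQ; cbn [fst snd].
      generalize (HQ (fst (SS w))) (HQ (snd (SS w))). lra. }
    assert (H2 : YY_norm (SS c) <= CS * YY_norm c).
    { unfold YY_norm, SS; cbn [fst snd]. generalize (HS (fst c)) (HS (snd c)). lra. }
    eapply Rle_trans; [exact H1|]. unfold C1. rewrite !Rmult_assoc.
    apply Rmult_le_compat_l; [lra|]. eapply Rle_trans; [exact H|].
    apply Rmult_le_compat_l; [lra|exact H2]. }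
  assert (Lplus : forall x y : YY, complexified_minus Y A z (plus x y) =
             plus (complexified_minus Y A z x : YY) (complexified_minus Y A z y)).
  { intros [x1 x2] [y1 y2]. unfold complexified_minus. cbn [plus].
    change (plus ((x1, x2) : YY) (y1, y2)) with (plus x1 y1, plus x2 y2).
    cbv beta iota. rewrite !(linear_plus A LA).
    match goal with |- _ = plus (?u1, ?u2) (?v1, ?v2) =>
      change (plus ((u1, u2) : YY) (v1, v2)) with (plus u1 v1, plus u2 v2) end.
    f_equal; Y_ring. }
  assert (Lscal : forall k (x : YY), complexified_minus Y A z (scal k x) =
             scal k (complexified_minus Y A z x : YY)).
  { intros k [x1 x2].
    change (scal k ((x1, x2) : YY)) with (scal k x1, scal k x2).
    unfold complexified_minus. cbv beta iota. rewrite !(linear_scal A LA).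
    match goal with |- _ = scal k (?u1, ?u2) =>
      change (scal k ((u1, u2) : YY)) with (scal k u1, scal k u2) end.
    f_equal; Y_ring. }
  assert (Linj : forall x y : YY, complexified_minus Y A z x = complexified_minus Y A z y -> x = y).
  { intros x y Hxy.
    assert (H0 : YY_norm (plus x (scal (- (1)) y) : YY) <= 0).
    { eapply Rle_trans; [apply Hbelow|]. rewrite Lplus, Lscal, Hxy. right.
      destruct (complexified_minus Y A z y) as [c1 c2].
      change (C1 * YY_norm (plus c1 (scal (- (1)) c1), plus c2 (scal (- (1)) c2)) = 0).
      unfold YY_norm; cbn [fst snd].
      replace (plus c1 (scal (- (1)) c1)) with (zero : Y).
      2:{ apply Y_coef_ext; intros e k. rewrite pr_plus_coef, pr_scal_coef, pr_zero. simpl. ring. }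
      replace (plus c2 (scal (- (1)) c2)) with (zero : Y).
      2:{ apply Y_coef_ext; intros e k. rewrite pr_plus_coef, pr_scal_coef, pr_zero. simpl. ring. }
      rewrite Y_norm_0. ring. }
    destruct x as [x1 x2], y as [y1 y2].
    change (Y_norm (plus x1 (scal (- (1)) y1)) + Y_norm (plus x2 (scal (- (1)) y2)) <= 0) in H0.
    assert (M : forall u v : Y, plus u (scal (- (1)) v) = minus u v).
    { intros. apply Y_coef_ext; intros e k.
      rewrite pr_plus_coef, pr_scal_coef, pr_minus_coef. ring. }
    rewrite !M in H0.
    assert (P1 := Y_norm_pos (minus x1 y1)). assert (P2 := Y_norm_pos (minus x2 y2)).
    f_equal; apply Y_minus_eq0; lra. }
  exists Bi. split; [|split].
  - constructor.
    + intros x y. apply Linj. now rewrite Lplus, !HBi.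
    + intros k x. apply Linj. now rewrite Lscal, !HBi.
    + exists (2 * Rabs C1 + 1). split; [generalize (Rabs_pos C1); lra|]. intros x.
      destruct (YY_norm_norm (Bi x)) as [N1 _]. destruct (YY_norm_norm x) as [_ N2].
      assert (N3 := Hbelow (Bi x)). rewrite HBi in N3.
      assert (N4 : C1 * YY_norm x <= Rabs C1 * (2 * norm x)).
      { apply Rle_trans with (Rabs C1 * YY_norm x).
        - apply Rmult_le_compat_r; [apply YY_norm_pos|apply Rle_abs].
        - apply Rmult_le_compat_l; [apply Rabs_pos|exact N2]. }
      change (norm (Bi x : YY) <= (2 * Rabs C1 + 1) * norm (x : YY)).
      assert (N5 : 0 <= norm (x : YY)) by apply norm_ge_0.
      eapply Rle_trans; [exact N1|]. eapply Rle_trans; [exact N3|].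
      eapply Rle_trans; [exact N4|].
      change (Rabs C1 * (2 * norm (x : YY)) <= (2 * Rabs C1 + 1) * norm (x : YY)). lra.
  - intros x. apply Linj, HBi.
  - exact HBi.
Qed.

End Spectrum.
End Newton.

(** ** Compactness *)

Definition increasing_seq (sigma : nat -> nat) : Prop := forall n, (sigma n < sigma (S n))%nat.

Lemma increasing_seq_lt (sigma : nat -> nat) : increasing_seq sigma ->
  forall i j, (i < j)%nat -> (sigma i < sigma j)%nat.
Proof.
  intros H i j Hij. induction Hij as [|j Hij IH]; [apply H|].
  specialize (H j). lia.
Qed.

Lemma increasing_seq_ge (sigma : nat -> nat) : increasing_seq sigma ->
  forall n, (n <= sigma n)%nat.
Proof. intros H n. induction n as [|n IH]; [lia|]. specialize (H n). lia. Qed.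

Lemma increasing_seq_comp (s1 s2 : nat -> nat) :
  increasing_seq s1 -> increasing_seq s2 -> increasing_seq (fun n => s1 (s2 n)).
Proof. intros H1 H2 n. apply increasing_seq_lt; auto. Qed.

Lemma bounded_subsequence (v : nat -> R) : (forall n, -1 <= v n <= 1) ->
  exists tau, increasing_seq tau /\ exists l : R, is_lim_seq (fun n => v (tau n)) l.
Proof.
  intros Hv.
  destruct (Bolzano_Weierstrass v (fun x => -1 <= x <= 1)) as [l Hl];
    [apply compact_P3|exact Hv|].
  assert (Hp : forall N (n : nat), exists p, (N <= p)%nat /\ Rabs (v p - l) < / (INR n + 1)).
  { intros N n.
    assert (Hn : 0 < / (INR n + 1)).
    { apply Rinv_0_lt_compat. generalize (pos_INR n); lra. }
    destruct (Hl (disc l (mkposreal _ Hn)) N) as [p [Hp1 Hp2]].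
    - exists (mkposreal _ Hn). intros x Hx. exact Hx.
    - exists p. split; [exact Hp1|]. exact Hp2. }
  set (next := fun N n => proj1_sig (constructive_indefinite_description _ (Hp N n))).
  assert (Hnext : forall N n, (N <= next N n)%nat /\ Rabs (v (next N n) - l) < / (INR n + 1)).
  { intros N n. exact (proj2_sig (constructive_indefinite_description _ (Hp N n))). }
  (* Restarting the search after [tau k] makes the indices increase strictly. *)
  set (tau := fix tau n := match n with O => next O O | S k => next (S (tau k)) (S k) end).
  assert (Ht : increasing_seq tau).
  { intros n. simpl. destruct (Hnext (S (tau n)) (S n)). lia. }
  exists tau. split; [exact Ht|]. exists l.
  apply is_lim_seq_spec. intros eps.
  destruct (archimed_cor1 eps (cond_pos eps)) as [N [HN1 HN2]].
  exists N. intros n Hn.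
  assert (Hd : Rabs (v (tau n) - l) < / (INR n + 1)).
  { destruct n as [|n]; simpl tau; apply Hnext. }
  eapply Rlt_trans; [exact Hd|]. eapply Rle_lt_trans; [|exact HN1].
  apply Rinv_le_contravar; [apply lt_0_INR, HN2|]. apply le_INR in Hn. lra.
Qed.

Lemma diagonal_subsequence (u : nat -> nat -> R) : (forall j n, -1 <= u j n <= 1) ->
  exists sigma, increasing_seq sigma /\
    forall j, exists l : R, is_lim_seq (fun n => u j (sigma n)) l.
Proof.
  intros Hu.
  set (ext := fun j (psi : nat -> nat) => proj1_sig (constructive_indefinite_description _
     (bounded_subsequence (fun n => u j (psi n)) (fun n => Hu j (psi n))))).
  assert (Hext : forall j psi, increasing_seq (ext j psi) /\
     exists l : R, is_lim_seq (fun n => u j (psi (ext j psi n))) l).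
  { intros j psi. exact (proj2_sig (constructive_indefinite_description _
     (bounded_subsequence (fun n => u j (psi n)) (fun n => Hu j (psi n))))). }
  set (psi := fix psi j : nat -> nat :=
     match j with O => fun n => n | S k => fun n => psi k (ext k (psi k) n) end).
  assert (Hpsi : forall j, increasing_seq (psi j)).
  { induction j as [|j IH]; [intros n; simpl; lia|].
    apply (increasing_seq_comp (psi j) (ext j (psi j))); [exact IH|apply Hext]. }
  (* Later extractions refine earlier ones, so the diagonal is eventually a subsequence of each of
     them. *)
  assert (Hsub : forall i j, exists rho, increasing_seq rho /\
      forall n, psi (i + j)%nat n = psi j (rho n)).
  { induction i as [|i IH]; intros j.
    - exists (fun n => n). split; [intros n; lia|reflexivity].
    - destruct (IH j) as [rho [H1 H2]].
      exists (fun n => rho (ext (i + j)%nat (psi (i + j)%nat) n)). split.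
      + apply (increasing_seq_comp rho); [exact H1|apply Hext].
      + intros n. simpl. apply H2. }
  set (sigma := fun n => psi n n).
  exists sigma. split.
  - intros n. unfold sigma. simpl. apply increasing_seq_lt; [apply Hpsi|].
    destruct (Hext n (psi n)) as [H _]. generalize (increasing_seq_ge _ H (S n)). lia.
  - intros j. destruct (Hext j (psi j)) as [_ [l Hl]]. exists l.
    apply is_lim_seq_spec. apply is_lim_seq_spec in Hl. intros eps.
    (* Coordinate [j] converges along [psi (S j)], and the diagonal refines it from index [S j]
       on. *)
    destruct (Hl eps) as [N HN]. exists (max N (S j)). intros n Hn.
    destruct (Hsub (n - S j)%nat (S j)) as [rho [H1 H2]].
    replace (n - S j + S j)%nat with n in H2 by lia.
    unfold sigma. rewrite H2. simpl. apply HN.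
    generalize (increasing_seq_ge _ H1 n). lia.
Qed.

Definition low (K : nat) (b : bool) (k : nat) : R := if Nat.ltb k K then 1 else 0.
Definition high (K : nat) (b : bool) (k : nat) : R := if Nat.ltb k K then 0 else 1.

Lemma low_le_1 K b k : Rabs (low K b k) <= 1.
Proof. unfold low. destruct (Nat.ltb k K); rewrite ?Rabs_R1, ?Rabs_R0; lra. Qed.

Lemma high_le_1 K b k : Rabs (high K b k) <= 1.
Proof. unfold high. destruct (Nat.ltb k K); rewrite ?Rabs_R1, ?Rabs_R0; lra. Qed.

Lemma low_norm (K : nat) (h : Y) (dl : R) : 0 <= dl ->
  (forall b k, (k < K)%nat -> Rabs (pr b h k) <= dl) ->
  Y_norm (Y_had (low K) h) <= 2 * (INR K * dl).
Proof.
  intros Hd H.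
  assert (Hb : forall b, X_norm (pr b (Y_had (low K) h)) <= INR K * dl).
  { intros b. apply X_norm_le_partial. intros n.
    apply Rle_trans with (INR (min (S n) K) * dl).
    - induction n as [|n IH].
      + simpl sum_f_R0. rewrite (Y_had_coef _ 1 (low_le_1 K)). unfold low.
        destruct (Nat.ltb_spec 0 K) as [HK|HK].
        * rewrite Rmult_1_l. replace (min 1 K) with 1%nat by lia. simpl INR.
          specialize (H b O HK). lra.
        * replace (min 1 K) with 0%nat by lia. rewrite Rmult_0_l, Rabs_R0. simpl; lra.
      + simpl sum_f_R0. rewrite (Y_had_coef _ 1 (low_le_1 K)). unfold low at 2.
        destruct (Nat.ltb_spec (S n) K) as [HK|HK].
        * replace (min (S (S n)) K) with (S (min (S n) K)) by lia.
          rewrite S_INR, Rmult_1_l. specialize (H b (S n) HK). lra.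
        * replace (min (S (S n)) K) with (min (S n) K) by lia.
          rewrite Rmult_0_l, Rabs_R0. lra.
    - apply Rmult_le_compat_r; [exact Hd|]. apply le_INR. lia. }
  rewrite Y_norm_pr. generalize (Hb true) (Hb false). lra.
Qed.

(** Extract a subsequence converging in every coefficient. Its limit may fail to be a norm limit,
    but [A] sees only finitely many coefficients up to a small error. *)
Lemma compact_of_small_tails (A : Y -> Y) : is_linear A ->
  (forall eps, 0 < eps -> exists K, forall h, low_zero K h -> Y_norm (A h) <= eps * Y_norm h) ->
  compact_operator Y A.
Proof.
  intros LA HT. split; [exact LA|]. intros x Hx.
  change (forall n, Y_norm (x n) <= 1) in Hx.
  assert (Hc : forall b k n, Rabs (pr b (x n) k) <= 1).
  { intros b k n. eapply Rle_trans; [apply coef_le_norm|].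
    eapply Rle_trans; [apply pr_norm|apply Hx]. }
  (* Even indices enumerate the coefficients of the first component, odd ones those of the
     second. *)
  destruct (diagonal_subsequence (fun j n => pr (Nat.even j) (x n) (Nat.div2 j)))
    as [sigma [Hs Hl]].
  { intros j n. specialize (Hc (Nat.even j) (Nat.div2 j) n).
    apply Rabs_le_between in Hc. exact Hc. }
  assert (Hl' : forall b k, exists l : R, is_lim_seq (fun n => pr b (x (sigma n)) k) l).
  { intros b k.
    destruct (Hl (if b then (2 * k)%nat else (S (2 * k))%nat)) as [l H]. exists l.
    revert H. apply is_lim_seq_ext. intros n. destruct b.
    - rewrite Nat.even_mul, Nat.div2_double. reflexivity.
    - rewrite Nat.even_succ, Nat.div2_succ_double, Nat.odd_mul. reflexivity. }
  set (lim := fun b k => proj1_sig (constructive_indefinite_description _ (Hl' b k))).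
  assert (Hlim : forall b k, is_lim_seq (fun n => pr b (x (sigma n)) k) (lim b k)).
  { intros b k. exact (proj2_sig (constructive_indefinite_description _ (Hl' b k))). }
  (* Finite sums pass to the limit, so the coefficientwise limit is again summable. *)
  assert (Hpart : forall b n, sum_f_R0 (fun k => Rabs (lim b k)) n <= 1).
  { intros b n.
    assert (HL : is_lim_seq (fun i => sum_f_R0 (fun k => Rabs (pr b (x (sigma i)) k)) n)
              (sum_f_R0 (fun k => Rabs (lim b k)) n)).
    { induction n as [|n IH]; simpl.
      - apply (is_lim_seq_abs _ (lim b O)), Hlim.
      - apply (is_lim_seq_plus' _ _ _ _ IH). apply (is_lim_seq_abs _ (lim b (S n))), Hlim. }
    apply (is_lim_seq_le _ (fun _ => 1) _ 1) with (2 := HL) (3 := is_lim_seq_const 1).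
    intros i. eapply Rle_trans; [apply partial_le_X_norm|].
    eapply Rle_trans; [apply pr_norm|apply Hx]. }
  set (y := mkY (X_of (lim true)) (X_of (lim false))).
  assert (Hy : forall b k, pr b y k = lim b k).
  { intros b k. unfold y. rewrite pr_mkY. destruct b; apply (X_of_norm _ 1), Hpart. }
  assert (Hyn : Y_norm y <= 2).
  { rewrite Y_norm_pr. unfold y. rewrite !pr_mkY.
    generalize (proj2 (X_of_norm _ _ (Hpart true))) (proj2 (X_of_norm _ _ (Hpart false))). lra. }
  exists sigma, (A y). split; [exact Hs|].
  assert (Hconv : forall eps, 0 < eps ->
     exists N, forall n, (N <= n)%nat -> Y_norm (minus (A (x (sigma n))) (A y)) < eps).
  { intros eps He. destruct (HT (eps / 8) ltac:(lra)) as [K HK].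
    destruct (linear_bound A LA) as [M [HM HAM]].
    set (dl := eps / (4 * M * (INR K + 1))).
    assert (HK1 : 0 < INR K + 1) by (generalize (pos_INR K); lra).
    assert (Hd : 0 < dl).
    { unfold dl. apply Rdiv_lt_0_compat; [lra|]. apply Rmult_lt_0_compat; lra. }
    assert (Hco : forall L, exists N, forall n, (N <= n)%nat ->
        forall b k, (k < L)%nat -> Rabs (pr b (x (sigma n)) k - pr b y k) <= dl).
    { induction L as [|L [N IH]]; [exists O; intros; lia|].
      assert (H1 := Hlim true L). apply is_lim_seq_spec in H1.
      assert (H2 := Hlim false L). apply is_lim_seq_spec in H2.
      destruct (H1 (mkposreal dl Hd)) as [N1 G1]. destruct (H2 (mkposreal dl Hd)) as [N2 G2].
      exists (max N (max N1 N2)). intros n Hn b k Hk.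
      destruct (Nat.eq_dec k L) as [->|Hne].
      - rewrite Hy. left. destruct b; [apply G1|apply G2]; lia.
      - apply IH; lia. }
    destruct (Hco K) as [N HN]. exists N. intros n Hn. specialize (HN n Hn).
    rewrite <- linear_minus by exact LA.
    set (h := minus (x (sigma n)) y).
    assert (Hh : Y_norm h <= 3).
    { unfold h. eapply Rle_trans; [apply Y_norm_minus|]. specialize (Hx (sigma n)). lra. }
    replace h with (plus (Y_had (low K) h) (Y_had (high K) h)).
    2:{ apply Y_coef_ext; intros b k. rewrite pr_plus_coef.
        rewrite (Y_had_coef _ 1 (low_le_1 K)), (Y_had_coef _ 1 (high_le_1 K)).
        unfold low, high. destruct (Nat.ltb k K); ring. }
    rewrite (linear_plus A LA). eapply Rle_lt_trans; [apply Y_norm_plus|].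
    assert (L1 : Y_norm (Y_had (low K) h) <= 2 * (INR K * dl)).
    { apply low_norm; [lra|]. intros b k Hk. unfold h. rewrite pr_minus_coef. now apply HN. }
    assert (L2 : Y_norm (A (Y_had (high K) h)) <= eps / 8 * (1 * 3)).
    { eapply Rle_trans; [apply HK|].
      - intros b k Hk. rewrite (Y_had_coef _ 1 (high_le_1 K)). unfold high.
        destruct (Nat.ltb_spec k K); [ring|lia].
      - apply Rmult_le_compat_l; [lra|].
        eapply Rle_trans; [apply (Y_norm_had _ 1 (high_le_1 K))|]. lra. }
    assert (L3 : Y_norm (A (Y_had (low K) h)) <= M * (2 * (INR K * dl))).
    { eapply Rle_trans; [apply HAM|]. apply Rmult_le_compat_l; lra. }
    assert (L4 : M * (2 * (INR K * dl)) <= eps / 2).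
    { apply Rle_trans with (M * (2 * ((INR K + 1) * dl))).
      - apply Rmult_le_compat_l; [lra|]. apply Rmult_le_compat_l; [lra|].
        apply Rmult_le_compat_r; lra.
      - right. unfold dl. field. lra. }
    lra. }
  intros P [eps HP]. destruct (Hconv eps (cond_pos eps)) as [N HN].
  exists N. intros n Hn. apply HP. exact (HN n Hn).
Qed.

(** ** Differentiability of [T] *)

Section TDerivative.
Variable B : Y -> Prop.
Hypothesis H8 : smooth B (reg (run T_program nil) 21).
Hypothesis H37 : smooth B (reg (run T_program nil) 37).

Lemma X_tail_plus (x y : X) : X_tail (X_plus x y) = X_plus (X_tail x) (X_tail y).
Proof. apply X_ext; intros k; simpl. rewrite !X_tail_coef. reflexivity. Qed.

Lemma X_tail_scal c (x : X) : X_tail (X_scal c x) = X_scal c (X_tail x).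
Proof. apply X_ext; intros k; simpl. rewrite !X_tail_coef. reflexivity. Qed.

Lemma DTm_plus p h k : B p -> DTm p (plus h k) = plus (DTm p h) (DTm p k).
Proof.
  intros Hp. apply Y_ext; intros b. rewrite pr_plus. destruct b; unfold DTm; cbn [pr fst snd].
  - apply (smooth_plus B _ H8), Hp.
  - unfold der. rewrite (smooth_plus B _ H37) by exact Hp.
    rewrite X_tail_plus, !X_scal_mul. ring.
Qed.

Lemma DTm_scal p c h : B p -> DTm p (scal c h) = scal c (DTm p h).
Proof.
  intros Hp. apply Y_ext; intros b. rewrite pr_scal. destruct b; unfold DTm; cbn [pr fst snd].
  - apply (smooth_scal B _ H8), Hp.
  - unfold der. rewrite (smooth_scal B _ H37) by exact Hp.
    rewrite X_tail_scal, !X_scal_mul. ring.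
Qed.

Lemma T_pair_norm (x y : X) : Y_norm (mkY x (X_scal 2 (X_tail y))) <= X_norm x + 2 * X_norm y.
Proof.
  rewrite Y_norm_pr, !pr_mkY, X_norm_scal, Rabs_pos_eq by lra.
  generalize (X_norm_tail y). lra.
Qed.

Lemma Tm_quadratic : exists M, 0 <= M /\ forall p, B p ->
  (forall h, Y_norm (DTm p h) <= M * Y_norm h) /\
  (forall q, B q ->
     Y_norm (minus (minus (Tm q) (Tm p)) (DTm p (minus q p))) <= M * Y_norm (minus q p) ^ 2).
Proof.
  destruct (smooth_quadratic B _ H8) as [M1 [N1 Q1]].
  destruct (smooth_quadratic B _ H37) as [M2 [N2 Q2]].
  exists (M1 + 2 * M2). split; [lra|]. intros p Hp.
  destruct (Q1 p Hp) as (_ & D1 & C1), (Q2 p Hp) as (_ & D2 & C2). split.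
  - intros h. eapply Rle_trans; [apply T_pair_norm|].
    specialize (D1 h). specialize (D2 h). unfold der. lra.
  - intros q Hq. destruct (C1 q Hq) as [_ E1], (C2 q Hq) as [_ E2].
    replace (minus (minus (Tm q) (Tm p)) (DTm p (minus q p))) with
      (mkY (X_minus (X_minus (val q 21) (val p 21)) (der p (minus q p) 21))
           (X_scal 2 (X_tail (X_minus (X_minus (val q 37) (val p 37)) (der p (minus q p) 37))))).
    + eapply Rle_trans; [apply T_pair_norm|]. unfold val, der. lra.
    + apply Y_ext; intros b. rewrite pr_mkY, !pr_minus.
      destruct b; unfold Tm, DTm; cbn [pr fst snd]; [reflexivity|].
      unfold X_minus, X_opp. rewrite !X_tail_plus, !X_tail_scal, !X_scal_mul. ring.
Qed.

Lemma DTm_linear p : B p -> is_linear (DTm p).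
Proof.
  intros Hp. constructor.
  - intros. now apply DTm_plus.
  - intros. now apply DTm_scal.
  - destruct Tm_quadratic as [M [HM Q]]. exists (M + 1). split; [lra|]. intros h.
    change (Y_norm (DTm p h) <= (M + 1) * Y_norm h).
    generalize (proj1 (Q p Hp) h) (Y_norm_pos h). lra.
Qed.

Lemma DTm_compact p : B p -> compact_operator Y (DTm p).
Proof.
  intros Hp. apply compact_of_small_tails; [now apply DTm_linear|]. intros eps He.
  destruct (smooth_tail B _ H8 p (eps / 2) Hp ltac:(lra)) as [K1 G1].
  destruct (smooth_tail B _ H37 p (eps / 4) Hp ltac:(lra)) as [K2 G2].
  exists (max K1 K2). intros h Hh. eapply Rle_trans; [apply T_pair_norm|].
  specialize (G1 h (low_zero_mono _ _ _ (Nat.le_max_l _ _) Hh)).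
  specialize (G2 h (low_zero_mono _ _ _ (Nat.le_max_r _ _) Hh)).
  unfold der. lra.
Qed.

Lemma T_filterdiff (p : Y) (rho : R) : 0 < rho -> (forall q : Y, Y_norm (minus q p) < rho -> B q) ->
  (forall q, B q -> T_defined q) -> filterdiff T (locally p) (DTm p).
Proof.
  intros Hr HB HD.
  assert (Hp : B p).
  { apply HB. replace (minus p p) with (zero : Y) by Y_ring. now rewrite Y_norm_0. }
  split; [now apply DTm_linear|]. intros x Hx.
  apply is_filter_lim_locally_unique in Hx. subst x.
  destruct Tm_quadratic as [M [HM Q]].
  intros [eps He]. simpl.
  assert (Hd : 0 < Rmin rho (eps / (M + 1))).
  (* Within [rho] the quadratic remainder is available; within [eps / (M + 1)] it is at most [eps]
     times the distance. *)
  { apply Rmin_glb_lt; [exact Hr|]. apply Rdiv_lt_0_compat; lra. }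
  exists (mkposreal _ Hd). intros q Hq.
  change (Y_norm (minus q p) < Rmin rho (eps / (M + 1))) in Hq.
  assert (Hq1 := Rlt_le_trans _ _ _ Hq (Rmin_l _ _)).
  assert (Hq2 := Rlt_le_trans _ _ _ Hq (Rmin_r _ _)).
  assert (Bq : B q) by (apply HB, Hq1).
  rewrite (T_Tm p (HD p Hp)), (T_Tm q (HD q Bq)).
  change (Y_norm (minus (minus (Tm q) (Tm p)) (DTm p (minus q p))) <= eps * Y_norm (minus q p)).
  eapply Rle_trans; [apply (proj2 (Q p Hp) q Bq)|].
  assert (Hn := Y_norm_pos (minus q p)). set (n := Y_norm (minus q p)) in *.
  assert (M * n <= eps).
  { apply Rle_trans with ((M + 1) * n); [nra|].
    apply Rmult_lt_compat_l with (r := M + 1) in Hq2; [|lra].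
    replace ((M + 1) * (eps / (M + 1))) with eps in Hq2 by (field; lra). lra. }
  replace (M * n ^ 2) with (M * n * n) by ring. apply Rmult_le_compat_r; lra.
Qed.

End TDerivative.

(** * Coordinates adapted to the derivative *)

Definition vec : Type := (list Z * list Z)%type.
Definition vget (b : bool) (i : nat) (v : vec) : Z := nth i (if b then fst v else snd v) 0%Z.
Definition vadd (v w : vec) : vec := (padd (fst v) (fst w), padd (snd v) (snd w)).
Definition vscale (c : Z) (v : vec) : vec := (map (Z.mul c) (fst v), map (Z.mul c) (snd v)).
Definition vl1 (v : vec) : Z := (l1 (fst v) + l1 (snd v))%Z.
Definition yv (u : R) (v : vec) : Y := mkY (polu u (fst v)) (polu u (snd v)).

Lemma pr_yv b u v : pr b (yv u v) = polu u (if b then fst v else snd v).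
Proof. unfold yv. rewrite pr_mkY. destruct b; reflexivity. Qed.

Lemma yv_vadd u v w : yv u (vadd v w) = plus (yv u v) (yv u w).
Proof. apply Y_ext; intros b. rewrite pr_plus, !pr_yv. destruct b; apply polu_padd. Qed.

Lemma yv_vscale u u' c v : yv (u * u') (vscale c v) = scal (IZR c * u) (yv u' v).
Proof.
  apply Y_ext; intros b. rewrite pr_scal, !pr_yv, X_scal_mul.
  destruct b; simpl; apply polu_scale.
Qed.

Lemma Y_norm_yv u v : 0 <= u -> Y_norm (yv u v) <= IZR (vl1 v) * u.
Proof.
  intros Hu. rewrite Y_norm_pr, !pr_yv. unfold vl1. rewrite plus_IZR.
  generalize (X_norm_polu u (fst v) Hu) (X_norm_polu u (snd v) Hu). lra.
Qed.

Lemma polu_coef u (P : list Z) : forall k, polu u P k = IZR (nth k P 0%Z) * u.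
Proof.
  induction P as [|a P IH]; intros k; simpl.
  - destruct k; ring.
  - rewrite X_shift_mul, X_const_coef, X_shift_coef. destruct k as [|k]; [ring|].
    rewrite IH. ring.
Qed.

Lemma yv_coef b u v k : pr b (yv u v) k = IZR (vget b k v) * u.
Proof. rewrite pr_yv, polu_coef. reflexivity. Qed.

Lemma X_pow_var_coef k : forall j, X_pow X_var k j = if Nat.eqb j k then 1 else 0.
Proof.
  induction k as [|k IH]; intros j; simpl X_pow.
  - unfold X_one. rewrite X_const_coef. destruct j; reflexivity.
  - rewrite X_shift_mul, X_shift_coef. destruct j as [|j]; [reflexivity|]. apply IH.
Qed.

Lemma basis_coef b k c j : pr c (basis b k) j = if (Bool.eqb b c && Nat.eqb j k)%bool then 1 else 0.
Proof.
  unfold basis. destruct b, c; rewrite pr_mkY; cbn [Bool.eqb andb];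
    try apply X_pow_var_coef; reflexivity.
Qed.

Lemma basis_norm b k : Y_norm (basis b k) <= 1.
Proof.
  rewrite Y_norm_pr. unfold basis. destruct b; rewrite !pr_mkY, X_norm_zero;
    generalize (X_norm_pow_le_1 X_var k X_norm_var); lra.
Qed.

Definition zbasis (b : bool) (k : nat) : vec :=
  if b then (repeat 0%Z k ++ [1%Z], []) else ([], repeat 0%Z k ++ [1%Z]).

Lemma yv_zbasis b k : yv 1 (zbasis b k) = basis b k.
Proof.
  assert (H : polu 1 (repeat 0%Z k ++ [1%Z]) = X_pow X_var k).
  { induction k as [|k IH]; simpl.
    - rewrite Rmult_1_l. fold X_one. ring.
    - rewrite IH, Rmult_0_l, X_const_0. ring. }
  unfold yv, zbasis, basis. destruct b; cbn [fst snd]; rewrite H; reflexivity.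
Qed.

(** A rank one perturbation of the identity, which replaces the basis vector [(b, i)] by [e + c V]
    and fixes the others. *)
Definition shear (b : bool) (i : nat) (c : R) (V x : Y) : Y :=
  plus x (scal (c * pr b x i) V).

Lemma shear_linear b i c V : is_linear (shear b i c V).
Proof.
  unfold shear. constructor.
  - intros x y. apply Y_coef_ext; intros e k.
    repeat rewrite ?pr_plus_coef, ?pr_scal_coef. ring.
  - intros d x. apply Y_coef_ext; intros e k.
    repeat rewrite ?pr_plus_coef, ?pr_scal_coef. ring.
  - exists (1 + Rabs c * Y_norm V). split.
    + generalize (Rmult_le_pos _ _ (Rabs_pos c) (Y_norm_pos V)). lra.
    + intros x. change (Y_norm (plus x (scal (c * pr b x i) V)) <=
                        (1 + Rabs c * Y_norm V) * Y_norm x).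
      eapply Rle_trans; [apply Y_norm_plus|]. rewrite Y_norm_scal', Rabs_mult.
      assert (H : Rabs (pr b x i) <= Y_norm x).
      { eapply Rle_trans; [apply coef_le_norm|apply pr_norm]. }
      assert (0 <= Rabs c * Y_norm V) by (apply Rmult_le_pos; [apply Rabs_pos|apply Y_norm_pos]).
      generalize (Y_norm_pos x). nra.
Qed.

(** With the entry [1 - 1/c] at the pivot, the factor [1 + c V_i] equals [c], so the inverse has
    factor -1: both directions stay free of division. The basis vector goes to [c] times
    [V + e / c], an eigenvector normalized at the pivot. *)
Lemma shear_inverse b i c V x : c <> 0 -> pr b V i = 1 - / c ->
  shear b i (-1) V (shear b i c V x) = x /\ shear b i c V (shear b i (-1) V x) = x.
Proof.
  intros Hc HV. unfold shear.
  split; apply Y_coef_ext; intros e k;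
    repeat rewrite ?pr_plus_coef, ?pr_scal_coef; rewrite HV; field; exact Hc.
Qed.

Definition zshear (b : bool) (i : nat) (c wi : Z) (V x : vec) : vec :=
  vadd (vscale wi x) (vscale (c * vget b i x) V).

Lemma yv_zshear b i c wi w u V x : IZR wi * w = 1 ->
  yv (u * w) (zshear b i c wi V x) = shear b i (IZR c) (yv w V) (yv u x).
Proof.
  intros Hw. unfold zshear, shear. rewrite yv_vadd. f_equal.
  - rewrite (Rmult_comm u w), yv_vscale, Hw.
    apply Y_coef_ext; intros e k. rewrite pr_scal_coef. ring.
  - rewrite yv_vscale, yv_coef, mult_IZR. f_equal. ring.
Qed.

(** The coordinate [(b, i)], the exponent [k] of the weight and the vector [V]. *)
Definition pivot : Type := ((bool * nat * Z) * vec)%type.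

Definition pivot_precision : Z := 22.
Definition w : R := ulp pivot_precision.
Definition wi : Z := zone pivot_precision.

Lemma wi_w : IZR wi * w = 1.
Proof. apply one_ulp. unfold pivot_precision. lia. Qed.

Definition pivot_ok (K : nat) (v : pivot) : bool :=
  let '((b, i, k), V) := v in
  (Nat.ltb i K && Z.leb 0 k && Z.eqb (vget b i V * Z.shiftl 1 k) ((Z.shiftl 1 k - 1) * wi))%bool.

Definition to_shear (v : pivot) : Y -> Y :=
  let '((b, i, k), V) := v in shear b i (IZR (Z.shiftl 1 k)) (yv w V).
Definition un_shear (v : pivot) : Y -> Y :=
  let '((b, i, k), V) := v in shear b i (-1) (yv w V).

Definition to_zshear (v : pivot) : vec -> vec :=
  let '((b, i, k), V) := v in zshear b i (Z.shiftl 1 k) wi V.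
Definition un_zshear (v : pivot) : vec -> vec :=
  let '((b, i, k), V) := v in zshear b i (-1) wi V.

(** Scaling the second component alone changes the relative weight of the two components in the norm
    of the coordinates. *)
Definition weight (c : R) (b : bool) (k : nat) : R := if b then 1 else c.

Definition Qmap (l : list pivot) (x : Y) : Y :=
  fold_right to_shear (Y_had (weight 2) x) l.
Definition Smap (l : list pivot) (x : Y) : Y :=
  Y_had (weight (1 / 2)) (fold_left (fun y v => un_shear v y) l x).

Lemma weight_bound c b k : 0 <= c <= 2 -> Rabs (weight c b k) <= 2.
Proof. intros H. unfold weight. destruct b; rewrite Rabs_pos_eq; lra. Qed.

Lemma weight_2_bound b k : Rabs (weight 2 b k) <= 2.
Proof. apply weight_bound; lra. Qed.

Lemma weight_half_bound b k : Rabs (weight (1 / 2) b k) <= 2.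
Proof. apply weight_bound; lra. Qed.

Lemma shears_linear l (L : Y -> Y) : is_linear L ->
  is_linear (fun x => fold_right to_shear (L x) l) /\
  is_linear (fun x => fold_left (fun y v => un_shear v y) l (L x)).
Proof.
  revert L. induction l as [|[[[b i] k] V] l IH]; intros L HL; [split; exact HL|]. simpl. split.
  - apply (is_linear_comp (fun x => fold_right to_shear (L x) l)); [apply IH, HL|].
    apply shear_linear.
  - apply (IH (fun x => un_shear (b, i, k, V) (L x))).
    apply (is_linear_comp L (un_shear (b, i, k, V)) HL). apply shear_linear.
Qed.

(** The left and right folds apply the shears in opposite orders, so consecutive inverses cancel. *)
Lemma shears_inverse K l : forallb (pivot_ok K) l = true -> forall x,
  fold_left (fun y v => un_shear v y) l (fold_right to_shear x l) = x /\
  fold_right to_shear (fold_left (fun y v => un_shear v y) l x) l = x.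
Proof.
  induction l as [|v l IH]; intros H x; simpl in *; [split; reflexivity|].
  apply andb_prop in H. destruct H as [Hv H]. specialize (IH H).
  assert (E : forall y, un_shear v (to_shear v y) = y /\ to_shear v (un_shear v y) = y).
  { intros y. destruct v as [[[b i] k] V]. simpl in *.
    apply andb_prop in Hv. destruct Hv as [Hv1 Hv]. apply andb_prop in Hv1.
    destruct Hv1 as [_ Hk]. apply Z.leb_le in Hk. apply Z.eqb_eq in Hv.
    assert (Hp : 0 < IZR (Z.shiftl 1 k)) by exact (IZR_one_pos k Hk).
    apply shear_inverse; [lra|]. rewrite yv_coef.
    apply (f_equal IZR) in Hv. rewrite !mult_IZR, minus_IZR in Hv.
    assert (Ew := wi_w).
    apply Rmult_eq_reg_r with (IZR (Z.shiftl 1 k)); [|lra].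
    transitivity (IZR (vget b i V) * IZR (Z.shiftl 1 k) * w); [ring|]. rewrite Hv.
    transitivity ((IZR (Z.shiftl 1 k) - 1) * (IZR wi * w)); [ring|]. rewrite Ew. field. lra. }
  split.
  - rewrite (proj1 (E _)). apply IH.
  - rewrite (proj2 (IH _)). apply E.
Qed.

Lemma weight_inverse x :
  Y_had (weight (1 / 2)) (Y_had (weight 2) x) = x /\
  Y_had (weight 2) (Y_had (weight (1 / 2)) x) = x.
Proof.
  split; apply Y_coef_ext; intros b k;
    repeat rewrite ?(Y_had_coef _ 2 weight_half_bound), ?(Y_had_coef _ 2 weight_2_bound);
    unfold weight; destruct b; field.
Qed.

Lemma conjugation_pivots K l : forallb (pivot_ok K) l = true -> conjugation (Smap l) (Qmap l).
Proof.
  intros H. assert (L2 := Y_had_linear _ 2 weight_2_bound).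
  assert (Lh := Y_had_linear _ 2 weight_half_bound).
  constructor.
  - apply (is_linear_comp (fold_left (fun y v => un_shear v y) l)); [|exact Lh].
    apply (shears_linear l (fun x => x)), is_linear_id.
  - apply shears_linear, L2.
  - intros x. unfold Smap, Qmap. rewrite (proj1 (shears_inverse K l H _)). apply weight_inverse.
  - intros x. unfold Smap, Qmap. rewrite (proj2 (weight_inverse _)). apply (shears_inverse K l H).
Qed.

Definition zQ (l : list pivot) (x : vec) : vec :=
  fold_right to_zshear (fst x, map (Z.mul 2) (snd x)) l.
(** To stay in the integers, the second component is halved by doubling the first and halving the
    unit. *)
Definition zS (l : list pivot) (x : vec) : vec :=
  let y := fold_left (fun y v => un_zshear v y) l x in (map (Z.mul 2) (fst y), snd y).

Lemma polu_double u P : polu (u / 2) (map (Z.mul 2) P) = polu u P.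
Proof.
  replace (u / 2) with (/ 2 * u) by field. rewrite polu_scale.
  replace (2 * / 2) with 1 by field. fold X_one. ring.
Qed.

Lemma yv_zQ l u x : yv (u * w ^ length l) (zQ l x) = Qmap l (yv u x).
Proof.
  unfold zQ, Qmap.
  assert (E : yv u (fst x, map (Z.mul 2) (snd x)) = Y_had (weight 2) (yv u x)).
  { apply Y_coef_ext; intros b k. rewrite (Y_had_coef _ 2 weight_2_bound), !pr_yv.
    unfold weight. destruct b; cbn [fst snd]; [ring|].
    replace u with (1 * u) at 1 by ring. rewrite polu_scale, X_const_mul. simpl. ring. }
  induction l as [|[[[b i] k] V] l IH]; simpl.
  - rewrite Rmult_1_r. exact E.
  - replace (u * (w * w ^ length l)) with (u * w ^ length l * w) by ring.
    rewrite yv_zshear by apply wi_w. now rewrite IH.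
Qed.

Lemma yv_zS l u x : yv (u * w ^ length l / 2) (zS l x) = Smap l (yv u x).
Proof.
  unfold zS, Smap.
  assert (E : yv (u * w ^ length l) (fold_left (fun y v => un_zshear v y) l x) =
              fold_left (fun y v => un_shear v y) l (yv u x)).
  { revert u x. induction l as [|[[[b i] k] V] l IH]; intros u x; simpl.
    - now rewrite Rmult_1_r.
    - replace (u * (w * w ^ length l)) with (u * w * w ^ length l) by ring.
      rewrite IH, yv_zshear by apply wi_w. reflexivity. }
  rewrite <- E. set (y := fold_left (fun y v => un_zshear v y) l x).
  apply Y_coef_ext; intros b k. rewrite (Y_had_coef _ 2 weight_half_bound), !pr_yv.
  unfold weight. destruct b; cbn [fst snd].
  - rewrite polu_double. ring.
  - rewrite !polu_coef. field.
Qed.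

(** All pivots sit in degrees below [K], so the shears fix these vectors and only the weight
    acts. *)
Lemma maps_basis_tail K l b k : forallb (pivot_ok K) l = true -> (K <= k)%nat ->
  Qmap l (basis b k) = scal (weight 2 b k) (basis b k) /\
  Smap l (basis b k) = scal (weight (1 / 2) b k) (basis b k).
Proof.
  intros H Hk.
  assert (W : forall c x, 0 <= c <= 2 -> x = basis b k ->
      Y_had (weight c) x = scal (weight c b k) (basis b k)).
  { intros c x Hc ->. apply Y_coef_ext; intros e j.
    rewrite (Y_had_coef _ 2) by (intros; apply weight_bound, Hc).
    rewrite pr_scal_coef, basis_coef. unfold weight. destruct b, e; cbn [Bool.eqb andb]; ring. }
  assert (Z : forall v c, pivot_ok K v = true -> let '((e, i, _), V) := v in
      forall d, shear e i d (yv w V) (scal c (basis b k)) = scal c (basis b k)).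
  { intros [[[e i] q] V] c Hv d. simpl in Hv.
    apply andb_prop in Hv. destruct Hv as [Hv _]. apply andb_prop in Hv.
    destruct Hv as [Hi _]. apply Nat.ltb_lt in Hi.
    unfold shear. apply Y_coef_ext; intros e' j. rewrite pr_plus_coef, pr_scal_coef.
    rewrite (pr_scal_coef e c (basis b k) i), (basis_coef b k e i).
    destruct (Nat.eqb_spec i k); [lia|]. rewrite Bool.andb_false_r. rewrite pr_scal_coef. ring. }
  split.
  - unfold Qmap. rewrite (W 2) by (reflexivity || lra).
    set (c := weight 2 b k). clearbody c. induction l as [|v l IH]; [reflexivity|].
    simpl in *. apply andb_prop in H. destruct H as [Hv H]. rewrite IH by exact H.
    specialize (Z v c Hv). destruct v as [[[e i] q] V]. apply Z.
  - unfold Smap. apply W; [lra|].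
    replace (basis b k) with (scal 1 (basis b k)).
    2:{ apply Y_coef_ext; intros e j. rewrite pr_scal_coef. ring. }
    induction l as [|v l IH]; [reflexivity|].
    simpl in *. apply andb_prop in H. destruct H as [Hv H].
    specialize (Z v 1 Hv). destruct v as [[[e i] q] V]. simpl un_shear. rewrite Z. now apply IH.
Qed.

Lemma ulp_add a b : (0 <= a)%Z -> (0 <= b)%Z -> ulp (a + b) = ulp a * ulp b.
Proof.
  intros Ha Hb. unfold ulp, zone. rewrite !Z.shiftl_1_l, Z.pow_add_r, mult_IZR by assumption.
  apply Rinv_mult.
Qed.

(** * The numerical data *)

(** Coefficients of an approximate fixed point, in units of [2^-56]. *)
Definition center_f : list Z :=
   [-54183297823406768; -182659019588668736; 21484106356162260; 6508856342515974;
    -521684986389154; -63691075838398; 7660550033055; -29729070885; -78013799354;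
    5580834778; 755722710; -74640654; -7641774; 940153; 57530; -12563; -3; 142]%Z.

Definition center_g : list Z :=
   [449861979118853056; -153201740504931840; 11859417268063902; 3787728977128490;
    -1334684263681066; 233247852838299; -20403091095463; -2353043946914; 1277524608478;
    -238655249237; 18791541143; 2224771291; -973676998; 153351231; -8109533; -2157988;
    653715; -79662]%Z.

(** Three approximate eigenvectors of the derivative at the fixed point, for the
    eigenvalues [23.365], [12.112] and [0.540], after elimination of the previous
    pivots; in units of [2^-22]. *)
Definition pivots : list pivot :=
  [ ((true, 0%nat, 7%Z),
     ([4161536; 3921447; -2403876; -855872; 112463; 14785; -2370; 30; 32; -3],
      [-15016805; 13152152; -1545144; -796819; 348408; -73200; 7307; 1080; -629; 129;
      -11]));
    ((true, 1%nat, 6%Z),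
     ([31141; 4128768; -1550420; -733616; 84127; 12816; -1911; 11; 26; -2],
      [-14320679; 11235016; -1203147; -690276; 293394; -60871; 5903; 949; -529; 107;
      -9]));
    ((false, 1%nat, 5%Z),
     ([828; -2109; 274363; -81846; -10834; 3584; 67; -60; 3; 1],
      [-4293852; 4063232; -977965; -63491; 85367; -25361; 4118; -112; -143; 44; -6])) ]%Z.

(** * Rigorous bounds *)

Definition center : Y := yv (ulp 56) (center_f, center_g).

(** Componentwise, because the ball arithmetic encloses the two components separately. *)
Definition near_center (p : Y) : Prop :=
  forall b, X_norm (X_minus (pr b p) (pr b center)) <= ulp 24.

Definition bdouble_tail (b : ball_t) : ball_t := (map (Z.mul 2) (tl (fst b)), 2 * snd b)%Z.

Lemma polu_tl u P : polu u (tl P) = X_tail (polu u P).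
Proof.
  apply X_ext; intros k. rewrite X_tail_coef, !polu_coef. destruct P; [|reflexivity].
  destruct k; reflexivity.
Qed.

Lemma enc_bdouble_tail u b x : enc u b x -> enc u (bdouble_tail b) (X_scal 2 (X_tail x)).
Proof.
  unfold enc, bdouble_tail; cbn [fst snd]. intros H.
  replace (polu u (map (Z.mul 2) (tl (fst b)))) with (X_scal 2 (X_tail (polu u (fst b)))).
  - replace (X_minus _ _) with (X_scal 2 (X_tail (X_minus x (polu u (fst b))))).
    + rewrite X_norm_scal, Rabs_pos_eq, mult_IZR by lra.
      generalize (X_norm_tail (X_minus x (polu u (fst b)))). lra.
    + unfold X_minus, X_opp. rewrite !X_tail_plus, !X_tail_scal, !X_scal_mul. ring.
  - rewrite <- polu_tl. replace u with (1 * u) at 2 by ring.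
    rewrite polu_scale, Rmult_1_r, X_const_mul. reflexivity.
Qed.

(** Both the number of coefficients kept in the derivative runs and the number of columns per
    component checked one by one. *)
Definition K : nat := 11.
Definition pivot_columns : list (bool * nat) :=
  map (fun k => (true, k)) (seq 0 K) ++ map (fun k => (false, k)) (seq 0 K).

Lemma in_pivot_columns b k : (k < K)%nat -> In (b, k) pivot_columns.
Proof.
  intros H. unfold pivot_columns. apply in_app_iff.
  assert (Hk : In k (seq 0 K)) by (apply in_seq; lia).
  destruct b; [left|right]; now apply (in_map (fun k => (_, k))).
Qed.

Definition Smat : Y -> Y := Smap pivots.
Definition Qmat : Y -> Y := Qmap pivots.

(** Eight times the column bounds 11/8 and 7/8 of [Smat] for the two components. *)
Definition S_norm8 (b : bool) : Z := if b then 11%Z else 7%Z.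
Definition Q_norm : Z := 1296.

Definition check_coordinates : bool :=
  (forallb (pivot_ok K) pivots &&
   forallb (fun c => let '(b, k) := c in
     Z.leb (8 * vl1 (zS pivots (zbasis b k))) (S_norm8 b * Z.shiftl 1 67) &&
     Z.leb (vl1 (zQ pivots (zbasis b k))) (Q_norm * Z.shiftl 1 66)) pivot_columns)%bool.

Lemma check_coordinates_true : check_coordinates = true.
Proof. vm_compute. reflexivity. Qed.

Lemma pivots_ok : forallb (pivot_ok K) pivots = true.
Proof. apply (proj1 (andb_prop _ _ check_coordinates_true)). Qed.

Lemma conjugation_S_Q : conjugation Smat Qmat.
Proof. apply (conjugation_pivots K), pivots_ok. Qed.

Lemma w_pow : w ^ length pivots = ulp 66.
Proof.
  change (length pivots) with 3%nat. change 66%Z with (22 + (22 + 22))%Z.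
  rewrite !ulp_add by lia. unfold w, pivot_precision. ring.
Qed.

Lemma ulp_1 : ulp 1 = 1 / 2.
Proof. unfold ulp, zone. simpl. field. Qed.

Lemma ulp_half u : (0 <= u)%Z -> ulp u * w ^ length pivots / 2 = ulp (u + 67).
Proof.
  intros H. rewrite w_pow. replace (u + 67)%Z with (u + (66 + 1))%Z by lia.
  rewrite !ulp_add by lia. rewrite ulp_1. field.
Qed.

Lemma ulp_shiftl a b : (0 <= a)%Z -> (0 <= b)%Z -> IZR (Z.shiftl 1 b) * ulp (a + b) = ulp a.
Proof.
  intros Ha Hb. rewrite ulp_add by assumption.
  transitivity (ulp a * (IZR (zone b) * ulp b)); [unfold zone; ring|].
  rewrite one_ulp by assumption. ring.
Qed.

Lemma column_checks b k : (k < K)%nat ->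
  (8 * vl1 (zS pivots (zbasis b k)) <= S_norm8 b * Z.shiftl 1 67)%Z /\
  (vl1 (zQ pivots (zbasis b k)) <= Q_norm * Z.shiftl 1 66)%Z.
Proof.
  intros Hk. assert (H := proj2 (andb_prop _ _ check_coordinates_true)).
  rewrite forallb_forall in H. specialize (H _ (in_pivot_columns b k Hk)).
  cbv beta iota in H. apply andb_prop in H. destruct H as [H1 H2].
  apply Z.leb_le in H1, H2. now split.
Qed.

Lemma S_bound y : Y_norm (Smat y) <=
  11 / 8 * X_norm (pr true y) + 7 / 8 * X_norm (pr false y).
Proof.
  apply (column_bound Smat (fun b => if b then 11 / 8 else 7 / 8)); [apply conjugation_S_Q|].
  intros b k. destruct (Nat.lt_ge_cases k K) as [Hk|Hk].
  - rewrite <- yv_zbasis. unfold Smat. rewrite <- yv_zS.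
    replace (1 * w ^ length pivots / 2) with (ulp 67).
    2:{ rewrite w_pow. change 67%Z with (66 + 1)%Z. rewrite ulp_add, ulp_1 by lia. field. }
    assert (U := ulp_pos 67 ltac:(lia)).
    eapply Rle_trans; [apply Y_norm_yv; lra|].
    destruct (column_checks b k Hk) as [H _]. apply IZR_le in H. rewrite !mult_IZR in H.
    assert (E := ulp_shiftl 0 67 ltac:(lia) ltac:(lia)). rewrite Z.add_0_l in E.
    assert (E0 : ulp 0 = 1) by (unfold ulp, zone; simpl; field). rewrite E0 in E.
    set (c := IZR (vl1 (zS pivots (zbasis b k)))) in *. set (M := IZR (Z.shiftl 1 67)) in *.
    apply Rle_trans with (IZR (S_norm8 b) / 8 * (M * ulp 67)).
    + replace (IZR (S_norm8 b) / 8 * (M * ulp 67)) with (IZR (S_norm8 b) * M / 8 * ulp 67) by field.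
      apply Rmult_le_compat_r; lra.
    + rewrite E. destruct b; simpl; lra.
  - unfold Smat. rewrite (proj2 (maps_basis_tail K pivots b k pivots_ok Hk)), Y_norm_scal'.
    assert (H := basis_norm b k). assert (H0 := Y_norm_pos (basis b k)).
    unfold weight. destruct b; rewrite Rabs_pos_eq by lra; lra.
Qed.

Lemma Q_bound y : Y_norm (Qmat y) <= IZR Q_norm * Y_norm y.
Proof.
  rewrite (Y_norm_pr y), Rmult_plus_distr_l.
  apply (column_bound Qmat (fun b => IZR Q_norm)); [apply conjugation_S_Q|].
  intros b k. destruct (Nat.lt_ge_cases k K) as [Hk|Hk].
  - rewrite <- yv_zbasis. unfold Qmat. rewrite <- yv_zQ, Rmult_1_l, w_pow.
    assert (U := ulp_pos 66 ltac:(lia)).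
    eapply Rle_trans; [apply Y_norm_yv; lra|].
    destruct (column_checks b k Hk) as [_ H]. apply IZR_le in H. rewrite mult_IZR in H.
    assert (E := ulp_shiftl 0 66 ltac:(lia) ltac:(lia)). rewrite Z.add_0_l in E.
    assert (E0 : ulp 0 = 1) by (unfold ulp, zone; simpl; field). rewrite E0 in E.
    rewrite <- (Rmult_1_r (IZR Q_norm)), <- E, <- Rmult_assoc.
    apply Rmult_le_compat_r; lra.
  - unfold Qmat. rewrite (proj1 (maps_basis_tail K pivots b k pivots_ok Hk)), Y_norm_scal'.
    assert (H := basis_norm b k). assert (H0 := Y_norm_pos (basis b k)).
    unfold weight, Q_norm. destruct b; rewrite Rabs_pos_eq by lra; lra.
Qed.

(** ** The residual at the center *)

Definition T_ball (env : list ball_t) : ball_t * ball_t :=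
  (breg env 21, bdouble_tail (breg env 37)).

(** The inequality says that the residual in the new coordinates is at most [(11/32) 2^-25 / 1296],
    in units of [2^-123]; a radius in units of [2^-56], times 11/8 or 7/8, becomes 11 or 7 times
    [2^64]. *)
Definition check_center : bool :=
  match annotate 56 18 (center_f, 0%Z) (center_g, 0%Z) T_program [] with
  | None => false
  | Some ann =>
      let (yf, yg) := T_ball (map (fun x => fst (snd x)) ann) in
      let z := zS pivots (vadd (fst yf, fst yg) (map Z.opp center_f, map Z.opp center_g)) in
      Z.leb (8 * Q_norm * (vl1 z + (S_norm8 true * snd yf + S_norm8 false * snd yg)
                                     * Z.shiftl 1 64))
            (11 * Z.shiftl 1 96)
  end.

Lemma check_center_true : check_center = true.
Proof. vm_compute. reflexivity. Qed.

(** [Smat] acts exactly on the centre, in units of [2^-(prec+67)], and by its norm on the radius.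
    The offset [v] is there to subtract a diagonal entry before norms are taken. *)
Lemma S_enclosure (prec : Z) (yf yg : ball_t) (y : Y) (v : vec) (N : Z) : (0 <= prec)%Z ->
  enc (ulp prec) yf (pr true y) -> enc (ulp prec) yg (pr false y) ->
  (vl1 (vadd (zS pivots (fst yf, fst yg)) v)
     + (S_norm8 true * snd yf + S_norm8 false * snd yg) * Z.shiftl 1 64 <= N)%Z ->
  Y_norm (plus (Smat y) (yv (ulp (prec + 67)) v)) <= IZR N * ulp (prec + 67).
Proof.
  intros Hp Hf Hg HN. destruct conjugation_S_Q as [LS _ _ _].
  set (yc := yv (ulp prec) (fst yf, fst yg)).
  replace (plus (Smat y) (yv (ulp (prec + 67)) v)) with
    (plus (yv (ulp (prec + 67)) (vadd (zS pivots (fst yf, fst yg)) v)) (Smat (minus y yc))).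
  2:{ rewrite yv_vadd, (linear_minus Smat) by exact LS.
      rewrite <- (ulp_half prec) at 1 by exact Hp. rewrite yv_zS. fold Smat. fold yc. Y_ring. }
  assert (U := ulp_pos (prec + 67) ltac:(lia)).
  eapply Rle_trans; [apply Y_norm_plus|].
  eapply Rle_trans; [apply Rplus_le_compat; [apply Y_norm_yv; lra|apply S_bound]|].
  rewrite !pr_minus. unfold yc. rewrite !pr_yv. cbn [fst snd]. unfold enc in Hf, Hg.
  apply IZR_le in HN. rewrite plus_IZR, mult_IZR, plus_IZR, !mult_IZR in HN. cbn [S_norm8] in HN.
  assert (E : ulp prec = 8 * IZR (Z.shiftl 1 64) * ulp (prec + 67)).
  { rewrite <- (ulp_shiftl prec 67) by lia. f_equal.
    rewrite <- mult_IZR. f_equal. }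
  set (M := IZR (Z.shiftl 1 64)) in *.
  assert (Hu : forall a, a * ulp prec = 8 * (a * M * ulp (prec + 67))).
  { intros a. rewrite E at 1. ring. }
  rewrite Hu in Hf, Hg.
  set (c := IZR (vl1 (vadd (zS pivots (fst yf, fst yg)) v))) in *.
  set (u := ulp (prec + 67)) in *.
  apply Rle_trans with ((c + (11 * IZR (snd yf) + 7 * IZR (snd yg)) * M) * u); [lra|].
  apply Rmult_le_compat_r; lra.
Qed.

Lemma yv_nil u : yv u ([], []) = zero.
Proof. apply Y_ext; intros [|]; reflexivity. Qed.

Lemma Forall2_reg (R1 : dfun -> ball_t -> Prop) env benv i :
  Forall2 R1 env benv -> R1 dfun_zero (nil, 0%Z) -> R1 (reg env i) (breg benv i).
Proof.
  intros H H0. revert i. unfold reg, breg.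
  induction H as [|f b env benv Hf H IH]; intros [|i]; simpl; auto.
Qed.

Lemma enc_exact u P : enc u (P, 0%Z) (polu u P).
Proof.
  unfold enc. cbn [fst snd]. replace (X_minus _ _) with X_zero by ring.
  rewrite X_norm_zero. lra.
Qed.

Strategy opaque [annotate trun zS zQ].

Lemma center_residual :
  Y_norm (Smat (minus (Tm center) center)) <= (1 - 21 / 32) * (ulp 25 / IZR Q_norm).
Proof.
  assert (H := check_center_true). unfold check_center in H.
  destruct (annotate 56 18 (center_f, 0%Z) (center_g, 0%Z) T_program []) as [ann|] eqn:Ha;
    [|discriminate].
  set (env := map (fun x => fst (snd x)) ann) in H. unfold T_ball in H.
  assert (HV : Forall2 (value_ok 56 (fun p => p = center)) (run T_program []) ([] ++ env)).
  { apply (annotate_sound 56 18 (center_f, 0%Z) (center_g, 0%Z)) with (5 := Ha).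
    - lia.
    - intros p b ->. unfold center. rewrite pr_yv. destruct b; apply enc_exact.
    - intros [|]; simpl; lia.
    - constructor. }
  simpl app in HV.
  assert (HR : forall i, enc (ulp 56) (breg env i) (val center i)).
  { intros i. apply (Forall2_reg _ _ _ i HV); [|reflexivity].
    split; [apply smooth_zero|]. intros; apply enc_zero. }
  set (yf := breg env 21) in *. set (yg := bdouble_tail (breg env 37)) in *.
  set (z := zS pivots (vadd (fst yf, fst yg) (map Z.opp center_f, map Z.opp center_g))) in H.
  apply Z.leb_le in H.
  set (bf := badd yf (map Z.opp center_f, 0%Z)). set (bg := badd yg (map Z.opp center_g, 0%Z)).
  assert (E1 : enc (ulp 56) bf (pr true (minus (Tm center) center))).
  { rewrite pr_minus. apply (enc_badd (ulp 56)); [apply (HR 21%nat)|].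
    change (map Z.opp center_f, 0%Z) with (bopp (center_f, 0%Z)). apply enc_bopp.
    unfold center. rewrite pr_yv. apply enc_exact. }
  assert (E2 : enc (ulp 56) bg (pr false (minus (Tm center) center))).
  { rewrite pr_minus. apply (enc_badd (ulp 56)); [apply enc_bdouble_tail, (HR 37%nat)|].
    change (map Z.opp center_g, 0%Z) with (bopp (center_g, 0%Z)). apply enc_bopp.
    unfold center. rewrite pr_yv. apply enc_exact. }
  assert (G := S_enclosure 56 bf bg _ ([], [])
     (vl1 z + (S_norm8 true * snd yf + S_norm8 false * snd yg) * Z.shiftl 1 64)%Z
     ltac:(lia) E1 E2).
  replace (plus _ _) with (Smat (minus (Tm center) center)) in G.
  2:{ rewrite yv_nil. Y_ring. }
  (* Adding the empty vector is the identity, but reduces only after a case split on the two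
     lists. *)
  assert (G' := G ltac:(
    unfold bf, bg; cbn [fst snd badd]; rewrite !Z.add_0_r;
    replace (vadd (zS pivots (padd (fst yf) (map Z.opp center_f),
                padd (fst yg) (map Z.opp center_g))) ([], [])) with z;
    [lia|unfold z, vadd; cbn [fst snd];
     match goal with |- ?a = (padd (fst ?a) [], padd (snd ?a) []) =>
       destruct a as [[|? ?] [|? ?]]; reflexivity end])).
  clear G. eapply Rle_trans; [exact G'|].
  set (n := (vl1 z + (S_norm8 true * snd yf + S_norm8 false * snd yg) * Z.shiftl 1 64)%Z) in *.
  apply IZR_le in H. rewrite !mult_IZR in H.
  assert (E := ulp_shiftl 27 96 ltac:(lia) ltac:(lia)).
  change (27 + 96)%Z with (56 + 67)%Z in E.
  replace (ulp 25) with (4 * ulp 27) by (unfold ulp, zone; simpl; field). rewrite <- E.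
  assert (U := ulp_pos (56 + 67) ltac:(lia)). set (u := ulp (56 + 67)) in *.
  set (M := IZR (Z.shiftl 1 96)) in *. unfold Q_norm in *.
  replace ((1 - 21 / 32) * (4 * (M * u) / 1296)) with (11 * M / (8 * 1296) * u) by field.
  apply Rmult_le_compat_r; lra.
Qed.

(** ** The derivative near the center *)

(** The centre cut to [K] coefficients and rounded by 26 bits, from [2^-56] to [2^-30]. The radius
    contains the discarded part and [2^32] units of [2^-56], the radius of [near_center]. *)
Definition data30 (b : bool) : ball_t :=
  let P := if b then center_f else center_g in
  let F := map (fun a => Z.shiftr a 26) (firstn K P) in
  (F, ((l1 (padd P (map (Z.mul (- Z.shiftl 1 26)) F)) + Z.shiftl 1 32) / Z.shiftl 1 26 + 1)%Z).

Lemma data30_sound p b : near_center p -> enc (ulp 30) (data30 b) (pr b p).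
Proof.
  intros Hp. specialize (Hp b). unfold enc, data30. cbn [fst snd].
  set (P := if b then center_f else center_g).
  set (F := map (fun a => Z.shiftr a 26) (firstn K P)).
  set (n := (l1 (padd P (map (Z.mul (- Z.shiftl 1 26)) F)) + Z.shiftl 1 32)%Z).
  assert (HP : pr b center = polu (ulp 56) P) by (unfold center, P; rewrite pr_yv; destruct b; reflexivity).
  assert (U := ulp_pos 56 ltac:(lia)).
  assert (E1 := ulp_shiftl 30 26 ltac:(lia) ltac:(lia)). change (30 + 26)%Z with 56%Z in E1.
  assert (E2 := ulp_shiftl 24 32 ltac:(lia) ltac:(lia)). change (24 + 32)%Z with 56%Z in E2.
  assert (HF : X_minus (polu (ulp 56) P) (polu (ulp 30) F) =
               polu (ulp 56) (padd P (map (Z.mul (- Z.shiftl 1 26)) F))).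
  { rewrite polu_padd. replace (ulp 56) with (ulp 56 * 1) at 3 by ring. rewrite polu_scale.
    rewrite opp_IZR.
    assert (H1 : polu (ulp 30) F = X_mul (X_const (ulp 30)) (polu 1 F)).
    { replace (ulp 30) with (ulp 30 * 1) at 1 by ring.
      clear. induction F as [|a F IH]; simpl; [ring|]. rewrite IH.
      replace (IZR a * (ulp 30 * 1)) with (ulp 30 * (IZR a * 1)) by ring.
      rewrite X_const_times. ring. }
    rewrite H1, <- E1.
    replace (- IZR (Z.shiftl 1 26) * ulp 56) with (- (IZR (Z.shiftl 1 26) * ulp 56)) by ring.
    rewrite X_const_opp. ring. }
  replace (X_minus (pr b p) (polu (ulp 30) F)) with
    (X_plus (X_minus (pr b p) (pr b center)) (X_minus (polu (ulp 56) P) (polu (ulp 30) F)))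
    by (rewrite HP; ring).
  eapply Rle_trans; [apply X_norm_triangle|]. rewrite HF.
  assert (HN := X_norm_polu (ulp 56) (padd P (map (Z.mul (- Z.shiftl 1 26)) F)) ltac:(lra)).
  apply Rle_trans with (IZR n * ulp 56).
  { unfold n. rewrite plus_IZR, Rmult_plus_distr_r, E2. lra. }
  rewrite <- E1, <- Rmult_assoc. apply Rmult_le_compat_r; [lra|].
  rewrite <- mult_IZR. apply IZR_le.
  assert (Hm : (0 < Z.shiftl 1 26)%Z) by reflexivity.
  assert (HZ : (n < Z.shiftl 1 26 * Z.succ (n / Z.shiftl 1 26))%Z) by (apply Z.mul_succ_div_gt; lia).
  unfold Z.succ in HZ. lia.
Qed.

(** Eight times the diagonal approximation of the derivative. *)
Definition mu8 (b : bool) (k : nat) : Z :=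
  match b, k with true, O => 187 | true, 1%nat => 97 | _, _ => 0 end%Z.

(** Only the two expanding directions get an entry; the direction of the eigenvalue 0.540 counts as
    error, since 0.540 is below 21/32. *)
Definition mu (b : bool) (k : nat) : R := IZR (mu8 b k) / 8.

Lemma mu_bound b k : Rabs (mu b k) <= 24.
Proof. unfold mu, mu8. destruct b, k as [|[|k]]; rewrite Rabs_pos_eq; lra. Qed.

Lemma mu_gap b k : mu b k = 0 \/ 2 <= mu b k.
Proof. unfold mu, mu8. destruct b, k as [|[|k]]; lra. Qed.

(** A column of [Qmat], exact in units of [2^-66], rounded by 36 bits; each of at most [K]
    coefficients loses at most one unit. *)
Definition column_direction (b : bool) (k : nat) (c : bool) : ball_t * Z :=
  let q := zQ pivots (zbasis b k) in
  ((map (fun a => Z.shiftr a 36) (if c then fst q else snd q), Z.of_nat K), 0%Z).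

(** Centre zero and a part of norm at most 2 in degrees [>= K]: this contains all columns beyond
    [K], whose weight is 1 or 2. *)
Definition tail_direction (b c : bool) : ball_t * Z :=
  ((nil, 0%Z), if Bool.eqb b c then Z.shiftl 1 31 else 0%Z).

Definition check_column (ann : list (instr * (ball_t * aux_t)))
    (D : bool -> ball_t * Z) (v : vec) : bool :=
  (forallb (fun c => Nat.leb (length (fst (fst (D c)))) K) [true; false] &&
   let (yf, yg) := T_ball (trun 30 K (D true) (D false) ann [] []) in
   Z.leb (vl1 (vadd (zS pivots (fst yf, fst yg)) v)
            + (S_norm8 true * snd yf + S_norm8 false * snd yg) * Z.shiftl 1 64)
         (21 * Z.shiftl 1 92))%bool.

(** Minus the diagonal entry in units of [2^-97]: an eighth is [2^94] units. *)
Definition column_offset (b : bool) (k : nat) : vec :=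
  vscale (- mu8 b k * Z.shiftl 1 94) (zbasis b k).

Definition check_derivative : bool :=
  match annotate 30 K (data30 true) (data30 false) T_program [] with
  | None => false
  | Some ann =>
      let env := map (fun x => fst (snd x)) ann in
      forallb (fun i => Z.ltb (tot (breg env i)) (Z.shiftl 1 30))
              [0; 6; 13; 16; 22; 30; 34]%nat &&
      Z.ltb 0 (Z.abs (hd 0%Z (fst (breg env 8))) - snd (breg env 8)) &&
      forallb (fun c => let '(b, k) := c in
                 check_column ann (column_direction b k) (column_offset b k)) pivot_columns &&
      forallb (fun b => check_column ann (tail_direction b) ([], [])) [true; false]
  end%bool.

Lemma check_derivative_true : check_derivative = true.
Proof. vm_compute. reflexivity. Qed.

Lemma data30_length b : (length (fst (data30 b)) <= K)%nat.
Proof. unfold data30. cbn [fst]. rewrite length_map. apply firstn_le_length. Qed.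

(** The computed check unpacked as statements about one abstract annotated program, shared by all
    enclosures that follow. *)
Record derivative_facts (ann : list (instr * (ball_t * aux_t))) : Prop := {
  df_ann : annotate 30 K (data30 true) (data30 false) T_program [] = Some ann;
  df_comp : forall i, In i [0; 6; 13; 16; 22; 30; 34]%nat ->
    (tot (breg (map (fun x => fst (snd x)) ann) i) < Z.shiftl 1 30)%Z;
  df_lambda : (0 < Z.abs (hd 0%Z (fst (breg (map (fun x => fst (snd x)) ann) 8)))
                 - snd (breg (map (fun x => fst (snd x)) ann) 8))%Z;
  df_column : forall b k, (k < K)%nat ->
    check_column ann (column_direction b k) (column_offset b k) = true;
  df_tail : forall b, check_column ann (tail_direction b) ([], []) = true
}.

Lemma derivative_facts_hold : exists ann, derivative_facts ann.
Proof.
  assert (H := check_derivative_true). unfold check_derivative in H.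
  destruct (annotate 30 K (data30 true) (data30 false) T_program []) as [ann|] eqn:Ha;
    [|discriminate].
  exists ann. cbv zeta in H. apply andb_prop in H. destruct H as [H H4].
  apply andb_prop in H. destruct H as [H H3]. apply andb_prop in H. destruct H as [H1 H2].
  rewrite forallb_forall in H1, H3, H4.
  constructor.
  - exact Ha.
  - intros i Hi. apply Z.ltb_lt, H1, Hi.
  - apply Z.ltb_lt, H2.
  - intros b k Hk. exact (H3 _ (in_pivot_columns b k Hk)).
  - intros b. apply H4. destruct b; simpl; tauto.
Qed.

Lemma near_center_values ann : derivative_facts ann ->
  Forall2 (value_ok 30 near_center) (run T_program []) (map (fun x => fst (snd x)) ann).
Proof.
  intros H.
  apply (annotate_sound 30 K (data30 true) (data30 false)) with (env := []) (benv := []).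
  - lia.
  - intros p b Hp. destruct b; apply data30_sound, Hp.
  - intros b. destruct b; apply data30_length.
  - constructor.
  - apply H.
Qed.

Lemma near_center_smooth i : smooth near_center (reg (run T_program []) i).
Proof.
  destruct derivative_facts_hold as [ann H].
  apply (Forall2_reg (value_ok 30 near_center) _ _ i (near_center_values ann H)).
  split; [apply smooth_zero|]. intros; apply enc_zero.
Qed.

Lemma near_center_defined p : near_center p -> T_defined p.
Proof.
  intros Hp. destruct derivative_facts_hold as [ann H].
  assert (HV := near_center_values ann H).
  set (env := map (fun x => fst (snd x)) ann) in *.
  assert (HR : forall i, enc (ulp 30) (breg env i) (val p i)).
  { intros i. apply (Forall2_reg _ _ _ i HV); [|exact Hp].
    split; [apply smooth_zero|]. intros; apply enc_zero. }
  assert (U := ulp_pos 30 ltac:(lia)). split.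
  - intros i Hi. assert (Ht := enc_tot (ulp 30) _ _ ltac:(lra) (HR i)).
    eapply Rle_lt_trans; [exact Ht|].
    rewrite <- (one_ulp 30) by lia. apply Rmult_lt_compat_r; [lra|].
    apply IZR_lt, (df_comp ann H i Hi).
  - intros E. assert (H0 := enc_coef_0 _ _ _ (HR 8%nat)). rewrite E in H0.
    assert (HL := df_lambda ann H). fold env in HL. apply IZR_lt in HL.
    rewrite minus_IZR, abs_IZR in HL.
    set (c := IZR (hd 0%Z (fst (breg env 8)))) in *.
    unfold Rminus in H0. rewrite Rplus_0_l, Rabs_Ropp, Rabs_mult, (Rabs_pos_eq (ulp 30)) in H0 by lra.
    nra.
Qed.

Lemma tangent_bound ann D v p h : derivative_facts ann -> near_center p ->
  (forall c, enc_tail 30 K (D c) (pr c h)) -> check_column ann D v = true ->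
  Y_norm (plus (Smat (DTm p h)) (yv (ulp 97) v)) <= 21 / 32.
Proof.
  intros H Hp HD HC. unfold check_column in HC. apply andb_prop in HC. destruct HC as [HL HC].
  rewrite forallb_forall in HL.
  assert (HT : Forall2 (tangent_ok 30 p h) (run T_program [])
             (trun 30 K (D true) (D false) ann [] [])).
  { apply (trun_sound 30 K (data30 true) (data30 false)) with (B := near_center).
    - lia.
    - intros q b Hq. destruct b; apply data30_sound, Hq.
    - intros b. destruct b; apply data30_length.
    - exact Hp.
    - intros [|]; apply HD.
    - intros c. assert (Hc : In c [true; false]) by (destruct c; simpl; tauto).
      specialize (HL c Hc). apply Nat.leb_le in HL. destruct c; exact HL.
    - constructor.
    - constructor.
    - apply H. }
  set (den := trun 30 K (D true) (D false) ann [] []) in *.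
  assert (HR : forall i, enc (ulp 30) (breg den i) (der p h i)).
  { intros i. apply (Forall2_reg _ _ _ i HT). apply enc_zero. }
  unfold T_ball in HC. apply Z.leb_le in HC.
  assert (G := S_enclosure 30 _ _ (DTm p h) v _ ltac:(lia) (HR 21%nat)
                 (enc_bdouble_tail _ _ _ (HR 37%nat)) HC).
  eapply Rle_trans; [exact G|].
  rewrite mult_IZR, Rmult_assoc.
  assert (E := ulp_shiftl 5 92 ltac:(lia) ltac:(lia)).
  change (5 + 92)%Z with (30 + 67)%Z in E. rewrite E.
  right. unfold ulp, zone. simpl. field.
Qed.

Lemma enc_rounded (P : list Z) : (length P <= K)%nat ->
  enc (ulp 30) (map (fun a => Z.shiftr a 36) P, Z.of_nat K) (polu (ulp 66) P).
Proof.
  intros HL. unfold enc. cbn [fst snd]. rewrite <- INR_IZR_INZ.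
  change 66%Z with (30 + 36)%Z. rewrite ulp_add by lia.
  assert (U := ulp_pos 30 ltac:(lia)).
  eapply Rle_trans; [apply polu_shiftr; lia || lra|].
  apply Rmult_le_compat_r; [lra|]. now apply le_INR.
Qed.

Lemma derivative_columns p : near_center p -> forall b k,
  Y_norm (minus (Smat (DTm p (Qmat (basis b k)))) (Y_had mu (basis b k))) <= 21 / 32.
Proof.
  intros Hp b k. destruct derivative_facts_hold as [ann H].
  assert (Hmu : Y_had mu (basis b k) = scal (mu b k) (basis b k)).
  { apply Y_coef_ext; intros c j. rewrite (Y_had_coef _ 24 mu_bound), pr_scal_coef, basis_coef.
    destruct b, c; cbn [Bool.eqb andb]; try ring;
      (destruct (Nat.eqb_spec j k) as [->|]; ring). }
  rewrite Hmu. destruct (Nat.lt_ge_cases k K) as [Hk|Hk].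
  - assert (Hc := df_column ann H b k Hk).
    assert (HL := Hc). unfold check_column in HL. apply andb_prop in HL. destruct HL as [HL _].
    rewrite forallb_forall in HL.
    replace (minus (Smat (DTm p (Qmat (basis b k)))) (scal (mu b k) (basis b k))) with
      (plus (Smat (DTm p (Qmat (basis b k)))) (yv (ulp 97) (column_offset b k))).
    + apply (tangent_bound ann (column_direction b k)); auto. intros c.
      unfold column_direction. apply enc_no_tail.
      unfold Qmat. rewrite <- yv_zbasis, <- yv_zQ, Rmult_1_l, w_pow, pr_yv.
      apply enc_rounded.
      assert (Hin : In c [true; false]) by (destruct c; simpl; tauto).
      specialize (HL c Hin). apply Nat.leb_le in HL. unfold column_direction in HL.
      cbn [fst] in HL. rewrite length_map in HL. exact HL.
    + replace (ulp 97) with (ulp 97 * 1) by ring. unfold column_offset.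
      rewrite yv_vscale, yv_zbasis, mult_IZR, opp_IZR.
      assert (E := ulp_shiftl 3 94 ltac:(lia) ltac:(lia)). change (3 + 94)%Z with 97%Z in E.
      replace (- IZR (mu8 b k) * IZR (Z.shiftl 1 94) * ulp 97)
        with (- (IZR (mu8 b k) * (IZR (Z.shiftl 1 94) * ulp 97))) by ring.
      rewrite E. replace (ulp 3) with (/ 8) by (unfold ulp, zone; simpl; field).
      apply Y_coef_ext; intros c j. rewrite pr_plus_coef, pr_minus_coef, !pr_scal_coef.
      unfold mu. field.
  - replace (mu b k) with 0.
    2:{ unfold mu, mu8, K in *. destruct b, k as [|[|k]]; try lia; lra. }
    replace (minus (Smat (DTm p (Qmat (basis b k)))) (scal 0 (basis b k))) with
      (plus (Smat (DTm p (Qmat (basis b k)))) (yv (ulp 97) ([], []))).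
    2:{ rewrite yv_nil. apply Y_coef_ext; intros c j.
        rewrite pr_plus_coef, pr_minus_coef, pr_scal_coef, pr_zero. simpl. ring. }
    apply (tangent_bound ann (tail_direction b)); auto using df_tail. intros c.
    unfold Qmat. rewrite (proj1 (maps_basis_tail K pivots b k pivots_ok Hk)).
    (* The direction is entirely of high degree, so the enclosed part is zero. *)
    exists X_zero, (pr c (scal (weight 2 b k) (basis b k))).
    split; [ring|]. split; [apply enc_zero|]. split.
    + intros j Hj. rewrite pr_scal_coef, basis_coef.
      destruct (Nat.eqb_spec j k); [lia|]. rewrite Bool.andb_false_r. ring.
    + cbn [tail_direction snd]. rewrite pr_scal, X_norm_scal.
      rewrite Rabs_pos_eq by (unfold weight; destruct b; lra).
      assert (Hb := basis_norm b k). assert (Hb0 := X_norm_pos (pr c (basis b k))).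
      destruct (Bool.eqb b c) eqn:E.
      * assert (Hn := Rle_trans _ _ _ (pr_norm c (basis b k)) Hb).
        assert (E1 : IZR (Z.shiftl 1 31) * ulp 30 = 2) by (unfold ulp, zone; simpl; field).
        rewrite E1. unfold weight. destruct b; lra.
      * replace (pr c (basis b k)) with X_zero.
        2:{ unfold basis. rewrite pr_mkY || idtac. destruct b, c; try discriminate; reflexivity. }
        rewrite X_norm_zero. lra.
Qed.

Lemma derivative_bound p h : near_center p ->
  Y_norm (minus (Smat (DTm p (Qmat h))) (Y_had mu h)) <= 21 / 32 * Y_norm h.
Proof.
  intros Hp. destruct conjugation_S_Q as [LS LQ _ _].
  assert (LD := DTm_linear near_center (near_center_smooth 21) (near_center_smooth 37) p Hp).
  assert (L1 : is_linear (fun h => Smat (DTm p (Qmat h)))).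
  { apply (is_linear_comp Qmat (fun h => Smat (DTm p h))); [exact LQ|].
    apply (is_linear_comp (DTm p) Smat); assumption. }
  assert (L2 := Y_had_linear mu 24 mu_bound).
  assert (L : is_linear (fun h => minus (Smat (DTm p (Qmat h))) (Y_had mu h))).
  { destruct (linear_bound _ L1) as [M1 [N1 B1]].
    constructor.
    - intros x y. rewrite (linear_plus _ L1), (linear_plus _ L2). Y_ring.
    - intros c x. rewrite (linear_scal _ L1), (linear_scal _ L2). Y_ring.
    - exists (M1 + 24). split; [lra|]. intros x.
      change (Y_norm (minus (Smat (DTm p (Qmat x))) (Y_had mu x)) <= (M1 + 24) * Y_norm x).
      eapply Rle_trans; [apply Y_norm_minus|].
      generalize (B1 x) (Y_norm_had mu 24 mu_bound x). lra. }
  rewrite (Y_norm_pr h), Rmult_plus_distr_l.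
  exact (column_bound _ (fun _ => 21 / 32) L (derivative_columns p Hp) h).
Qed.

(** Enough for [21/32 * sqrt 2 < 63/64 < 1]. *)
Lemma sqrt_2_lt : sqrt 2 < 3 / 2.
Proof.
  rewrite <- (sqrt_pow2 (3 / 2)) by lra. apply sqrt_lt_1_alt. lra.
Qed.

(** * The hyperbolic fixed point *)

(** Newton's map is confined to half the radius on which the derivative is controlled; the other
    half is left as a neighbourhood of the fixed point. *)
Lemma T_fixed_point : exists p : Y,
  Tm p = p /\ forall q : Y, Y_norm (minus q p) <= ulp 25 -> near_center q.
Proof.
  set (B := fun q : Y => forall b, X_norm (X_minus (pr b q) (pr b center)) <= ulp 25).
  assert (U := ulp_pos 25 ltac:(lia)).
  assert (E24 : ulp 24 = ulp 25 + ulp 25) by (unfold ulp, zone; simpl; field).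
  assert (HB : forall q, B q -> near_center q).
  { intros q Hq b. specialize (Hq b). lra. }
  destruct (Tm_quadratic near_center (near_center_smooth 21) (near_center_smooth 37))
    as [M [HM Q2]].
  destruct (newton_fixed_point Smat Qmat conjugation_S_Q mu 24 mu_bound mu_gap (21 / 32)
              Tm DTm B center M (ulp 25 / IZR Q_norm)) as [p [Bp Fp]].
  - lra.
  - exact HM.
  - unfold Q_norm. lra.
  (* [Q_norm] converts the radius in the new coordinates into [2^-25] in the original ones. *)
  - intros x Hx b. destruct conjugation_S_Q as [_ LQ _ QS].
    rewrite <- (QS center), <- pr_minus, <- (linear_minus Qmat) by exact LQ.
    eapply Rle_trans; [apply pr_norm|]. eapply Rle_trans; [apply Q_bound|].
    apply Rmult_le_compat_l with (r := IZR Q_norm) in Hx; [|unfold Q_norm; lra].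
    replace (IZR Q_norm * (ulp 25 / IZR Q_norm)) with (ulp 25) in Hx
      by (unfold Q_norm; field). exact Hx.
  - intros q q' Hq Hq'. apply (proj2 (Q2 q (HB q Hq))), HB, Hq'.
  - intros q h Hq. apply derivative_bound, HB, Hq.
  - exact center_residual.
  - exists p. split; [exact Fp|]. intros q Hq b. specialize (Bp b).
    replace (X_minus (pr b q) (pr b center)) with
      (X_plus (X_minus (pr b q) (pr b p)) (X_minus (pr b p) (pr b center))) by ring.
    eapply Rle_trans; [apply X_norm_triangle|].
    assert (H := pr_norm b (minus q p)). rewrite pr_minus in H. lra.
Qed.

Lemma T_hyperbolic (p : Y) : Tm p = p ->
  (forall q : Y, Y_norm (minus q p) <= ulp 25 -> near_center q) ->
  hyperbolic_fixed_point Y T p.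
Proof.
  intros Hp HB.
  assert (U := ulp_pos 25 ltac:(lia)).
  assert (Np : near_center p).
  { apply HB. replace (minus p p) with (zero : Y) by Y_ring. rewrite Y_norm_0. lra. }
  assert (H21 := near_center_smooth 21). assert (H37 := near_center_smooth 37).
  split.
  - rewrite (T_Tm p (near_center_defined p Np)). exact Hp.
  - exists (DTm p). split; [|split].
    + apply (T_filterdiff near_center H21 H37 p (ulp 25)); [exact U| |exact near_center_defined].
      intros q Hq. apply HB. lra.
    + apply (DTm_compact near_center H21 H37 p Np).
    + intros z Hz.
      apply (not_in_spectrum Smat Qmat conjugation_S_Q mu 24 mu_bound mu_gap (21 / 32)).
      * apply (DTm_linear near_center H21 H37 p Np).
      * intros h. apply derivative_bound, Np.
      * assert (H := sqrt_2_lt). assert (0 <= sqrt 2) by apply sqrt_pos. lra.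
      * exact Hz.
Qed.

(** * Analyticity of the elements of X *)

(** The coefficients of [(z + h)^m] as a polynomial in [h]. *)
Fixpoint binom_coef (z : C) (m n : nat) : C :=
  match m with
  | O => match n with O => 1%C | _ => 0%C end
  | S m => (z * binom_coef z m n +
            match n with O => 0 | S n => binom_coef z m n end)%C
  end.

Fixpoint Csum (u : nat -> C) (n : nat) : C :=
  match n with O => u O | S n => (Csum u n + u (S n))%C end.

Lemma Csum_plus u v n : Csum (fun k => u k + v k)%C n = (Csum u n + Csum v n)%C.
Proof. induction n as [|n IH]; simpl; [reflexivity|]. rewrite IH. ring. Qed.

Lemma Csum_scal c u n : Csum (fun k => c * u k)%C n = (c * Csum u n)%C.
Proof. induction n as [|n IH]; simpl; [reflexivity|]. rewrite IH. ring. Qed.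

Lemma Csum_ext u v n : (forall k, u k = v k) -> Csum u n = Csum v n.
Proof. intros H. induction n as [|n IH]; simpl; rewrite ?IH, H; reflexivity. Qed.

Lemma Csum_shift u n :
  Csum (fun k => match k with O => 0 | S k => u k end)%C (S n) = Csum u n.
Proof. induction n as [|n IH]; [simpl; ring|]. simpl in *. rewrite IH. reflexivity. Qed.

Lemma binom_partial_sum z h m : forall N, (m <= N)%nat ->
  Csum (fun n => binom_coef z m n * h ^ n)%C N = ((z + h) ^ m)%C.
Proof.
  induction m as [|m IH]; intros N HN.
  - simpl. induction N as [|N IHN]; [simpl; ring|].
    simpl Csum. rewrite IHN by lia. simpl. ring.
  - destruct N as [|N]; [lia|].
    rewrite (Csum_ext _ (fun n => z * (binom_coef z m n * h ^ n) +
        match n with O => 0 | S k => h * (binom_coef z m k * h ^ k) end)%C).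
    + rewrite Csum_plus, Csum_scal, IH by lia.
      rewrite (Csum_shift (fun k => h * (binom_coef z m k * h ^ k))%C), Csum_scal, IH by lia.
      simpl. ring.
    + intros [|n]; simpl; ring.
Qed.

(** The binomial theorem for absolute values; for [|z| + eta <= 1] it bounds all truncated
    expansions by 1, uniformly in [m]. *)
Lemma binom_abs_sum z eta m : 0 <= eta -> forall N,
  sum_f_R0 (fun n => Cmod (binom_coef z m n) * eta ^ n) N <= (Cmod z + eta) ^ m.
Proof.
  intros He. induction m as [|m IH]; intros N.
  - simpl. induction N as [|N IHN]; simpl in *.
    + rewrite Cmod_1. lra.
    + rewrite Cmod_0. lra.
  - assert (Hz := Cmod_ge_0 z).
    assert (H1 : sum_f_R0 (fun n => Cmod (binom_coef z (S m) n) * eta ^ n) N <=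
      Cmod z * sum_f_R0 (fun n => Cmod (binom_coef z m n) * eta ^ n) N +
      eta * match N with O => 0 | S M => sum_f_R0 (fun n => Cmod (binom_coef z m n) * eta ^ n) M end).
    { destruct N as [|N].
      - simpl. rewrite Cplus_0_r, Cmod_mult. lra.
      - rewrite sum_shift, (sum_shift (fun n => Cmod (binom_coef z m n) * eta ^ n) N).
        rewrite !scal_sum, Rmult_plus_distr_l.
        simpl binom_coef at 1. rewrite Cplus_0_r, Cmod_mult.
        rewrite scal_sum, Rmult_assoc, Rplus_assoc. apply Rplus_le_compat_l.
        rewrite <- sum_plus. apply sum_Rle. intros n _. simpl binom_coef.
        assert (Hp : 0 <= eta ^ S n) by (apply pow_le, He).
        assert (T := Cmod_triangle (z * binom_coef z m (S n))%C (binom_coef z m n)).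
        rewrite Cmod_mult in T. simpl pow in *.
        replace (Cmod (binom_coef z m (S n)) * (eta * eta ^ n) * Cmod z +
                 Cmod (binom_coef z m n) * eta ^ n * eta) with
          ((Cmod z * Cmod (binom_coef z m (S n)) + Cmod (binom_coef z m n)) * (eta * eta ^ n)) by ring.
        apply Rmult_le_compat_r; assumption. }
    eapply Rle_trans; [exact H1|]. simpl pow. rewrite Rmult_plus_distr_r.
    apply Rplus_le_compat; apply Rmult_le_compat_l; auto.
    destruct N as [|N]; [apply pow_le; lra|apply IH].
Qed.

Definition expansion_coef (f : X) (z : C) (n : nat) : C :=
  (Series (fun m => f m * Re (binom_coef z m n)), Series (fun m => f m * Im (binom_coef z m n))).

Lemma bounded_weight_ex (f : X) (u : nat -> R) (M : R) :
  (forall k, Rabs (u k) <= M) -> ex_series (fun k => f k * u k).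
Proof.
  intros H. apply ex_series_dominated with (fun k => M * Rabs (f k)).
  - intros k. rewrite Rabs_mult, Rmult_comm.
    apply Rmult_le_compat_r; [apply Rabs_pos|apply H].
  - apply @ex_series_scal, coef_summable.
Qed.

Lemma tail_weight_bound (f : X) (u : nat -> R) (N : nat) :
  (forall k, Rabs (u k) <= 2) -> (forall k, (k <= N)%nat -> u k = 0) ->
  Rabs (Series (fun k => f k * u k)) <= 2 * X_norm (X_tails (S N) f).
Proof.
  intros Hu H0.
  assert (Hp : forall n, sum_f_R0 (fun k => Rabs (f k * u k)) n <= 2 * X_norm (X_tails (S N) f)).
  { intros n.
    assert (G : forall j, sum_f_R0 (fun k => Rabs (f k * u k)) j + 2 * sum_f_R0 (fun k => Rabs (f k)) N
             <= 2 * sum_f_R0 (fun k => Rabs (f k)) (max j N)).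
    { induction j as [|j IH].
      - simpl. rewrite (H0 O), Rmult_0_r, Rabs_R0 by lia. lra.
      - simpl sum_f_R0 at 1. destruct (Nat.le_gt_cases (S j) N) as [Hj|Hj].
        + replace (max (S j) N) with (max j N) by lia.
          rewrite (H0 (S j)), Rmult_0_r, Rabs_R0 by exact Hj. lra.
        + replace (max (S j) N) with (S (max j N)) by lia. simpl sum_f_R0 at 3.
          replace (max j N) with j in * by lia.
          rewrite Rabs_mult. assert (H := Hu (S j)). assert (H2 := Rabs_pos (f (S j))).
          assert (Rabs (f (S j)) * Rabs (u (S j)) <= Rabs (f (S j)) * 2)
            by (apply Rmult_le_compat_l; assumption).
          lra. }
    specialize (G n). assert (T := X_norm_tails N f). assert (P := partial_le_X_norm f (max n N)).
    lra. }
  assert (Hex : ex_series (fun k => Rabs (f k * u k))).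
  { apply (nonneg_series_bound _ _ (fun k => Rabs_pos _) Hp). }
  eapply Rle_trans; [apply Series_Rabs, Hex|].
  apply (nonneg_series_bound _ _ (fun k => Rabs_pos _) Hp).
Qed.

(** Avoids exchanging a double series: truncation at [N] reproduces [(z + h)^m] exactly for
    [m <= N], and for larger [m] both are at most 1 in modulus, so only the coefficients of [f]
    beyond [N] contribute. *)
Lemma evalX_expansion (f : X) (z h : C) (eta : R) :
  0 < eta -> Cmod z + eta <= 1 -> Cmod h <= eta ->
  forall N, Cmod (evalX f (z + h) - Csum (fun n => expansion_coef f z n * h ^ n) N)%C
            <= 4 * X_norm (X_tails (S N) f).
Proof.
  intros He Hz Hh N. assert (Hz0 := Cmod_ge_0 z). assert (Hh0 := Cmod_ge_0 h).
  assert (Hb : forall m n, Cmod (binom_coef z m n) <= / eta ^ n).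
  { intros m n. assert (Hen : 0 < eta ^ n) by (apply pow_lt, He).
    apply Rmult_le_reg_r with (eta ^ n); [exact Hen|]. rewrite Rinv_l by lra.
    apply Rle_trans with (sum_f_R0 (fun n => Cmod (binom_coef z m n) * eta ^ n) n).
    - assert (P : forall j, 0 <= sum_f_R0 (fun n => Cmod (binom_coef z m n) * eta ^ n) j).
      { intros j. apply cond_pos_sum. intros k. apply Rmult_le_pos; [apply Cmod_ge_0|].
        apply pow_le; lra. }
      destruct n as [|n]; simpl; [lra|]. generalize (P n). simpl. lra.
    - eapply Rle_trans; [apply binom_abs_sum; lra|]. apply pow_le_1. lra. }
  set (P := fun m => Csum (fun n => binom_coef z m n * h ^ n)%C N).
  assert (HP : forall m, Cmod (P m) <= 1).
  { intros m. unfold P.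
    apply Rle_trans with (sum_f_R0 (fun n => Cmod (binom_coef z m n) * eta ^ n) N).
    - generalize N; intros j. induction j as [|j IH]; simpl.
      + rewrite Cmod_mult, Cmod_1. lra.
      + eapply Rle_trans; [apply Cmod_triangle|]. apply Rplus_le_compat; [exact IH|].
        rewrite Cmod_mult. apply Rmult_le_compat_l; [apply Cmod_ge_0|].
        change (Cmod (h ^ S j)%C <= eta ^ S j). rewrite Cmod_pow. apply pow_incr. lra.
    - eapply Rle_trans; [apply binom_abs_sum; lra|]. apply pow_le_1. lra. }
  assert (HE : Csum (fun n => expansion_coef f z n * h ^ n)%C N =
     (Series (fun m => f m * Re (P m)), Series (fun m => f m * Im (P m)))).
  { assert (Ex : forall n, (expansion_coef f z n * h ^ n)%C =
        (Series (fun m => f m * Re (binom_coef z m n * h ^ n)%C),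
         Series (fun m => f m * Im (binom_coef z m n * h ^ n)%C))).
    { intros n. unfold expansion_coef.
      assert (X1 : ex_series (fun m => f m * Re (binom_coef z m n))).
      { apply (bounded_weight_ex _ _ (/ eta ^ n)). intros m.
        eapply Rle_trans; [apply Rabs_Re_le|apply Hb]. }
      assert (X2 : ex_series (fun m => f m * Im (binom_coef z m n))).
      { apply (bounded_weight_ex _ _ (/ eta ^ n)). intros m.
        eapply Rle_trans; [apply Rabs_Im_le|apply Hb]. }
      apply C_ext.
      - rewrite (Series_ext (fun m => f m * Re (binom_coef z m n * h ^ n)%C)
          (fun m => Re (h ^ n)%C * (f m * Re (binom_coef z m n)) -
                    Im (h ^ n)%C * (f m * Im (binom_coef z m n))))
          by (intros m; unfold Re, Im; simpl; ring).
        rewrite Series_minus, !Series_scal_l by (apply @ex_series_scal; assumption).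
        unfold Re, Im. simpl. ring.
      - rewrite (Series_ext (fun m => f m * Im (binom_coef z m n * h ^ n)%C)
          (fun m => Im (h ^ n)%C * (f m * Re (binom_coef z m n)) +
                    Re (h ^ n)%C * (f m * Im (binom_coef z m n))))
          by (intros m; unfold Re, Im; simpl; ring).
        rewrite Series_plus, !Series_scal_l by (apply @ex_series_scal; assumption).
        unfold Re, Im. simpl. ring. }
    assert (Ey : forall (part : C -> R), (forall c, Rabs (part c) <= Cmod c) ->
       forall n, ex_series (fun m => f m * part (binom_coef z m n * h ^ n)%C)).
    { intros part Hpart n. apply (bounded_weight_ex _ _ (/ eta ^ n * Cmod (h ^ n)%C)).
      intros m. eapply Rle_trans; [apply Hpart|]. rewrite Cmod_mult.
      apply Rmult_le_compat_r; [apply Cmod_ge_0|apply Hb]. }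
    assert (Ez : forall (part : C -> R), (forall c, Rabs (part c) <= Cmod c) ->
       forall j, exists M, forall m,
         Rabs (part (Csum (fun n => binom_coef z m n * h ^ n)%C j)) <= M).
    { intros part Hpart j.
      assert (G : exists M, forall m, Cmod (Csum (fun n => binom_coef z m n * h ^ n)%C j) <= M).
      { induction j as [|j [M IH]]; simpl.
        - exists (/ eta ^ 0 * Cmod (h ^ 0)%C). intros m. rewrite Cmod_mult.
          apply Rmult_le_compat_r; [apply Cmod_ge_0|apply Hb].
        - exists (M + / eta ^ S j * Cmod (h ^ S j)%C). intros m.
          eapply Rle_trans; [apply Cmod_triangle|]. apply Rplus_le_compat; [apply IH|].
          change (Cmod (binom_coef z m (S j) * h ^ S j)%C <= / eta ^ S j * Cmod (h ^ S j)%C).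
          rewrite Cmod_mult. apply Rmult_le_compat_r; [apply Cmod_ge_0|apply Hb]. }
      destruct G as [M HM]. exists M. intros m. eapply Rle_trans; [apply Hpart|apply HM]. }
    unfold P. generalize N; intros j. induction j as [|j IH]; cbn [Csum]; [apply Ex|].
    rewrite IH, Ex.
    destruct (Ez Re Rabs_Re_le j) as [M1 HM1]. destruct (Ez Im Rabs_Im_le j) as [M2 HM2].
    unfold Cplus at 1. cbn [fst snd]. f_equal; rewrite <- Series_plus.
    - apply Series_ext. intros m. unfold Re. simpl. ring.
    - exact (bounded_weight_ex _ _ _ HM1).
    - apply Ey, Rabs_Re_le.
    - apply Series_ext. intros m. unfold Im. simpl. ring.
    - exact (bounded_weight_ex _ _ _ HM2).
    - apply Ey, Rabs_Im_le. }
  assert (Hw : Cmod (z + h)%C <= 1).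
  { eapply Rle_trans; [apply Cmod_triangle|]. lra. }
  set (D := fun m => ((z + h) ^ m - P m)%C).
  assert (HD : forall m, Cmod (D m) <= 2).
  { intros m. unfold D, Cminus. eapply Rle_trans; [apply Cmod_triangle|].
    rewrite Cmod_opp. generalize (Cmod_pow_le_1 _ m Hw) (HP m). lra. }
  assert (HD0 : forall m, (m <= N)%nat -> D m = 0%C).
  { intros m Hm. unfold D, P. rewrite binom_partial_sum by exact Hm. ring. }
  assert (HPb : forall (part : C -> R), (forall c, Rabs (part c) <= Cmod c) ->
      ex_series (fun m => f m * part (P m))).
  { intros part Hpart. apply (bounded_weight_ex _ _ 1). intros m.
    eapply Rle_trans; [apply Hpart|apply HP]. }
  replace (evalX f (z + h) - Csum (fun n => expansion_coef f z n * h ^ n)%C N)%C with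
    ((Series (fun m => f m * Re (D m)), Series (fun m => f m * Im (D m))) : C).
  2:{ rewrite HE.
      assert (ERe : Series (fun m => f m * Re (D m)) =
         Series (fun m => f m * Re ((z + h) ^ m)%C) - Series (fun m => f m * Re (P m))).
      { rewrite <- Series_minus.
        - apply Series_ext. intros m. unfold D, Re. simpl. ring.
        - exact (eval_ex_Re (z + h)%C Hw f).
        - exact (HPb Re Rabs_Re_le). }
      assert (EIm : Series (fun m => f m * Im (D m)) =
         Series (fun m => f m * Im ((z + h) ^ m)%C) - Series (fun m => f m * Im (P m))).
      { rewrite <- Series_minus.
        - apply Series_ext. intros m. unfold D, Im. simpl. ring.
        - exact (eval_ex_Im (z + h)%C Hw f).
        - exact (HPb Im Rabs_Im_le). }
      rewrite ERe, EIm. reflexivity. }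
  assert (T1 : Rabs (Series (fun m => f m * Re (D m))) <= 2 * X_norm (X_tails (S N) f)).
  { apply tail_weight_bound.
    - intros m. eapply Rle_trans; [apply Rabs_Re_le|apply HD].
    - intros m Hm. now rewrite HD0. }
  assert (T2 : Rabs (Series (fun m => f m * Im (D m))) <= 2 * X_norm (X_tails (S N) f)).
  { apply tail_weight_bound.
    - intros m. eapply Rle_trans; [apply Rabs_Im_le|apply HD].
    - intros m Hm. now rewrite HD0. }
  eapply Rle_trans; [apply Cmod_2Rmax|]. cbn [fst snd].
  assert (S2 : sqrt 2 <= 2).
  { rewrite <- (sqrt_pow2 2) at 2 by lra. apply sqrt_le_1_alt. lra. }
  assert (Hm := Rmax_lub _ _ _ T1 T2).
  assert (H0 : 0 <= Rmax (Rabs (Series (fun m => f m * Re (D m))))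
                     (Rabs (Series (fun m => f m * Im (D m))))).
  { eapply Rle_trans; [apply Rabs_pos|apply Rmax_l]. }
  assert (H1 := sqrt_pos 2). nra.
Qed.

Lemma Csum_sum_n (a : nat -> C) (h : C) (n : nat) :
  @sum_n C_AbelianMonoid (fun k => scal (pow_n h k) (a k)) n = Csum (fun k => a k * h ^ k)%C n.
Proof.
  assert (E : forall k, scal (pow_n h k) (a k) = (a k * h ^ k)%C).
  { intros k. replace (pow_n h k) with (h ^ k)%C.
    - unfold scal; simpl. unfold mult; simpl. ring.
    - induction k as [|k IH]; [reflexivity|]. simpl. rewrite IH. reflexivity. }
  induction n as [|n IH].
  - rewrite sum_O, E. reflexivity.
  - rewrite sum_Sn, IH, E. reflexivity.
Qed.

Lemma is_pseries_of_bound (a : nat -> C) (h l : C) (b : nat -> R) :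
  (forall n, Cmod (l - Csum (fun k => a k * h ^ k) n)%C <= b n) ->
  (forall eps, 0 < eps -> exists N, forall n, (N <= n)%nat -> b n < eps) ->
  @is_pseries C_AbsRing C_NormedModule a h l.
Proof.
  intros Hb Hlim. unfold is_pseries, is_series.
  apply (filterlim_locally_ball_norm (K := C_AbsRing) (U := C_NormedModule)).
  intros eps. destruct (Hlim eps (cond_pos eps)) as [N HN].
  exists N. intros n Hn. unfold ball_norm. change (norm ?x) with (Cmod x).
  rewrite Csum_sum_n. specialize (Hb n). specialize (HN n Hn).
  change (Cmod (Csum (fun k => a k * h ^ k)%C n - l)%C < eps).
  replace (Csum (fun k => a k * h ^ k)%C n - l)%C with
    (- (l - Csum (fun k => a k * h ^ k)%C n))%C by ring.
  rewrite Cmod_opp. lra.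
Qed.

Lemma analytic_affine (f : X) (phi : C -> C) (A B al be : R) (z0 : C) : al <> 0 ->
  Cmod (al * z0 + be)%C < 1 ->
  (forall z, Cmod (al * z + be)%C < 1 -> phi z = (A * evalX f (al * z + be) + B)%C) ->
  analytic_at phi z0.
Proof.
  intros Hal Hz Hphi. set (w := (al * z0 + be)%C) in *.
  (* Half the distance to the unit circle, so that the displaced points remain in the disk. *)
  set (eta := (1 - Cmod w) / 2). assert (He : 0 < eta) by (unfold eta; lra).
  assert (Ha : 0 < Rabs al) by (apply Rabs_pos_lt, Hal).
  set (a := fun n => (A * (expansion_coef f w n * RtoC al ^ n) +
                      match n with O => RtoC B | _ => 0 end)%C).
  assert (Hd : 0 < eta / Rabs al) by (apply Rdiv_lt_0_compat; assumption).
  exists a, (mkposreal _ Hd). intros z Hzz. simpl in Hzz.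
  set (h := (al * (z - z0))%C).
  assert (Hh : Cmod h <= eta).
  { unfold h. rewrite Cmod_mult, Cmod_R. left.
    apply Rmult_lt_compat_l with (r := Rabs al) in Hzz; [|exact Ha].
    replace (Rabs al * (eta / Rabs al)) with eta in Hzz by (field; lra). exact Hzz. }
  assert (Ez : (al * z + be)%C = (w + h)%C) by (unfold w, h; ring).
  assert (Hin : Cmod (al * z + be)%C < 1).
  { rewrite Ez. eapply Rle_lt_trans; [apply Cmod_triangle|]. unfold eta in *. lra. }
  apply is_pseries_of_bound with (b := fun n => Rabs A * (4 * X_norm (X_tails (S n) f))).
  - intros n. rewrite (Hphi z Hin), Ez.
    assert (Es : Csum (fun k => a k * (z - z0) ^ k)%C n =
        (A * Csum (fun k => expansion_coef f w k * h ^ k) n + B)%C).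
    { assert (Ek : forall k, (a k * (z - z0) ^ k)%C =
         (A * (expansion_coef f w k * h ^ k) + match k with O => RtoC B | _ => 0 end)%C).
      { intros k. unfold a, h. rewrite Cpow_mult_l. destruct k; simpl; ring. }
      rewrite (Csum_ext _ _ _ Ek), Csum_plus, Csum_scal. f_equal.
      induction n as [|n IH]; simpl; [reflexivity|]. rewrite IH. ring. }
    rewrite Es.
    replace (A * evalX f (w + h) + B - (A * Csum (fun k => expansion_coef f w k * h ^ k) n + B))%C
      with (A * (evalX f (w + h) - Csum (fun k => expansion_coef f w k * h ^ k) n))%C by ring.
    rewrite Cmod_mult, Cmod_R. apply Rmult_le_compat_l; [apply Rabs_pos|].
    apply (evalX_expansion f w h eta); [exact He|unfold eta; lra|exact Hh].
  - intros eps Hep. assert (HA := Rabs_pos A).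
    destruct (X_tails_small f (eps / (4 * (Rabs A + 1)))) as [N HN];
      [apply Rdiv_lt_0_compat; lra|].
    exists N. intros n Hn. specialize (HN (S n) ltac:(lia)).
    assert (H0 := X_norm_pos (X_tails (S n) f)).
    apply Rmult_lt_compat_l with (r := 4 * (Rabs A + 1)) in HN; [|lra].
    replace (4 * (Rabs A + 1) * (eps / (4 * (Rabs A + 1)))) with eps in HN by (field; lra).
    nra.
Qed.

Lemma Cconj_RtoC (x : R) : Cconj (RtoC x) = RtoC x.
Proof. unfold Cconj, RtoC. simpl. f_equal. ring. Qed.

Lemma evalX_conj (f : X) (z : C) : evalX f (Cconj z) = Cconj (evalX f z).
Proof.
  unfold evalX, Cconj at 3. cbn [fst snd]. f_equal.
  - apply Series_ext. intros k. rewrite <- Cpow_conj. reflexivity.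
  - rewrite <- Series_opp. apply Series_ext. intros k. rewrite <- Cpow_conj.
    unfold Cconj, Im. simpl. ring.
Qed.

Lemma Cconj_affine (al be : R) (z : C) : (al * Cconj z + be)%C = Cconj (al * z + be)%C.
Proof. rewrite Cplus_conj, Cmult_conj, !Cconj_RtoC. reflexivity. Qed.

Lemma symmetric_analytic_affine (f : X) (phi : C -> C) (A B al be c : R) : al <> 0 ->
  (forall z, Cmod (al * z + be)%C < 1 -> phi z = (A * evalX f (al * z + be) + B)%C) ->
  (forall x, 0 <= x <= c -> Rabs (al * x + be) < 1) ->
  symmetric_analytic_near phi c.
Proof.
  intros Hal Hphi Hc. exists (fun z => Cmod (al * z + be)%C < 1).
  split; [|split].
  - intros z Hz.
    assert (Ha : 0 < Rabs al) by (apply Rabs_pos_lt, Hal).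
    (* Neighbourhoods in C are squares, so the modulus may be twice [eta]; the factor 4 absorbs
       this. *)
    set (eta := (1 - Cmod (al * z + be)%C) / (4 * Rabs al)).
    assert (He : 0 < eta) by (apply Rdiv_lt_0_compat; lra).
    exists (mkposreal _ He). intros y [Hy1 Hy2].
    change (Rabs (fst y - fst z) < eta) in Hy1. change (Rabs (snd y - snd z) < eta) in Hy2.
    replace (al * y + be)%C with ((al * z + be) + al * (y - z))%C by ring.
    eapply Rle_lt_trans; [apply Cmod_triangle|]. rewrite Cmod_mult, Cmod_R.
    assert (Hm : Cmod (y - z)%C <= 2 * eta).
    { eapply Rle_trans; [apply Cmod_2Rmax|].
      assert (S2 : sqrt 2 <= 2).
      { rewrite <- (sqrt_pow2 2) at 2 by lra. apply sqrt_le_1_alt. lra. }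
      assert (Hmx : Rmax (Rabs (fst (y - z)%C)) (Rabs (snd (y - z)%C)) <= eta).
      { apply Rmax_lub; left; assumption. }
      assert (0 <= Rmax (Rabs (fst (y - z)%C)) (Rabs (snd (y - z)%C)))
        by (eapply Rle_trans; [apply Rabs_pos|apply Rmax_l]).
      assert (H1 := sqrt_pos 2). nra. }
    assert (H2 : Rabs al * Cmod (y - z)%C <= Rabs al * (2 * eta))
      by (apply Rmult_le_compat_l; lra).
    replace (Rabs al * (2 * eta)) with ((1 - Cmod (al * z + be)%C) / 2) in H2
      by (unfold eta; field; lra).
    lra.
  - intros x Hx. rewrite <- RtoC_mult, <- RtoC_plus, Cmod_R. apply Hc, Hx.
  - intros z Hz. split; [|split].
    + apply (analytic_affine f phi A B al be); assumption.
    + rewrite Cconj_affine, Cmod_conj. exact Hz.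
    + rewrite !Hphi; [|exact Hz|rewrite Cconj_affine, Cmod_conj; exact Hz].
      rewrite Cconj_affine, evalX_conj, Cplus_conj, Cmult_conj, !Cconj_RtoC. reflexivity.
Qed.

(** * Renormalization of a self-similar Lorenz map *)

(** [h] is controlled only on [[a, b]]; clamping its argument makes it continuous on the line
    without changing it there. *)
Lemma lipschitz_ivt (h : R -> R) (a b y L : R) : a < b -> 0 <= L ->
  (forall u v, a <= u <= b -> a <= v <= b -> Rabs (h u - h v) <= L * Rabs (u - v)) ->
  h a < y < h b -> exists c, a < c < b /\ h c = y.
Proof.
  intros Hab HL Hlip Hy.
  set (cl := fun x => Rmax a (Rmin b x)).
  assert (Hcl : forall x, a <= cl x <= b).
  { intros x. unfold cl. split; [apply Rmax_l|]. apply Rmax_lub; [lra|apply Rmin_l]. }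
  assert (Hcl1 : forall u v, Rabs (cl u - cl v) <= Rabs (u - v)).
  { intros u v. unfold cl, Rmax, Rmin.
    destruct (Rle_dec b u), (Rle_dec b v); repeat destruct (Rle_dec a _);
      unfold Rabs; repeat destruct (Rcase_abs _); lra. }
  assert (Hid : forall x, a <= x <= b -> cl x = x).
  { intros x Hx. unfold cl. rewrite Rmin_right, Rmax_right; lra. }
  assert (Hc : continuity (fun x => h (cl x))).
  { intros x eps He. exists (eps / (L + 1)). split; [apply Rdiv_lt_0_compat; lra|].
    intros x' [_ Hx']. unfold Rlimit.dist in *. simpl in *. unfold R_dist in *.
    eapply Rle_lt_trans; [apply Hlip; apply Hcl|].
    apply Rle_lt_trans with ((L + 1) * Rabs (x' - x)).
    - apply Rmult_le_compat; auto using Rabs_pos; lra.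
    - apply Rmult_lt_compat_l with (r := L + 1) in Hx'; [|lra].
      replace ((L + 1) * (eps / (L + 1))) with eps in Hx' by (field; lra). exact Hx'. }
  destruct (IVT_gen (fun x => h (cl x)) a b y Hc) as [c [H1 H2]].
  { rewrite (Hid a), (Hid b) by lra. rewrite Rmin_left, Rmax_right; lra. }
  rewrite Rmin_left, Rmax_right in H1 by lra. rewrite (Hid c H1) in H2.
  exists c. split; [|exact H2].
  split.
  - destruct (Req_dec a c) as [E|E]; [subst; lra|lra].
  - destruct (Req_dec c b) as [E|E]; [subst; lra|lra].
Qed.

Lemma first_return_time (F G : R -> R) (p q x : R) (k : nat) :
  first_return_map F p q G -> punctured p q x -> (1 <= k)%nat ->
  p <= iterate k F x <= q ->
  (forall j, (1 <= j < k)%nat -> ~ (p <= iterate j F x <= q)) ->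
  G x = iterate k F x.
Proof.
  intros HG Hx Hk Hin Hnot. destruct (HG x Hx) as (n & Hn & Hn1 & Hn2 & ->).
  destruct (Nat.lt_trichotomy n k) as [H|[->|H]]; [|reflexivity|]; exfalso.
  - apply (Hnot n); [lia|exact Hn1].
  - apply (Hn2 k); [lia|exact Hin].
Qed.

Section SelfSimilar.
(** [FL] and [FR] extend the branches continuously to 0, where [F] has no meaning. The right
    critical value has the orbit -1, [f0], [- lam]; the left one goes from [r] to [lam * r]. *)
Variables (F FL FR : R -> R) (r lam f0 L : R).
Hypothesis Hr : 0 < r.
Hypothesis Hlam : 0 < lam < 1.
Hypothesis HL : 0 <= L.
Hypothesis F_left : forall x, x < 0 -> F x = FL x.
Hypothesis F_right : forall x, 0 < x -> F x = FR x.
Hypothesis lip_left : forall u v, -1 <= u <= 0 -> -1 <= v <= 0 ->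
  Rabs (FL u - FL v) <= L * Rabs (u - v).
Hypothesis lip_right : forall u v, 0 <= u <= r -> 0 <= v <= r ->
  Rabs (FR u - FR v) <= L * Rabs (u - v).
Hypothesis inc_left : forall x y, -1 <= x -> x < y -> y <= 0 -> FL x < FL y.
Hypothesis inc_right : forall x y, 0 <= x -> x < y -> y <= r -> FR x < FR y.
Hypothesis FL_0 : FL 0 = r.
Hypothesis FR_0 : FR 0 = -1.
Hypothesis FL_m1 : FL (-1) = f0.
Hypothesis Hf0 : -1 < f0 < 0.
Hypothesis FL_f0 : FL f0 = - lam.
Hypothesis FR_r : FR r = lam * r.
Hypothesis similar_left : forall y, -1 <= y -> y < 0 -> FR (FL (lam * y)) = lam * FL y.
Hypothesis similar_right : forall y, 0 < y -> y <= r -> FL (FL (FR (lam * y))) = lam * FR y.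
Hypothesis FL_lam : lam * r < FL (- lam).
Hypothesis FR_q : FR (lam * r) < - lam.
Hypothesis FL_FR_q : FL (FR (lam * r)) < - lam.

Let q : R := lam * r.

Lemma q_bounds : 0 < q < r.
Proof. unfold q. nra. Qed.

Lemma FL_range x : -1 <= x -> x < 0 -> f0 <= FL x < r.
Proof.
  intros H1 H2. split.
  - rewrite <- FL_m1. destruct (Req_dec x (-1)) as [->|]; [lra|]. left. apply inc_left; lra.
  - rewrite <- FL_0. apply inc_left; lra.
Qed.

Lemma FR_range x : 0 < x -> x <= r -> -1 < FR x <= q.
Proof.
  intros H1 H2. split.
  - rewrite <- FR_0. apply inc_right; lra.
  - unfold q. rewrite <- FR_r. destruct (Req_dec x r) as [->|]; [lra|]. left. apply inc_right; lra.
Qed.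

Lemma F_maps_to x : punctured (-1) r x -> -1 <= F x <= r.
Proof.
  intros [H1 H2]. assert (Hq := q_bounds). destruct (Rlt_dec x 0) as [Hx|Hx].
  - rewrite F_left by exact Hx. generalize (FL_range x ltac:(lra) Hx). lra.
  - rewrite F_right by lra. generalize (FR_range x ltac:(lra) ltac:(lra)). lra.
Qed.

Lemma F_increasing_left x y : -1 <= x -> x < y -> y < 0 -> F x < F y.
Proof. intros. rewrite !F_left by lra. apply inc_left; lra. Qed.

Lemma F_increasing_right x y : 0 < x -> x < y -> y <= r -> F x < F y.
Proof. intros. rewrite !F_right by lra. apply inc_right; lra. Qed.

Lemma small_displacement eps : 0 < eps -> 0 < eps / (L + 1) /\
  forall x y, Rabs (x - y) < eps / (L + 1) -> L * Rabs (x - y) < eps.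
Proof.
  intros He. split; [apply Rdiv_lt_0_compat; lra|]. intros x y H.
  apply Rmult_lt_compat_l with (r := L + 1) in H; [|lra].
  replace ((L + 1) * (eps / (L + 1))) with eps in H by (field; lra).
  generalize (Rabs_pos (x - y)). lra.
Qed.

Lemma F_continuous : continuous_on (punctured (-1) r) F.
Proof.
  intros x [Hx Hx0]. apply filterlim_locally. intros eps.
  destruct (small_displacement eps (cond_pos eps)) as [Hd Hs].
  assert (Hd' : 0 < Rmin (eps / (L + 1)) (Rabs x)).
  { apply Rmin_glb_lt; [exact Hd|]. now apply Rabs_pos_lt. }
  exists (mkposreal _ Hd'). intros y Hy [Hy1 Hy2].
  change (Rabs (y - x) < Rmin (eps / (L + 1)) (Rabs x)) in Hy.
  assert (G1 := Rlt_le_trans _ _ _ Hy (Rmin_l _ _)).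
  assert (G2 := Rlt_le_trans _ _ _ Hy (Rmin_r _ _)).
  change (Rabs (F y - F x) < eps).
  destruct (Rlt_dec x 0) as [Hn|Hn].
  - assert (y < 0).
    { rewrite (Rabs_left x Hn) in G2. apply Rabs_lt_between in G2. lra. }
    rewrite !F_left by assumption. eapply Rle_lt_trans; [apply lip_left; lra|]. apply Hs, G1.
  - assert (0 < y).
    { rewrite (Rabs_pos_eq x) in G2 by lra. apply Rabs_lt_between in G2. lra. }
    rewrite !F_right by lra. eapply Rle_lt_trans; [apply lip_right; lra|]. apply Hs, G1.
Qed.

Lemma F_left_limit : filterlim F (at_left 0) (locally r).
Proof.
  apply filterlim_locally. intros eps.
  destruct (small_displacement eps (cond_pos eps)) as [Hd Hs].
  assert (Hd' : 0 < Rmin (eps / (L + 1)) 1) by (apply Rmin_glb_lt; lra).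
  exists (mkposreal _ Hd'). intros y Hy Hy0.
  change (Rabs (y - 0) < Rmin (eps / (L + 1)) 1) in Hy.
  assert (G1 := Rlt_le_trans _ _ _ Hy (Rmin_l _ _)).
  assert (G2 := Rlt_le_trans _ _ _ Hy (Rmin_r _ _)).
  apply Rabs_lt_between in G2.
  change (Rabs (F y - r) < eps). rewrite F_left, <- FL_0 by exact Hy0.
  eapply Rle_lt_trans; [apply lip_left; lra|]. apply Hs, G1.
Qed.

Lemma F_right_limit : filterlim F (at_right 0) (locally (-1)).
Proof.
  apply filterlim_locally. intros eps.
  destruct (small_displacement eps (cond_pos eps)) as [Hd Hs].
  assert (Hd' : 0 < Rmin (eps / (L + 1)) r) by (apply Rmin_glb_lt; lra).
  exists (mkposreal _ Hd'). intros y Hy Hy0.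
  change (Rabs (y - 0) < Rmin (eps / (L + 1)) r) in Hy.
  assert (G1 := Rlt_le_trans _ _ _ Hy (Rmin_l _ _)).
  assert (G2 := Rlt_le_trans _ _ _ Hy (Rmin_r _ _)).
  apply Rabs_lt_between in G2.
  change (Rabs (F y - -1) < eps). rewrite F_right, <- FR_0 by exact Hy0.
  eapply Rle_lt_trans; [apply lip_right; lra|]. apply Hs, G1.
Qed.

(** ** The first return to [[-lam, lam * r]] *)

Definition rescaled (x : R) : R := lam * F (x / lam).

Lemma unscale_left x : - lam <= x -> x < 0 ->
  -1 <= x / lam /\ x / lam < 0 /\ lam * (x / lam) = x.
Proof.
  intros H1 H2. assert (E : lam * (x / lam) = x) by (field; lra).
  repeat split; [|nra|exact E]. apply Rmult_le_reg_l with lam; lra.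
Qed.

Lemma unscale_right x : 0 < x -> x <= q -> 0 < x / lam /\ x / lam <= r /\ lam * (x / lam) = x.
Proof.
  intros H1 H2. assert (E : lam * (x / lam) = x) by (field; lra).
  repeat split; [nra| |exact E]. apply Rmult_le_reg_l with lam; [lra|]. unfold q in H2. lra.
Qed.

Lemma orbit_left x : - lam <= x -> x < 0 ->
  q < F x < r /\ F (F x) = rescaled x /\ - lam <= rescaled x <= q.
Proof.
  intros H1 H2. assert (Hq := q_bounds).
  destruct (unscale_left x H1 H2) as (Y1 & Y2 & E). set (y := x / lam) in *.
  assert (HF : q < F x < r).
  { rewrite F_left by exact H2. split.
    - apply Rlt_le_trans with (FL (- lam)); [exact FL_lam|].
      destruct (Req_dec (- lam) x) as [<-|]; [lra|]. left. apply inc_left; lra.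
    - rewrite <- FL_0. apply inc_left; lra. }
  split; [exact HF|]. rewrite (F_right (F x)), (F_left x) by lra.
  unfold rescaled. fold y. rewrite (F_left y) by exact Y2.
  rewrite <- E at 1. split; [apply similar_left; assumption|].
  generalize (FL_range y Y1 Y2). unfold q. nra.
Qed.

Lemma orbit_right x : 0 < x -> x <= q ->
  -1 < F x < - lam /\ F x < 0 /\ f0 < F (F x) < - lam /\ F (F (F x)) = rescaled x /\
  - lam <= rescaled x <= q.
Proof.
  intros H1 H2. assert (Hq := q_bounds).
  destruct (unscale_right x H1 H2) as (Y1 & Y2 & E). set (y := x / lam) in *.
  assert (HF : -1 < FR x <= FR q).
  { split; [rewrite <- FR_0; apply inc_right; lra|].
    destruct (Req_dec x q) as [->|]; [lra|]. left. apply inc_right; lra. }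
  assert (HFq : FR q < - lam) by exact FR_q.
  assert (H3 : f0 < FL (FR x) <= FL (FR q)).
  { split; [rewrite <- FL_m1; apply inc_left; lra|].
    destruct (Req_dec (FR x) (FR q)) as [->|]; [lra|]. left. apply inc_left; lra. }
  assert (H4 : FL (FR q) < - lam) by exact FL_FR_q.
  rewrite (F_right x) by exact H1. rewrite (F_left (FR x)) by lra.
  rewrite (F_left (FL (FR x))) by lra.
  unfold rescaled. fold y. rewrite (F_right y) by exact Y1.
  split; [lra|]. split; [lra|]. split; [lra|].
  rewrite <- E at 1. split; [apply similar_right; assumption|].
  generalize (FR_range y Y1 Y2). unfold q in *. nra.
Qed.

Lemma rescaled_first_return : first_return_map F (- lam) q rescaled.
Proof.
  intros x [Hx Hx0]. destruct (Rlt_dec x 0) as [Hn|Hn].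
  - destruct (orbit_left x ltac:(lra) Hn) as (H1 & H2 & H3).
    exists 2%nat. change (iterate 2 F x) with (F (F x)). rewrite H2.
    split; [lia|]. split; [exact H3|]. split; [|reflexivity].
    intros j Hj. replace j with 1%nat by lia. change (iterate 1 F x) with (F x). lra.
  - destruct (orbit_right x ltac:(lra) ltac:(lra)) as (H1 & H2 & H3 & H4 & H5).
    exists 3%nat. change (iterate 3 F x) with (F (F (F x))). rewrite H4.
    split; [lia|]. split; [exact H5|]. split; [|reflexivity].
    intros j Hj. assert (j = 1 \/ j = 2)%nat as [-> | ->] by lia.
    + change (iterate 1 F x) with (F x). lra.
    + change (iterate 2 F x) with (F (F x)). lra.
Qed.

(** ** Maximality *)

Section Maximal.
Variables (p' q' : R) (G : R -> R).
Hypothesis Hp' : -1 <= p'.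
Hypothesis Hp'2 : p' <= - lam.
Hypothesis Hq' : q <= q'.
Hypothesis Hq'2 : q' <= r.
Hypothesis HG : first_return_map F p' q' G.
Hypothesis G_maps : forall x, punctured p' q' x -> p' <= G x <= q'.
Hypothesis G_inc_left : forall x y, p' <= x -> x < y -> y < 0 -> G x < G y.
Hypothesis G_inc_right : forall x y, 0 < x -> x < y -> y <= q' -> G x < G y.
Hypothesis G_left : filterlim G (at_left 0) (locally q').
Hypothesis G_right : filterlim G (at_right 0) (locally p').

Lemma left_near (m d : R) : m < q' -> 0 < d ->
  exists x, - d < x /\ p' <= x /\ x < 0 /\ m < G x.
Proof.
  intros Hm Hd.
  assert (H1 : at_left 0 (fun x => m < G x)).
  { apply (G_left (fun y => m < y)). exists (mkposreal (q' - m) ltac:(lra)). intros y Hy.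
    change (Rabs (y - q') < q' - m) in Hy. apply Rabs_lt_between in Hy. lra. }
  destruct H1 as [e He].
  set (x := - (Rmin (e / 2) (Rmin (d / 2) lam))).
  assert (He0 := cond_pos e).
  assert (M1 : 0 < Rmin (e / 2) (Rmin (d / 2) lam)) by (repeat apply Rmin_glb_lt; lra).
  assert (M2 := Rmin_l (e / 2) (Rmin (d / 2) lam)).
  assert (M3 := Rmin_r (e / 2) (Rmin (d / 2) lam)).
  assert (M4 := Rmin_l (d / 2) lam). assert (M5 := Rmin_r (d / 2) lam).
  exists x. unfold x. repeat split; try lra.
  apply He; [|lra]. change (Rabs (x - 0) < e). unfold x. rewrite Rabs_left; lra.
Qed.

Lemma right_near (m d : R) : p' < m -> 0 < d ->
  exists x, x < d /\ x <= q' /\ 0 < x /\ G x < m.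
Proof.
  intros Hm Hd.
  assert (H1 : at_right 0 (fun x => G x < m)).
  { apply (G_right (fun y => y < m)). exists (mkposreal (m - p') ltac:(lra)). intros y Hy.
    change (Rabs (y - p') < m - p') in Hy. apply Rabs_lt_between in Hy. lra. }
  destruct H1 as [e He]. assert (Hq0 := q_bounds).
  set (x := Rmin (e / 2) (Rmin (d / 2) q)).
  assert (He0 := cond_pos e).
  assert (M1 : 0 < Rmin (e / 2) (Rmin (d / 2) q)) by (repeat apply Rmin_glb_lt; lra).
  assert (M2 := Rmin_l (e / 2) (Rmin (d / 2) q)).
  assert (M3 := Rmin_r (e / 2) (Rmin (d / 2) q)).
  assert (M4 := Rmin_l (d / 2) q). assert (M5 := Rmin_r (d / 2) q).
  exists x. unfold x. repeat split; try lra.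
  apply He; [|lra]. change (Rabs (x - 0) < e). unfold x. rewrite Rabs_pos_eq; lra.
Qed.

Lemma near_zero_left eps : 0 < eps -> exists d, 0 < d /\ d <= 1 /\
  forall x, - d < x -> x < 0 -> r - eps < FL x < r.
Proof.
  intros He. destruct (small_displacement eps He) as [Hd Hs].
  exists (Rmin (eps / (L + 1)) 1). split; [apply Rmin_glb_lt; lra|].
  split; [apply Rmin_r|]. intros x Hx1 Hx2.
  assert (M1 := Rmin_l (eps / (L + 1)) 1). assert (M2 := Rmin_r (eps / (L + 1)) 1).
  assert (H := lip_left x 0 ltac:(lra) ltac:(lra)).
  assert (H2 := Hs x 0 ltac:(rewrite Rabs_left; lra)).
  rewrite FL_0 in H. assert (H3 : FL x < r) by (rewrite <- FL_0; apply inc_left; lra).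
  rewrite Rabs_left in H by lra. lra.
Qed.

Lemma near_zero_right eps : 0 < eps -> exists d, 0 < d /\ d <= r /\
  forall x, 0 < x -> x < d -> -1 < FR x < -1 + eps.
Proof.
  intros He. destruct (small_displacement eps He) as [Hd Hs].
  exists (Rmin (eps / (L + 1)) r). split; [apply Rmin_glb_lt; lra|].
  split; [apply Rmin_r|]. intros x Hx1 Hx2.
  assert (M1 := Rmin_l (eps / (L + 1)) r). assert (M2 := Rmin_r (eps / (L + 1)) r).
  assert (H := lip_right x 0 ltac:(lra) ltac:(lra)).
  assert (H2 := Hs x 0 ltac:(rewrite Rabs_pos_eq; lra)).
  rewrite FR_0 in H. assert (H3 : -1 < FR x) by (rewrite <- FR_0; apply inc_right; lra).
  rewrite Rabs_pos_eq in H by lra. lra.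
Qed.

Lemma FL_shift_small x y eps : -1 <= x -> x <= y -> y <= 0 -> L * (y - x) < eps ->
  FL y < FL x + eps.
Proof.
  intros H1 H2 H3 H4. assert (H := lip_left y x ltac:(lra) ltac:(lra)).
  rewrite (Rabs_pos_eq (y - x)) in H by lra.
  generalize (Rle_abs (FL y - FL x)). lra.
Qed.

(** If [q < q' < r], points just left of 0 first jump near [r], outside the interval, and then
    return just below [q]; but the first return map must tend to [q'] there. *)
Lemma right_endpoint : q' = q \/ q' = r.
Proof.
  assert (Hq0 := q_bounds).
  destruct (Req_dec q' r) as [|Hne]; [now right|left].
  apply Rle_antisym; [|exact Hq']. apply Rnot_lt_le. intros Hlt.
  set (eps := Rmin (r - q') ((q - p') / (L + 1))).
  assert (Hd1 : 0 < (q - p') / (L + 1)) by (apply Rdiv_lt_0_compat; lra).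
  destruct (near_zero_left eps) as (d & D1 & D2 & D3); [apply Rmin_glb_lt; lra|].
  destruct (left_near q d Hlt D1) as (x & X1 & X2 & X3 & X4).
  specialize (D3 x X1 X3).
  assert (M1 := Rmin_l (r - q') ((q - p') / (L + 1))).
  assert (M2 := Rmin_r (r - q') ((q - p') / (L + 1))). fold eps in M1, M2.
  assert (HFF : p' <= FR (FL x) <= q).
  { split; [|apply FR_range; lra].
    assert (H := lip_right (FL x) r ltac:(lra) ltac:(lra)).
    destruct (small_displacement (q - p') ltac:(lra)) as [_ Hs].
    assert (H2 := Hs (FL x) r ltac:(rewrite Rabs_left; lra)).
    rewrite FR_r in H. fold q in H.
    generalize (Rabs_maj2 (FR (FL x) - q)). lra. }
  assert (E : G x = F (F x)).
  { apply (first_return_time F G p' q' x 2 HG).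
    - split; lra.
    - lia.
    - change (iterate 2 F x) with (F (F x)). rewrite (F_left x), F_right by lra. lra.
    - intros j Hj. replace j with 1%nat by lia. change (iterate 1 F x) with (F x).
      rewrite F_left by lra. lra. }
  rewrite E, (F_left x), F_right in X4 by lra. lra.
Qed.

(** Points just right of 0 follow -1, [f0], [- lam] from above. For [p'] strictly between two of
    these values, the first return has values above the larger one instead of tending to [p']. *)
Lemma left_endpoint : p' = -1 \/ p' = f0 \/ p' = - lam.
Proof.
  assert (Hq0 := q_bounds).
  destruct (Req_dec p' (-1)) as [|Hne]; [now left|right].
  assert (Hf : f0 < - lam).
  { rewrite <- FL_f0, <- FL_m1. apply inc_left; lra. }
  destruct (Rle_lt_dec p' f0) as [Hle|Hgt]; [left|right].
  - apply Rle_antisym; [exact Hle|]. apply Rnot_lt_le. intros Hlt.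
    set (eps := Rmin (p' + 1) (- f0 / (L + 1))).
    assert (Hd1 : 0 < - f0 / (L + 1)) by (apply Rdiv_lt_0_compat; lra).
    destruct (near_zero_right eps) as (d & D1 & D2 & D3); [apply Rmin_glb_lt; lra|].
    destruct (right_near f0 d Hlt D1) as (x & X1 & X2 & X3 & X4).
    specialize (D3 x X3 X1).
    assert (M1 := Rmin_l (p' + 1) (- f0 / (L + 1))).
    assert (M2 := Rmin_r (p' + 1) (- f0 / (L + 1))). fold eps in M1, M2.
    assert (HFF : f0 < FL (FR x) < 0).
    { split; [rewrite <- FL_m1; apply inc_left; lra|].
      destruct (small_displacement (- f0) ltac:(lra)) as [_ Hs].
      assert (H2 := Hs (FR x) (-1) ltac:(rewrite Rabs_pos_eq; lra)).
      rewrite Rabs_pos_eq in H2 by lra.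
      assert (H3 := FL_shift_small (-1) (FR x) (- f0) ltac:(lra) ltac:(lra) ltac:(lra) H2).
      rewrite FL_m1 in H3. lra. }
    assert (E : G x = F (F x)).
    { apply (first_return_time F G p' q' x 2 HG).
      - split; lra.
      - lia.
      - change (iterate 2 F x) with (F (F x)). rewrite (F_right x), F_left by lra. lra.
      - intros j Hj. replace j with 1%nat by lia. change (iterate 1 F x) with (F x).
        rewrite F_right by lra. lra. }
    rewrite E, (F_right x), F_left in X4 by lra. lra.
  - apply Rle_antisym; [exact Hp'2|]. apply Rnot_lt_le. intros Hlt.
    set (e2 := Rmin (p' - f0) (lam / (L + 1))).
    assert (Hd2 : 0 < lam / (L + 1)) by (apply Rdiv_lt_0_compat; lra).
    assert (He2 : 0 < e2) by (apply Rmin_glb_lt; lra).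
    assert (N1 := Rmin_l (p' - f0) (lam / (L + 1))).
    assert (N2 := Rmin_r (p' - f0) (lam / (L + 1))). fold e2 in N1, N2.
    set (eps := Rmin (p' + 1) (e2 / (L + 1))).
    assert (Hd1 : 0 < e2 / (L + 1)) by (apply Rdiv_lt_0_compat; lra).
    destruct (near_zero_right eps) as (d & D1 & D2 & D3); [apply Rmin_glb_lt; lra|].
    destruct (right_near (- lam) d Hlt D1) as (x & X1 & X2 & X3 & X4).
    specialize (D3 x X3 X1).
    assert (M1 := Rmin_l (p' + 1) (e2 / (L + 1))).
    assert (M2 := Rmin_r (p' + 1) (e2 / (L + 1))). fold eps in M1, M2.
    assert (HFF : f0 < FL (FR x) < f0 + e2).
    { split; [rewrite <- FL_m1; apply inc_left; lra|].
      destruct (small_displacement e2 ltac:(lra)) as [_ Hs].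
      assert (H2 := Hs (FR x) (-1) ltac:(rewrite Rabs_pos_eq; lra)).
      rewrite Rabs_pos_eq in H2 by lra.
      assert (H3 := FL_shift_small (-1) (FR x) e2 ltac:(lra) ltac:(lra) ltac:(lra) H2).
      rewrite FL_m1 in H3. lra. }
    set (z := FL (FR x)) in *.
    assert (HFFF : - lam < FL z < 0).
    { split; [rewrite <- FL_f0; apply inc_left; lra|].
      destruct (small_displacement lam ltac:(lra)) as [_ Hs].
      assert (H2 := Hs z f0 ltac:(rewrite Rabs_pos_eq; lra)).
      rewrite Rabs_pos_eq in H2 by lra.
      assert (H3 := FL_shift_small f0 z lam ltac:(lra) ltac:(lra) ltac:(lra) H2).
      rewrite FL_f0 in H3. lra. }
    assert (EF : F (F (F x)) = FL z).
    { rewrite (F_right x), (F_left (FR x)) by lra. fold z. apply F_left; lra. }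
    assert (E : G x = F (F (F x))).
    { apply (first_return_time F G p' q' x 3 HG).
      - split; lra.
      - lia.
      - change (iterate 3 F x) with (F (F (F x))). rewrite EF. lra.
      - intros j Hj. assert (j = 1 \/ j = 2)%nat as [-> | ->] by lia.
        + change (iterate 1 F x) with (F x). rewrite F_right by lra. lra.
        + change (iterate 2 F x) with (F (F x)).
          rewrite (F_right x), F_left by lra. fold z. lra. }
    rewrite E, EF in X4. lra.
Qed.

(** If a point is mapped onto an endpoint of the interval, the strict monotonicity of
    the first return map forces values outside the interval. *)
Lemma maximal : ~ (p' = -1 /\ q' = r) -> p' = - lam /\ q' = q.
Proof.
  intros Hproper. assert (Hq0 := q_bounds).
  destruct right_endpoint as [Eq|Eq].
  - split; [|exact Eq]. destruct (Req_dec p' (- lam)) as [|Hne]; [assumption|exfalso].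
    assert (HFp : FL p' < q).
    { destruct left_endpoint as [E|[E|E]]; [| |contradiction]; rewrite E;
        [rewrite FL_m1|rewrite FL_f0]; lra. }
    (* [c] returns at once, to the right endpoint [q' = q], so points between [c] and 0 would have
       to be mapped beyond it. *)
    destruct (lipschitz_ivt FL p' 0 q L) as (c & C1 & C2); try lra.
    { intros u v Hu Hv. apply lip_left; lra. }
    assert (E : G c = F c).
    { apply (first_return_time F G p' q' c 1 HG); try lia.
      - split; lra.
      - change (iterate 1 F c) with (F c). rewrite F_left, C2 by lra. lra. }
    rewrite F_left, C2 in E by lra.
    assert (H1 := G_inc_left c (c / 2) ltac:(lra) ltac:(lra) ltac:(lra)).
    assert (H2 := G_maps (c / 2) ltac:(split; lra)). lra.
  - exfalso.
    assert (Hp1 : -1 < p' < 0).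
    { split; [|lra]. destruct (Req_dec p' (-1)); [tauto|lra]. }
    (* Symmetrically, [c] returns at once to [p'], which leaves no value for points between 0 and
       [c]. *)
    destruct (lipschitz_ivt FR 0 r p' L) as (c & C1 & C2); try lra.
    { intros u v Hu Hv. apply lip_right; lra. }
    { rewrite FR_0, FR_r. fold q. lra. }
    assert (E : G c = F c).
    { apply (first_return_time F G p' q' c 1 HG); try lia.
      - split; lra.
      - change (iterate 1 F c) with (F c). rewrite F_right, C2 by lra. lra. }
    rewrite F_right, C2 in E by lra.
    assert (H1 := G_inc_right (c / 2) c ltac:(lra) ltac:(lra) ltac:(lra)).
    assert (H2 := G_maps (c / 2) ltac:(split; lra)). lra.
Qed.

End Maximal.

(** ** The type *)

Lemma rescaled_type : renormalization_type (-1) r F (- lam) q rescaled alpha beta.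
Proof.
  assert (Hq0 := q_bounds).
  (* [c] is the preimage of 0 on the left and [d] that of [c] on the right: [(c, 0)] and [(0, d)]
     are the branches, and they cannot be extended since an iterate hits 0 at each end. *)
  destruct (lipschitz_ivt FL (-1) 0 0 L) as (c & C1 & C2); try lra.
  { intros u v Hu Hv. apply lip_left; lra. }
  destruct (lipschitz_ivt FR 0 r c L) as (d & D1 & D2); try lra.
  { intros u v Hu Hv. apply lip_right; lra. }
  { rewrite FR_0, FR_r. fold q. lra. }
  assert (Hc : c < - lam).
  { apply Rnot_le_lt. intros Hle.
    assert (FL (- lam) <= FL c).
    { destruct (Req_dec (- lam) c) as [<-|]; [lra|]. left. apply inc_left; lra. }
    generalize FL_lam. fold q. lra. }
  assert (HFq : -1 < FR q) by (rewrite <- FR_0; apply inc_right; lra).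
  assert (HFq2 : FR q < - lam) by exact FR_q.
  assert (Hd : q < d).
  { apply Rnot_le_lt. intros Hle.
    assert (H1 : c <= FR q).
    { rewrite <- D2. destruct (Req_dec d q) as [<-|]; [lra|]. left. apply inc_right; lra. }
    assert (H2 : FL c <= FL (FR q)).
    { destruct (Req_dec c (FR q)) as [<-|]; [lra|]. left. apply inc_left; lra. }
    assert (H3 : FL (FR q) < - lam) by exact FL_FR_q. lra. }
  assert (OA : forall x, c < x < 0 -> 0 < F x < r).
  { intros x Hx. rewrite F_left by lra.
    split; [rewrite <- C2|rewrite <- FL_0]; apply inc_left; lra. }
  assert (OB : forall x, 0 < x < d -> -1 < F x < c /\ -1 < F (F x) < 0).
  { intros x Hx. assert (H1 : -1 < FR x < c).
    { split; [rewrite <- FR_0|rewrite <- D2]; apply inc_right; lra. }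
    rewrite (F_right x), F_left by lra. split; [exact H1|].
    split; [apply Rlt_trans with f0; [lra|]; rewrite <- FL_m1|rewrite <- C2]; apply inc_left; lra. }
  exists 2%nat, 3%nat, c, 0, 0, d.
  split; [lia|]. split; [lia|].
  split; [|split; [|split; [|split; [|split]]]].
  - intros x H1 H2. destruct (orbit_left x ltac:(lra) ltac:(lra)) as (_ & E & _).
    split; [symmetry; exact E|lra].
  - intros x H1 H2. destruct (orbit_right x ltac:(lra) ltac:(lra)) as (_ & _ & _ & E & _).
    split; [symmetry; exact E|lra].
  - split.
    + split; [lra|]. split; [lra|]. split; [lra|]. split.
      * intros x j Hx Hj. assert (j = 0 \/ j = 1)%nat as [-> | ->] by lia.
        -- change (iterate 0 F x) with x. lra.
        -- change (iterate 1 F x) with (F x). generalize (OA x Hx). lra.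
      * intros x y H1 H2 H3. change (F (F x) < F (F y)).
        assert (A1 := OA x ltac:(lra)). assert (A2 := OA y ltac:(lra)).
        apply F_increasing_right; [lra| |lra]. apply F_increasing_left; lra.
    + intros c' d' (M1 & M2 & M3 & M4 & _) Hc' Hd'. split.
      * apply Rle_antisym; [exact Hc'|]. apply Rnot_lt_le. intros Hlt.
        apply (M4 c 1%nat); [lra|lia|]. change (F c = 0). rewrite F_left by lra. exact C2.
      * apply Rle_antisym; [|exact Hd']. apply Rnot_lt_le. intros Hlt.
        apply (M4 0 0%nat); [lra|lia|]. reflexivity.
  - split; [reflexivity|]. intros j Hj. assert (j = 0 \/ j = 1)%nat as [-> | ->] by lia.
    + left. split; [reflexivity|]. intros x Hx. change (-1 < x < 0). lra.
    + right. split; [reflexivity|]. exact OA.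
  - split.
    + split; [lra|]. split; [lra|]. split; [lra|]. split.
      * intros x j Hx Hj. destruct (OB x Hx) as [B1 B2].
        assert (j = 0 \/ j = 1 \/ j = 2)%nat as [-> |[-> | ->]] by lia.
        -- change (iterate 0 F x) with x. lra.
        -- change (iterate 1 F x) with (F x). lra.
        -- change (iterate 2 F x) with (F (F x)). lra.
      * intros x y H1 H2 H3. change (F (F (F x)) < F (F (F y))).
        destruct (OB x ltac:(lra)) as [A1 A2]. destruct (OB y ltac:(lra)) as [A3 A4].
        apply F_increasing_left; [lra| |lra]. apply F_increasing_left; [lra| |lra].
        apply F_increasing_right; lra.
    + intros c' d' (M1 & M2 & M3 & M4 & _) Hc' Hd'. split.
      * apply Rle_antisym; [exact Hc'|]. apply Rnot_lt_le. intros Hlt.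
        apply (M4 0 0%nat); [lra|lia|]. reflexivity.
      * apply Rle_antisym; [|exact Hd']. apply Rnot_lt_le. intros Hlt.
        apply (M4 d 2%nat); [lra|lia|]. change (F (F d) = 0).
        rewrite (F_right d), D2, F_left by lra. exact C2.
  - split; [reflexivity|]. intros j Hj.
    assert (j = 0 \/ j = 1 \/ j = 2)%nat as [-> |[-> | ->]] by lia.
    + right. split; [reflexivity|]. intros x Hx. change (0 < x < r). lra.
    + left. split; [reflexivity|]. intros x Hx. change (-1 < F x < 0).
      generalize (proj1 (OB x Hx)). lra.
    + left. split; [reflexivity|]. intros x Hx. apply (OB x Hx).
Qed.

End SelfSimilar.

(** * The Lorenz map of a fixed point *)

Definition evalR (f : X) (x : R) : R := Re (evalX f x).

Lemma evalX_R (f : X) (x : R) : evalX f x = evalR f x.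
Proof.
  assert (H := evalX_conj f x). rewrite Cconj_RtoC in H.
  apply C_ext; [reflexivity|]. apply (f_equal Im) in H. unfold Cconj, Im in *. simpl in *. lra.
Qed.

Lemma Cmod_RtoC_le_1 (x : R) : -1 <= x <= 1 -> Cmod x <= 1.
Proof. intros H. rewrite Cmod_R. apply Rabs_le, H. Qed.

Lemma evalR_split (f : X) (x : R) : -1 <= x <= 1 -> evalR f x = f O + x * evalR (X_tail f) x.
Proof.
  intros H. apply RtoC_inj. rewrite RtoC_plus, RtoC_mult, <- !evalX_R.
  apply evalX_split, Cmod_RtoC_le_1, H.
Qed.

Lemma Rabs_evalR (f : X) (x : R) : -1 <= x <= 1 -> Rabs (evalR f x) <= X_norm f.
Proof.
  intros H. rewrite <- Cmod_R, <- evalX_R. apply Cmod_evalX, Cmod_RtoC_le_1, H.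
Qed.

Lemma evalR_0 (f : X) : evalR f 0 = f O.
Proof. unfold evalR. rewrite evalX_0. reflexivity. Qed.

Lemma X_comp_coef_0 (f q : X) : X_norm q <= 1 -> X_comp f q O = evalR f (q O).
Proof.
  intros H. rewrite <- (evalR_0 (X_comp f q)). unfold evalR.
  rewrite evalX_comp, evalX_0 by (rewrite ?Cmod_0; lra). reflexivity.
Qed.

Lemma X_mul_coef_0 (f g : X) : X_mul f g O = f O * g O.
Proof. rewrite X_mul_coef. unfold cauchy. simpl. ring. Qed.

Lemma X_minus_coef_0 (f g : X) : X_minus f g O = f O - g O.
Proof. simpl. ring. Qed.

(** On this interval the derivative [(n + 1) x^n] has modulus at most [(n + 1) / 2^n <= 1]. *)
Lemma pow_diff_half (x y : R) n : Rabs x <= 1 / 2 -> Rabs y <= 1 / 2 ->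
  Rabs (y ^ S n - x ^ S n) <= Rabs (y - x).
Proof.
  intros Hx Hy. induction n as [|n IH]; [simpl; rewrite !Rmult_1_r; lra|].
  replace (y ^ S (S n) - x ^ S (S n)) with (y * (y ^ S n - x ^ S n) + x ^ S n * (y - x))
    by (simpl; ring).
  eapply Rle_trans; [apply Rabs_triang|]. rewrite !Rabs_mult.
  assert (Hp : Rabs (x ^ S n) <= 1 / 2).
  { rewrite <- RPow_abs. simpl.
    assert (H1 : Rabs x ^ n <= 1) by (apply pow_le_1; generalize (Rabs_pos x); lra).
    assert (H0 : 0 <= Rabs x ^ n) by (apply pow_le, Rabs_pos). generalize (Rabs_pos x). nra. }
  generalize (Rabs_pos (y - x)) (Rabs_pos (y ^ S n - x ^ S n)) (Rabs_pos y)
    (Rabs_pos (x ^ S n)). nra.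
Qed.

(** After the linear term is removed, the rest is a bounded linear functional of the coefficients
    from degree 2 on, and on monomials it is at most [|y - x|]. *)
Lemma slope_bound (h : X) (x y : R) : Rabs x <= 1 / 2 -> Rabs y <= 1 / 2 ->
  Rabs (evalR h y - evalR h x - h 1%nat * (y - x)) <= X_norm (X_tail (X_tail h)) * Rabs (y - x).
Proof.
  intros Hx Hy. assert (Hx' := Hx). assert (Hy' := Hy).
  apply Rabs_le_between in Hx'. apply Rabs_le_between in Hy'.
  rewrite (evalR_split h y), (evalR_split h x), (evalR_split (X_tail h) y),
    (evalR_split (X_tail h) x) by lra.
  rewrite X_tail_coef. generalize (X_tail (X_tail h)). intros e.
  replace (_ - _ - _) with (y * (y * evalR e y) - x * (x * evalR e x)) by ring.
  rewrite (Rmult_comm (X_norm e)).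
  apply (X_sublinear_bound (fun e => Rabs (y * (y * evalR e y) - x * (x * evalR e x)))).
  - split.
    + intros u v. unfold evalR. rewrite !evalX_plus by (apply Cmod_RtoC_le_1; lra).
      eapply Rle_trans; [|apply Rabs_triang]. right. f_equal. unfold Re. simpl. ring.
    + exists 2. intros u. unfold Rminus. eapply Rle_trans; [apply Rabs_triang|].
      rewrite Rabs_Ropp, !Rabs_mult.
      assert (A1 := Rabs_evalR u x ltac:(lra)). assert (A2 := Rabs_evalR u y ltac:(lra)).
      generalize (Rabs_pos x) (Rabs_pos y) (Rabs_pos (evalR u x)) (Rabs_pos (evalR u y)).
      intros. assert (Rabs y * Rabs (evalR u y) <= Rabs (evalR u y)) by nra.
      assert (Rabs x * Rabs (evalR u x) <= Rabs (evalR u x)) by nra. nra.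
  - intros c k. assert (E : forall z : R, -1 <= z <= 1 ->
      evalR (X_scal c (X_pow X_var k)) z = c * z ^ k).
    { intros z Hz. apply RtoC_inj.
      rewrite <- evalX_R, evalX_scal, evalX_pow, evalX_var by (apply Cmod_RtoC_le_1, Hz).
      rewrite RtoC_mult, RtoC_pow. reflexivity. }
    rewrite !E by lra.
    replace (y * (y * (c * y ^ k)) - x * (x * (c * x ^ k))) with
      (c * (y ^ S (S k) - x ^ S (S k))) by (simpl; ring).
    rewrite Rabs_mult. apply Rmult_le_compat_l; [apply Rabs_pos|]. now apply pow_diff_half.
Qed.

Lemma evalR_lipschitz (h : X) (x y : R) : Rabs x <= 1 / 2 -> Rabs y <= 1 / 2 ->
  Rabs (evalR h y - evalR h x) <= X_norm h * Rabs (y - x).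
Proof.
  intros Hx Hy. assert (H := slope_bound h x y Hx Hy).
  assert (N : X_norm h = Rabs (h O) + (Rabs (h 1%nat) + X_norm (X_tail (X_tail h)))).
  { rewrite X_norm_split, (X_norm_split (X_tail h)), X_tail_coef. reflexivity. }
  replace (evalR h y - evalR h x) with
    (evalR h y - evalR h x - h 1%nat * (y - x) + h 1%nat * (y - x)) by ring.
  eapply Rle_trans; [apply Rabs_triang|]. rewrite Rabs_mult, N.
  generalize (Rabs_pos (h O)) (Rabs_pos (y - x)). nra.
Qed.

(** ** Bounds for the orbit of the critical values *)

(** Register 1 holds [F(-1)], 8 the factor [lambda], 10 the right endpoint [r], 14 the value
    [F(-lambda)], and 20 and 24 the values [F(lambda r)] and [F(F(lambda r))]. *)
Definition orbit_program : list instr :=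
  [ICst 0 1; ICmp true 0; ICst 5 11; ICst 1 1; IMul 1 1; ISub 4 3; IMul 5 2; ICmp true 6;
   ISub 0 7; ISub 0 2; ICmp true 9; IMul 8 8; ISub 11 3; IMul 12 2; ICmp true 13;
   IMul 8 10; IMul 15 15; IAdd 16 16; ICmp false 17; IMul 16 18; ISub 19 3;
   IMul 20 20; ISub 21 3; IMul 22 2; ICmp true 23].

Definition orbit (p : Y) (i : nat) : X := fst (reg (run orbit_program []) i) p.

Definition milli_between (lo hi : Z) (b : ball_t) : bool :=
  (Z.leb (lo * zone 30) (1000 * (hd 0%Z (fst b) - snd b)) &&
   Z.leb (1000 * (hd 0%Z (fst b) + snd b)) (hi * zone 30))%bool.

Definition milli_below (hi : Z) (b : ball_t) : bool := Z.leb (1000 * tot b) (hi * zone 30).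

Definition btail (b : ball_t) : ball_t := (tl (fst b), snd b).

Definition check_orbit : bool :=
  match annotate 30 K (data30 true) (data30 false) orbit_program [] with
  | None => false
  | Some ann =>
      let env := map (fun x => fst (snd x)) ann in
      (forallb (fun i => milli_below 1000 (breg env i)) [0; 6; 9; 13; 17; 23]%nat &&
       (milli_between (-752) (-751) (breg env 1) && milli_between 240 241 (breg env 8) &&
        milli_between 453 454 (breg env 10) && milli_between 370 400 (breg env 14) &&
        milli_between (-1000) (-900) (breg env 20) &&
        milli_between (-700) (-500) (breg env 24)))%bool
  end.

(** The linear coefficient of [f] and that of [z g(z)] dominate the sums of all higher ones; this
    makes both branches monotone. *)
Definition check_slopes : bool :=
  (milli_between (-3000) (-2500) (btail (data30 true)) &&
   milli_below 500 (btail (btail (data30 true))) &&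
   milli_between 6000 7000 (data30 false) &&
   milli_below 2500 (btail (data30 false)))%bool.

Lemma check_orbit_true : check_orbit = true.
Proof. vm_compute. reflexivity. Qed.

Lemma check_slopes_true : check_slopes = true.
Proof. vm_compute. reflexivity. Qed.

Lemma milli_between_sound lo hi b x : enc (ulp 30) b x -> milli_between lo hi b = true ->
  IZR lo / 1000 <= x O <= IZR hi / 1000.
Proof.
  intros Hb H. apply andb_prop in H. destruct H as [H1 H2].
  apply Z.leb_le, IZR_le in H1. apply Z.leb_le, IZR_le in H2.
  rewrite !mult_IZR in *. rewrite minus_IZR in H1. rewrite plus_IZR in H2.
  apply enc_coef_0, Rabs_le_between in Hb.
  assert (U := ulp_pos 30 ltac:(lia)). assert (E := one_ulp 30 ltac:(lia)).
  set (u := ulp 30) in *. set (Z1 := IZR (zone 30)) in *.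
  set (c := IZR (hd 0%Z (fst b))) in *. set (e := IZR (snd b)) in *.
  apply Rmult_le_compat_r with (r := u) in H1; [|lra].
  apply Rmult_le_compat_r with (r := u) in H2; [|lra].
  rewrite Rmult_assoc in H1. rewrite (Rmult_assoc (IZR hi)) in H2. rewrite E in H1, H2. lra.
Qed.

Lemma milli_below_sound hi b x : enc (ulp 30) b x -> milli_below hi b = true ->
  X_norm x <= IZR hi / 1000.
Proof.
  intros Hb H. apply Z.leb_le, IZR_le in H. rewrite !mult_IZR in H.
  assert (U := ulp_pos 30 ltac:(lia)). assert (E := one_ulp 30 ltac:(lia)).
  apply enc_tot in Hb; [|lra].
  apply Rmult_le_compat_r with (r := ulp 30) in H; [|lra].
  rewrite (Rmult_assoc (IZR hi)), E in H. lra.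
Qed.

Lemma enc_btail u b x : enc u b x -> enc u (btail b) (X_tail x).
Proof.
  unfold enc, btail. cbn [fst snd]. intros H. eapply Rle_trans; [|exact H].
  replace (X_minus (X_tail x) (polu u (tl (fst b)))) with (X_tail (X_minus x (polu u (fst b)))).
  - apply X_norm_tail.
  - rewrite polu_tl. unfold X_minus, X_opp. now rewrite X_tail_plus, X_tail_scal.
Qed.

(** The function [phi] at [x^2], with [1 / s = 5 / 11]; the right branch is [psi] at [x^2], with
    [1 / t = 2]. *)
Definition left_branch (f : X) (x : R) : R := evalR f ((x * x - 1) * (5 / 11)).

Definition right_branch (g : X) (x : R) : R := x * x * evalR g (x * x + x * x) - 1.

(** All numerical information about the fixed point used from here on; the remaining input is the
    fixed point equation. *)
Record critical_orbit (f g : X) (r lam f0 : R) : Prop := {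
  left_m1 : left_branch f (-1) = f0;
  left_f0 : left_branch f f0 = - lam;
  left_0 : left_branch f 0 = r;
  f0_between : -752 / 1000 <= f0 <= -751 / 1000;
  lam_between : 240 / 1000 <= lam <= 241 / 1000;
  r_between : 453 / 1000 <= r <= 454 / 1000;
  left_lam : 370 / 1000 <= left_branch f (- lam);
  right_q : right_branch g (lam * r) <= -900 / 1000;
  left_right_q : left_branch f (right_branch g (lam * r)) <= -500 / 1000;
  f_slope : f 1%nat <= -2500 / 1000;
  f_curvature : X_norm (X_tail (X_tail f)) <= 500 / 1000;
  g_slope : 6000 / 1000 <= g O;
  g_curvature : X_norm (X_tail g) <= 2500 / 1000
}.

Lemma near_center_orbit (p : Y) : near_center p ->
  exists r lam f0, critical_orbit (pr true p) (pr false p) r lam f0.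
Proof.
  intros Hp. assert (HC := check_orbit_true). unfold check_orbit in HC.
  destruct (annotate 30 K (data30 true) (data30 false) orbit_program []) as [ann|] eqn:Ha;
    [|discriminate].
  cbv zeta in HC. apply andb_prop in HC. destruct HC as [HC HC2].
  apply andb_prop in HC2. destruct HC2 as [HC2 B24].
  apply andb_prop in HC2. destruct HC2 as [HC2 B20].
  apply andb_prop in HC2. destruct HC2 as [HC2 B14].
  apply andb_prop in HC2. destruct HC2 as [HC2 B10].
  apply andb_prop in HC2. destruct HC2 as [B1 B8].
  rewrite forallb_forall in HC.
  assert (HV : Forall2 (value_ok 30 near_center) (run orbit_program [])
             (map (fun x => fst (snd x)) ann)).
  { apply (annotate_sound 30 K (data30 true) (data30 false)) with (env := []) (benv := []).
    - lia.
    - intros q b Hq. destruct b; apply data30_sound, Hq.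
    - intros b. destruct b; apply data30_length.
    - constructor.
    - exact Ha. }
  set (env := map (fun x => fst (snd x)) ann) in *.
  assert (HR : forall i, enc (ulp 30) (breg env i) (orbit p i)).
  { intros i. apply (Forall2_reg _ _ _ i HV); [|exact Hp].
    split; [apply smooth_zero|]. intros; apply enc_zero. }
  assert (EC : forall b i k, orbit p k = X_comp (pr b p) (orbit p i) ->
     In i [0; 6; 9; 13; 17; 23]%nat -> orbit p k O = evalR (pr b p) (orbit p i O)).
  { intros b i k E Hi. rewrite E. apply X_comp_coef_0.
    assert (H := milli_below_sound _ _ _ (HR i) (HC i Hi)). lra. }
  assert (EM : forall i j k, orbit p k = X_mul (orbit p i) (orbit p j) ->
     orbit p k O = orbit p i O * orbit p j O).
  { intros i j k ->. apply X_mul_coef_0. }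
  assert (EA : forall i j k, orbit p k = X_plus (orbit p i) (orbit p j) ->
     orbit p k O = orbit p i O + orbit p j O) by (intros i j k ->; reflexivity).
  assert (ES : forall i j k, orbit p k = X_minus (orbit p i) (orbit p j) ->
     orbit p k O = orbit p i O - orbit p j O) by (intros i j k ->; apply X_minus_coef_0).
  assert (EK : forall n d k, orbit p k = X_const (IZR n / IZR (Zpos d)) ->
     orbit p k O = IZR n / IZR (Zpos d)) by (intros n d k ->; apply X_const_coef).
  assert (E0 : orbit p 0 O = 0) by (rewrite (EK 0%Z 1%positive 0%nat eq_refl); field).
  assert (E2 : orbit p 2 O = 5 / 11) by exact (EK 5%Z 11%positive 2%nat eq_refl).
  assert (E3 : orbit p 3 O = 1) by (rewrite (EK 1%Z 1%positive 3%nat eq_refl); field).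
  assert (B := fun i lo hi => milli_between_sound lo hi _ _ (HR i)).
  assert (HS := check_slopes_true). unfold check_slopes in HS.
  apply andb_prop in HS. destruct HS as [HS D4]. apply andb_prop in HS. destruct HS as [HS D3].
  apply andb_prop in HS. destruct HS as [D1 D2].
  assert (D := fun b => data30_sound p b Hp).
  assert (EL : forall x y, y = (x * x - 1) * (5 / 11) -> left_branch (pr true p) x = evalR (pr true p) y)
    by (intros x y ->; reflexivity).
  assert (EQ : right_branch (pr false p) (orbit p 8 O * orbit p 10 O) = orbit p 20 O).
  { rewrite (ES 19 3 20 eq_refl)%nat, (EM 16 18 19 eq_refl)%nat, (EC false 17 18 eq_refl)%nat,
      (EA 16 16 17 eq_refl)%nat, (EM 15 15 16 eq_refl)%nat, (EM 8 10 15 eq_refl)%nat, E3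
      by (simpl; tauto). reflexivity. }
  exists (orbit p 10 O), (orbit p 8 O), (orbit p 1 O). constructor.
  - rewrite (EC true 0 1 eq_refl)%nat by (simpl; tauto). apply EL. rewrite E0. field.
  - rewrite (ES 0 7 8 eq_refl)%nat, (EC true 6 7 eq_refl)%nat, E0 by (simpl; tauto).
    rewrite (EL _ (orbit p 6 O)); [ring|].
    rewrite (EM 5 2 6 eq_refl)%nat, (ES 4 3 5 eq_refl)%nat, (EM 1 1 4 eq_refl)%nat, E2, E3. ring.
  - rewrite (EC true 9 10 eq_refl)%nat by (simpl; tauto). apply EL.
    rewrite (ES 0 2 9 eq_refl)%nat, E0, E2. ring.
  - exact (B 1%nat (-752)%Z (-751)%Z B1).
  - exact (B 8%nat 240%Z 241%Z B8).
  - exact (B 10%nat 453%Z 454%Z B10).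
  - rewrite (EL _ (orbit p 13 O)), <- (EC true 13 14 eq_refl)%nat; [|simpl; tauto|].
    + exact (proj1 (B 14%nat 370%Z 400%Z B14)).
    + rewrite (EM 12 2 13 eq_refl)%nat, (ES 11 3 12 eq_refl)%nat, (EM 8 8 11 eq_refl)%nat, E2, E3.
      ring.
  - rewrite EQ. exact (proj2 (B 20%nat (-1000)%Z (-900)%Z B20)).
  - rewrite EQ, (EL _ (orbit p 23 O)), <- (EC true 23 24 eq_refl)%nat; [|simpl; tauto|].
    + exact (proj2 (B 24%nat (-700)%Z (-500)%Z B24)).
    + rewrite (EM 22 2 23 eq_refl)%nat, (ES 21 3 22 eq_refl)%nat, (EM 20 20 21 eq_refl)%nat, E2, E3.
      ring.
  - rewrite <- X_tail_coef.
    apply (milli_between_sound (-3000) (-2500) (btail (data30 true))); [|exact D1].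
    apply enc_btail, D.
  - apply (milli_below_sound 500 (btail (btail (data30 true)))); [|exact D2].
    apply enc_btail, enc_btail, D.
  - apply (milli_between_sound 6000 7000 (data30 false)); [apply D|exact D3].
  - apply (milli_below_sound 2500 (btail (data30 false))); [|exact D4].
    apply enc_btail, D.
Qed.

(** * The Lorenz map and its rescalings *)

Definition lorenz_map (f g : X) (x : R) : R :=
  if Rlt_dec x 0 then left_branch f x else right_branch g x.

Lemma lorenz_map_left f g x : x < 0 -> lorenz_map f g x = left_branch f x.
Proof. intros H. unfold lorenz_map. destruct (Rlt_dec x 0); [reflexivity|lra]. Qed.

Lemma lorenz_map_right f g x : 0 < x -> lorenz_map f g x = right_branch g x.
Proof. intros H. unfold lorenz_map. destruct (Rlt_dec x 0); [lra|reflexivity]. Qed.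

Lemma evalR_shift (g : X) (x : R) : -1 <= x <= 1 -> evalR (X_shift g) x = x * evalR g x.
Proof.
  intros H. apply RtoC_inj. rewrite RtoC_mult, <- !evalX_R.
  apply evalX_shift, Cmod_RtoC_le_1, H.
Qed.

(** As a value of [z g(z)] at [z = 2 x^2], the right branch falls under the same slope and Lipschitz
    estimates as the left one. *)
Lemma right_branch_shift (g : X) (x : R) : x * x <= 1 / 2 ->
  right_branch g x = / 2 * evalR (X_shift g) (x * x + x * x) - 1.
Proof.
  intros H. unfold right_branch. assert (0 <= x * x) by nra. rewrite evalR_shift by lra. field.
Qed.

(** Multiplying by the slope covers the decreasing [f] and the increasing [z g(z)] at once. *)
Lemma evalR_monotone (h : X) (x y : R) : Rabs x <= 1 / 2 -> Rabs y <= 1 / 2 -> x < y ->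
  X_norm (X_tail (X_tail h)) < Rabs (h 1%nat) -> 0 < h 1%nat * (evalR h y - evalR h x).
Proof.
  intros Hx Hy Hxy Hs. assert (H := slope_bound h x y Hx Hy).
  rewrite (Rabs_pos_eq (y - x)) in H by lra. apply Rabs_le_between in H.
  set (E := evalR h y - evalR h x) in *. set (c := X_norm (X_tail (X_tail h))) in *.
  unfold Rabs in Hs. destruct (Rcase_abs (h 1%nat)).
  - assert (0 < (- h 1%nat - c) * (y - x)) by (apply Rmult_lt_0_compat; lra).
    assert (E < 0) by lra. nra.
  - assert (0 < (h 1%nat - c) * (y - x)) by (apply Rmult_lt_0_compat; lra).
    assert (0 < E) by lra. assert (Hc := X_norm_pos (X_tail (X_tail h))). fold c in Hc.
    apply Rmult_lt_0_compat; lra.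
Qed.

(** General domains, so that continuity on the punctured interval and both one-sided limits are
    instances. *)
Lemma rescaled_filterlim (F : R -> R) (mu x l : R) (D D' : R -> Prop) : 0 < mu ->
  (forall y, D' y -> D (y / mu)) -> filterlim F (within D (locally (x / mu))) (locally l) ->
  filterlim (rescaled F mu) (within D' (locally x)) (locally (mu * l)).
Proof.
  intros Hmu HD H. apply filterlim_locally. intros eps.
  assert (He : 0 < eps / mu) by (apply Rdiv_lt_0_compat; [apply cond_pos|exact Hmu]).
  destruct (proj1 (filterlim_locally F l) H (mkposreal _ He)) as [d Hd].
  assert (Hd' : 0 < mu * d) by (apply Rmult_lt_0_compat; [exact Hmu|apply cond_pos]).
  exists (mkposreal _ Hd'). intros y Hy Hy'.
  change (Rabs (y - x) < mu * d) in Hy. change (Rabs (mu * F (y / mu) - mu * l) < eps).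
  assert (Hb : Rabs (y / mu - x / mu) < d).
  { replace (y / mu - x / mu) with ((y - x) / mu) by (field; lra).
    unfold Rdiv. rewrite Rabs_mult, Rabs_inv, (Rabs_pos_eq mu) by lra.
    apply Rmult_lt_reg_l with mu; [exact Hmu|].
    replace (mu * (Rabs (y - x) * / mu)) with (Rabs (y - x)) by (field; lra). exact Hy. }
  assert (G := Hd (y / mu) Hb (HD y Hy')). change (Rabs (F (y / mu) - l) < eps / mu) in G.
  rewrite <- Rmult_minus_distr_l, Rabs_mult, (Rabs_pos_eq mu) by lra.
  apply Rmult_lt_compat_l with (r := mu) in G; [|exact Hmu].
  replace (mu * (eps / mu)) with (pos eps) in G by (field; lra). exact G.
Qed.

Lemma Rpower_2 (x : R) : 0 < x -> Rpower x 2 = x * x.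
Proof.
  intros H. replace 2 with (INR 2) by (simpl; ring). rewrite Rpower_pow by exact H. simpl. ring.
Qed.

Lemma rescaled_1 (F : R -> R) : rescaled F 1 = F.
Proof.
  apply functional_extensionality. intros x. unfold rescaled.
  replace (x / 1) with x by field. ring.
Qed.

Section LorenzMap.
Variables (f g : X) (r lam f0 : R).
Hypothesis co : critical_orbit f g r lam f0.

Let FL : R -> R := left_branch f.
Let FR : R -> R := right_branch g.
Let L : R := X_norm f + X_norm (X_shift g).

Lemma left_arg x : -1 <= x <= 0 -> Rabs ((x * x - 1) * (5 / 11)) <= 1 / 2.
Proof. intros H. apply Rabs_le. nra. Qed.

Lemma right_arg x : 0 <= x <= r -> x * x <= 1 / 4 /\ Rabs (x * x + x * x) <= 1 / 2.
Proof.
  intros H. assert (Hr := r_between _ _ _ _ _ co). assert (x * x <= 1 / 4) by nra.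
  split; [assumption|]. apply Rabs_le. nra.
Qed.

Lemma left_increasing x y : -1 <= x -> x < y -> y <= 0 -> FL x < FL y.
Proof.
  intros H1 H2 H3. assert (Hs := f_slope _ _ _ _ _ co). assert (Hc := f_curvature _ _ _ _ _ co).
  assert (H := evalR_monotone f ((y * y - 1) * (5 / 11)) ((x * x - 1) * (5 / 11))
    (left_arg y ltac:(lra)) (left_arg x ltac:(lra)) ltac:(nra)
    ltac:(rewrite Rabs_left by lra; lra)).
  unfold FL, left_branch. nra.
Qed.

Lemma right_increasing x y : 0 <= x -> x < y -> y <= r -> FR x < FR y.
Proof.
  intros H1 H2 H3. assert (Hs := g_slope _ _ _ _ _ co). assert (Hc := g_curvature _ _ _ _ _ co).
  destruct (right_arg x ltac:(lra)) as [X1 X2]. destruct (right_arg y ltac:(lra)) as [Y1 Y2].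
  assert (E1 : X_shift g 1%nat = g O) by exact (X_shift_coef g 1).
  assert (E2 : X_tail (X_tail (X_shift g)) = X_tail g) 
    by (apply X_ext; intros k; rewrite !X_tail_coef; exact (X_shift_coef g (S (S k)))).
  assert (H := evalR_monotone (X_shift g) (x * x + x * x) (y * y + y * y) X2 Y2 ltac:(nra)
    ltac:(rewrite E1, E2, Rabs_pos_eq by lra; lra)).
  unfold FR. rewrite !right_branch_shift by lra. rewrite E1 in H. nra.
Qed.

Lemma lipschitz_pos : 0 <= L.
Proof. unfold L. generalize (X_norm_pos f) (X_norm_pos (X_shift g)). lra. Qed.

Lemma left_lipschitz u v : -1 <= u <= 0 -> -1 <= v <= 0 -> Rabs (FL u - FL v) <= L * Rabs (u - v).
Proof.
  intros Hu Hv. eapply Rle_trans; [apply evalR_lipschitz; apply left_arg; assumption|].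
  apply Rmult_le_compat; [apply X_norm_pos|apply Rabs_pos| |].
  - unfold L. generalize (X_norm_pos (X_shift g)). lra.
  - replace ((u * u - 1) * (5 / 11) - (v * v - 1) * (5 / 11)) with ((u + v) * (5 / 11) * (u - v))
      by ring.
    rewrite Rabs_mult. rewrite <- (Rmult_1_l (Rabs (u - v))) at 2.
    apply Rmult_le_compat_r; [apply Rabs_pos|]. apply Rabs_le. lra.
Qed.

Lemma right_lipschitz u v : 0 <= u <= r -> 0 <= v <= r -> Rabs (FR u - FR v) <= L * Rabs (u - v).
Proof.
  intros Hu Hv. assert (Hr := r_between _ _ _ _ _ co).
  destruct (right_arg u Hu) as [U1 U2]. destruct (right_arg v Hv) as [V1 V2].
  unfold FR. rewrite !right_branch_shift by lra.
  replace (_ - 1 - (_ - 1)) with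
    (/ 2 * (evalR (X_shift g) (u * u + u * u) - evalR (X_shift g) (v * v + v * v))) by ring.
  rewrite Rabs_mult, (Rabs_pos_eq (/ 2)) by lra.
  assert (H := evalR_lipschitz (X_shift g) _ _ V2 U2).
  replace (u * u + u * u - (v * v + v * v)) with (2 * (u + v) * (u - v)) in H by ring.
  rewrite Rabs_mult, (Rabs_pos_eq (2 * (u + v))) in H by lra.
  unfold L. generalize (X_norm_pos f) (X_norm_pos (X_shift g)) (Rabs_pos (u - v)).
  intros N1 N2 N3. assert (X_norm (X_shift g) * (2 * (u + v) * Rabs (u - v)) <=
    X_norm (X_shift g) * (2 * Rabs (u - v))).
  { apply Rmult_le_compat_l; [exact N2|]. nra. }
  nra.
Qed.

Lemma right_0 : FR 0 = -1.
Proof. unfold FR, right_branch. ring. Qed.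

Lemma phi_of_affine (z : C) : phi_of (f, g) z = evalX f ((5 / 11)%R * z + (- (5 / 11))%R).
Proof. unfold phi_of. rewrite div_s. cbn [fst]. f_equal. rewrite RtoC_opp. ring. Qed.

Lemma psi_of_affine (z : C) : Cmod (2 * z) < 1 ->
  psi_of (f, g) z = ((/ 2)%R * evalX (X_shift g) (2 * z) - 1)%C.
Proof.
  intros H. unfold psi_of. rewrite div_t. cbn [snd].
  rewrite evalX_shift by lra. replace (z + z)%C with (2 * z)%C by ring.
  rewrite RtoC_inv by lra. field.
Qed.

Hypothesis right_r : FR r = lam * r.

Let F : R -> R := lorenz_map f g.

(** All rescalings at once: [mu = 1] gives [F], [mu = lam] its first return map. *)
Lemma lorenz_rescaled (mu : R) (phi psi : C -> C) : 0 < mu ->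
  (forall z, phi z = (mu * evalX f ((5 / 11 / (mu * mu))%R * z + (- (5 / 11))%R))%C) ->
  (forall z, Cmod ((2 / (mu * mu))%R * z)%C < 1 ->
     psi z = ((mu / 2)%R * evalX (X_shift g) ((2 / (mu * mu))%R * z) + (- mu)%R)%C) ->
  lorenz_with 2 (- mu) (mu * r) phi psi (rescaled F mu).
Proof.
  intros Hmu Hphi Hpsi.
  destruct (f0_between _ _ _ _ _ co) as [Bf1 Bf2], (lam_between _ _ _ _ _ co) as [Bl1 Bl2],
    (r_between _ _ _ _ _ co) as [Br1 Br2].
  assert (Hr : 0 < r) by lra. assert (Hl : 0 < lam < 1) by lra. assert (Hf : -1 < f0 < 0) by lra.
  assert (HLeft := lorenz_map_left f g). assert (HRight := lorenz_map_right f g).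
  assert (Hmu2 : 0 < mu * mu) by nra.
  assert (Sc : forall x, mu * (x / mu) = x) by (intros x; field; lra).
  assert (P1 : forall x, - mu <= x -> -1 <= x / mu).
  { intros x Hx. apply Rmult_le_reg_l with mu; [exact Hmu|]. rewrite Sc. lra. }
  assert (P2 : forall x, x <= mu * r -> x / mu <= r).
  { intros x Hx. apply Rmult_le_reg_l with mu; [exact Hmu|]. rewrite Sc. lra. }
  assert (P3 : forall x, 0 < x -> 0 < x / mu).
  { intros x Hx. apply Rdiv_lt_0_compat; lra. }
  assert (P4 : forall x, x < 0 -> x / mu < 0).
  { intros x Hx. apply Rmult_lt_reg_l with mu; [exact Hmu|]. rewrite Sc. lra. }
  assert (P5 : forall x y, x < y -> x / mu < y / mu).
  { intros x y Hx. apply Rmult_lt_reg_l with mu; [exact Hmu|]. rewrite !Sc. lra. }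
  assert (P6 : forall x, punctured (- mu) (mu * r) x -> punctured (-1) r (x / mu)).
  { intros x [[X1 X2] X3]. split; [split; [apply P1|apply P2]; assumption|].
    intros E. apply X3. rewrite <- (Sc x), E. ring. }
  assert (Hmu3 : mu * mu <> 0) by lra.
  constructor.
  - split; nra.
  - lra.
  - intros x Hx. assert (H := F_maps_to F FL FR r lam f0 Hr Hl HLeft HRight left_increasing
      right_increasing (left_0 _ _ _ _ _ co) right_0 (left_m1 _ _ _ _ _ co) Hf right_r _ (P6 x Hx)).
    unfold rescaled. nra.
  - intros x Hx. apply (rescaled_filterlim F mu x _ (punctured (-1) r)); [exact Hmu|exact P6|].
    exact (F_continuous F FL FR r lam L Hl lipschitz_pos HLeft HRight left_lipschitz
      right_lipschitz _ (P6 x Hx)).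
  - intros x y X1 X2 X3. apply Rmult_lt_compat_l; [exact Hmu|].
    apply (F_increasing_left F FL HLeft left_increasing); auto.
  - intros x y X1 X2 X3. apply Rmult_lt_compat_l; [exact Hmu|].
    apply (F_increasing_right F FR r HRight right_increasing); auto.
  - apply (rescaled_filterlim F mu 0 _ (fun u => u < 0)); [exact Hmu|exact P4|].
    replace (0 / mu) with 0 by (field; lra).
    exact (F_left_limit F FL r lam L Hl lipschitz_pos HLeft left_lipschitz (left_0 _ _ _ _ _ co)).
  - replace (- mu) with (mu * -1) by ring.
    apply (rescaled_filterlim F mu 0 _ (fun u => 0 < u)); [exact Hmu|exact P3|].
    replace (0 / mu) with 0 by (field; lra).
    exact (F_right_limit F FR r lam L Hr Hl lipschitz_pos HRight right_lipschitz right_0).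
  - rewrite Rabs_left, Ropp_involutive, Rpower_2 by lra.
    apply (symmetric_analytic_affine f phi mu 0 (5 / 11 / (mu * mu)) (- (5 / 11))).
    + apply Rgt_not_eq, Rdiv_lt_0_compat; lra.
    + intros z _. rewrite Hphi. ring.
    + intros x Hx. replace (5 / 11 / (mu * mu) * x) with (x / (mu * mu) * (5 / 11)) by (field; lra).
      assert (0 <= x / (mu * mu) <= 1).
      { split; [apply Rmult_le_pos; [lra|left; apply Rinv_0_lt_compat, Hmu2]|].
        apply Rmult_le_reg_l with (mu * mu); [exact Hmu2|].
        replace (mu * mu * (x / (mu * mu))) with x by (field; lra). lra. }
      apply Rabs_lt_between. lra.
  - rewrite Rpower_2 by nra.
    apply (symmetric_analytic_affine (X_shift g) psi (mu / 2) (- mu) (2 / (mu * mu)) 0).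
    + apply Rgt_not_eq, Rdiv_lt_0_compat; lra.
    + intros z Hz. rewrite Cplus_0_r in *. apply Hpsi, Hz.
    + intros x Hx. replace (2 / (mu * mu) * x + 0) with (2 * (x / (mu * mu))) by (field; lra).
      assert (0 <= x / (mu * mu) <= r * r).
      { split; [apply Rmult_le_pos; [lra|left; apply Rinv_0_lt_compat, Hmu2]|].
        apply Rmult_le_reg_l with (mu * mu); [exact Hmu2|].
        replace (mu * mu * (x / (mu * mu))) with x by (field; lra). lra. }
      apply Rabs_lt_between. nra.
  - intros x [X1 X2]. rewrite Rpower_2 by (apply Rabs_pos_lt; lra).
    replace (Rabs x * Rabs x) with (x * x) by (rewrite <- Rabs_mult, Rabs_pos_eq; nra).
    rewrite Hphi. unfold rescaled, F. rewrite HLeft by (apply P4, X2).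
    rewrite RtoC_mult. f_equal. unfold left_branch. rewrite <- evalX_R. f_equal.
    rewrite <- RtoC_mult, <- RtoC_plus. f_equal. field. lra.
  - intros x [X1 X2]. rewrite Rpower_2 by (apply Rabs_pos_lt; lra).
    rewrite Rabs_pos_eq by lra.
    assert (Y1 := P3 x X1). assert (Y2 := P2 x ltac:(lra)).
    destruct (right_arg (x / mu) ltac:(lra)) as [Y3 _].
    assert (E : 2 / (mu * mu) * (x * x) = x / mu * (x / mu) + x / mu * (x / mu)) by (field; lra).
    rewrite Hpsi.
    + unfold rescaled, F. rewrite HRight by exact Y1. rewrite right_branch_shift by lra.
      rewrite <- RtoC_mult, E, evalX_R, <- RtoC_mult, <- RtoC_plus. f_equal. field.
    + rewrite <- RtoC_mult, Cmod_R, E. apply Rabs_lt_between. nra.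
Qed.

Lemma lorenz_F : lorenz_with 2 (-1) r (phi_of (f, g)) (psi_of (f, g)) F.
Proof.
  rewrite <- (rescaled_1 F). replace r with (1 * r) by ring. replace (-1) with (- (1)) by ring.
  apply lorenz_rescaled; [lra| |].
  - intros z. rewrite phi_of_affine. replace (5 / 11 / (1 * 1)) with (5 / 11) by field. ring.
  - intros z. replace (2 / (1 * 1)) with 2 by field. intros Hz. rewrite psi_of_affine by exact Hz.
    replace (1 / 2) with (/ 2) by field. rewrite RtoC_opp. ring.
Qed.

Lemma lorenz_first_return : is_lorenz 2 (- lam) (lam * r) (rescaled F lam).
Proof.
  destruct (lam_between _ _ _ _ _ co) as [Bl1 Bl2].
  (* The two analytic functions are read off from the required formulas by unification. *)
  eexists _, _. apply lorenz_rescaled; [lra| |]; reflexivity.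
Qed.

Hypothesis similar_left : forall y, -1 <= y -> y < 0 -> FR (FL (lam * y)) = lam * FL y.
Hypothesis similar_right : forall y, 0 < y -> y <= r -> FL (FL (FR (lam * y))) = lam * FR y.

Lemma self_renormalization : renormalizes_to 2 alpha beta (-1) r F r F.
Proof.
  split; [exists (phi_of (f, g)), (psi_of (f, g)); exact lorenz_F|].
  destruct (f0_between _ _ _ _ _ co) as [Bf1 Bf2], (lam_between _ _ _ _ _ co) as [Bl1 Bl2],
    (r_between _ _ _ _ _ co) as [Br1 Br2].
  assert (Hr : 0 < r) by lra. assert (Hl : 0 < lam < 1) by lra. assert (Hf : -1 < f0 < 0) by lra.
  assert (HLeft := lorenz_map_left f g). assert (HRight := lorenz_map_right f g).
  assert (K1 : lam * r < FL (- lam)).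
  { assert (K := left_lam _ _ _ _ _ co). unfold FL. nra. }
  assert (K2 : FR (lam * r) < - lam).
  { assert (K := right_q _ _ _ _ _ co). unfold FR. lra. }
  assert (K3 : FL (FR (lam * r)) < - lam).
  { assert (K := left_right_q _ _ _ _ _ co). unfold FL, FR. lra. }
  assert (Hq : 0 < lam * r < r) by nra.
  assert (Hret : first_return_map F (- lam) (lam * r) (rescaled F lam)).
  { exact (rescaled_first_return F FL FR r lam f0 Hr Hl HLeft HRight left_increasing
      right_increasing (left_0 _ _ _ _ _ co) right_0 (left_m1 _ _ _ _ _ co) Hf right_r
      similar_left similar_right K1 K2 K3). }
  exists (- lam), (lam * r), (rescaled F lam).
  split; [split|split; [|split; [|split]]].
  - split; [lra|]. split; [lra|]. split; [lra|]. split; [lra|].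
    split; [lra|]. exists (rescaled F lam). split; [exact Hret|apply lorenz_first_return].
  - intros p' q' (P1 & P2 & P3 & P4 & P5 & G & HG & phi & psi & HL) P6 P7.
    apply (maximal F FL FR r lam f0 L Hr Hl lipschitz_pos HLeft HRight left_lipschitz
      right_lipschitz left_increasing right_increasing (left_0 _ _ _ _ _ co) right_0
      (left_m1 _ _ _ _ _ co) Hf (left_f0 _ _ _ _ _ co) right_r p' q' G); try assumption.
    + apply HL.
    + apply HL.
    + apply HL.
    + apply HL.
    + apply HL.
  - exact Hret.
  - exact (rescaled_type F FL FR r lam f0 L Hr Hl lipschitz_pos HLeft HRight left_lipschitz
      right_lipschitz left_increasing right_increasing (left_0 _ _ _ _ _ co) right_0
      (left_m1 _ _ _ _ _ co) Hf right_r similar_left similar_right K1 K2 K3).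
  - field.
  - intros x Hx. replace (- lam / -1) with lam by field. unfold rescaled.
    replace (lam * x / lam) with x by (field; lra). field. lra.
Qed.

End LorenzMap.

(** ** Fixed points of the operator are self-similar *)

Section FixedPoint.
Variables (f g : X) (r lam f0 : R).
Hypothesis co : critical_orbit f g r lam f0.
Hypothesis fixed : T_spec (f, g) (f, g).

Lemma op_lambda_real : op_lambda (f, g) = lam.
Proof.
  unfold op_lambda. cbn [fst]. rewrite div_s, !evalX_R.
  assert (E0 : evalR f 0 = f0).
  { rewrite <- (left_m1 _ _ _ _ _ co). unfold left_branch. f_equal. field. }
  rewrite E0. replace ((f0 ^ 2 - 1) * RtoC (5 / 11))%C with (RtoC ((f0 * f0 - 1) * (5 / 11))).
  - rewrite evalX_R. assert (H := left_f0 _ _ _ _ _ co). unfold left_branch in H.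
    rewrite H, RtoC_opp. ring.
  - rewrite RtoC_mult, RtoC_minus, RtoC_mult. simpl. ring.
Qed.

(** At [w = (y^2 - 1) / s] the argument of [u] becomes [((lam y)^2 - 1) / s], so the first fixed
    point equation turns into an identity between branches. *)
Lemma fixed_left y : -1 <= y <= 1 ->
  right_branch g (left_branch f (lam * y)) = lam * left_branch f y.
Proof.
  intros Hy. assert (Hl := lam_between _ _ _ _ _ co).
  set (w := (y * y - 1) * (5 / 11)).
  assert (Hw : Cmod w < 1) by (rewrite Cmod_R; apply Rabs_lt_between; unfold w; nra).
  destruct (fixed w Hw) as [H _]. cbn [fst] in H.
  assert (Ea : op_u_arg (f, g) w = RtoC ((lam * y * (lam * y) - 1) * (5 / 11))).
  { unfold op_u_arg. rewrite op_lambda_real, inv_s. unfold w.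
    replace (5 / 11)%C with (RtoC (5 / 11)) by (rewrite RtoC_div by lra; reflexivity).
    rewrite !RtoC_mult, !RtoC_minus, !RtoC_mult. simpl. ring. }
  assert (Eu : op_u (f, g) w = RtoC (left_branch f (lam * y) * left_branch f (lam * y))).
  { unfold op_u. rewrite Ea. cbn [fst]. rewrite evalX_R, RtoC_mult. simpl. unfold left_branch. ring. }
  unfold op_f in H. rewrite Eu, op_lambda_real, div_t, <- RtoC_plus in H. cbn [fst snd] in H.
  rewrite !evalX_R in H. set (z := left_branch f (lam * y)) in *.
  apply RtoC_inj. unfold right_branch. unfold left_branch at 1. fold w.
  rewrite RtoC_mult, H, RtoC_minus, RtoC_mult. field.
  intros E. apply RtoC_inj in E. lra.
Qed.

(** The second equation at [w = y^2 / t]. It is available only for [w <> 0], hence [0 < y]. *)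
Lemma fixed_right y : 0 < y -> y <= r ->
  left_branch f (left_branch f (right_branch g (lam * y))) = lam * right_branch g y.
Proof.
  intros Hy Hyr. assert (Hl := lam_between _ _ _ _ _ co). assert (Hr := r_between _ _ _ _ _ co).
  set (w := y * y + y * y).
  assert (Hw : Cmod w < 1) by (rewrite Cmod_R; apply Rabs_lt_between; unfold w; nra).
  assert (Hw0 : RtoC w <> 0%C) by (intros E; apply RtoC_inj in E; unfold w in E; nra).
  destruct (fixed w Hw) as [_ H]. specialize (H Hw0). cbn [snd] in H.
  set (x := right_branch g (lam * y)).
  (* The operator works with [v = x + 1], and [v (v - 2) = x^2 - 1] recovers the argument of the
     left branch. *)
  assert (Ev : op_v (f, g) w = RtoC (x + 1)).
  { unfold op_v. rewrite op_lambda_real. cbn [snd].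
    replace (lam ^ 2 * w)%C with (RtoC (lam * y * (lam * y) + lam * y * (lam * y))).
    - rewrite evalX_R. unfold x, right_branch, w, t.
      replace (5 / 10) with (/ 2) by field.
      rewrite RtoC_inv, !RtoC_plus, RtoC_minus, !RtoC_mult by lra. simpl. field.
    - unfold w. rewrite !RtoC_plus, !RtoC_mult. simpl. ring. }
  assert (Ea : op_v_arg (f, g) w = RtoC ((x * x - 1) * (5 / 11))).
  { unfold op_v_arg. rewrite Ev, div_s, RtoC_mult, RtoC_minus, RtoC_mult, RtoC_plus. ring. }
  assert (Eg : op_g_arg (f, g) w = RtoC ((left_branch f x * left_branch f x - 1) * (5 / 11))).
  { unfold op_g_arg. rewrite Ea, inv_s. cbn [fst]. rewrite evalX_R.
    fold (left_branch f x).
    replace (5 / 11)%C with (RtoC (5 / 11)) by (rewrite RtoC_div by lra; reflexivity).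
    rewrite RtoC_mult, RtoC_minus, RtoC_mult. simpl. ring. }
  unfold op_g in H. rewrite Eg, op_lambda_real in H. cbn [fst] in H. rewrite !evalX_R in H.
  fold (left_branch f (left_branch f x)) in H.
  set (v := left_branch f (left_branch f x)) in *.
  assert (H' : evalR g w = / (y * y) * (1 + v / lam)).
  { apply RtoC_inj. rewrite H. unfold t, w.
    rewrite <- RtoC_mult. replace (5 / 10 * (y * y + y * y)) with (y * y) by field.
    rewrite (RtoC_mult (/ (y * y))), RtoC_plus, RtoC_div, RtoC_inv by nra. reflexivity. }
  unfold right_branch. fold w. rewrite H'. field. lra.
Qed.

Lemma fixed_right_r : right_branch g r = lam * r.
Proof.
  assert (H := fixed_left 0 ltac:(lra)). rewrite Rmult_0_r, (left_0 _ _ _ _ _ co) in H. exact H.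
Qed.

Lemma fixed_represents : represents (f, g) r (lorenz_map f g).
Proof.
  split.
  - generalize (r_between _ _ _ _ _ co). unfold t. nra.
  - exact (lorenz_F f g r lam f0 co fixed_right_r).
Qed.

Lemma fixed_renormalizes : renormalizes_to 2 alpha beta (-1) r (lorenz_map f g) r (lorenz_map f g).
Proof.
  apply (self_renormalization f g r lam f0 co fixed_right_r).
  - intros y H1 H2. apply fixed_left. lra.
  - exact fixed_right.
Qed.

End FixedPoint.

Theorem theorem2p11 :
  exists (p : Y) (r : R) (F : R -> R),
    represents p r F /\
    renormalizes_to 2 alpha beta (-1) r F r F /\
    T_domain p /\
    hyperbolic_fixed_point Y T p.
Proof.
  destruct T_fixed_point as (p & Hp & Hnear).
  assert (Hc : near_center p).
  { apply Hnear. replace (minus p p) with (zero : Y) by Y_ring. rewrite Y_norm_0. left. apply ulp_pos. lia. }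
  assert (Hd := near_center_defined p Hc).
  destruct (near_center_orbit p Hc) as (r & lam & f0 & co).
  (* At a fixed point the specification of the image becomes a pair of functional equations for [p]
     itself. *)
  assert (Hs := Tm_spec p Hd). rewrite Hp in Hs.
  assert (Hh := T_hyperbolic p Hp Hnear). assert (HD := T_defined_domain p Hd).
  clear Hp Hnear Hc Hd. destruct p as [f g].
  exists (f, g), r, (lorenz_map f g).
  split; [exact (fixed_represents f g r lam f0 co Hs)|].
  split; [exact (fixed_renormalizes f g r lam f0 co Hs)|].
  split; assumption.
Qed.
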